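(* Let $(\Omega,g)$ be a totally convex disc with smooth boundary in a complete Riemannian surface. Assume $(\Omega,g)$ has property $(\star)$: no free boundary stable geodesic exists on $(\Omega,g)$. Then, either there exists a free boundary proper minimising geodesic of free boundary index one, or there exists a pair of simultaneously stationary minimising geodesics with extremities in $\partial\Omega$.
   Context: A subset of a Riemannian manifold is totally convex if every geodesic with extremities in the subset lies entirely in the subset. Non-trivial geodesics are parametrised by arc length; a geodesic is minimising if its length equals the Riemannian distance between its endpoints. $(\cdot)^T$ denotes orthogonal projection onto the tangent line of $\partial\Omega$. A geodesic $\gamma:[0,a]\to\Omega$ with extremities in $\partial\Omega$ is free boundary if it is orthogonal to $\partial\Omega$ at both extremities, and proper if it meets $\partial\Omega$ only at its extremities. For $X$ a normal vector field along a free boundary proper geodesic $\gamma$, let $$Q(X,X)=\int_0^a\big(|\nabla_{\gamma'}X|^2-K|X|^2\big)dt-A(X(\gamma(0)),X(\gamma(0)))-A(X(\gamma(a)),X(\gamma(a))),$$ where $K$ is the Gaussian curvature and $A(Y,Y)=\langle\nabla_YN,Y\rangle$ with $N$ the outward unit normal of $\partial\Omega$. $\gamma$ is free boundary stable if $Q(X,X)\geq0$ for all normal $X$; its free boundary index is the index of $Q$. Two minimising geodesics $\gamma_1,\gamma_2:[0,a]\to\Omega$ with the same extremities $p=\gamma_i(0)$, $q=\gamma_i(a)$ in $\partial\Omega$ (two geodesics means two different geodesics) are simultaneously stationary if there exists a constant $c>0$ such that $(\gamma_1'(0))^T=-c(\gamma_2'(0))^T$ and $(\gamma_1'(a))^T=-c(\gamma_2'(a))^T$.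 *)

(* Defs.v *)
From mathcomp Require Export all_boot all_order all_algebra.
From mathcomp Require Export all_classical all_reals all_analysis.
Export Order.TTheory GRing.Theory Num.Theory.
Export numFieldNormedType.Exports.

Set Implicit Arguments.
Unset Strict Implicit.
Unset Printing Implicit Defensive.

Local Open Scope classical_set_scope.
Local Open Scope ring_scope.

(* Meant for open [U]: the derivatives are two-sided limits. *)
Fixpoint Ck (R : realType) (V W : normedModType R) (k : nat) (U : set V)
    (f : V -> W) : Prop :=
  match k with
  | 0%N => forall x, U x -> {for x, continuous f}
  | k'.+1 => (forall x, U x -> differentiable f x) /\
             (forall v, Ck k' U (fun x => 'D_v f x))
  end.

Definition smooth_on (R : realType) (V W : normedModType R) (U : set V)
  (f : V -> W) : Prop := forall k, Ck k U f.

(* A connected smooth surface without boundary. The smooth structure is given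
   by an atlas indexed by the points: [chart p : dom p -> cod p] is a chart
   around [p], with inverse [param p]. Outside these sets the values of the
   two functions are irrelevant. *)
Record surface (R : realType) := Surface {
  point :> topologicalType;
  dom : point -> set point;
  cod : point -> set 'rV[R]_2;
  chart : point -> point -> 'rV[R]_2;
  param : point -> 'rV[R]_2 -> point;
  surface_hausdorff : hausdorff_space point;
  surface_countable : @second_countable point;
  surface_connected : connected [set: point];
  dom_open : forall p, open (dom p);
  cod_open : forall p, open (cod p);
  dom_center : forall p, dom p p;
  chart_cod : forall p x, dom p x -> cod p (chart p x);
  param_dom : forall p y, cod p y -> dom p (param p y);
  chartK : forall p x, dom p x -> param p (chart p x) = x;
  paramK : forall p y, cod p y -> chart p (param p y) = y;
  chart_continuous : forall p x, dom p x -> {for x, continuous (chart p)};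
  param_continuous : forall p y, cod p y -> {for y, continuous (param p)};
  transition_smooth : forall p q,
    smooth_on [set y | cod p y /\ dom q (param p y)] (chart q \o param p)
}.

Section Tangent.
Context {R : realType} (M : surface R).

(* The tangent plane at [p] is identified with R^2 through the chart [chart p],
   so a tangent vector at [p] is an element of ['rV[R]_2] and a vector field is
   a function [M -> 'rV[R]_2]. *)

(* components, in the chart centred at [i], of the vector [v] tangent at [p] *)
Definition comp (i p : M) (v : 'rV[R]_2) : 'rV[R]_2 :=
  'D_v (chart i \o param p) (chart p p).

(* vector tangent at [param i y] whose components in the chart centred at [i]
   are [v] *)
Definition push (i : M) (y v : 'rV[R]_2) : 'rV[R]_2 :=
  'D_v (chart (param i y) \o param i) y.

Definition form (G : M -> 'M[R]_2) (p : M) (u v : 'rV[R]_2) : R :=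
  (u *m G p *m v^T) 0 0.

Definition local_gram (G : M -> 'M[R]_2) (i : M) (y : 'rV[R]_2) : 'M[R]_2 :=
  \matrix_(a, b) form G (param i y) (push i y (delta_mx 0 a))
                                    (push i y (delta_mx 0 b)).

Definition vfield_smooth (U : set M) (X : M -> 'rV[R]_2) : Prop :=
  forall i : M, smooth_on [set y | cod i y /\ U (param i y)]
                          (fun y => comp i (param i y) (X (param i y))).

Definition curve_Ck (k : nat) (A : set R) (c : R -> M) : Prop :=
  (forall t, A t -> {for t, continuous c}) /\
  (forall i : M, Ck k (A `&` c @^-1` dom i) (chart i \o c)).

Definition curve_smooth (A : set R) (c : R -> M) : Prop :=
  forall k, curve_Ck k A c.

Definition velocity (c : R -> M) (t : R) : 'rV[R]_2 :=
  derive1 (chart (c t) \o c) t.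

(* vector fields along a curve [c] *)
Definition field_along_smooth (A : set R) (c : R -> M) (X : R -> 'rV[R]_2) :
    Prop :=
  forall i : M, smooth_on (A `&` c @^-1` dom i) (fun t => comp i (c t) (X t)).

End Tangent.

Record riemannian (R : realType) (M : surface R) := Riemannian {
  gram :> M -> 'M[R]_2;
  gram_sym : forall p, (gram p)^T = gram p;
  gram_pos : forall p v, v != 0 -> 0 < form gram p v v;
  gram_smooth : forall (i : M) (a b : 'I_2),
    smooth_on (cod i) (fun y => local_gram gram i y a b : R)
}.

Section Riemannian.
Context {R : realType} {M : surface R} (g : riemannian M).

Definition inner (p : M) (u v : 'rV[R]_2) : R := form g p u v.

Definition norm (p : M) (v : 'rV[R]_2) : R := Num.sqrt (inner p v v).

(* derivative of [g_bc] along the a-th coordinate, in the chart centred at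
   [i] *)
Definition dgram (i : M) (y : 'rV[R]_2) (a b c : 'I_2) : R :=
  'D_(delta_mx 0 a : 'rV[R]_2) (fun z => local_gram g i z b c : R) y.

(* Gamma^k_{ab} *)
Definition christoffel (i : M) (k a b : 'I_2) (y : 'rV[R]_2) : R :=
  2^-1 * \sum_(l < 2) invmx (local_gram g i y) k l *
    (dgram i y a b l + dgram i y b a l - dgram i y l a b).

Definition christoffel_vec (i : M) (y u v : 'rV[R]_2) : 'rV[R]_2 :=
  \row_k \sum_(a < 2) \sum_(b < 2) christoffel i k a b y * u 0 a * v 0 b.

(* l-th component of R(d_a, d_b) d_c, where
   R(X, Y) Z = nabla_X nabla_Y Z - nabla_Y nabla_X Z - nabla_[X, Y] Z *)
Definition riemann (i : M) (y : 'rV[R]_2) (l a b c : 'I_2) : R :=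
  'D_(delta_mx 0 a : 'rV[R]_2) (christoffel i l b c : 'rV[R]_2 -> R) y
  - 'D_(delta_mx 0 b : 'rV[R]_2) (christoffel i l a c : 'rV[R]_2 -> R) y
  + \sum_(m < 2) (christoffel i l a m y * christoffel i m b c y
                  - christoffel i l b m y * christoffel i m a c y).

(* K = <R(d_0, d_1) d_1, d_0> / (g_00 g_11 - g_01^2) *)
Definition gauss_curvature (p : M) : R :=
  let y := chart p p in
  (\sum_(l < 2) riemann p y l 0 1 1 * local_gram g p y l 0)
    / \det (local_gram g p y).

(* covariant derivative at time [t] of the vector field [X] along [c] *)
Definition cov_along (c : R -> M) (X : R -> 'rV[R]_2) (t : R) : 'rV[R]_2 :=
  derive1 (fun s => comp (c t) (c s) (X s)) t
  + christoffel_vec (c t) (chart (c t) (c t)) (velocity c t) (X t).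

(* nabla_Y X at [p], for a vector field [X] defined near [p] *)
Definition cov (p : M) (Y : 'rV[R]_2) (X : M -> 'rV[R]_2) : 'rV[R]_2 :=
  'D_Y (fun y => comp p (param p y) (X (param p y))) (chart p p)
  + christoffel_vec p (chart p p) Y (X p).

Definition geodesic_on (A : set R) (c : R -> M) : Prop :=
  curve_smooth A c /\
  (forall t, A t -> norm (c t) (velocity c t) = 1 /\
                    cov_along c (velocity c) t = 0).

(* A unit speed geodesic [0, a] -> M, encoded as a function on R of which only
   the values on [0, a] are relevant; asking for a geodesic on a slightly larger
   open interval gives a meaning to the derivatives at 0 and a. *)
Definition geodesic (a : R) (c : R -> M) : Prop :=
  0 < a /\ exists2 e : R, 0 < e & geodesic_on `]- e, a + e[ c.

Definition complete : Prop :=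
  forall (p : M) (v : 'rV[R]_2), norm p v = 1 ->
  exists c : R -> M, [/\ geodesic_on setT c, c 0 = p & velocity c 0 = v].

Definition curve_length (a b : R) (c : R -> M) : R :=
  \int[lebesgue_measure]_(t in `[a, b]) norm (c t) (velocity c t).

Definition dist (p q : M) : R :=
  inf [set l | exists c : R -> M,
    [/\ exists2 e : R, 0 < e & curve_Ck 1 `]- e, 1 + e[ c,
        c 0 = p, c 1 = q & l = curve_length 0 1 c]].

Definition minimising (a : R) (c : R -> M) : Prop :=
  curve_length 0 a c = dist (c 0) (c a).

Definition totally_convex (Omega : set M) : Prop :=
  forall (a : R) (c : R -> M), geodesic a c -> Omega (c 0) -> Omega (c a) ->
  forall t, 0 <= t <= a -> Omega (c t).

End Riemannian.

Section Domain.
Context {R : realType} {M : surface R}.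

(* Euclidean disc: the norm of ['rV[R]_2] in the library is the sup norm *)
Definition unit_disc : set 'rV[R]_2 :=
  [set x | x 0 0 ^+ 2 + x 0 1 ^+ 2 <= 1].

(* image of the closed unit disc by a smooth embedding, smoothness up to the
   boundary being smoothness on an open neighbourhood of the disc *)
Definition smooth_disc (Omega : set M) : Prop :=
  exists (W : set 'rV[R]_2) (F : 'rV[R]_2 -> M),
    [/\ open W /\ unit_disc `<=` W,
        (forall x, W x -> {for x, continuous F}) /\
        (forall i : M, smooth_on (W `&` F @^-1` dom i) (chart i \o F)),
        forall x v, unit_disc x -> 'D_v (chart (F x) \o F) x = 0 -> v = 0,
        forall x y, unit_disc x -> unit_disc y -> F x = F y -> x = y
      & Omega = F @` unit_disc].

Definition bd (Omega : set M) : set M := Omega `\` Omega°.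

(* [v] belongs to the tangent line of the boundary of [Omega] at [p] *)
Definition bd_tangent (Omega : set M) (p : M) (v : 'rV[R]_2) : Prop :=
  exists (e : R) (c : R -> M),
    [/\ 0 < e, curve_smooth `]- e, e[ c, forall t, - e < t < e -> bd Omega (c t),
        c 0 = p & velocity c 0 = v].

End Domain.

Section FreeBoundary.
Context {R : realType} {M : surface R} (g : riemannian M) (Omega : set M).

Definition bd_orthogonal (p : M) (v : 'rV[R]_2) : Prop :=
  forall w, bd_tangent Omega p w -> inner g p v w = 0.

(* [N] is a smooth vector field near the boundary which restricts on the
   boundary to the outward unit normal. Only this restriction is determined by
   [Omega]; the extension serves to write [nabla_Y N], whose value for [Y]
   tangent to the boundary does not depend on it. *)
Definition outward_unit_normal (N : M -> 'rV[R]_2) : Prop :=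
  (exists U : set M, [/\ open U, bd Omega `<=` U & vfield_smooth U N]) /\
  (forall p, bd Omega p ->
     [/\ norm g p (N p) = 1,
         bd_orthogonal p (N p)
       & \forall t \near 0^'+, ~ Omega (param p (chart p p + t *: N p))]).

Variable N : M -> 'rV[R]_2.

Definition second_form (p : M) (Y : 'rV[R]_2) : R := inner g p (cov g p Y N) Y.

(* orthogonal projection to the tangent line of the boundary at [p] *)
Definition bd_proj (p : M) (v : 'rV[R]_2) : 'rV[R]_2 :=
  v - inner g p v (N p) *: N p.

Definition geodesic_in (a : R) (c : R -> M) : Prop :=
  [/\ geodesic g a c, forall t, 0 <= t <= a -> Omega (c t),
      bd Omega (c 0) & bd Omega (c a)].

Definition free_boundary (a : R) (c : R -> M) : Prop :=
  [/\ geodesic_in a c, bd_orthogonal (c 0) (velocity c 0)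
    & bd_orthogonal (c a) (velocity c a)].

Definition proper (a : R) (c : R -> M) : Prop :=
  forall t, 0 < t < a -> ~ bd Omega (c t).

Definition normal_field (a : R) (c : R -> M) (X : R -> 'rV[R]_2) : Prop :=
  (exists2 e : R, 0 < e & field_along_smooth `]- e, a + e[ c X) /\
  (forall t, 0 <= t <= a -> inner g (c t) (X t) (velocity c t) = 0).

Definition Qform (a : R) (c : R -> M) (X : R -> 'rV[R]_2) : R :=
  \int[lebesgue_measure]_(t in `[0, a])
    (norm g (c t) (cov_along g c X t) ^+ 2
     - gauss_curvature g (c t) * norm g (c t) (X t) ^+ 2)
  - second_form (c 0) (X 0) - second_form (c a) (X a).

Definition free_boundary_stable (a : R) (c : R -> M) : Prop :=
  [/\ free_boundary a c, proper a c
    & forall X, normal_field a c X -> 0 <= Qform a c X].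

(* [Qform] is negative definite on some k-dimensional space of normal fields *)
Definition index_ge (a : R) (c : R -> M) (k : nat) : Prop :=
  exists X : 'I_k -> R -> 'rV[R]_2,
    (forall j, normal_field a c (X j)) /\
    (forall s : 'rV[R]_k, s != 0 ->
       Qform a c (fun t => \sum_(j < k) s 0 j *: X j t) < 0).

Definition free_boundary_index (a : R) (c : R -> M) (k : nat) : Prop :=
  index_ge a c k /\ ~ index_ge a c k.+1.

Definition simultaneously_stationary (a : R) (c1 c2 : R -> M) : Prop :=
  exists k : R,
    [/\ 0 < k,
        bd_proj (c1 0) (velocity c1 0) = - (k *: bd_proj (c2 0) (velocity c2 0))
      & bd_proj (c1 a) (velocity c1 a) =
        - (k *: bd_proj (c2 a) (velocity c2 a))].

End FreeBoundary.

(* Main.v *)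
Require Import Defs.
From mathcomp Require Import ring lra.

(** Let P parametrise the boundary of Omega with period T. The function
    d(x, y) = dist (P x) (P y) vanishes on both edges of the strip
    x <= y <= x + T, so the min-max level W of the connected sets joining the
    edges is attained at a point through which one cannot pass below W.
    Each minimising geodesic from P x to P y has a gradient, the vector of its
    tangential components at the ends; by first variation it bounds d from
    above to first order. If all gradients lie in an open half-plane, d
    decreases near (x, y) along a common direction; if they meet every open
    half-plane, (x, y) is a strict local maximum. Both allow passing below W.
    The gradients form a closed set, so otherwise two are opposite, which gives
    a simultaneously stationary pair, or one vanishes, which gives a free
    boundary geodesic. The latter has index at least one by hypothesis, and
    index two would again make (x, y) a strict local maximum. *)

Set Implicit Arguments.
Unset Strict Implicit.
Unset Printing Implicit Defensive.

Local Open Scope classical_set_scope.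
Local Open Scope ring_scope.

(** The distance between boundary points need not be differentiable, since several minimising
    geodesics may join them. Around the critical pair only upper bounds for it are used, and each
    comes from exhibiting a curve; this is why common descent directions and strict local maxima are
    the two ways of passing. The min-max runs over connected sets, so that it can be handled by
    topology alone. Index two yields a strict local maximum because pairs of boundary points also
    form a surface: the end displacements of a two-dimensional negative space fill it, for a
    combination leaving both ends in place would shorten a minimising geodesic. Lengths are bounded
    through the energy in a chart, by [sqrt e <= (e + 1) / 2], and since no chart need contain the
    geodesic, the second-order bounds are chained over short intervals with boundary terms that do
    not depend on the chart. Geodesics are supplied by completeness; about the equation, uniqueness
    and continuous dependence are proved. Total convexity keeps minimisers in [Omega] and makes the
    free boundary ones proper. Limits of minimisers are taken along ultrafilters. *)

Section Row2.
Context {R : realType}.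
Local Notation V := 'rV[R]_2.

Lemma ord2P (i : 'I_2) : i = 0 \/ i = 1.
Proof. by case: i => [[|[|//]]] hi; [left|right]; exact: val_inj. Qed.

Lemma sum_ord2 (W : nmodType) (F : 'I_2 -> W) : \sum_(i < 2) F i = F 0 + F 1.
Proof. by rewrite big_ord_recl big_ord1; congr (_ + F _); exact: val_inj. Qed.

Lemma row2P (u v : V) : u 0 0 = v 0 0 -> u 0 1 = v 0 1 -> u = v.
Proof. by move=> e0 e1; apply/rowP => i; have [->|->] := ord2P i. Qed.

Lemma coord_le_norm (u : V) (i : 'I_2) : `|u 0 i| <= `|u|.
Proof. by rewrite [leRHS]/Num.Def.normr/= mx_normrE; exact: (le_bigmax _ _ (0, i)). Qed.

Lemma norm_row2_le (u : V) (e : R) : `|u 0 0| <= e -> `|u 0 1| <= e -> `|u| <= e.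
Proof.
move=> e0 e1; rewrite [leLHS]/Num.Def.normr/= mx_normrE.
apply: bigmax_le; first by rewrite (le_trans _ e0).
by move=> [i j] _ /=; rewrite (ord1 i); have [->|->] := ord2P j.
Qed.

Lemma norm_row2 (u : V) : `|u| = Num.max `|u 0 0| `|u 0 1|.
Proof.
apply/eqP; rewrite eq_le ge_max !coord_le_norm /= andbT.
by apply: norm_row2_le; rewrite le_max lexx ?orbT.
Qed.

Definition row2 (a b : R) : V := \row_j (if j == 0 then a else b).

Lemma row2_0 a b : row2 a b 0 0 = a. Proof. by rewrite mxE. Qed.
Lemma row2_1 a b : row2 a b 0 1 = b. Proof. by rewrite mxE. Qed.

Lemma row2_delta (u : V) :
  u = u 0 0 *: delta_mx 0 0 + u 0 1 *: delta_mx 0 1.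
Proof. by apply: row2P; rewrite !mxE /= ?mulr1 ?mulr0 ?addr0 ?add0r. Qed.

End Row2.

(** * Directional derivatives and the chain rule *)

Section Calculus.
Context {R : realType}.
Implicit Types (V W : normedModType R).

Lemma is_derive_dir V W (f : V -> W) x v : differentiable f x ->
  is_derive x v f ('D_v f x).
Proof. by move=> df; apply: derivableP; apply: diff_derivable. Qed.

Lemma derive_line V W (f : V -> W) x v :
  'D_v f x = 'D_1 (fun h : R => f (h *: v + x)) 0.
Proof.
rewrite /derive; apply: (congr1 (fun F : R -> W => lim (F @ 0^'))).
by apply/funext => h; rewrite /= scale0r add0r addr0 [h%:A]mulr1.
Qed.

(** Restricting [f] to the line through [x] reduces the claim to a function of one variable, so that
    [f] is differentiated along [v] only while [g] is fully differentiable. *)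
Lemma is_derive_comp V V' W (f : V -> V') (g : V' -> W) x v dv :
  is_derive x v f dv -> differentiable g (f x) ->
  is_derive x v (g \o f) ('D_dv g (f x)).
Proof.
move=> [fx fxE] dg.
pose k := fun h : R => f (h *: v + x).
have k0 : k 0 = f x by rewrite /k scale0r add0r.
have dk : derivable k 0 1 := (derivable1P f x v).1 fx.
have dk' : differentiable k 0 by apply/derivable1_diffP.
have dgk : differentiable g (k 0) by rewrite k0.
have dc : differentiable (g \o k) 0 by apply: differentiable_comp.
have kE : 'D_1 k 0 = dv by rewrite -fxE (derive_line f).
apply: DeriveDef; first by apply: (derivable1P (g \o f) x v).2; apply/derivable1_diffP.
rewrite derive_line -[fun h => _]/(g \o k).
by rewrite deriveE // diff_comp //= -(deriveE _ dk') -(deriveE _ dgk) kE k0.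
Qed.

Lemma deriveDr V W (f : V -> W) x u v : differentiable f x ->
  'D_(u + v) f x = 'D_u f x + 'D_v f x.
Proof. by move=> df; rewrite !deriveE // linearD. Qed.

Lemma deriveZr V W (f : V -> W) x a v : differentiable f x ->
  'D_(a *: v) f x = a *: 'D_v f x.
Proof. by move=> df; rewrite !deriveE // linearZ. Qed.

Lemma derive_row2 W (f : 'rV[R]_2 -> W) x v : differentiable f x ->
  'D_v f x = v 0 0 *: 'D_(delta_mx 0 0 : 'rV[R]_2) f x
             + v 0 1 *: 'D_(delta_mx 0 1 : 'rV[R]_2) f x.
Proof. by move=> df; rewrite {1}(row2_delta v) deriveDr // !deriveZr. Qed.

Lemma derivable1_real W (f : R -> W) x v : differentiable f x ->
  'D_v f x = v *: 'D_1 f x.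
Proof. by move=> df; rewrite -[in LHS](mulr1 v) deriveZr. Qed.

Lemma is_derive_coord V m n (M : V -> 'M[R]_(m, n)) x v dM i j :
  is_derive x v M dM -> is_derive x v (fun y => M y i j) (dM i j).
Proof.
move=> [d <-]; apply: DeriveDef; first exact: (derivable_mxP M x v).1 d i j.
by rewrite derive_mx // mxE.
Qed.

Lemma is_derive_mx V m n (M : V -> 'M[R]_(m, n)) x v (dM : 'M[R]_(m, n)) :
  (forall i j, is_derive x v (fun y => M y i j) (dM i j)) ->
  is_derive x v M dM.
Proof.
move=> d; have dM' : derivable M x v by apply: (derivable_mxP M x v).2 => i j; case: (d i j).
apply: DeriveDef => //; rewrite derive_mx //; apply/matrixP => i j.
by rewrite mxE; case: (d i j).
Qed.

Lemma continuous_mx (T : topologicalType) m n (M : T -> 'M[R]_(m, n)) x :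
  (forall i j, {for x, continuous (fun y => M y i j)}) -> {for x, continuous M}.
Proof.
move=> cM; apply/cvgrPdist_le => e e0.
have H : forall i j, \forall y \near x, `|M x i j - M y i j| <= e.
  by move=> i j; have /cvgrPdist_le/(_ e e0) := cM i j.
have : \forall y \near x, forall i j, `|M x i j - M y i j| <= e.
  by apply: filter_forall => i; apply: filter_forall => j; exact: H.
apply: filterS => y Hy; rewrite [leLHS]/Num.Def.normr/= mx_normrE.
by apply: bigmax_le; [exact: ltW | move=> [i j] _ /=; rewrite !mxE].
Qed.

Lemma differentiable_mx V m n (M : V -> 'M[R]_(m, n)) x :
  (forall i j, differentiable (fun y => M y i j) x) -> differentiable M x.
Proof.
move=> d.
have -> : M = fun y => \sum_i \sum_j (M y i j) *: delta_mx i j.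
  by apply/funext => y; rewrite {1}(matrix_sum_delta (M y)).
have S n' (h : 'I_n' -> V -> 'M[R]_(m, n)) : (forall i, differentiable (h i) x) ->
    differentiable (fun y => \sum_i h i y) x.
  move=> dh; have -> : (fun y => \sum_i h i y) = \sum_i h i.
    by apply/funext => y; rewrite fct_sumE.
  exact: differentiable_sum.
apply: (S _ (fun i y => \sum_j (M y i j) *: delta_mx i j)) => i.
apply: (S _ (fun j y => (M y i j) *: delta_mx i j)) => j.
exact: differentiableZl.
Qed.

End Calculus.

(** * Functions of class C^k *)

Section CkCalculus.
Context {R : realType}.
Implicit Types (V W : normedModType R).

Lemma differentiable_eps V W (f : V -> W) x (L : {linear V -> W}) :
  continuous L ->
  (forall e, 0 < e -> \forall h \near 0, `|f (h + x) - f x - L h| <= e * `|h|) ->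
  differentiable f x.
Proof.
move=> cL H.
have dxf : f \o shift x = cst (f x) + L +o_ 0 id.
  apply/eqaddoP => e e0; near=> h.
  rewrite (_ : (_ - _) h = f (h + x) - f x - L h); last first.
    by rewrite /= !fctE /= opprD addrA.
  by near: h; exact: H.
have E := diff_unique cL dxf.
by apply/diff_locallyP; rewrite E; split.
Unshelve. all: by end_near. Qed.

Lemma diff_eps V W (f : V -> W) x e : differentiable f x -> 0 < e ->
  \forall h \near 0, `|f (h + x) - f x - 'D_h f x| <= e * `|h|.
Proof.
move=> df e0; have /eqaddoP/(_ e e0) := diff_locally df.
by apply: filterS => h; rewrite !fctE /= opprD addrA deriveE.
Qed.

Lemma near_eq_differentiable V W (f g : V -> W) x :
  (\near x, f x = g x) -> differentiable f x -> differentiable g x.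
Proof.
move=> fg df.
have cL : continuous ('d f x) by apply: diff_continuous.
apply: (@differentiable_eps V W g x ('d f x) cL) => e e0.
have fgx := nbhs_singleton fg.
have H := diff_eps df e0.
have fg0 : \forall h \near (0 : V), f (h + x) = g (h + x).
  have := fg; rewrite (near_shift 0 x); apply: filterS => h /=.
  by rewrite subr0.
near=> h; rewrite -fgx (_ : g (h + x) = f (h + x)).
  by rewrite -deriveE //; near: h.
by apply/esym; near: h.
Unshelve. all: by end_near. Qed.

Lemma near_eq_continuous_for (S T : topologicalType) (f g : S -> T) x :
  (\near x, f x = g x) -> {for x, continuous f} -> {for x, continuous g}.
Proof.
move=> fg cf; rewrite /prop_for /continuous_at -(nbhs_singleton fg).
by apply: cvg_trans cf; apply: near_eq_cvg.
Qed.

Lemma open_near (T : topologicalType) (U : set T) x (P : T -> Prop) :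
  open U -> U x -> (forall y, U y -> P y) -> \forall y \near x, P y.
Proof.
move=> oU Ux H; near=> y; apply: H.
by near: y; exact: open_nbhs_nbhs.
Unshelve. all: by end_near. Qed.

Lemma derive_eq_on V W (U : set V) (f g : V -> W) x v : open U -> U x ->
  (forall y, U y -> f y = g y) -> 'D_v f x = 'D_v g x.
Proof. by move=> oU Ux fg; apply: near_eq_derive; exact: open_near oU Ux fg. Qed.

Lemma Ck_ext V W k (U : set V) (f g : V -> W) : open U ->
  (forall x, U x -> f x = g x) -> Ck k U f -> Ck k U g.
Proof.
move=> oU; elim: k f g => [|k IH] f g fg /=.
  move=> H x Ux; apply: near_eq_continuous_for (H x Ux).
  exact: open_near oU Ux fg.
move=> [df Df]; split=> [x Ux|v].
  by apply: near_eq_differentiable (df x Ux); exact: open_near oU Ux fg.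
apply: IH (Df v) => x Ux /=; apply: near_eq_derive.
exact: open_near oU Ux fg.
Qed.

Lemma Ck_sub V W k (U U' : set V) (f : V -> W) : U `<=` U' ->
  Ck k U' f -> Ck k U f.
Proof.
move=> UU; elim: k f => [|k IH] f /=; first by move=> H x /UU; exact: H.
by move=> [df Df]; split=> [x /UU|v]; [exact: df|exact: IH].
Qed.

Lemma CkW V W k (U : set V) (f : V -> W) : Ck k.+1 U f -> Ck k U f.
Proof.
elim: k f => [|k IH] f; first by move=> [df _] x Ux; exact: differentiable_continuous (df x Ux).
by move=> [df Df]; split=> [//|v]; apply: IH; exact: Df.
Qed.

Lemma Ck_leq V W k m (U : set V) (f : V -> W) : (k <= m)%N -> Ck m U f -> Ck k U f.
Proof.
move=> /subnK <-; elim: (m - k)%N => [//|n IH]; rewrite addSn => /CkW; exact: IH.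
Qed.

Lemma Ck_continuous V W k (U : set V) (f : V -> W) x : Ck k U f -> U x ->
  {for x, continuous f}.
Proof. by move=> /(Ck_leq (leq0n k)) H; exact: H. Qed.

Lemma Ck_differentiable V W k (U : set V) (f : V -> W) x : Ck k.+1 U f -> U x ->
  differentiable f x.
Proof. by move=> [H _]; exact: H. Qed.

Lemma Ck_cst V W k (U : set V) (a : W) : Ck k U (cst a).
Proof.
elim: k a => [|k IH] a /=; first by move=> x _; exact: cst_continuous.
split=> [x _|v]; first exact: differentiable_cst.
rewrite (_ : (fun x => _) = cst 0); first exact: IH.
by apply/funext => x; rewrite derive_cst.
Qed.

Lemma Ck_add V W k (U : set V) (f g : V -> W) : open U ->
  Ck k U f -> Ck k U g -> Ck k U (f \+ g).
Proof.
move=> oU; elim: k f g => [|k IH] f g /=.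
  by move=> cf cg x Ux; apply: continuousD; [exact: cf|exact: cg].
move=> [df Df] [dg Dg]; split=> [x Ux|v].
  by apply: differentiableD; [exact: df|exact: dg].
apply: Ck_ext oU _ (IH _ _ (Df v) (Dg v)) => x Ux /=.
by rewrite deriveD //; apply: diff_derivable; [exact: df|exact: dg].
Qed.

Lemma Ck_mul V k (U : set V) (a f : V -> R) : open U ->
  Ck k U a -> Ck k U f -> Ck k U (fun x => a x * f x).
Proof.
move=> oU; elim: k a f => [|k IH] a f.
  by move=> ca cf x Ux; apply: continuousM; [exact: ca|exact: cf].
move=> Ca Cf; have [[da Da] [df Df]] := (Ca, Cf); split=> [x Ux|v].
  by apply: (@differentiableM _ _ a f); [exact: da|exact: df].
apply: (Ck_ext oU _ (Ck_add oU (IH _ _ (CkW Ca) (Df v)) (IH _ _ (CkW Cf) (Da v)))) => x Ux /=.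
by rewrite (@deriveM _ _ a f) //; apply: diff_derivable; [exact: da|exact: df].
Qed.

Lemma Ck_inv V k (U : set V) (f : V -> R) : open U ->
  (forall x, U x -> f x != 0) -> Ck k U f -> Ck k U (fun x => (f x)^-1).
Proof.
move=> oU f0; elim: k f f0 => [|k IH] f f0 Cf.
  by move=> x Ux; apply: cvgV; [exact: f0|exact: Cf].
have [df Df] := Cf; split=> [x Ux|v].
  by apply: (@differentiableV _ _ f) => //; [exact: df|exact: f0].
have Ci := IH f f0 (CkW Cf).
have CN := Ck_mul oU (@Ck_cst V R k U (-1)) (Ck_mul oU Ci (Ck_mul oU Ci (Df v))).
apply: (Ck_ext oU _ CN) => x Ux /=.
rewrite (@deriveV _ _ f) //; [|exact: f0|exact: diff_derivable (df x Ux)].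
by rewrite mulN1r [in RHS]/GRing.scale /= mulNr mulrA -invfM expr2.
Qed.

Lemma Ck_coord V m n k (U : set V) (M : V -> 'M[R]_(m, n)) i j : open U ->
  Ck k U M -> Ck k U (fun x => M x i j).
Proof.
move=> oU; elim: k M => [|k IH] M.
  by move=> cM x Ux; apply: (@continuous_comp _ _ _ M (fun A : 'M[R]_(m, n) => A i j)); [exact: cM|exact: coord_continuous].
move=> [dM DM]; split=> [x Ux|v].
  rewrite (_ : (fun x => _) = (fun A : 'M[R]_(m, n) => A i j) \o M) //.
  by apply: differentiable_comp; [exact: dM|exact: differentiable_coord].
apply: (Ck_ext oU _ (IH _ (DM v))) => x Ux.
by have [_ ->] := is_derive_coord i j (is_derive_dir v (dM x Ux)).
Qed.

Lemma Ck_mx V m n k (U : set V) (M : V -> 'M[R]_(m, n)) : open U ->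
  (forall i j, Ck k U (fun x => M x i j)) -> Ck k U M.
Proof.
move=> oU; elim: k M => [|k IH] M H.
  by move=> x Ux; apply: continuous_mx => i j; exact: H.
split=> [x Ux|v]; first by apply: differentiable_mx => i j; have [+ _] := H i j; exact.
apply: IH => i j; have [d /(_ v) D] := H i j.
apply: (Ck_ext oU _ D) => x Ux.
have dM : differentiable M x by apply: differentiable_mx => i' j'; have [+ _] := H i' j'; exact.
by have [_ ->] := is_derive_coord i j (is_derive_dir v dM).
Qed.

(** The induction on [k] is for all [f] at once: the chain rule expresses the derivative through the
    coordinates of ['D_v g] and the partial derivatives of [f], which are again composed with [g].
    For real values the terms are products, covered by [Ck_mul]. *)
Lemma Ck_comp_real V k (U : set V) (U' : set 'rV[R]_2) (g : V -> 'rV[R]_2)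
    (f : 'rV[R]_2 -> R) : open U -> (forall x, U x -> U' (g x)) ->
  Ck k U g -> Ck k U' f -> Ck k U (f \o g).
Proof.
move=> oU UU; elim: k f => [|k IH] f Cg Cf.
  by move=> x Ux; apply: continuous_comp; [exact: Cg|apply: Cf; exact: UU].
have [[dg Dg] [df Df]] := (Cg, Cf); split=> [x Ux|v].
  by apply: differentiable_comp; [exact: dg|apply: df; exact: UU].
pose term (j : 'I_2) x := 'D_v g x 0 j * 'D_(delta_mx 0 j : 'rV[R]_2) f (g x).
have Cterm j : Ck k U (term j).
  apply: Ck_mul => //; first exact: Ck_coord (Dg v).
  exact: (IH ('D_(delta_mx 0 j : 'rV[R]_2) f) (CkW Cg) (Df _)).
apply: (Ck_ext oU _ (Ck_add oU (Cterm 0) (Cterm 1))) => x Ux.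
have dgx := dg x Ux; have dfx := df _ (UU x Ux).
by have [_ ->] := is_derive_comp (is_derive_dir v dgx) dfx; rewrite derive_row2.
Qed.

Lemma Ck_comp V m n k (U : set V) (U' : set 'rV[R]_2) (g : V -> 'rV[R]_2)
    (f : 'rV[R]_2 -> 'M[R]_(m, n)) : open U -> open U' -> (forall x, U x -> U' (g x)) ->
  Ck k U g -> Ck k U' f -> Ck k U (f \o g).
Proof.
move=> oU oU' UU Cg Cf; apply: Ck_mx => // i j.
by apply: (Ck_comp_real (f := fun y => f y i j)) UU Cg _ => //; exact: Ck_coord.
Qed.

End CkCalculus.

(** * Mean values, Taylor bounds and primitives *)

Section RealTools.
Context {R : realType}.
Implicit Types (V W : normedModType R).

Lemma near_normP V (x : V) (P : V -> Prop) :
  (\forall y \near x, P y) <-> exists2 r, 0 < r & forall y, `|y - x| < r -> P y.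
Proof.
split=> [/nbhs_ballP[r /= r0 H]|[r r0 H]].
  by exists r => // y yx; apply: H; rewrite -ball_normE /ball_ /= distrC.
by apply/nbhs_ballP; exists r => //= y; rewrite -ball_normE /ball_ /= distrC; exact: H.
Qed.

Lemma continuous_forP V W (f : V -> W) x : {for x, continuous f} <->
  forall e, 0 < e -> exists2 r, 0 < r & forall y, `|y - x| < r -> `|f y - f x| < e.
Proof.
split=> [cf e e0|H].
  have /cvgrPdist_lt/(_ e e0) := cf.
  by move/near_normP => [r r0 K]; exists r => // y /K; rewrite distrC.
apply/cvgrPdist_lt => e e0; apply/near_normP.
by have [r r0 K] := H e e0; exists r => // y /K; rewrite distrC.
Qed.

Lemma open_normP V (U : set V) x : open U -> U x ->
  exists2 r, 0 < r & forall y, `|y - x| < r -> U y.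
Proof. by move=> oU Ux; apply/near_normP; exact: open_nbhs_nbhs. Qed.

Lemma near_ball V (x y : V) r : `|y - x| < r -> \forall z \near y, `|z - x| < r.
Proof.
move=> yr; apply/near_normP; exists (r - `|y - x|); first by rewrite subr_gt0.
by move=> z zy; have := ler_normD (z - y) (y - x); rewrite addrA subrK; move: zy; lra.
Qed.

Lemma near_cont (T : topologicalType) V (f : T -> V) x r : {for x, continuous f} -> 0 < r ->
  \forall y \near x, `|f y - f x| < r.
Proof. by move=> cf r0; apply: (cf [set z | `|z - f x| < r]); apply: near_ball; rewrite subrr normr0. Qed.

Lemma half_lt (r : R) : 0 < r -> r / 2 < r.
Proof. by move=> r0; rewrite ltr_pdivrMr // ltr_pMr // ltr1n. Qed.

Lemma lt_min2 (a b : R) : 0 < a -> 0 < b -> exists r : R, [/\ 0 < r, r < a & r < b].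
Proof.
move=> a0 b0; have m0 : 0 < Num.min a b by rewrite lt_min a0.
by exists (Num.min a b / 2); have := half_lt m0; rewrite lt_min => /andP[]; split=> //; rewrite divr_gt0.
Qed.

Lemma lt_min3 (a b c : R) : 0 < a -> 0 < b -> 0 < c -> exists r : R, [/\ 0 < r, r < a, r < b & r < c].
Proof.
move=> a0 b0 /(lt_min2 b0)[r [r0 rb rc]]; have [s [s0 sa sr]] := lt_min2 a0 r0.
by exists s; split=> //; exact: lt_trans sr _.
Qed.

Lemma lt_min4 (a b c d : R) : 0 < a -> 0 < b -> 0 < c -> 0 < d ->
  exists r : R, [/\ 0 < r, r < a, r < b, r < c & r < d].
Proof.
move=> a0 b0 c0 /(lt_min3 b0 c0)[r [r0 rb rc rd]]; have [s [s0 sa sr]] := lt_min2 a0 r0.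
by exists s; split=> //; exact: lt_trans sr _.
Qed.

Lemma left_close (t d : R) : 0 < t -> 0 < d -> exists s, [/\ 0 <= s, s < t & t - s < d].
Proof.
by move=> t0 d0; have [r [r0 rt rd]] := lt_min2 t0 d0; exists (t - r); split; lra.
Qed.

Lemma convex_lt (a b t r : R) : a < r -> b < r -> 0 <= t <= 1 -> t * a + (1 - t) * b < r.
Proof.
move=> ar br /andP[t0 t1]; have [ab|/ltW ba] := leP a b.
  by apply: le_lt_trans br; nra.
by apply: le_lt_trans ar; nra.
Qed.

Lemma seg_ball V (x y z : V) (r t : R) : `|y - x| < r -> `|z - x| < r -> 0 <= t <= 1 ->
  `|z + t *: (y - z) - x| < r.
Proof.
move=> yr zr t01; have /andP[t0 t1] := t01.
have -> : z + t *: (y - z) - x = t *: (y - x) + (1 - t) *: (z - x).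
  have -> : y - z = (y - x) - (z - x) by rewrite opprB addrA subrK.
  by rewrite addrAC; move: (y - x) (z - x) => p q; rewrite scalerBr scalerBl scale1r addrC addrA addrAC.
rewrite (le_lt_trans (ler_normD _ _)) // !normrZ (ger0_norm t0) ger0_norm ?subr_ge0 //.
exact: convex_lt.
Qed.

Lemma within_continuous_in (S T : topologicalType) (f : S -> T) (A : set S) :
  (forall x, A x -> {for x, continuous f}) -> {within A, continuous f}.
Proof.
by move=> H; apply/continuous_in_subspaceT => x /[!inE]; exact: H.
Qed.

Lemma is_derive_continuous W (f : R -> W) (t : R) (df : W) : is_derive t 1 f df ->
  {for t, continuous f}.
Proof. by move=> [d _]; apply: differentiable_continuous; apply/derivable1_diffP. Qed.

Lemma is_derive_subst V W (f : V -> W) (x v : V) (a b : W) : is_derive x v f a -> a = b -> is_derive x v f b.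
Proof. by move=> d <-. Qed.

Lemma is_derive_time W (f : R -> W) (tau : R -> R) (s a : R) (v : W) :
  is_derive s 1 tau a -> is_derive (tau s) 1 f v -> is_derive s 1 (f \o tau) (a *: v).
Proof.
move=> dt df; have dd : differentiable f (tau s) by apply/derivable1_diffP; case: df.
by have := is_derive_comp dt dd; rewrite (derivable1_real _ dd); have [_ ->] := df.
Qed.

Lemma mean_value (f df : R -> R) (a b : R) : a < b ->
  (forall t : R, a <= t <= b -> is_derive t 1 f (df t)) ->
  exists2 c : R, a < c < b & f b - f a = df c * (b - a).
Proof.
move=> ab d; have [||c] := @MVT R f df a b ab.
- by move=> x; rewrite in_itv /= => /andP[x1 x2]; apply: d; rewrite !ltW.
- apply: within_continuous_in => x /=; rewrite in_itv /= => /d.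
  exact: is_derive_continuous.
by rewrite in_itv /= => cab ->; exists c.
Qed.

Lemma nondecreasing_derive (f df : R -> R) (a b : R) : a <= b ->
  (forall t : R, a <= t <= b -> is_derive t 1 f (df t)) ->
  (forall t : R, a <= t <= b -> 0 <= df t) -> f a <= f b.
Proof.
rewrite le_eqVlt => /orP[/eqP->//|ab] d d0.
have [c /andP[c1 c2] E] := mean_value ab d; rewrite -subr_ge0 E.
by apply: mulr_ge0; [apply: d0; rewrite !ltW|rewrite subr_ge0 ltW].
Qed.

Lemma derive_bound_norm n (f df : R -> 'rV[R]_n) (a b K : R) : a <= b -> 0 <= K ->
  (forall t : R, a <= t <= b -> is_derive t 1 f (df t)) ->
  (forall t : R, a <= t <= b -> `|df t| <= K) -> `|f b - f a| <= K * (b - a).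
Proof.
move=> + K0; rewrite le_eqVlt => /orP[/eqP->|ab] d dK; first by rewrite !subrr normr0 mulr0.
have Kab : 0 <= K * (b - a) by rewrite mulr_ge0 // subr_ge0 ltW.
rewrite [leLHS]/Num.Def.normr/= mx_normrE.
apply: bigmax_le => // [[i j] _ /=]; rewrite (ord1 i) !mxE.
have [|c /andP[c1 c2] ->] := @mean_value (fun t => f t 0 j) (fun t => df t 0 j) a b ab.
  by move=> t /d; exact: is_derive_coord.
have ba : 0 < b - a by rewrite subr_gt0.
rewrite normrM (gtr0_norm ba) ler_pM2r //.
have cab : a <= c <= b by rewrite !ltW.
apply: le_trans (dK _ cab); rewrite [leRHS]/Num.Def.normr/= mx_normrE.
exact: (le_bigmax _ (fun p => `|df c p.1 p.2|) (0, j)).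
Qed.

Lemma is_derive_line V W (f : V -> W) x v (t : R) : differentiable f (x + t *: v) ->
  is_derive t 1 (fun s => f (x + s *: v)) ('D_v f (x + t *: v)).
Proof.
move=> df; have d : is_derive t 1 (fun s : R => x + s *: v) v.
  have -> : (fun s : R => x + s *: v) = cst x + (fun s => s *: v) by [].
  rewrite -[X in is_derive _ _ _ X]add0r; apply: is_deriveD.
  have d2 : differentiable (fun s : R => s *: v) t by exact: differentiableZl.
  apply: DeriveDef; first exact: diff_derivable.
  by rewrite deriveE // diff_val scale1r.
exact: (is_derive_comp d df).
Qed.

Lemma derive_shift_dir V W (f : V -> W) x a v :
  'D_v (fun y => f (y + a)) x = 'D_v f (x + a).
Proof.
rewrite derive_line [RHS]derive_line; apply: (congr1 (fun F : R -> W => 'D_1 F 0)).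
by apply/funext => h; rewrite addrA.
Qed.

Lemma mean_value_line V (f : V -> R) x v :
  (forall t : R, 0 <= t <= 1 -> differentiable f (x + t *: v)) ->
  exists2 t : R, 0 < t < 1 & f (x + v) - f x = 'D_v f (x + t *: v).
Proof.
move=> df; have [|t t01] := @mean_value (fun s => f (x + s *: v))
  (fun s => 'D_v f (x + s *: v)) 0 1 ltr01; first by move=> t /df; exact: is_derive_line.
by rewrite scale1r scale0r addr0 subr0 mulr1 => E; exists t.
Qed.

(** The derivatives are taken along the increment [v] itself, so [K] is already of second order in
    [v]; the power of [|v|] is extracted where the bound is applied. *)
Lemma taylor2 V (f : V -> R) x v K :
  (forall t : R, 0 <= t <= 1 -> differentiable f (x + t *: v) /\
     differentiable ('D_v f) (x + t *: v)) ->
  (forall t : R, 0 <= t <= 1 -> `|'D_v ('D_v f) (x + t *: v)| <= K) ->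
  `|f (x + v) - f x - 'D_v f x| <= K.
Proof.
move=> df dK; have [|t /andP[t0 t1] ->] := @mean_value_line V f x v; first by move=> t /df[].
have [|c /andP[c0 c1] E] := @mean_value (fun s => 'D_v f (x + s *: v))
  (fun s => 'D_v ('D_v f) (x + s *: v)) 0 t t0.
  by move=> s /andP[s0 s1]; apply: is_derive_line; have [|_ H] := df s; [lra|exact: H].
rewrite scale0r addr0 subr0 in E; rewrite E normrM (gtr0_norm t0).
have Kc : `|'D_v ('D_v f) (x + c *: v)| <= K by apply: dK; lra.
by rewrite -[leRHS]mulr1 ler_pM // ltW.
Qed.

Lemma taylor3 V (f : V -> R) x v K :
  (forall t : R, 0 <= t <= 1 -> [/\ differentiable f (x + t *: v),
     differentiable ('D_v f) (x + t *: v) & differentiable ('D_v ('D_v f)) (x + t *: v)]) ->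
  (forall t : R, 0 <= t <= 1 -> `|'D_v ('D_v ('D_v f)) (x + t *: v)| <= K) ->
  `|f (x + v) - f x - 'D_v f x - 2^-1 * 'D_v ('D_v f) x| <= K.
Proof.
move=> df dK.
have [d1 d1E] : exists d1, d1 = 'D_v f x by exists ('D_v f x).
have [d2 d2E] : exists d2, d2 = 'D_v ('D_v f) x by exists ('D_v ('D_v f) x).
rewrite -d2E -d1E.
have [|t /andP[t0 t1] E1] := @mean_value (fun s => f (x + s *: v) - s * d1 - 2^-1 * s ^+ 2 * d2)
  (fun s => 'D_v f (x + s *: v) - d1 - s * d2) 0 1 ltr01.
  move=> s /df[a b c]; have i1 := is_derive_line a.
  apply: is_derive_eq.
  by rewrite /GRing.scale /=; field.
have [|c /andP[c0 c1] E2] := @mean_value (fun s => 'D_v f (x + s *: v) - s * d2)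
  (fun s => 'D_v ('D_v f) (x + s *: v) - d2) 0 t t0.
  move=> s s01; have [|a b c] := df s; first lra.
  have i1 := is_derive_line b.
  by apply: is_derive_eq; rewrite /GRing.scale /=; field.
have [|c' /andP[c0' c1'] E3] := @mean_value (fun s => 'D_v ('D_v f) (x + s *: v))
  (fun s => 'D_v ('D_v ('D_v f)) (x + s *: v)) 0 c c0.
  move=> s s01; have H01 : 0 <= s <= 1 by clear -s01 c1 t1; lra.
  by apply: is_derive_line; have [_ _ H] := df s H01.
rewrite !scale0r !addr0 !scale1r in E1 E2 E3.
have {}E1 : f (x + v) - f x - d1 - 2^-1 * d2 = 'D_v f (x + t *: v) - d1 - t * d2.
  by move: E1; move: (f (x + v)) (f x) ('D_v f _) => p q r E1; clear -E1; lra.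
have {}E2 : 'D_v f (x + t *: v) - d1 - t * d2 = ('D_v ('D_v f) (x + c *: v) - d2) * t.
  rewrite -d1E in E2; move: E2; move: ('D_v f _) ('D_v ('D_v f) _) => p q E2.
  by clear -E2; lra.
rewrite -d2E subr0 in E3; rewrite E1 E2 E3 -mulrA normrM.
(* Three successive mean values leave the third derivative at an intermediate point times [c * t],
   with both factors in [[0, 1]]. *)
have ct : `|c * t| <= 1 by clear -c0 c1 t0 t1; rewrite ger0_norm; nra.
apply: le_trans (ler_piMr (normr_ge0 _) ct) _; apply: dK; clear -c0 c0' c1 c1' t1; lra.
Qed.

(** The second difference [f (x + s u + s v) - f (x + s u) - f (x + s v) + f x] is symmetric in [u]
    and [v], and two mean values equate it with [s ^+ 2] times a mixed derivative at a point near
    [x], in either order. *)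
Lemma schwarz V (U : set V) (f : V -> R) x u v : open U -> U x -> Ck 2 U f ->
  'D_u ('D_v f) x = 'D_v ('D_u f) x.
Proof.
move=> oU Ux Cf.
have key a b : forall e, 0 < e -> \forall s \near 0^'+,
    `|(f (x + s *: a + s *: b) - f (x + s *: a) - f (x + s *: b) + f x)
      - s ^+ 2 * 'D_b ('D_a f) x| <= e * s ^+ 2.
  move=> e e0.
  have [_ /(_ a)[_ /(_ b) cab]] := Cf.
  have [r r0 Hr] := (continuous_forP _ _).1 (cab x Ux) e e0.
  have [r' r'0 HU] := open_normP oU Ux.
  pose rr := Num.min r r'.
  pose M := `|a| + `|b| + 1.
  have M0 : 0 < M by rewrite /M -addrA ltr_wpDl // ltr_wpDl.
  have rr0 : 0 < rr by rewrite lt_min r0.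
  near=> s.
  have s0 : 0 < s by near: s; exact: nbhs_right_gt.
  have sM : s * M < rr.
    rewrite -ltr_pdivlMr //; near: s; apply: nbhs_right_lt; exact: divr_gt0.
  have close p q : 0 <= p <= 1 -> 0 <= q <= 1 ->
      `|x + (p * s) *: a + (q * s) *: b - x| < rr.
    move=> /andP[p0 p1] /andP[q0 q1]; apply: le_lt_trans sM.
    rewrite addrAC [x + _ - x]addrAC subrr add0r (le_trans (ler_normD _ _)) // !normrZ.
    rewrite (ger0_norm p0) (ger0_norm q0) (gtr0_norm s0).
    have ps : p * s <= s by rewrite ler_piMl // ltW.
    have qs : q * s <= s by rewrite ler_piMl // ltW.
    have h1 : p * s * `|a| <= s * `|a| by rewrite ler_wpM2r.
    have h2 : q * s * `|b| <= s * `|b| by rewrite ler_wpM2r.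
    rewrite /M; clear -h1 h2 s0; nra.
  have inU p q : 0 <= p <= 1 -> 0 <= q <= 1 -> U (x + (p * s) *: a + (q * s) *: b).
    move=> p1 q1; apply: HU; apply: lt_le_trans (close p q p1 q1) _.
    by rewrite /rr ge_min lexx orbT.
  have h01 : (0 : R) <= (0 : R) <= 1 by apply/andP; split; [exact: lexx|exact: ler01].
  pose h y := f (y + s *: b) - f y.
  have dshift p : 0 <= p <= 1 -> differentiable (fun y => f (y + s *: b)) (x + p *: (s *: a)).
    move=> p1; apply: (@differentiable_comp _ _ _ _ (fun y => y + s *: b) f).
      by apply: (@differentiableD _ _ _ id (cst (s *: b))); [exact: ex_diff|exact: differentiable_cst].
    apply: (Ck_differentiable Cf); rewrite scalerA.
    have := inU p 1 p1; rewrite mul1r; apply; apply/andP; split; [exact: ler01|exact: lexx].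
  have df p : 0 <= p <= 1 -> differentiable f (x + p *: (s *: a)).
    move=> p1; apply: (Ck_differentiable Cf); rewrite scalerA.
    by have := inU p 0 p1 h01; rewrite mul0r scale0r addr0.
  have dh p : 0 <= p <= 1 -> differentiable h (x + p *: (s *: a)).
    by move=> p1; apply: (@differentiableB _ _ _ (fun y => f (y + s *: b)) f); [exact: dshift|exact: df].
  have [p /andP[p0 p1]] := @mean_value_line V h x (s *: a) dh.
  have p01 : 0 <= p <= 1 by rewrite !ltW.
  have -> : 'D_(s *: a) h (x + p *: (s *: a)) =
     s * ('D_a f (x + p *: (s *: a) + s *: b) - 'D_a f (x + p *: (s *: a))).
    rewrite deriveZr; last exact: dh.
    congr (_ * _); rewrite (@deriveB _ _ _ (fun y => f (y + s *: b)) f); first last.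
    - exact: diff_derivable (df p p01).
    - exact: diff_derivable (dshift p p01).
    by congr (_ - _); apply: derive_shift_dir.
  move=> E.
  have [|q /andP[q0 q1] E2] := @mean_value_line V ('D_a f) (x + p *: (s *: a)) (s *: b).
    move=> q q01; have [_ /(_ a)[+ _]] := Cf; apply.
    by rewrite !scalerA; exact: inU.
  have q01 : 0 <= q <= 1 by rewrite !ltW.
  have Uz := inU p q p01 q01.
  have lz := lt_le_trans (close p q p01 q01) _.
  have {lz} Hz := Hr _ (lz r _).
  have rrr : rr <= r by rewrite /rr ge_min lexx.
  have {}Hz := Hz rrr.
  rewrite deriveZr in E2; last by have [_ /(_ a)[+ _]] := Cf; apply; rewrite !scalerA.
  rewrite !scalerA in E2 E.
  move: E; rewrite /h E2 => E.
  have -> : f (x + s *: a + s *: b) - f (x + s *: a) - f (x + s *: b) + f x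
     - s ^+ 2 * 'D_b ('D_a f) x =
     s ^+ 2 * ('D_b ('D_a f) (x + (p * s) *: a + (q * s) *: b) - 'D_b ('D_a f) x).
    rewrite mulrBr; congr (_ - _); rewrite expr2 -mulrA -[RHS]E.
    by rewrite opprB addrA addrAC.
  have s20 : 0 <= s ^+ 2 by rewrite exprn_ge0 // ltW.
  by rewrite normrM (ger0_norm s20) mulrC ler_wpM2r // ltW.
apply/eqP; rewrite -subr_eq0 -normr_le0; apply/ler_addgt0Pl => e e0; rewrite addr0.
have e2 : 0 < e / 2 by rewrite divr_gt0.
have K1 := key u v _ e2; have K2 := key v u _ e2.
have [s /= [[H1 H2] s0]] := filter_ex (filterI (filterI K1 K2) (nbhs_right_gt 0)).
rewrite [x + s *: v + s *: u]addrAC in H2.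
have s2 : 0 < s ^+ 2 by rewrite exprn_gt0.
rewrite -(ler_pM2r s2) -[X in _ * X <= _](gtr0_norm s2) -normrM.
move: H1 H2; clear.
move: (f (x + s *: u + s *: v)) (f (x + s *: u)) (f (x + s *: v)) (f x)
  ('D_v ('D_u f) x) ('D_u ('D_v f) x) (s ^+ 2) => a b c d p q k.
by rewrite !ler_norml => /andP[a1 a2] /andP[b1 b2]; apply/andP; split; lra.
Unshelve. all: by end_near. Qed.

Lemma norm_comb_le (a b p q K0 K1 n : R) : `|p| <= n -> `|q| <= n ->
  `|a| <= K0 -> `|b| <= K1 -> `|p * a + q * b| <= (K0 + K1) * n.
Proof.
move=> pn qn aK bK; apply: le_trans (ler_normD _ _) _.
by rewrite !normrM mulrDl lerD // mulrC ler_pM.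
Qed.

Lemma norm_comb_le2 (a b p q K0 K1 n k : R) : `|p| <= n -> `|q| <= n ->
  `|a| <= K0 * k -> `|b| <= K1 * k -> `|p * a + q * b| <= (K0 + K1) * k * n.
Proof. by rewrite mulrDl; exact: norm_comb_le. Qed.

Lemma norm_comb_le3 (a b p q K0 K1 n k l : R) : `|p| <= n -> `|q| <= n ->
  `|a| <= K0 * l * k -> `|b| <= K1 * l * k -> `|p * a + q * b| <= (K0 + K1) * l * k * n.
Proof. by rewrite (mulrDl K0); exact: norm_comb_le2. Qed.

Lemma Ck_bound1 (U : set 'rV[R]_2) (f : 'rV[R]_2 -> R) x : open U -> U x -> Ck 1 U f ->
  exists r K : R, [/\ 0 < r, 0 <= K &
    forall y u, `|y - x| < r -> U y /\ `|'D_u f y| <= K * `|u|].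
Proof.
move=> oU Ux [df cf].
pose e (j : 'I_2) : 'rV[R]_2 := delta_mx 0 j.
have B j : exists2 r, 0 < r & forall y, `|y - x| < r -> `|'D_(e j) f y| <= `|'D_(e j) f x| + 1.
  have [r r0 H] := (continuous_forP _ _).1 (cf (e j) x Ux) 1 ltr01.
  exists r => // y /H; rewrite -lerBlDl => /ltW; apply: le_trans.
  exact: lerB_dist.
have [r0 r00 H0] := B 0; have [r1 r10 H1] := B 1; have [r2 r20 H2] := open_normP oU Ux.
exists (Num.min r0 (Num.min r1 r2)), (`|'D_(e 0) f x| + 1 + (`|'D_(e 1) f x| + 1)).
split; [by rewrite !lt_min r00 r10|by rewrite !addr_ge0|].
move=> y u; rewrite !lt_min => /and3P[/H0 h0 /H1 h1 /H2 Uy]; split=> //.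
rewrite derive_row2; last exact: df.
exact: norm_comb_le (coord_le_norm u 0) (coord_le_norm u 1) h0 h1.
Qed.

Lemma derive_comb V (a b : V -> R) p q x u : derivable a x u -> derivable b x u ->
  'D_u (fun z => p *: a z + q *: b z) x = p * 'D_u a x + q * 'D_u b x.
Proof.
move=> da db; rewrite (@deriveD _ _ _ (fun z => p *: a z) (fun z => q *: b z)).
- by rewrite (@deriveZ _ _ _ a) // (@deriveZ _ _ _ b).
- exact: derivableZ.
- exact: derivableZ.
Qed.

Lemma derive_row2_on (U : set 'rV[R]_2) (f : 'rV[R]_2 -> R) v u y : open U -> U y ->
  Ck 2 U f -> 'D_u ('D_v f) y =
    v 0 0 * 'D_u ('D_(delta_mx 0 0 : 'rV[R]_2) f) y
    + v 0 1 * 'D_u ('D_(delta_mx 0 1 : 'rV[R]_2) f) y.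
Proof.
move=> oU Uy [df Df].
rewrite (@near_eq_derive _ _ _ _ (fun z => v 0 0 *: 'D_(delta_mx 0 0 : 'rV[R]_2) f z
   + v 0 1 *: 'D_(delta_mx 0 1 : 'rV[R]_2) f z)); last first.
  by apply: open_near oU Uy _ => z Uz; exact: derive_row2 (df z Uz).
have d j : derivable ('D_(delta_mx 0 j : 'rV[R]_2) f) y u.
  by have [+ _] := Df (delta_mx 0 j); move=> /(_ y Uy); exact: diff_derivable.
exact: derive_comb.
Qed.

Lemma Ck_bound2 (U : set 'rV[R]_2) (f : 'rV[R]_2 -> R) x : open U -> U x -> Ck 2 U f ->
  exists r K : R, [/\ 0 < r, 0 <= K &
    forall y u v, `|y - x| < r -> U y /\ `|'D_u ('D_v f) y| <= K * `|u| * `|v|].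
Proof.
move=> oU Ux Cf; have [df Df] := Cf.
have [r0 [K0 [r00 K00 H0]]] := Ck_bound1 oU Ux (Df (delta_mx 0 0)).
have [r1 [K1 [r10 K10 H1]]] := Ck_bound1 oU Ux (Df (delta_mx 0 1)).
exists (Num.min r0 r1), (K0 + K1); split; [by rewrite lt_min r00|exact: addr_ge0|].
move=> y u v; rewrite lt_min => /andP[y0 y1].
have [Uy B0] := H0 y u y0; have [_ B1] := H1 y u y1; split=> //.
rewrite (derive_row2_on _ _ oU Uy Cf).
exact: norm_comb_le2 (coord_le_norm v 0) (coord_le_norm v 1) B0 B1.
Qed.

Lemma Ck_bound3 (U : set 'rV[R]_2) (f : 'rV[R]_2 -> R) x : open U -> U x -> Ck 3 U f ->
  exists r K : R, [/\ 0 < r, 0 <= K & forall y u v w, `|y - x| < r ->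
    U y /\ `|'D_u ('D_v ('D_w f)) y| <= K * `|u| * `|v| * `|w|].
Proof.
move=> oU Ux Cf; have [df Df] := Cf.
have [r0 [K0 [r00 K00 H0]]] := Ck_bound2 oU Ux (Df (delta_mx 0 0)).
have [r1 [K1 [r10 K10 H1]]] := Ck_bound2 oU Ux (Df (delta_mx 0 1)).
exists (Num.min r0 r1), (K0 + K1); split; [by rewrite lt_min r00|exact: addr_ge0|].
move=> y u v w; rewrite lt_min => /andP[y0 y1].
have [Uy B0] := H0 y u v y0; have [_ B1] := H1 y u v y1; split=> //.
have E z : U z -> 'D_v ('D_w f) z = w 0 0 *: 'D_v ('D_(delta_mx 0 0 : 'rV[R]_2) f) z
    + w 0 1 *: 'D_v ('D_(delta_mx 0 1 : 'rV[R]_2) f) z.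
  by move=> Uz; exact: derive_row2_on (CkW Cf).
rewrite (@near_eq_derive _ _ _ _ _ _ _ (open_near oU Uy E)).
have d j : derivable ('D_v ('D_(delta_mx 0 j : 'rV[R]_2) f)) y u.
  by have [_ /(_ v)[+ _]] := Df (delta_mx 0 j); move=> /(_ y Uy); exact: diff_derivable.
rewrite (derive_comb _ _ (d 0) (d 1)).
exact: norm_comb_le3 (coord_le_norm w 0) (coord_le_norm w 1) B0 B1.
Qed.

(** By the mean value on the segment from [z] to [y], the error is a difference of derivatives at
    two points near [x], which continuity of the partial derivatives makes small. *)
Lemma strictly_differentiable_real (U : set 'rV[R]_2) (f : 'rV[R]_2 -> R) x e :
  open U -> U x -> Ck 1 U f -> 0 < e ->
  exists2 r : R, 0 < r & forall y z, `|y - x| < r -> `|z - x| < r ->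
    `|f y - f z - 'D_(y - z) f x| <= e * `|y - z|.
Proof.
move=> oU Ux [df cf] e0; have e2 : 0 < e / 2 by rewrite divr_gt0.
pose d (j : 'I_2) : 'rV[R]_2 := delta_mx 0 j.
have [r0 r00 H0] := (continuous_forP _ _).1 (cf (d 0) x Ux) _ e2.
have [r1 r10 H1] := (continuous_forP _ _).1 (cf (d 1) x Ux) _ e2.
have [r2 r20 H2] := open_normP oU Ux.
exists (Num.min r0 (Num.min r1 r2)); first by rewrite !lt_min r00 r10.
move=> y z; set r := Num.min _ _ => yr zr.
have seg t : 0 <= t <= 1 -> `|z + t *: (y - z) - x| < r by exact: seg_ball.
have inU t : 0 <= t <= 1 -> U (z + t *: (y - z)).
  by move=> /seg; rewrite !lt_min => /and3P[_ _]; exact: H2.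
have [|t /andP[t0 t1] E] := mean_value_line (f := f) (x := z) (v := y - z).
  by move=> t /inU Ut; apply: df.
rewrite [z + _]addrC subrK in E; rewrite E.
have t01 : 0 <= t <= 1 by rewrite !ltW.
have := seg t t01; rewrite !lt_min => /and3P[/H0 h0 /H1 h1 /H2 Us].
have -> := derive_row2 (y - z) (df _ Us); have -> := derive_row2 (y - z) (df _ Ux).
move: h0 h1; rewrite -/(d 0) -/(d 1).
move: ('D_(d 0) f _) ('D_(d 0) f _) ('D_(d 1) f _) ('D_(d 1) f _) => a b a' b' h0 h1.
have -> : (y - z) 0 0 *: b + (y - z) 0 1 *: b' - ((y - z) 0 0 *: a + (y - z) 0 1 *: a')
   = (y - z) 0 0 * (b - a) + (y - z) 0 1 * (b' - a') by rewrite /GRing.scale /=; ring.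
rewrite (splitr e); exact: norm_comb_le (coord_le_norm _ 0) (coord_le_norm _ 1) (ltW h0) (ltW h1).
Qed.

Lemma strictly_differentiable (U : set 'rV[R]_2) (f : 'rV[R]_2 -> 'rV[R]_2) x e :
  open U -> U x -> Ck 1 U f -> 0 < e ->
  exists2 r : R, 0 < r & forall y z, `|y - x| < r -> `|z - x| < r ->
    `|f y - f z - 'D_(y - z) f x| <= e * `|y - z|.
Proof.
move=> oU Ux Cf e0.
have [r0 r00 H0] := strictly_differentiable_real oU Ux (Ck_coord 0 0 oU Cf) e0.
have [r1 r10 H1] := strictly_differentiable_real oU Ux (Ck_coord 0 1 oU Cf) e0.
exists (Num.min r0 r1); first by rewrite lt_min r00.
move=> y z; rewrite !lt_min => /andP[y0 y1] /andP[z0 z1].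
have df : differentiable f x by exact: Ck_differentiable Cf Ux.
have [_ E0] := is_derive_coord 0 0 (is_derive_dir (y - z) df).
have [_ E1] := is_derive_coord 0 1 (is_derive_dir (y - z) df).
by apply: norm_row2_le; rewrite !mxE -?E0 -?E1; [exact: H0|exact: H1].
Qed.

Lemma compact_norm_ball (x : 'rV[R]_2) (r : R) : 0 < r ->
  compact [set y : 'rV[R]_2 | `|y - x| <= r].
Proof.
move=> r0; have -> : [set y | `|y - x| <= r] = closed_ball x r.
  by rewrite closed_ballE //; apply/seteqP; split=> y; rewrite /closed_ball_ /= distrC.
apply: bounded_closed_compact; last exact: closed_ball_closed.
exists (`|x| + r); split; first exact: num_real.
move=> M xrM y; rewrite closed_ballE // /closed_ball_ /= => xy; apply: le_trans (ltW xrM).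
by rewrite -lerBlDl (le_trans _ xy) // distrC lerB_dist.
Qed.

(** A minimiser [y0] of [|h y - q|] on the compact ball lies in its inner half, so the correction
    [y0 + (q - h y0)] is still in the ball; it would halve a positive residual. *)
Lemma near_identity_surjective (h : 'rV[R]_2 -> 'rV[R]_2) x r q : 0 < r ->
  (forall y z, `|y - x| <= r -> `|z - x| <= r -> `|h y - h z - (y - z)| <= 2^-1 * `|y - z|) ->
  `|q - h x| <= r / 8 -> exists2 y, `|y - x| <= r & h y = q.
Proof.
move=> r0 H qr.
pose B : set 'rV[R]_2 := [set y | `|y - x| <= r].
have Bx : B x by rewrite /B /= subrr normr0 ltW.
have cB : compact B.
  exact: compact_norm_ball.
have lip y z : B y -> B z -> `|h y - h z| <= 2 * `|y - z|.
  move=> By Bz; have := H y z By Bz.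
  rewrite -[h y - h z](subrK (y - z)) => k.
  rewrite (le_trans (ler_normD _ _)) //.
  rewrite subrK in k; have n0 := normr_ge0 (y - z).
  by move: k n0; move: `|y - z| (`|_ - _|) => a b; clear; lra.
have ch : {within B, continuous (fun y => `|h y - q|)}.
  apply/subspace_continuousP => y By; apply/cvgrPdist_lt => e e0.
  rewrite near_withinE; apply: (near_normP (y : 'rV[R]_2) _).2; exists (e / 2); first by rewrite divr_gt0.
  move=> z zy Bz; rewrite (le_lt_trans (ler_dist_dist _ _)) // opprB addrA subrK.
  by rewrite (le_lt_trans (lip _ _ By Bz)) // distrC mulrC -ltr_pdivlMr.
have [|y0 /[!inE] By0 M] := compact_EVT_min _ cB ch; first by exists x.
exists y0 => //; apply/eqP; rewrite -subr_eq0 -normr_le0 leNgt; apply/negP => e0.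
have y0x : `|y0 - x| <= r / 2.
  have := H y0 x By0 Bx; have := M x; rewrite inE => /(_ Bx).
  rewrite (distrC (h x)) => M1 M2.
  have T1 : `|y0 - x| <= `|h y0 - h x| + `|h y0 - h x - (y0 - x)|.
    rewrite -[in leLHS](subKr (h y0 - h x) (y0 - x)); exact: ler_normB.
  have T2 := ler_distD q (h y0) (h x).
  move: T1 T2 M1 M2 qr; clear; move: (`|_|) (`|_|) (`|_|) (`|_|) (`|_|) => *; lra.
have M1 := M x; rewrite inE (distrC (h x)) in M1; have {}M1 := M1 Bx.
pose y1 := y0 + (q - h y0).
have By1 : B y1.
  rewrite /B /= /y1 addrAC (le_trans (ler_normD _ _)) //.
  rewrite -(distrC q) in M1.
  by move: M1 y0x qr r0; clear; move: (`|_|) (`|_|) (`|_|) => *; lra.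
have := M y1; rewrite inE => /(_ By1); apply/negP; rewrite -ltNge.
have := H y1 y0 By1 By0; rewrite /y1 [y0 + _]addrC addrK.
rewrite opprB addrA subrK => le1.
rewrite (le_lt_trans le1) // distrC; move: e0; clear; move: (`|_|) => *; lra.
Qed.

(** The supremum of the initial segments on which [P] holds is reached and cannot be passed over
    before [a]. All continuation arguments along curves and geodesics below are instances. *)
Lemma real_induction (P : R -> Prop) (a : R) : 0 <= a -> P 0 ->
  (forall t, 0 <= t < a -> P t -> exists2 d : R, 0 < d & forall s, t <= s <= t + d -> s <= a -> P s) ->
  (forall t, 0 < t <= a -> (forall s, 0 <= s < t -> P s) -> P t) ->
  forall t, 0 <= t <= a -> P t.
Proof.
move=> a0 P0 Pr Pl.
pose S := [set t | 0 <= t <= a /\ forall s, 0 <= s <= t -> P s].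
have S0 : S 0 by split=> [|s /le_anti <-//]; rewrite lexx.
have Sub : has_sup S by split; [exists 0|exists a => t [/andP[_ ta] _]].
pose T := sup S.
have T0 : 0 <= T by apply: ub_le_sup => //; case: Sub.
have Ta : T <= a by apply: ge_sup; [exists 0|move=> t [/andP[_ ta] _]].
have lt s : 0 <= s < T -> P s.
  move=> /andP[s0 sT]; have [t [_ Ht] st] := sup_gt (ex_intro _ 0 S0) sT.
  by apply: Ht; rewrite s0 ltW.
have PT : P T.
  by have [->//|Tn0] := eqVneq T 0; apply: Pl lt; rewrite lt_neqAle eq_sym Tn0 T0.
have le s : 0 <= s <= T -> P s.
  by move=> /andP[s0]; rewrite le_eqVlt => /orP[/eqP->//|sT]; apply: lt; rewrite s0.
have [TE|Tna] := eqVneq T a; first by rewrite TE in le.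
have Tla : T < a by rewrite lt_neqAle Tna.
have [|d d0 Hd] := Pr T _ PT; first by rewrite T0.
have SS : S (Num.min (T + d) a).
  split; first by rewrite le_min a0 (addr_ge0 T0 (ltW d0)) ge_min lexx orbT.
  move=> s /andP[s0]; rewrite le_min => /andP[sd sa].
  have [sT|Ts] := leP s T; first by apply: le; rewrite s0.
  by apply: Hd => //; rewrite (ltW Ts).
have : Num.min (T + d) a <= T by apply: ub_le_sup => //; case: Sub.
by rewrite leNgt lt_min ltrDl d0 Tla.
Qed.

Local Notation mu := (@lebesgue_measure R).

Lemma integral_derive (f : R -> R) (t : R) : continuous f -> -1 < t ->
  is_derive t 1 (fun t : R => \int[mu]_(s in `[-1, t]) f s) (f t).
Proof.
move=> cf t1; have tt1 : t < t + 1 by rewrite ltrDl.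
have int : mu.-integrable `[-1, t + 1] (EFin \o f).
  by apply: continuous_compact_integrable; [exact: segment_compact|exact: continuous_subspaceT].
have [d e] := @continuous_FTC1_closed R f (-1) t (t + 1) tt1 int t1 (cf t).
by apply: DeriveDef; [exact: d|rewrite -derive1E; exact: e].
Qed.

Lemma primitive (f : R -> R) (a : R) : 0 < a ->
  (forall t, 0 <= t <= a -> {for t, continuous f}) ->
  exists H : R -> R, (forall t : R, 0 <= t <= a -> is_derive t 1 H (f t)) /\
    \int[mu]_(t in `[0, a]) f t = H a - H 0.
Proof.
move=> a0 cf.
(* Clamping the time to [[0, a]] extends [f] to a continuous function on the line, and integrating
   from [-1] makes the derivative of the primitive two-sided at 0. *)
pose p (t : R) := Num.max 0 (Num.min t a).
have cp : continuous p.
  apply: (@max_fun_continuous _ R R (cst 0) (fun t => Num.min t a)); first exact: cst_continuous.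
  apply: (@min_fun_continuous _ R R id (cst a)); last exact: cst_continuous.
  by move=> t; exact: cvg_id.
have p01 t : 0 <= p t <= a by rewrite /p le_max lexx ge_max (ltW a0) ge_min lexx orbT.
have pE t : 0 <= t <= a -> p t = t by move=> /andP[t0 ta]; rewrite /p min_l // max_r.
pose g := f \o p.
have cg : continuous g by move=> t; apply: continuous_comp; [exact: cp|exact: cf].
pose H t := \int[mu]_(s in `[-1, t]) g s.
have HD (t : R) : -1 < t -> is_derive t 1 H (g t) by exact: integral_derive.
exists H; split.
  by move=> t ta; rewrite -[in f t](pE t ta); apply: HD; case/andP: ta => t0 _; rewrite (lt_le_trans _ t0) // ltrN10.
have -> : \int[mu]_(t in `[0, a]) f t = \int[mu]_(t in `[0, a]) g t.
  by apply: eq_Rintegral => t; rewrite inE /= in_itv /= => /pE ta; rewrite /g /= ta.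
rewrite /Rintegral (@continuous_FTC2 _ g H).
- by [].
- exact: a0.
- exact: continuous_subspaceT.
- split.
  + by move=> t; rewrite in_itv /= => /andP[t0 _]; have [] := HD t (lt_trans (ltrN10 _) t0).
  + by apply: cvg_at_right_filter; exact: is_derive_continuous (HD 0 (ltrN10 _)).
  + by apply: cvg_at_left_filter; exact: is_derive_continuous (HD a (lt_trans (ltrN10 _) a0)).
- move=> t; rewrite in_itv /= => /andP[t0 _]; rewrite derive1E.
  by have [_ ->] := HD t (lt_trans (ltrN10 _) t0).
Qed.

(** The step is a normalised primitive of the positive part of [t (1 - t)]. Its derivative is
    continuous and vanishes outside [[0, 1]], which allows C1 curves to rest before being glued. The
    condition [-1 < t] reflects the lower end of the integral. *)
Lemma smooth_step : exists f df : R -> R, [/\ continuous df,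
  forall t : R, -1 < t -> [/\ is_derive t 1 f (df t), 0 <= df t & 0 <= f t <= 1],
  forall t, -1 < t -> t <= 0 -> f t = 0 & forall t, 1 <= t -> f t = 1].
Proof.
pose g (t : R) := Num.max 0 (t * (1 - t)); pose F t := \int[mu]_(s in `[-1, t]) g s.
have cg : continuous g.
  apply: (@max_fun_continuous _ R R (cst 0) (fun t => t * (1 - t))); first exact: cst_continuous.
  move=> t; apply: cvgM; [exact: cvg_id|apply: cvgB; [exact: cvg_cst|exact: cvg_id]].
have g0 t : 0 <= g t by rewrite le_max lexx.
have DF (t : R) : -1 < t -> is_derive t 1 F (g t) by exact: integral_derive.
have mono s t : -1 < s -> s <= t -> F s <= F t.
  move=> s1 st; apply: (nondecreasing_derive st) => x /andP[sx _]; last exact: g0.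
  by apply: DF; exact: lt_le_trans sx.
have const s t : -1 < s -> s <= t -> (forall x, s <= x <= t -> g x = 0) -> F s = F t.
  move=> s1 st gx; apply/le_anti; rewrite mono //= -lerN2.
  apply: (@nondecreasing_derive (fun x => - F x) (fun x => - g x) s t st) => x xt; last by rewrite gx // oppr0.
  by apply: is_deriveN; apply: DF; move: xt => /andP[sx _]; exact: lt_le_trans sx.
have [|c /andP[c0 c1] Fc] := mean_value (f := F) (df := g) ltr01.
  by move=> t /andP[t0 _]; apply: DF; lra.
have F01 : 0 < F 1 - F 0.
  by rewrite Fc subr0 mulr1 lt_max mulr_gt0 ?orbT // subr_gt0.
have k0 : 0 < (F 1 - F 0)^-1 by rewrite invr_gt0.
have e0 t : -1 < t -> t <= 0 -> F t = F 0.
  by move=> t1 t0; apply: const => // x /andP[_ x0]; rewrite /g max_l //; nra.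
have e1 t : 1 <= t -> F t = F 1.
  by move=> t1; apply/esym; apply: const => // x /andP[x1 _]; rewrite /g max_l //; nra.
exists (fun t => (F 1 - F 0)^-1 * (F t - F 0)), (fun t => (F 1 - F 0)^-1 * g t); split.
- by move=> t; apply: cvgM; [exact: cvg_cst|exact: cg].
- move=> t t1; split; last first.
  + rewrite mulr_ge0 ?(ltW k0) //=; last first.
      by rewrite subr_ge0; have [/(e0 t t1)->//|/ltW t0] := leP t 0; apply: mono => //; lra.
    rewrite mulrC ler_pdivrMr // mul1r lerD2r.
    by have [/e1->//|/ltW t1'] := leP 1 t; exact: mono.
  + by rewrite mulr_ge0 // ltW.
  + have := is_deriveZ (F 1 - F 0)^-1 (is_deriveB (DF t t1) (is_derive_cst (F 0) t 1)).
    by rewrite subr0.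
- by move=> t t1 t0; rewrite (e0 t) // subrr mulr0.
- by move=> t t1; rewrite (e1 t t1) mulVf // gt_eqF.
Qed.

End RealTools.

(** * Bilinear forms on the plane *)

Section BilinearForm.
Context {R : realType}.
Local Notation V := 'rV[R]_2.

Definition bf (A : 'M[R]_2) (u v : V) : R := (u *m A *m v^T) 0 0.

Lemma bf_def A u v : bf A u v = (u *m A *m v^T) 0 0.
Proof. by []. Qed.

Lemma bfE A u v : bf A u v = u 0 0 * A 0 0 * v 0 0 + u 0 0 * A 0 1 * v 0 1
  + u 0 1 * A 1 0 * v 0 0 + u 0 1 * A 1 1 * v 0 1.
Proof.
rewrite /bf !mxE sum_ord2 !mxE !sum_ord2.
by rewrite !mulrDl -!addrA; congr (_ + _); rewrite addrCA.
Qed.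

Lemma bfDl A u u' v : bf A (u + u') v = bf A u v + bf A u' v.
Proof. by rewrite /bf !mulmxDl mxE. Qed.
Lemma bfDr A u v v' : bf A u (v + v') = bf A u v + bf A u v'.
Proof. by rewrite /bf linearD /= !mulmxDr mxE. Qed.
Lemma bfZl A a u v : bf A (a *: u) v = a * bf A u v.
Proof. by rewrite /bf -!scalemxAl mxE. Qed.
Lemma bfZr A a u v : bf A u (a *: v) = a * bf A u v.
Proof. by rewrite /bf linearZ /= -!scalemxAr mxE. Qed.
Lemma bfNl A u v : bf A (- u) v = - bf A u v.
Proof. by rewrite -scaleN1r bfZl mulN1r. Qed.
Lemma bfNr A u v : bf A u (- v) = - bf A u v.
Proof. by rewrite -scaleN1r bfZr mulN1r. Qed.
Lemma bfBl A u u' v : bf A (u - u') v = bf A u v - bf A u' v.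
Proof. by rewrite bfDl bfNl. Qed.
Lemma bfBr A u v v' : bf A u (v - v') = bf A u v - bf A u v'.
Proof. by rewrite bfDr bfNr. Qed.
Lemma bf0l A v : bf A 0 v = 0.
Proof. by rewrite -(scale0r 0) bfZl mul0r. Qed.
Lemma bf0r A u : bf A u 0 = 0.
Proof. by rewrite -(scale0r 0) bfZr mul0r. Qed.
Lemma bfDm A B u v : bf (A + B) u v = bf A u v + bf B u v.
Proof. by rewrite /bf mulmxDr mulmxDl mxE. Qed.
Lemma bfZm a A u v : bf (a *: A) u v = a * bf A u v.
Proof. by rewrite /bf -scalemxAr -scalemxAl mxE. Qed.
Lemma bfBm A B u v : bf (A - B) u v = bf A u v - bf B u v.
Proof. by rewrite bfDm -scaleN1r bfZm mulN1r. Qed.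

Lemma bfC A u v : A^T = A -> bf A u v = bf A v u.
Proof.
move=> sA; have e : A 1 0 = A 0 1 by rewrite -{1}sA mxE.
by rewrite !bfE e; ring.
Qed.

Lemma is_derive_bf (W : normedModType R) (A : W -> 'M[R]_2) (u v : W -> V) (t d : W)
    (dA : 'M[R]_2) (du dv : V) :
  is_derive t d A dA -> is_derive t d u du -> is_derive t d v dv ->
  is_derive t d (fun s => bf (A s) (u s) (v s))
    (bf dA (u t) (v t) + bf (A t) du (v t) + bf (A t) (u t) dv).
Proof.
move=> HA Hu Hv.
have M3 (i j : 'I_2) : is_derive t d (fun s => u s 0 i * A s i j * v s 0 j)
    (du 0 i * A t i j * v t 0 j + u t 0 i * dA i j * v t 0 j + u t 0 i * A t i j * dv 0 j).
  have hA := is_derive_coord i j HA; have hu := is_derive_coord 0 i Hu.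
  have hv := is_derive_coord 0 j Hv.
  apply: (is_derive_eq (is_deriveM (is_deriveM hu hA) hv)).
  by rewrite !fctE /GRing.scale /=; ring.
have -> : (fun s => bf (A s) (u s) (v s)) = (fun s => u s 0 0 * A s 0 0 * v s 0 0)
   + (fun s => u s 0 0 * A s 0 1 * v s 0 1) + (fun s => u s 0 1 * A s 1 0 * v s 0 0)
   + (fun s => u s 0 1 * A s 1 1 * v s 0 1).
  by apply/funext => s; rewrite bfE.
apply: (is_derive_eq (is_deriveD (is_deriveD (is_deriveD (M3 0 0) (M3 0 1)) (M3 1 0)) (M3 1 1))).
by rewrite !bfE; ring.
Qed.

Lemma bf_nondeg A u v : (forall w, w != 0 -> 0 < bf A w w) ->
  (forall w, bf A u w = bf A v w) -> u = v.
Proof.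
move=> pA H; apply/eqP; rewrite -subr_eq0; apply/negPn/negP => /pA.
by rewrite bfBl H subrr ltxx.
Qed.

Lemma bf_norm_le A u v : `|bf A u v| <= 4 * `|A| * `|u| * `|v|.
Proof.
have Aij i j : `|A i j| <= `|A|.
  by rewrite [leRHS]/Num.Def.normr/= mx_normrE; exact: (le_bigmax _ _ (i, j)).
have term i j : `|u 0 i * A i j * v 0 j| <= `|A| * `|u| * `|v|.
  by rewrite !normrM [`|A| * _]mulrC !ler_pM ?mulr_ge0 ?coord_le_norm.
have sum4 (a b c d e : R) : `|a| <= e -> `|b| <= e -> `|c| <= e -> `|d| <= e ->
    `|a + b + c + d| <= 4 * e.
  by clear; rewrite !ler_norml => /andP[a1 a2] /andP[b1 b2] /andP[c1 c2] /andP[d1 d2];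
    apply/andP; split; lra.
rewrite bfE (_ : 4 * `|A| * `|u| * `|v| = 4 * (`|A| * `|u| * `|v|)); last by rewrite !mulrA.
by apply: sum4; exact: term.
Qed.

Lemma bf_linear_expand A (P : V -> V) : (forall u v, P (u + v) = P u + P v) ->
  (forall c u, P (c *: u) = c *: P u) -> forall a b,
  bf A (P a) (P b) = bf (\matrix_(m, n) bf A (P (delta_mx 0 m)) (P (delta_mx 0 n))) a b.
Proof.
move=> PD PZ a b; rewrite [in LHS](row2_delta a) [in LHS](row2_delta b) !PD !PZ.
rewrite [RHS]bfE !mxE !bfDl !bfDr !bfZl !bfZr.
by move: (bf _ _ _) (bf _ _ _) (bf _ _ _) (bf _ _ _) => *; ring.
Qed.

Definition dot (u v : V) : R := u 0 0 * v 0 0 + u 0 1 * v 0 1.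

Lemma dot_norm_le (u v : V) : `|dot u v| <= 2 * `|u| * `|v|.
Proof.
apply: le_trans (ler_normD _ _) _; rewrite !normrM -mulrA mulr_natl mulr2n.
by apply: lerD; apply: ler_pM; rewrite ?coord_le_norm.
Qed.

End BilinearForm.

Lemma formE (R : realType) (M : surface R) (G : M -> 'M[R]_2) p u v :
  form G p u v = bf (G p) u v.
Proof. by []. Qed.

Opaque bf derive derive1.

(** * Transition maps and components of tangent vectors *)

Section Charts.
Context {R : realType} {M : surface R}.
Local Notation V := 'rV[R]_2.
Implicit Types (i j k p : M) (y v : V).

Definition overlap i j : set V := [set y | cod i y /\ dom j (param i y)].
Definition trans i j : V -> V := chart j \o param i.

Lemma nbhs_dom i p : dom i p -> nbhs p (dom i).
Proof. by move=> pi; apply: open_nbhs_nbhs; split=> //; exact: dom_open. Qed.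

Lemma nbhs_cod i y : cod i y -> nbhs y (cod i).
Proof. by move=> yi; apply: open_nbhs_nbhs; split=> //; exact: cod_open. Qed.

Lemma overlap_open i j : open (overlap i j).
Proof.
rewrite openE => y [yi yj]; rewrite /interior.
have h : \forall z \near y, dom j (param i z) := param_continuous yi (nbhs_dom yj).
by apply: filterS2 (nbhs_cod yi) h => z; split.
Qed.

Arguments overlap_open : clear implicits.

Lemma trans_Ck n i j : Ck n (overlap i j) (trans i j).
Proof. exact: transition_smooth. Qed.

Lemma trans_differentiable i j y : overlap i j y -> differentiable (trans i j) y.
Proof. exact: (Ck_differentiable (@trans_Ck 1 i j)). Qed.

Lemma overlap_trans i j y : overlap i j y -> overlap j i (trans i j y).
Proof. by move=> [yi yj]; split; [exact: chart_cod|rewrite /trans /= chartK //; exact: param_dom]. Qed.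

Lemma overlap_chart i j p : dom i p -> dom j p -> overlap i j (chart i p).
Proof. by move=> pi pj; split; [exact: chart_cod|rewrite chartK]. Qed.

(* [locked] keeps conversion from unfolding the derivatives. *)
Definition cmp i p v : V := locked (fun i p v => comp i p v) i p v.
Definition psh i y v : V := locked (fun i y v => push i y v) i y v.
Definition TD i j y v : V := locked (fun i j y v => 'D_v (trans i j) y) i j y v.

Lemma cmpE i p v : comp i p v = cmp i p v. Proof. by rewrite /cmp -lock. Qed.
Lemma pshE i y v : push i y v = psh i y v. Proof. by rewrite /psh -lock. Qed.
Lemma TDE i j y v : 'D_v (trans i j) y = TD i j y v. Proof. by rewrite /TD -lock. Qed.
Lemma cmp_TD i p v : cmp i p v = TD p i (chart p p) v.
Proof. by rewrite -cmpE -TDE. Qed.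
Lemma psh_TD i y v : psh i y v = TD i (param i y) y v.
Proof. by rewrite -pshE -TDE. Qed.

Lemma TDD i j y u v : overlap i j y -> TD i j y (u + v) = TD i j y u + TD i j y v.
Proof. by move=> o; rewrite -!TDE; exact: deriveDr (trans_differentiable o). Qed.

Lemma TDZ i j y (c : R) v : overlap i j y -> TD i j y (c *: v) = c *: TD i j y v.
Proof. by move=> o; rewrite -!TDE; exact: deriveZr (trans_differentiable o). Qed.

Lemma is_derive_trans i j y v : overlap i j y -> is_derive y v (trans i j) (TD i j y v).
Proof. by move=> o; rewrite -TDE; exact: is_derive_dir (trans_differentiable o). Qed.

Lemma TD_comp i j k y v : overlap i j y -> dom k (param i y) ->
  TD j k (trans i j y) (TD i j y v) = TD i k y v.
Proof.
move=> oij yk; have [yi yj] := oij.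
have ojk : overlap j k (trans i j y) by split; [exact: chart_cod|rewrite /trans /= chartK].
have [_ E] := is_derive_comp (is_derive_trans v oij) (trans_differentiable ojk).
rewrite -TDE -E -TDE.
have H z : overlap i j z -> (trans j k \o trans i j) z = trans i k z.
  by move=> [zi zj]; rewrite /trans /= chartK.
refine (@derive_eq_on R 'rV[R]_2 'rV[R]_2 (overlap i j) _ _ y v _ oij H).
exact: overlap_open.
Qed.

Lemma TD_self i y v : cod i y -> TD i i y v = v.
Proof.
move=> yi; rewrite -TDE.
have H z : cod i z -> trans i i z = id z by move=> zi; rewrite /trans /= paramK.
rewrite (@derive_eq_on R 'rV[R]_2 'rV[R]_2 (cod i) _ id y v _ yi H) ?derive_id //.
exact: cod_open.
Qed.

Lemma TDK i j y v : overlap i j y -> TD j i (trans i j y) (TD i j y v) = v.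
Proof. by move=> o; have [yi _] := o; rewrite TD_comp // ?TD_self //; exact: param_dom. Qed.

Lemma trans_chart i j p : dom i p -> trans i j (chart i p) = chart j p.
Proof. by move=> pi; rewrite /trans /= chartK. Qed.

Lemma overlap_center i p : dom i p -> overlap p i (chart p p).
Proof. by move=> pi; apply: overlap_chart => //; exact: dom_center. Qed.

Lemma TD_cmp i j p v : dom i p -> dom j p -> TD i j (chart i p) (cmp i p v) = cmp j p v.
Proof.
move=> pi pj; have pp := dom_center p; rewrite !cmp_TD -(trans_chart i pp).
by rewrite TD_comp ?chartK //; exact: overlap_center.
Qed.

Lemma psh_trans i j y v : overlap i j y -> psh j (trans i j y) (TD i j y v) = psh i y v.
Proof.
move=> o; have [yi yj] := o.
have e : param j (trans i j y) = param i y by rewrite /trans /= chartK.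
by rewrite !psh_TD e TD_comp //; exact: dom_center.
Qed.

Lemma psh_cmp i p v : dom i p -> psh i (chart i p) (cmp i p v) = v.
Proof.
move=> pi; have pp := dom_center p; rewrite psh_TD chartK // TD_cmp // cmp_TD TD_self //.
exact: chart_cod.
Qed.

Lemma cmp_psh i y v : cod i y -> cmp i (param i y) (psh i y v) = v.
Proof.
move=> yi; have yd := param_dom yi; have cc := dom_center (param i y).
have o : overlap i (param i y) y by split.
by rewrite cmp_TD psh_TD; have := TDK v o; rewrite /trans /=.
Qed.

Lemma cmpD i p u v : dom i p -> cmp i p (u + v) = cmp i p u + cmp i p v.
Proof. by move=> pi; rewrite !cmp_TD; exact: TDD (overlap_center pi). Qed.

Lemma cmpZ i p (c : R) v : dom i p -> cmp i p (c *: v) = c *: cmp i p v.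
Proof. by move=> pi; rewrite !cmp_TD; exact: TDZ (overlap_center pi). Qed.

Lemma cmp0 i p : dom i p -> cmp i p 0 = 0.
Proof. by move=> pi; rewrite -[X in cmp i p X](scale0r (0 : V)) cmpZ // scale0r. Qed.

Lemma pshD i y u v : cod i y -> psh i y (u + v) = psh i y u + psh i y v.
Proof. by move=> yi; rewrite !psh_TD; apply: TDD; split=> //; exact: dom_center. Qed.

Lemma pshZ i y (c : R) v : cod i y -> psh i y (c *: v) = c *: psh i y v.
Proof. by move=> yi; rewrite !psh_TD; apply: TDZ; split=> //; exact: dom_center. Qed.

Lemma near_dom (c : R -> M) t i : {for t, continuous c} -> dom i (c t) ->
  \forall s \near t, dom i (c s).
Proof. by move=> cc ci; exact: cc (nbhs_dom ci). Qed.

Lemma is_derive_chart (c : R -> M) (t : R) i j u : {for t, continuous c} ->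
  dom i (c t) -> dom j (c t) -> is_derive t 1 (chart i \o c) u ->
  is_derive t 1 (chart j \o c) (TD i j (chart i (c t)) u).
Proof.
move=> cc ci cj du.
have dT : differentiable (trans i j) ((chart i \o c) t).
  by apply: trans_differentiable; exact: overlap_chart.
rewrite -TDE; apply: near_eq_is_derive (is_derive_comp du dT).
near=> s; rewrite /trans /= chartK //; near: s; exact: near_dom.
Unshelve. all: by end_near. Qed.

Lemma velocity_chart (c : R -> M) (t : R) i u : {for t, continuous c} -> dom i (c t) ->
  is_derive t 1 (chart i \o c) u -> velocity c t = psh i (chart i (c t)) u.
Proof.
move=> cc ci du; have [_ E] := is_derive_chart cc ci (dom_center (c t)) du.
by rewrite /velocity derive1E E psh_TD chartK.
Qed.

Lemma cmp_velocity (c : R -> M) (t : R) i u : {for t, continuous c} -> dom i (c t) ->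
  is_derive t 1 (chart i \o c) u -> cmp i (c t) (velocity c t) = u.
Proof.
move=> cc ci du; rewrite (velocity_chart cc ci du) -{1}(chartK ci) cmp_psh //.
exact: chart_cod.
Qed.

End Charts.

(** * The metric and its Christoffel symbols in a chart *)

Section Metric.
Context {R : realType} {M : surface R} (g : riemannian M).
Local Notation V := 'rV[R]_2.
Implicit Types (i j k p : M) (y v a b c : V).

Definition Gm i y : 'M[R]_2 := locked (fun i y => local_gram g i y) i y.
Definition DG i y v : 'M[R]_2 := locked (fun i y v => 'D_v (local_gram g i) y) i y v.
Definition Gam i y a b : V := locked (fun i y a b => christoffel_vec g i y a b) i y a b.

Lemma GmE i y : local_gram g i y = Gm i y. Proof. by rewrite /Gm -lock. Qed.
Lemma GamE i y a b : christoffel_vec g i y a b = Gam i y a b.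
Proof. by rewrite /Gam -lock. Qed.
Lemma DGE i y v : 'D_v (Gm i) y = DG i y v.
Proof.
rewrite /DG -lock; apply: (congr1 (fun F : V -> 'M[R]_2 => 'D_v F y)).
by apply/funext => z; rewrite GmE.
Qed.

Lemma gramE i y a b : cod i y -> bf (Gm i y) a b = bf (g (param i y)) (psh i y a) (psh i y b).
Proof.
move=> yi; rewrite (@bf_linear_expand R (g (param i y)) (psh i y)) => [|*|*].
- by rewrite -GmE; congr (bf _ a b); apply/matrixP => m n; rewrite !mxE formE !pshE.
- exact: pshD.
- exact: pshZ.
Qed.

Lemma inner_chart i p u v : dom i p ->
  inner g p u v = bf (Gm i (chart i p)) (cmp i p u) (cmp i p v).
Proof.
move=> pi; rewrite gramE; last exact: chart_cod.
by rewrite chartK // !psh_cmp // /inner formE.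
Qed.

Lemma gram_trans i j y a b : overlap i j y ->
  bf (Gm i y) a b = bf (Gm j (trans i j y)) (TD i j y a) (TD i j y b).
Proof.
move=> o; have [yi yj] := o; have tj : cod j (trans i j y) := chart_cod yj.
rewrite (gramE _ _ tj) (gramE _ _ yi) !psh_trans //.
by rewrite /trans /= chartK.
Qed.

Lemma Gm_sym i y : (Gm i y)^T = Gm i y.
Proof.
rewrite -GmE; apply/matrixP => a b; rewrite !mxE !formE.
exact: bfC (gram_sym g (param i y)).
Qed.

Lemma GmC i y a b : bf (Gm i y) a b = bf (Gm i y) b a.
Proof. by apply: bfC; exact: Gm_sym. Qed.

Lemma Gm_gt0 i y a : cod i y -> a != 0 -> 0 < bf (Gm i y) a a.
Proof.
move=> yi a0; rewrite gramE // -formE; apply: gram_pos; apply: contra_neq a0 => e.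
by rewrite -(cmp_psh a yi) e cmp0 //; exact: param_dom.
Qed.

Lemma Gm_Ck n i : Ck n (cod i) (Gm i).
Proof.
have -> : Gm i = local_gram g i by apply/funext => y; rewrite GmE.
by apply: Ck_mx (@cod_open _ M i) _ => a b; exact: gram_smooth.
Qed.

Lemma Gm_differentiable i y : cod i y -> differentiable (Gm i) y.
Proof. exact: (Ck_differentiable (@Gm_Ck 1 i)). Qed.

Lemma is_derive_Gm i y v : cod i y -> is_derive y v (Gm i) (DG i y v).
Proof. by move=> yi; rewrite -DGE; exact: is_derive_dir (Gm_differentiable yi). Qed.

Lemma DGD i y u v : cod i y -> DG i y (u + v) = DG i y u + DG i y v.
Proof. by move=> yi; rewrite -!DGE; exact: deriveDr (Gm_differentiable yi). Qed.

Lemma DGZ i y (c : R) v : cod i y -> DG i y (c *: v) = c *: DG i y v.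
Proof. by move=> yi; rewrite -!DGE; exact: deriveZr (Gm_differentiable yi). Qed.

Lemma Gm_unit i y : cod i y -> Gm i y \in unitmx.
Proof.
move=> yi; rewrite -row_free_unit -kermx_eq0; apply/eqP/row_matrixP => k.
rewrite row0; apply/eqP/negPn/negP => k0; have := Gm_gt0 yi k0.
have /sub_kermxP E : (row k (kermx (Gm i y)) <= kermx (Gm i y))%MS by exact: row_sub.
by rewrite bf_def E mul0mx mxE ltxx.
Qed.

Lemma DG_sym i y a : cod i y -> (DG i y a)^T = DG i y a.
Proof.
move=> yi; apply/matrixP => k l; rewrite mxE.
have d := is_derive_Gm a yi.
have [_ <-] := is_derive_coord l k d; have [_ <-] := is_derive_coord k l d.
by apply: (congr1 (fun F : V -> R => 'D_a F y)); apply/funext => z; rewrite -{1}Gm_sym mxE.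
Qed.

Lemma DGC i y a b c : cod i y -> bf (DG i y a) b c = bf (DG i y a) c b.
Proof. by move=> yi; apply: bfC; exact: DG_sym. Qed.

Lemma christoffel_vec_coord i y a b (k : 'I_2) : christoffel_vec g i y a b 0 k =
  bf (\matrix_(m, n) christoffel g i k m n y) a b.
Proof.
rewrite mxE; set C := christoffel g i k; clearbody C.
by rewrite bfE !mxE !sum_ord2; ring.
Qed.

Lemma christoffel_vecE i y a b (k : 'I_2) : christoffel_vec g i y a b 0 k =
  \sum_(l < 2) invmx (local_gram g i y) k l *
    (2^-1 * bf (\matrix_(m, n) (dgram g i y m n l + dgram g i y n m l - dgram g i y l m n)) a b).
Proof.
rewrite christoffel_vec_coord /christoffel.
move: (invmx _) (dgram g i y) => J D.
by rewrite bfE !mxE !sum_ord2 !bfE !mxE; ring.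
Qed.

Lemma dgramE i y (m n l : 'I_2) : cod i y ->
  dgram g i y m n l = DG i y (delta_mx 0 m) n l.
Proof.
move=> yi; have [_ <-] := is_derive_coord n l (is_derive_Gm (delta_mx 0 m : V) yi).
rewrite /dgram; apply: (congr1 (fun F : V -> R => 'D_(delta_mx 0 m : V) F y)).
by apply/funext => z; rewrite GmE.
Qed.

(** Pairing with [c] removes the inverse Gram matrix from the definition of the Christoffel symbols.
    Symmetry, metric compatibility and smoothness of [Gam] are all read off from this form. *)
Lemma koszul i y a b c : cod i y ->
  2 * bf (Gm i y) (Gam i y a b) c =
  bf (DG i y a) b c + bf (DG i y b) a c - bf (DG i y c) a b.
Proof.
move=> yi; have gu := Gm_unit yi.
pose T (l : 'I_2) : 'M[R]_2 :=
  \matrix_(m, n) (dgram g i y m n l + dgram g i y n m l - dgram g i y l m n).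
pose w : V := \row_l (2^-1 * bf (T l) a b).
have E : Gam i y a b = w *m invmx (Gm i y).
  rewrite -GamE; apply/rowP => k; rewrite christoffel_vecE mxE; apply: eq_bigr => l _.
  by rewrite -/(T l) GmE /w [in RHS]mxE mulrC -[in LHS](Gm_sym i y) -trmx_inv [in LHS]mxE.
have -> : bf (Gm i y) (Gam i y a b) c = (w *m c^T) 0 0.
  by rewrite E bf_def -mulmxA -mulmxA (mulmxA (invmx _)) mulVmx // mul1mx.
have DE v b' c' : bf (DG i y v) b' c' =
    v 0 0 * bf (\matrix_(m, n) dgram g i y 0 m n) b' c'
    + v 0 1 * bf (\matrix_(m, n) dgram g i y 1 m n) b' c'.
  rewrite [in LHS](row2_delta v) DGD // !DGZ // bfDm !bfZm.
  have DM m : DG i y (delta_mx 0 m) = \matrix_(m', n) dgram g i y m m' n.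
    by apply/matrixP => m' n; rewrite mxE dgramE.
  by rewrite (DM 0) (DM 1).
rewrite !DE /w /T; move: (dgram g i y) => D.
by rewrite mxE !sum_ord2 !mxE !bfE !mxE; field.
Qed.

Lemma Gm_inj i y u v : cod i y -> (forall w, bf (Gm i y) u w = bf (Gm i y) v w) -> u = v.
Proof. by move=> yi; apply: bf_nondeg => w; exact: Gm_gt0. Qed.

Lemma GamC i y a b : cod i y -> Gam i y a b = Gam i y b a.
Proof.
move=> yi; apply: (Gm_inj yi) => w.
apply: (mulfI (x := 2)); first by rewrite pnatr_eq0.
by rewrite !koszul // (DGC w a b yi) [bf _ b w + _]addrC.
Qed.

(** In the sum of the Koszul formulas for [(a, b, c)] and [(a, c, b)] only the derivative along [a]
    survives. *)
Lemma metric_compat i y a b c : cod i y ->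
  bf (DG i y a) b c = bf (Gm i y) (Gam i y a b) c + bf (Gm i y) b (Gam i y a c).
Proof.
move=> yi; have k1 := koszul a b c yi; have k2 := koszul a c b yi.
rewrite (GmC i y b); rewrite (DGC a c b yi) in k2.
rewrite (DGC b a c yi) in k1; rewrite (DGC c a b yi) in k1.
rewrite (DGC c a b yi) in k2; rewrite (DGC b a c yi) in k2.
move: k1 k2; move: (bf (DG i y a) _ _) (bf (DG i y b) _ _) (bf (DG i y c) _ _) => p q r.
move: (bf _ _ _) (bf _ _ _) => s t; clear; lra.
Qed.

Lemma GamDl i y a a' b : Gam i y (a + a') b = Gam i y a b + Gam i y a' b.
Proof. by rewrite -!GamE; apply/rowP => k; rewrite [RHS]mxE !christoffel_vec_coord bfDl. Qed.
Lemma GamDr i y a b b' : Gam i y a (b + b') = Gam i y a b + Gam i y a b'.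
Proof. by rewrite -!GamE; apply/rowP => k; rewrite [RHS]mxE !christoffel_vec_coord bfDr. Qed.
Lemma GamZl i y (c : R) a b : Gam i y (c *: a) b = c *: Gam i y a b.
Proof. by rewrite -!GamE; apply/rowP => k; rewrite [RHS]mxE !christoffel_vec_coord bfZl. Qed.
Lemma GamZr i y (c : R) a b : Gam i y a (c *: b) = c *: Gam i y a b.
Proof. by rewrite -!GamE; apply/rowP => k; rewrite [RHS]mxE !christoffel_vec_coord bfZr. Qed.

End Metric.

Lemma det2 (R : comRingType) (A : 'M[R]_2) : \det A = A 0 0 * A 1 1 - A 0 1 * A 1 0.
Proof.
rewrite (expand_det_row _ 0) !big_ord_recl big_ord0 /cofactor !det_mx11 !mxE addr0 /=.
rewrite expr0 expr1 mul1r mulN1r mulrN.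
have e (k l : nat) (hk : (k < 2)%N) (i : 'I_2) : k = i -> Ordinal hk = i by move=> ki; exact: val_inj.
by congr (_ * A _ _ - A _ _ * A _ _); exact: val_inj.
Qed.

Lemma bf_delta (R : realType) (A : 'M[R]_2) (m n : 'I_2) :
  bf A (delta_mx 0 m) (delta_mx 0 n) = A m n.
Proof.
by rewrite bfE !mxE; case: (ord2P m) => ->; case: (ord2P n) => ->;
  rewrite /= !(mul0r, mul1r, mulr0, mulr1, addr0, add0r).
Qed.

(** * The connection and its curvature under change of chart *)

Section Connection.
Context {R : realType} {M : surface R} (g : riemannian M).
Local Notation V := 'rV[R]_2.
Implicit Types (i j k p : M) (y v a b c : V).
Local Notation G := (Gm g).
Local Notation Gam := (Gam g).

Lemma TD_Ck n i j v : Ck n (overlap i j) (fun y => TD i j y v).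
Proof.
have [_ /(_ v)] := @trans_Ck R M n.+1 i j.
by rewrite (_ : 'D_v (trans i j) = fun y => TD i j y v) //; apply/funext => y; rewrite TDE.
Qed.

Definition D2 i j y a b : V := locked (fun i j y a b => 'D_a (fun z => TD i j z b) y) i j y a b.

Lemma D2E i j y a b : 'D_a (fun z => TD i j z b) y = D2 i j y a b.
Proof. by rewrite /D2 -lock. Qed.

Lemma is_derive_TD i j y a b : overlap i j y ->
  is_derive y a (fun z => TD i j z b) (D2 i j y a b).
Proof.
move=> o; rewrite -D2E; apply: is_derive_dir.
exact: (Ck_differentiable (@TD_Ck 1 i j b)).
Qed.

Lemma TD0 i j y : overlap i j y -> TD i j y 0 = 0.
Proof. by move=> o; rewrite -[X in TD i j y X](scale0r (0 : V)) TDZ // scale0r. Qed.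

Lemma Gam0l i y a : Gam i y 0 a = 0.
Proof. by rewrite -[X in Gam i y X](scale0r (0 : V)) GamZl scale0r. Qed.

Lemma Gam0r i y a : Gam i y a 0 = 0.
Proof. by rewrite -[X in Gam i y a X](scale0r (0 : V)) GamZr scale0r. Qed.

Lemma D2_Ck n i j a b : Ck n (overlap i j) (fun y => D2 i j y a b).
Proof.
have [_ /(_ a)] := @TD_Ck n.+1 i j b.
by rewrite (_ : 'D_a _ = fun z => D2 i j z a b) //; apply/funext => x; rewrite D2E.
Qed.

Lemma D2C i j y a b : overlap i j y -> D2 i j y a b = D2 i j y b a.
Proof.
move=> o; apply/rowP => k.
have [_ <-] := is_derive_coord 0 k (is_derive_TD a b o).
have [_ <-] := is_derive_coord 0 k (is_derive_TD b a o).
have oo := @overlap_open R M i j.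
have Cf : Ck 2 (overlap i j) (fun z => trans i j z 0 k).
  apply: (@Ck_coord R V 1 2 2 _ (trans i j) 0 k oo); exact: trans_Ck.
have E c z : overlap i j z -> TD i j z c 0 k = 'D_c (fun z => trans i j z 0 k) z.
  by move=> oz; have [_ ->] := is_derive_coord 0 k (is_derive_trans c oz).
rewrite (@derive_eq_on R V R _ _ _ y a oo o (E b)).
rewrite (@derive_eq_on R V R _ _ _ y b oo o (E a)).
exact: schwarz oo o Cf.
Qed.

Lemma D2Dl i j y a a' b : overlap i j y -> D2 i j y (a + a') b = D2 i j y a b + D2 i j y a' b.
Proof.
move=> o; rewrite -!D2E; apply: deriveDr; exact: (Ck_differentiable (@TD_Ck 1 i j b)).
Qed.

Lemma D2Zl i j y (r : R) a b : overlap i j y -> D2 i j y (r *: a) b = r *: D2 i j y a b.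
Proof.
move=> o; rewrite -!D2E; apply: deriveZr; exact: (Ck_differentiable (@TD_Ck 1 i j b)).
Qed.

Lemma D2Dr i j y a b b' : overlap i j y -> D2 i j y a (b + b') = D2 i j y a b + D2 i j y a b'.
Proof. by move=> o; rewrite D2C // D2Dl // !(D2C a). Qed.

Lemma D2Zr i j y (r : R) a b : overlap i j y -> D2 i j y a (r *: b) = r *: D2 i j y a b.
Proof. by move=> o; rewrite D2C // D2Zl // (D2C a). Qed.

Lemma derive_gram_trans i j y a b c : overlap i j y ->
  bf (DG g i y c) a b = bf (DG g j (trans i j y) (TD i j y c)) (TD i j y a) (TD i j y b)
    + bf (G j (trans i j y)) (D2 i j y c a) (TD i j y b)
    + bf (G j (trans i j y)) (TD i j y a) (D2 i j y c b).
Proof.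
move=> o; have [yi yj] := o; have yj' := chart_cod yj.
have d1 := is_derive_bf (is_derive_Gm g c yi) (is_derive_cst a y c) (is_derive_cst b y c).
rewrite !bf0l !bf0r !addr0 in d1.
have d0 : is_derive y c (fun z => G j (trans i j z)) (DG g j (trans i j y) (TD i j y c)).
  rewrite -DGE; apply: (is_derive_comp (is_derive_trans c o)); exact: Gm_differentiable.
have d2 := is_derive_bf d0 (is_derive_TD c a o) (is_derive_TD c b o).
have [_ <-] := d1; have [_ <-] := d2.
apply: (@derive_eq_on R V R _ _ _ y c (@overlap_open R M i j) o) => z oz.
exact: (gram_trans g a b oz).
Qed.

(** The defect [E] of the transformation law is symmetric. Paired with the metric it is skew in the
    last two arguments, by comparing the derivative of [gram_trans] with metric compatibility. A
    trilinear form with both symmetries is zero. *)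
Lemma Gam_trans i j y a b : overlap i j y ->
  Gam j (trans i j y) (TD i j y a) (TD i j y b) = TD i j y (Gam i y a b) - D2 i j y a b.
Proof.
move=> o; have [yi yj] := o; have yj' : cod j (trans i j y) := chart_cod yj.
pose E c a := TD i j y (Gam i y c a) - D2 i j y c a - Gam j (trans i j y) (TD i j y c) (TD i j y a).
pose F c a b := bf (G j (trans i j y)) (E c a) (TD i j y b).
have EC c a' : E c a' = E a' c by rewrite /E GamC // D2C // (GamC _ _ _ yj').
have skew c a' b' : F c a' b' = - F c b' a'.
  have := derive_gram_trans a' b' c o; rewrite !metric_compat //.
  rewrite (gram_trans g (Gam i y c a') b' o) (gram_trans g a' (Gam i y c b') o).
  rewrite /F /E !bfBl ![bf _ (TD i j y a') (D2 _ _ _ _ _)]GmC.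
  rewrite ![bf _ (TD i j y a') (TD i j y (Gam _ _ _ _))]GmC.
  rewrite ![bf _ (TD i j y a') (Gam _ _ _ _)]GmC.
  move: (bf _ _ _) (bf _ _ _) (bf _ _ _) (bf _ _ _) (bf _ _ _) (bf _ _ _) => *; lra.
have F0 c a' b' : F c a' b' = 0.
  have s1 := skew c a' b'; have s2 := skew b' c a'; have s3 := skew a' b' c.
  have e1 : F c b' a' = F b' c a' by rewrite /F EC.
  have e2 : F b' a' c = F a' b' c by rewrite /F EC.
  have e3 : F a' c b' = F c a' b' by rewrite /F EC.
  clearbody F; lra.
suff /eqP : E a b = 0 by rewrite /E subr_eq0 eq_sym => /eqP.
apply: (Gm_inj (g := g) yj') => w; rewrite bf0l.
have := F0 a b (TD j i (trans i j y) w); rewrite /F.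
have oj := overlap_trans o.
have := TDK w oj; rewrite (_ : trans j i (trans i j y) = y); last by rewrite /trans /= chartK ?paramK.
by move=> ->.
Qed.

Lemma TD_path i j (y v : R -> V) (t : R) y' v' : overlap i j (y t) ->
  is_derive t 1 y y' -> is_derive t 1 v v' ->
  is_derive t 1 (fun s => TD i j (y s) (v s)) (D2 i j (y t) y' (v t) + TD i j (y t) v').
Proof.
move=> o dy dv; have oo := @overlap_open R M i j.
have term (k : 'I_2) : is_derive t 1 (fun s => v s 0 k *: TD i j (y s) (delta_mx 0 k))
    (v t 0 k *: D2 i j (y t) y' (delta_mx 0 k) + v' 0 k *: TD i j (y t) (delta_mx 0 k)).
  apply: is_derive_mx => l m; rewrite (ord1 l).
  have dT : is_derive t 1 (fun s => TD i j (y s) (delta_mx 0 k)) (D2 i j (y t) y' (delta_mx 0 k)).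
    have dd := @is_derive_TD i j (y t) y' (delta_mx 0 k) o.
    rewrite -D2E; apply: (is_derive_comp dy); exact: (Ck_differentiable (@TD_Ck 1 i j _)).
  have dv0 := is_derive_coord 0 k dv; have dT0 := is_derive_coord 0 m dT.
  have -> : (fun s => (v s 0 k *: TD i j (y s) (delta_mx 0 k)) 0 m) =
      (fun s => v s 0 k) * (fun s => TD i j (y s) (delta_mx 0 k) 0 m).
    by apply/funext => s; rewrite [LHS]mxE.
  apply: (is_derive_eq (is_deriveM dv0 dT0)); rewrite !mxE /GRing.scale /=; ring.
have near_o : \forall s \near t, overlap i j (y s).
  by apply: (is_derive_continuous dy); apply: open_nbhs_nbhs.
apply: near_eq_is_derive; last first.
  apply: (is_derive_eq (is_deriveD (term 0) (term 1))).
  rewrite [in RHS](row2_delta v') TDD // !TDZ //.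
  rewrite [in RHS](row2_delta (v t)) D2Dr // !D2Zr // -!addrA; congr (_ + _).
  by rewrite addrCA.
apply: filterS near_o => s os; rewrite [in RHS](row2_delta (v s)) TDD // !TDZ //.
Qed.

(** The definition of [cov_along] works in the chart centred at [c t]. Passing to the chart [i]
    produces a second derivative of the transition map twice, once from differentiating the
    components and once from [Gam_trans], with opposite signs. *)
Lemma cmp_cov_along i (c : R -> M) (X : R -> V) (t : R) u' v' :
  {for t, continuous c} -> dom i (c t) -> is_derive t 1 (chart i \o c) u' ->
  is_derive t 1 (fun s => cmp i (c s) (X s)) v' ->
  cmp i (c t) (cov_along g c X t) = v' + Gam i (chart i (c t)) u' (cmp i (c t) (X t)).
Proof.
move=> cc ci du dv; set p := c t; have pp := dom_center p.
have o : overlap i p (chart i p) by exact: overlap_chart.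
have dw := TD_path o du dv.
have E1 : derive1 (fun s => comp p (c s) (X s)) t
    = D2 i p (chart i p) u' (cmp i p (X t)) + TD i p (chart i p) v'.
  rewrite derive1E; have [_ <-] := dw; apply: near_eq_derive.
  have h1 := near_dom cc ci; have h2 := near_dom cc pp.
  by apply: filterS2 h1 h2 => s si sp; rewrite cmpE /= TD_cmp.
rewrite /cov_along E1 GamE.
have E2 : velocity c t = TD i p (chart i p) u'.
  by rewrite (velocity_chart cc ci du) psh_TD chartK.
have E3 : X t = TD i p (chart i p) (cmp i p (X t)).
  by rewrite -[LHS](psh_cmp _ ci) psh_TD chartK.
have E4 : chart p p = trans i p (chart i p) by rewrite trans_chart.
have swp (a b d : V) : a + b + (d - a) = b + d by rewrite addrC addrA subrK addrC.
rewrite -/p E2 {2}E3 E4 Gam_trans // swp.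
by rewrite -TDD // cmp_TD E4 TDK.
Qed.

Lemma GmDG_Ck n i a b c : Ck n (cod i) (fun y => bf (DG g i y a) b c).
Proof.
have oc := @cod_open _ M i.
have CG : Ck n (cod i) (fun y => DG g i y a).
  have [_ /(_ a)] := Gm_Ck g n.+1 i.
  by rewrite (_ : 'D_a (G i) = fun y => DG g i y a) //; apply/funext => y; rewrite DGE.
have C4 (k l : 'I_2) : Ck n (cod i) (fun y => (b 0 k * c 0 l) * DG g i y a k l).
  by apply: Ck_mul => //; [exact: Ck_cst|exact: Ck_coord].
apply: (Ck_ext oc _ (Ck_add oc (Ck_add oc (Ck_add oc (C4 0 0) (C4 0 1)) (C4 1 0)) (C4 1 1))).
by move=> y _ /=; rewrite bfE; ring.
Qed.

Definition gdet (A : 'M[R]_2) : R := A 0 0 * A 1 1 - A 0 1 * A 0 1.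

Lemma gdet_gt0 i y : cod i y -> 0 < gdet (G i y).
Proof.
move=> yi; have e0 : (delta_mx 0 0 : V) != 0.
  by apply/eqP => /matrixP/(_ 0 0); rewrite !mxE => /eqP; rewrite oner_eq0.
have p0 := Gm_gt0 g yi e0; rewrite bfE !mxE /= in p0.
pose w : V := row2 (G i y 0 1) (- G i y 0 0).
have w0 : w != 0.
  apply/eqP => /matrixP/(_ 0 1); rewrite row2_1 mxE => /eqP; rewrite oppr_eq0 => /eqP e.
  by move: p0; rewrite e !(mul0r, mulr0, addr0) ltxx.
have := Gm_gt0 g yi w0; rewrite bfE !row2_0 !row2_1.
have -> : G i y 1 0 = G i y 0 1 by rewrite -{1}(Gm_sym g i y) mxE.
rewrite /gdet; move: p0; rewrite ?(mulr0n, mulr1n, mul1r, mulr1, mul0r, mulr0, addr0).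
move: (G i y 0 0) (G i y 0 1) (G i y 1 1) => p q r p0 H.
by rewrite -(pmulr_rgt0 _ p0); clear -H; nra.
Qed.

(** The Koszul formula is a linear system for the two components of [Gam]; Cramer's rule writes them
    with the denominator [gdet], which is positive. *)
Lemma Gam_Ck n i a b : Ck n (cod i) (fun y => Gam i y a b).
Proof.
have oc := @cod_open _ M i.
pose P (l : 'I_2) y := 2^-1 * (bf (DG g i y a) b (delta_mx 0 l) + bf (DG g i y b) a (delta_mx 0 l)
  + (-1) * bf (DG g i y (delta_mx 0 l)) a b).
have CP l : Ck n (cod i) (P l).
  apply: Ck_mul => //; first exact: Ck_cst.
  apply: (@Ck_add R V R) => //; last by apply: Ck_mul => //; [exact: Ck_cst|exact: GmDG_Ck].
  by apply: (@Ck_add R V R) => //; exact: GmDG_Ck.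
have CG (k l : 'I_2) : Ck n (cod i) (fun y => G i y k l) by apply: Ck_coord => //; exact: Gm_Ck.
have Cd : Ck n (cod i) (fun y => (gdet (G i y))^-1).
  apply: Ck_inv => // [y /gdet_gt0/lt0r_neq0//|].
  have C2 := @Ck_mul R V n _ _ _ oc (@Ck_cst R V R n (cod i) (-1)) (@Ck_mul R V n _ _ _ oc (CG 0 1) (CG 0 1)).
  apply: (Ck_ext oc _ (Ck_add oc (Ck_mul oc (CG 0 0) (CG 1 1)) C2)) => y _ /=.
  by rewrite /gdet mulN1r.
have e l y : cod i y -> P l y = bf (G i y) (Gam i y a b) (delta_mx 0 l).
  by move=> yi; have := koszul g a b (delta_mx 0 l) yi; rewrite /P; lra.
have coordE (l : 'I_2) y : bf (G i y) (Gam i y a b) (delta_mx 0 l) =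
    Gam i y a b 0 0 * G i y 0 l + Gam i y a b 0 1 * G i y 1 l.
  by rewrite bfE !mxE /=; have [->|->] := ord2P l; rewrite /= !(mulr0, mulr1, addr0, add0r).
apply: Ck_mx => // u k; rewrite (ord1 u).
have [->|->] := ord2P k.
- have CN := Ck_mul oc (@Ck_cst R V R n (cod i) (-1)) (Ck_mul oc (CP 1) (CG 0 1)).
  apply: (Ck_ext oc _ (Ck_mul oc Cd (Ck_add oc (Ck_mul oc (CP 0) (CG 1 1)) CN))) => y yi /=.
  have dn : gdet (G i y) != 0 by rewrite gt_eqF // gdet_gt0.
  have sG : G i y 1 0 = G i y 0 1 by rewrite -{1}(Gm_sym g i y) mxE.
  rewrite !e // !coordE sG; move: dn; rewrite /gdet => dn.
  by field.
- have CN := Ck_mul oc (@Ck_cst R V R n (cod i) (-1)) (Ck_mul oc (CP 0) (CG 0 1)).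
  apply: (Ck_ext oc _ (Ck_mul oc Cd (Ck_add oc (Ck_mul oc (CP 1) (CG 0 0)) CN))) => y yi /=.
  have dn : gdet (G i y) != 0 by rewrite gt_eqF // gdet_gt0.
  have sG : G i y 1 0 = G i y 0 1 by rewrite -{1}(Gm_sym g i y) mxE.
  rewrite !e // !coordE sG; move: dn; rewrite /gdet => dn.
  by field.
Qed.

Definition DGam i y c a b : V := locked (fun i y c a b => 'D_c (fun z => Gam i z a b) y) i y c a b.

Lemma is_derive_Gam i y c a b : cod i y ->
  is_derive y c (fun z => Gam i z a b) (DGam i y c a b).
Proof.
move=> yi; rewrite /DGam -lock; apply: is_derive_dir.
exact: (Ck_differentiable (@Gam_Ck 1 i a b)).
Qed.

Lemma DGamD i y c c' a b : cod i y -> DGam i y (c + c') a b = DGam i y c a b + DGam i y c' a b.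
Proof.
move=> yi; have df := Ck_differentiable (@Gam_Ck 1 i a b) yi.
have [_ <-] := is_derive_Gam (c + c') a b yi; have [_ <-] := is_derive_Gam c a b yi.
by have [_ <-] := is_derive_Gam c' a b yi; exact: deriveDr.
Qed.

Lemma DGamZ i y (r : R) c a b : cod i y -> DGam i y (r *: c) a b = r *: DGam i y c a b.
Proof.
move=> yi; have df := Ck_differentiable (@Gam_Ck 1 i a b) yi.
have [_ <-] := is_derive_Gam (r *: c) a b yi; have [_ <-] := is_derive_Gam c a b yi.
exact: deriveZr.
Qed.

Lemma DGamC i y c a b : cod i y -> DGam i y c a b = DGam i y c b a.
Proof.
move=> yi; have [_ <-] := is_derive_Gam c a b yi; have [_ <-] := is_derive_Gam c b a yi.
by apply: (derive_eq_on c (@cod_open _ M i) yi) => z zi; exact: GamC.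
Qed.

Lemma DGamDr i y c a b b' : cod i y -> DGam i y c a (b + b') = DGam i y c a b + DGam i y c a b'.
Proof.
move=> yi; have [_ <-] := is_derive_Gam c a (b + b') yi.
have [_ <-] := is_deriveD (is_derive_Gam c a b yi) (is_derive_Gam c a b' yi).
by apply: (derive_eq_on c (@cod_open _ M i) yi) => z zi; exact: GamDr.
Qed.

Lemma DGamZr i y c (r : R) a b : cod i y -> DGam i y c a (r *: b) = r *: DGam i y c a b.
Proof.
move=> yi; have [_ <-] := is_derive_Gam c a (r *: b) yi.
have [_ <-] := is_deriveZ r (is_derive_Gam c a b yi).
by apply: (derive_eq_on c (@cod_open _ M i) yi) => z zi; exact: GamZr.
Qed.

Lemma DGamDl i y c a a' b : cod i y -> DGam i y c (a + a') b = DGam i y c a b + DGam i y c a' b.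
Proof.
by move=> yi; rewrite (DGamC c _ b yi) DGamDr // (DGamC c a b yi) (DGamC c a' b yi).
Qed.

Lemma DGamZl i y c (r : R) a b : cod i y -> DGam i y c (r *: a) b = r *: DGam i y c a b.
Proof. by move=> yi; rewrite (DGamC c _ b yi) DGamZr // (DGamC c a b yi). Qed.

(* components of R(a, b) c *)
Definition Rm i y a b c : V := DGam i y a b c - DGam i y b a c
  + (Gam i y a (Gam i y b c) - Gam i y b (Gam i y a c)).

(** The second derivatives of the function [<c, c>], for a vector [c] with constant components,
    commute; by metric compatibility their difference is twice [<R(a, b) c, c>]. *)
Lemma Rm_skew i y a b c : cod i y -> bf (G i y) (Rm i y a b c) c = 0.
Proof.
move=> yi; have oc := @cod_open _ M i.
have H a' b' : 'D_a' ('D_b' (fun z => bf (G i z) c c)) y =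
   2 * (bf (G i y) (Gam i y a' (Gam i y b' c)) c + bf (G i y) (Gam i y b' c) (Gam i y a' c)
     + bf (G i y) (DGam i y a' b' c) c).
  have E z : cod i z -> 'D_b' (fun z => bf (G i z) c c) z = 2 * bf (G i z) (Gam i z b' c) c.
    move=> zi.
    have [_ ->] := is_derive_bf (is_derive_Gm g b' zi) (is_derive_cst c z b') (is_derive_cst c z b').
    by rewrite !bf0l !bf0r !addr0 /= metric_compat // (GmC g i z c); ring.
  rewrite (derive_eq_on a' oc yi E).
  have d := is_derive_bf (is_derive_Gm g a' yi) (is_derive_Gam a' b' c yi) (is_derive_cst c y a').
  have [_ ->] := is_deriveZ 2 d.
  by rewrite bf0r addr0 metric_compat // /cst /GRing.scale /=; ring.
have Cf : Ck 2 (cod i) (fun z => bf (G i z) c c).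
  have C4 (k l : 'I_2) : Ck 2 (cod i) (fun z => (c 0 k * c 0 l) * G i z k l).
    by apply: Ck_mul => //; [exact: Ck_cst|apply: Ck_coord => //; exact: Gm_Ck].
  apply: (Ck_ext oc _ (Ck_add oc (Ck_add oc (Ck_add oc (C4 0 0) (C4 0 1)) (C4 1 0)) (C4 1 1))).
  by move=> z _ /=; rewrite bfE; ring.
have := schwarz a b oc yi Cf; rewrite !H /Rm !bfDl !bfNl.
rewrite (GmC g i y (Gam i y a c)).
by move: (bf _ _ _) (bf _ _ _) (bf _ _ _) (bf _ _ _) (bf _ _ _) => *; lra.
Qed.

Lemma bilinear_coord (B : V -> V -> V) (k : 'I_2) :
  (forall u u' v, B (u + u') v = B u v + B u' v) -> (forall (r : R) u v, B (r *: u) v = r *: B u v) ->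
  (forall u v v', B u (v + v') = B u v + B u v') -> (forall (r : R) u v, B u (r *: v) = r *: B u v) ->
  forall u v, B u v 0 k = bf (\matrix_(m, n) B (delta_mx 0 m) (delta_mx 0 n) 0 k) u v.
Proof.
move=> Dl Zl Dr Zr u v; rewrite [in LHS](row2_delta u) [in LHS](row2_delta v).
by rewrite !Dl !Zl !Dr !Zr [RHS]bfE !mxE; ring.
Qed.

Lemma Gam_coord i y a b (k : 'I_2) :
  Gam i y a b 0 k = bf (\matrix_(m, n) Gam i y (delta_mx 0 m) (delta_mx 0 n) 0 k) a b.
Proof.
by apply: (bilinear_coord (B := Gam i y)) => *; rewrite ?GamDl ?GamDr ?GamZl ?GamZr.
Qed.

Lemma DGam_coord i y c a b (k : 'I_2) : cod i y ->
  DGam i y c a b 0 k = bf (\matrix_(m, n) DGam i y c (delta_mx 0 m) (delta_mx 0 n) 0 k) a b.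
Proof.
move=> yi; apply: (bilinear_coord (B := DGam i y c)) => *.
- exact: DGamDl.
- exact: DGamZl.
- exact: DGamDr.
- exact: DGamZr.
Qed.

Lemma Gam_path (W : normedModType R) i (z u v : W -> V) (t d : W) z' u' v' : cod i (z t) ->
  is_derive t d z z' -> is_derive t d u u' -> is_derive t d v v' ->
  is_derive t d (fun s => Gam i (z s) (u s) (v s))
    (DGam i (z t) z' (u t) (v t) + Gam i (z t) u' (v t) + Gam i (z t) (u t) v').
Proof.
move=> zi dz du dv; apply: is_derive_mx => l k; rewrite (ord1 l).
pose C z := \matrix_(m, n) Gam i z (delta_mx 0 m) (delta_mx 0 n) 0 k : 'M[R]_2.
have dC : is_derive t d (fun s => C (z s))
    (\matrix_(m, n) DGam i (z t) z' (delta_mx 0 m) (delta_mx 0 n) 0 k : 'M[R]_2).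
  apply: is_derive_mx => m n.
  have -> : (fun s => C (z s) m n) = (fun s => Gam i (z s) (delta_mx 0 m) (delta_mx 0 n) 0 k).
    by apply/funext => s; rewrite mxE.
  rewrite mxE; apply: is_derive_coord.
  have := is_derive_Gam z' (delta_mx 0 m) (delta_mx 0 n) zi => -[_ <-].
  apply: (is_derive_comp dz); exact: (Ck_differentiable (@Gam_Ck 1 i _ _)).
have := is_derive_bf dC du dv.
have -> : (fun s => bf (C (z s)) (u s) (v s)) = (fun s => Gam i (z s) (u s) (v s) 0 k).
  by apply/funext => s; rewrite Gam_coord.
by rewrite /C -DGam_coord // -!Gam_coord !mxE.
Qed.

Lemma is_derive_affine y c (t : R) : is_derive t 1 (fun s : R => y + s *: c) c.
Proof.
have d := @is_derive_line R V V id y c t.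
by rewrite derive_id in d; apply: d; exact: ex_diff.
Qed.

(** This is [Gam_trans] differentiated along [c]. In the skew part in [a] and [c] the third
    derivatives of the transition map cancel, by [D3C], and tensoriality of the curvature
    results. *)
Lemma D2_trans i j y a b c : overlap i j y ->
  DGam j (trans i j y) (TD i j y c) (TD i j y a) (TD i j y b)
    + Gam j (trans i j y) (D2 i j y c a) (TD i j y b)
    + Gam j (trans i j y) (TD i j y a) (D2 i j y c b) =
  D2 i j y c (Gam i y a b) + TD i j y (DGam i y c a b) - 'D_c (fun z => D2 i j z a b) y.
Proof.
move=> o; have [yi yj] := o; have yj' : cod j (trans i j y) := chart_cod yj.
pose z (s : R) := y + s *: c; have z0 : z 0 = y by rewrite /z scale0r addr0.
have dz : is_derive (0 : R) 1 z c := is_derive_affine y c 0.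
have o0 : overlap i j (z 0) by rewrite z0.
have dT a' := TD_path o0 dz (is_derive_cst a' (0 : R) 1).
have dtr : is_derive (0 : R) 1 (fun s => trans i j (z s)) (TD i j (z 0) c).
  by rewrite -TDE; apply: (is_derive_comp dz); exact: trans_differentiable.
have cj0 : cod j (trans i j (z 0)) by rewrite z0.
have L := Gam_path (z := fun s => trans i j (z s)) cj0 dtr (dT a) (dT b).
have ci0 : cod i (z 0) by rewrite z0.
have dG := Gam_path ci0 dz (is_derive_cst a (0 : R) 1) (is_derive_cst b (0 : R) 1).
have R1 := TD_path o0 dz dG.
have dD2 := is_derive_comp dz (Ck_differentiable (@D2_Ck 1 i j a b) o0).
have near_o : \forall s \near (0 : R), overlap i j (z s).
  apply: (is_derive_continuous dz); apply: open_nbhs_nbhs; split=> //; exact: overlap_open.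
have RR := is_deriveB R1 dD2.
have L' : is_derive (0 : R) 1 (fun s => Gam j (trans i j (z s)) (TD i j (z s) a) (TD i j (z s) b)) _ := L.
have E : 'D_1 (fun s => Gam j (trans i j (z s)) (TD i j (z s) a) (TD i j (z s) b)) (0 : R) =
  'D_1 ((fun s => TD i j (z s) (Gam i (z s) a b)) - ((fun z => D2 i j z a b) \o z)) 0.
  apply: near_eq_derive; apply: filterS near_o => s os; rewrite Gam_trans //.
have [_ E1] := L'; have [_ E2] := RR.
rewrite E1 E2 /cst !z0 in E.
by rewrite (TD0 o) !addr0 Gam0l Gam0r !addr0 in E.
Qed.

Lemma D3C i j y a b c : overlap i j y ->
  'D_c (fun z => D2 i j z a b) y = 'D_a (fun z => D2 i j z c b) y.
Proof.
move=> o; have oo := @overlap_open R M i j.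
have d a' : differentiable (fun z => D2 i j z a' b) y.
  exact: (Ck_differentiable (@D2_Ck 1 i j a' b)).
apply/rowP => k.
have [_ <-] := is_derive_coord 0 k (is_derive_dir c (d a)).
have [_ <-] := is_derive_coord 0 k (is_derive_dir a (d c)).
have E a' z : overlap i j z -> D2 i j z a' b 0 k = 'D_a' (fun z => TD i j z b 0 k) z.
  by move=> oz; have [_ ->] := is_derive_coord 0 k (is_derive_TD a' b oz).
rewrite (@derive_eq_on R V R _ _ _ y c oo o (E a)) (@derive_eq_on R V R _ _ _ y a oo o (E c)).
apply: (schwarz _ _ oo o); apply: (@Ck_coord R V 1 2 2 _ (fun z => TD i j z b) 0 k oo).
exact: TD_Ck.
Qed.

Lemma Rm_trans i j y a b c : overlap i j y ->
  Rm j (trans i j y) (TD i j y a) (TD i j y b) (TD i j y c) = TD i j y (Rm i y a b c).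
Proof.
move=> o; have [yi yj] := o; have yj' : cod j (trans i j y) := chart_cod yj.
have h1 := D2_trans b c a o; have h2 := D2_trans a c b o.
rewrite (D3C b c a o) in h1.
rewrite /Rm !Gam_trans // !GamDr.
have GN u v : Gam j (trans i j y) u (- v) = - Gam j (trans i j y) u v.
  by rewrite -scaleN1r GamZr scaleN1r.
have TN u : TD i j y (- u) = - TD i j y u by rewrite -scaleN1r TDZ // scaleN1r.
rewrite !GN !Gam_trans // !(TDD _ _ o) !TN ?(TDD _ _ o) ?TN.
rewrite (D2C b a o) in h2.
move/(canRL (addrK _))/(canRL (addrK _)): h1 => ->.
move/(canRL (addrK _))/(canRL (addrK _)): h2 => ->.
apply/rowP => k; rewrite !mxE; ring.
Qed.

Lemma RmDl i y a a' b c : cod i y -> Rm i y (a + a') b c = Rm i y a b c + Rm i y a' b c.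
Proof.
move=> yi; rewrite /Rm DGamD // GamDl (GamDl g i y a a' c) GamDr.
rewrite (DGamDl b a a' c yi).
by apply/rowP => k; rewrite !mxE; ring.
Qed.

Lemma RmZl i y (r : R) a b c : cod i y -> Rm i y (r *: a) b c = r *: Rm i y a b c.
Proof.
move=> yi; rewrite /Rm DGamZ // GamZl (GamZl g i y r a c) GamZr.
rewrite (DGamZl b r a c yi).
by apply/rowP => k; rewrite !mxE; ring.
Qed.

Lemma RmN i y a b c : Rm i y a b c = - Rm i y b a c.
Proof. by rewrite /Rm opprD !opprB. Qed.

Lemma RmDr i y a b c c' : cod i y -> Rm i y a b (c + c') = Rm i y a b c + Rm i y a b c'.
Proof.
by move=> yi; rewrite /Rm !DGamDr // !GamDr; apply/rowP => k; rewrite !mxE; ring.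
Qed.

Lemma RmZr i y a b (r : R) c : cod i y -> Rm i y a b (r *: c) = r *: Rm i y a b c.
Proof.
by move=> yi; rewrite /Rm !DGamZr // !GamZr; apply/rowP => k; rewrite !mxE; ring.
Qed.

Lemma Rm_skew2 i y a b c d : cod i y ->
  bf (G i y) (Rm i y a b c) d = - bf (G i y) (Rm i y a b d) c.
Proof.
move=> yi; have := Rm_skew a b (c + d) yi; rewrite RmDr // bfDl !bfDr.
rewrite (Rm_skew a b c yi) (Rm_skew a b d yi).
by move: (bf _ _ _) (bf _ _ _) => *; lra.
Qed.

Local Notation e0 := (delta_mx 0 0 : V).
Local Notation e1 := (delta_mx 0 1 : V).

(** In the plane [R(a, b)] is a multiple of [R(e0, e1)] by the determinant of [a] and [b]; skewness
    in the last two arguments produces the same determinant once more. *)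
Lemma Rm_wedge i y a b : cod i y ->
  bf (G i y) (Rm i y a b b) a = (a 0 0 * b 0 1 - a 0 1 * b 0 0) ^+ 2 * bf (G i y) (Rm i y e0 e1 e1) e0.
Proof.
move=> yi.
have Rs u c : Rm i y u u c = 0.
  by apply/eqP; rewrite /Rm !subrr addr0.
have RDr u v v' c : Rm i y u (v + v') c = Rm i y u v c + Rm i y u v' c.
  by rewrite RmN RmDl // opprD -!RmN.
have RZr u (r : R) v c : Rm i y u (r *: v) c = r *: Rm i y u v c.
  by rewrite RmN RmZl // -scalerN -RmN.
have W c : Rm i y a b c = (a 0 0 * b 0 1 - a 0 1 * b 0 0) *: Rm i y e0 e1 c.
  rewrite [in LHS](row2_delta a) [in LHS](row2_delta b) RmDl // !RmZl // !RDr !RZr !Rs.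
  by rewrite (RmN i y e1 e0); apply/rowP => k; rewrite !mxE; ring.
rewrite W [in Rm _ _ _ _ b](row2_delta b) [X in bf _ _ X](row2_delta a) RmDr // !RmZr //.
rewrite bfZl bfDl !bfZl !bfDr !bfZr (Rm_skew _ _ e0 yi) (Rm_skew _ _ e1 yi).
by rewrite (Rm_skew2 e0 e1 e0 e1 yi); ring.
Qed.

Lemma gram_wedge (A : 'M[R]_2) a b : A^T = A ->
  bf A a a * bf A b b - bf A a b ^+ 2 = (a 0 0 * b 0 1 - a 0 1 * b 0 0) ^+ 2 * gdet A.
Proof.
move=> sA; have e : A 1 0 = A 0 1 by rewrite -{1}sA mxE.
by rewrite !bfE /gdet e; ring.
Qed.

Lemma riemannE i y (l a b c : 'I_2) : cod i y ->
  riemann g i y l a b c = Rm i y (delta_mx 0 a) (delta_mx 0 b) (delta_mx 0 c) 0 l.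
Proof.
move=> yi.
have chE (k m n : 'I_2) z : christoffel g i k m n z = Gam i z (delta_mx 0 m) (delta_mx 0 n) 0 k.
  by rewrite -GamE christoffel_vec_coord bf_delta mxE.
have dE (d k m n : 'I_2) : 'D_(delta_mx 0 d : V) (christoffel g i k m n : V -> R) y =
    DGam i y (delta_mx 0 d) (delta_mx 0 m) (delta_mx 0 n) 0 k.
  have [_ <-] := is_derive_coord 0 k (is_derive_Gam (delta_mx 0 d) (delta_mx 0 m) (delta_mx 0 n) yi).
  by apply: (congr1 (fun F : V -> R => 'D_(delta_mx 0 d : V) F y)); apply/funext => z; rewrite chE.
have GG (d m n : 'I_2) : Gam i y (delta_mx 0 d) (Gam i y (delta_mx 0 m) (delta_mx 0 n)) 0 l =
    \sum_(k < 2) christoffel g i l d k y * christoffel g i k m n y.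
  rewrite {1}(row2_delta (Gam i y (delta_mx 0 m) (delta_mx 0 n))) GamDr !GamZr !mxE.
  by rewrite sum_ord2 !chE; ring.
by rewrite /riemann !dE /Rm !mxE !GG sumrB.
Qed.

(** The definition of the curvature reads it off in the chart centred at [p]. Tensoriality carries
    it to any chart, and the Gram determinant of [a] and [b] accounts for the squared area. *)
Lemma gauss_curvatureE i p a b : dom i p ->
  bf (G i (chart i p)) (Rm i (chart i p) a b b) a =
  gauss_curvature g p * (bf (G i (chart i p)) a a * bf (G i (chart i p)) b b
                         - bf (G i (chart i p)) a b ^+ 2).
Proof.
move=> pi; have pp := dom_center p; set y := chart p p.
have py : cod p y := chart_cod pp.
have dn : gdet (G p y) != 0 by rewrite gt_eqF // gdet_gt0.
have K0 : bf (G p y) (Rm p y e0 e1 e1) e0 = gauss_curvature g p * gdet (G p y).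
  rewrite /gauss_curvature -/y GmE.
  have -> : \det (G p y) = gdet (G p y).
    by rewrite det2 /gdet; congr (_ - _ * _); rewrite -{1}(Gm_sym g p y) mxE.
  rewrite divfK // bfE sum_ord2 !riemannE //.
  move: (Rm p y e0 e1 e1) => r; rewrite !mxE /=.
  by rewrite ?(mulr0n, mulr1n); ring.
have o := overlap_center pi.
have [a' ea] : exists a', a = TD p i y a'.
  exists (TD i p (chart i p) a); rewrite /y -(trans_chart p pi) TDK //; exact: overlap_chart.
have [b' eb] : exists b', b = TD p i y b'.
  exists (TD i p (chart i p) b); rewrite /y -(trans_chart p pi) TDK //; exact: overlap_chart.
rewrite -(trans_chart i pp) -/y ea eb Rm_trans // -!gram_trans //.
by rewrite Rm_wedge // K0 gram_wedge ?Gm_sym //; ring.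
Qed.

End Connection.

(** * Convergence of vectors and forms along a filter *)

Section Limits.
Context {R : realType}.
Local Notation V := 'rV[R]_2.

Lemma cvg_coord (T : Type) (F : set_system T) {FF : Filter F} m n (M : T -> 'M[R]_(m, n)) (L : 'M[R]_(m, n)) i j :
  M @ F --> L -> (fun t => M t i j) @ F --> L i j.
Proof.
move=> cM; apply: (@continuous_cvg _ _ _ F FF M (fun A : 'M[R]_(m, n) => A i j)) cM.
exact: coord_continuous.
Qed.

Lemma cvg_mx (T : Type) (F : set_system T) {FF : Filter F} m n (M : T -> 'M[R]_(m, n)) (L : 'M[R]_(m, n)) :
  (forall i j, (fun t => M t i j) @ F --> L i j) -> M @ F --> L.
Proof.
move=> cM; apply/cvgrPdist_le => e e0.
have : \forall y \near F, forall i j, `|L i j - M y i j| <= e.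
  apply: filter_forall => i; apply: filter_forall => j.
  by have /cvgrPdist_le/(_ e e0) := cM i j.
apply: filterS => y Hy; rewrite [leLHS]/Num.Def.normr/= mx_normrE.
by apply: bigmax_le; [exact: ltW | move=> [i j] _ /=; rewrite !mxE].
Qed.

Lemma cvg_bf (T : Type) (F : set_system T) {FF : Filter F} (A : T -> 'M[R]_2) (u v : T -> V)
    (A0 : 'M[R]_2) (u0 v0 : V) :
  A @ F --> A0 -> u @ F --> u0 -> v @ F --> v0 ->
  (fun t => bf (A t) (u t) (v t)) @ F --> bf A0 u0 v0.
Proof.
move=> cA cu cv; rewrite bfE (_ : (fun t => _) = (fun t => u t 0 0 * A t 0 0 * v t 0 0
   + u t 0 0 * A t 0 1 * v t 0 1 + u t 0 1 * A t 1 0 * v t 0 0 + u t 0 1 * A t 1 1 * v t 0 1)).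
  have M3 i j : (fun t => u t 0 i * A t i j * v t 0 j) @ F --> u0 0 i * A0 i j * v0 0 j.
    by apply: cvgM; [apply: cvgM|]; exact: cvg_coord.
  by apply: cvgD (M3 1 1); apply: cvgD (M3 1 0); apply: cvgD (M3 0 0) (M3 0 1).
by apply/funext => t; rewrite bfE.
Qed.

Lemma cvg_row2_comb (T : Type) (F : set_system T) {FF : Filter F} (v : T -> V) (E : 'I_2 -> T -> V)
    (v0 : V) (E0 : 'I_2 -> V) :
  v @ F --> v0 -> (forall k, E k @ F --> E0 k) ->
  (fun t => v t 0 0 *: E 0 t + v t 0 1 *: E 1 t) @ F --> v0 0 0 *: E0 0 + v0 0 1 *: E0 1.
Proof. by move=> cv cE; apply: cvgD; apply: cvgZ => //; exact: cvg_coord. Qed.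

End Limits.

(** * Uniform bounds near a point of a chart *)

Section LocalBounds.
Context {R : realType} {M : surface R} (g : riemannian M).
Local Notation V := 'rV[R]_2.
Implicit Types (i j : M) (y v a b : V).
Local Notation G := (Gm g).
Local Notation Gam := (Gam g).

Lemma cvg_TD (T : Type) (F : set_system T) {FF : Filter F} i j (y v : T -> V) (y0 v0 : V) :
  overlap i j y0 -> y @ F --> y0 -> v @ F --> v0 ->
  (fun t => TD i j (y t) (v t)) @ F --> TD i j y0 v0.
Proof.
move=> o cy cv; have oo := @overlap_open R M i j.
have cT (k : 'I_2) : (fun t => TD i j (y t) (delta_mx 0 k)) @ F --> TD i j y0 (delta_mx 0 k).
  apply: (@cvg_comp _ _ _ y (fun z => TD i j z (delta_mx 0 k)) _ _ _ cy).
  exact: (Ck_continuous (@TD_Ck R M 0 i j (delta_mx 0 k)) o).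
have near_o : \forall t \near F, overlap i j (y t) by apply: cy; exact: open_nbhs_nbhs.
have H := @cvg_row2_comb R T F FF v (fun k t => TD i j (y t) (delta_mx 0 k)) v0 _ cv cT.
move: H; rewrite -!TDZ // -TDD // -row2_delta.
apply: cvg_trans; apply: near_eq_cvg; apply: filterS near_o => t ot.
by rewrite -!TDZ // -TDD // -row2_delta.
Qed.

Lemma cvg_Gm (T : Type) (F : set_system T) {FF : Filter F} i (y : T -> V) (y0 : V) :
  cod i y0 -> y @ F --> y0 -> (fun t => G i (y t)) @ F --> G i y0.
Proof.
by move=> yi cy; apply: (cvg_comp _ _ cy); exact: (Ck_continuous (Gm_Ck g 0 i) yi).
Qed.

Lemma cvg_Gam (T : Type) (F : set_system T) {FF : Filter F} i (y a b : T -> V) (y0 a0 b0 : V) :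
  cod i y0 -> y @ F --> y0 -> a @ F --> a0 -> b @ F --> b0 ->
  (fun t => Gam i (y t) (a t) (b t)) @ F --> Gam i y0 a0 b0.
Proof.
move=> yi cy ca cb; apply: cvg_mx => l k; rewrite (ord1 l) Gam_coord.
rewrite (_ : (fun t => _) = fun t =>
   bf (\matrix_(m, n) Gam i (y t) (delta_mx 0 m) (delta_mx 0 n) 0 k) (a t) (b t)).
  apply: cvg_bf ca cb; apply: cvg_mx => m n; rewrite mxE.
  rewrite (_ : (fun t => _) = fun t => Gam i (y t) (delta_mx 0 m) (delta_mx 0 n) 0 k).
    have H : (fun t => Gam i (y t) (delta_mx 0 m) (delta_mx 0 n)) @ F
        --> Gam i y0 (delta_mx 0 m) (delta_mx 0 n).
      apply: (@cvg_comp _ _ _ y (fun z => Gam i z (delta_mx 0 m) (delta_mx 0 n)) _ _ _ cy).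
      exact: (Ck_continuous (@Gam_Ck R M g 0 i _ _) yi).
    exact: cvg_coord H.
  by apply/funext => t; rewrite mxE.
by apply/funext => t; rewrite Gam_coord.
Qed.

Lemma cvg_normP (T : Type) (F : set_system T) {FF : Filter F} n (y : T -> 'rV[R]_n) (y0 : 'rV[R]_n) : y @ F --> y0 <->
  forall e, 0 < e -> \forall t \near F, `|y t - y0| < e.
Proof.
split=> [/cvgrPdist_lt H e e0|H]; first by apply: filterS (H e e0) => t; rewrite distrC.
by apply/cvgrPdist_lt => e e0; apply: filterS (H e e0) => t; rewrite distrC.
Qed.

(** On the compact unit sphere the form at [y0] has a positive minimum [m]. Half of it survives when
    the matrix moves by less than [m / 8], because [bf_norm_le] costs a factor 4. *)
Lemma gram_lower i y0 : cod i y0 -> exists r l : R, [/\ 0 < r, 0 < l &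
  forall y, `|y - y0| < r -> cod i y /\ forall v, l * `|v| ^+ 2 <= bf (G i y) v v].
Proof.
move=> yi.
pose S : set V := [set v | `|v| = 1].
have cS : compact S.
  apply: (subclosed_compact _ (@compact_norm_ball R 0 1 ltr01)).
    by apply: (@closed_comp _ _ (fun v : V => `|v|) [set 1]) => [v _|]; [exact: norm_continuous|exact: closed_eq].
  by move=> v /= vS; rewrite subr0 vS.
have cf : {within S, continuous (fun v => bf (G i y0) v v)}.
  apply: within_continuous_in => v _.
  by apply: (@cvg_bf R V (nbhs v) _ (fun=> G i y0) id id); [exact: cvg_cst|exact: cvg_id|exact: cvg_id].
have S0 : S !=set0.
  exists (row2 1 0); apply/eqP; rewrite norm_row2 row2_0 row2_1 normr1 normr0; apply/eqP.
  by rewrite max_l // ler01.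
have [v0 /[!inE] Sv0 min0] := compact_EVT_min S0 cS cf.
pose m := bf (G i y0) v0 v0.
have v0n0 : v0 != 0 by apply/eqP => e; move: Sv0; rewrite /S /= e normr0 => /eqP; rewrite eq_sym oner_eq0.
have m0 : 0 < m by exact: Gm_gt0.
have low v : m * `|v| ^+ 2 <= bf (G i y0) v v.
  have [->|vn0] := eqVneq v 0; first by rewrite normr0 expr0n /= mulr0 bf0l.
  have nv : 0 < `|v| by rewrite normr_gt0.
  have Sn : S (`|v|^-1 *: v) by rewrite /S /= normrZ normfV normr_id mulVf // gt_eqF.
  have := min0 (`|v|^-1 *: v); rewrite inE => /(_ Sn).
  rewrite bfZl bfZr mulrA -expr2 -/m => H.
  by rewrite mulrC -ler_pdivlMl ?exprn_gt0 // -exprVn.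
have [r1 r10 H1] := open_normP (@cod_open _ M i) yi.
have e0 : 0 < m / 8 by rewrite divr_gt0.
have [r2 r20 H2] := (continuous_forP _ _).1 (Ck_continuous (Gm_Ck g 0 i) yi) _ e0.
exists (Num.min r1 r2), (m / 2); split; [by rewrite lt_min r10|by rewrite divr_gt0|].
move=> y; rewrite lt_min => /andP[/H1 yc /H2 yG]; split=> // v.
have := bf_norm_le (G i y - G i y0) v v; rewrite bfBm => B.
have n2 : `|G i y - G i y0| * `|v| ^+ 2 <= m / 8 * `|v| ^+ 2.
  by rewrite ler_wpM2r ?sqr_ge0 // ltW.
have := low v; move: B n2; rewrite -!mulrA -expr2.
move: (bf _ _ _) (bf _ _ _) (`|G i y - G i y0|) (`|v| ^+ 2) => p q s w.
by clear; rewrite ler_norml => /andP[B1 B2] n2 lo; lra.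
Qed.

Lemma gram_upper i y0 : cod i y0 -> exists r L : R, [/\ 0 < r, 0 < L &
  forall y, `|y - y0| < r -> cod i y /\ forall u v, `|bf (G i y) u v| <= L * `|u| * `|v|].
Proof.
move=> yi; have [r1 r10 H1] := open_normP (@cod_open _ M i) yi.
have [r2 r20 H2] := (continuous_forP _ _).1 (Ck_continuous (Gm_Ck g 0 i) yi) _ ltr01.
exists (Num.min r1 r2), (4 * (`|G i y0| + 1)); split; [by rewrite lt_min r10|by rewrite mulr_gt0 // ltr_wpDl|].
move=> y; rewrite lt_min => /andP[/H1 yc /H2 yG]; split=> // u v.
apply: le_trans (bf_norm_le _ _ _) _; rewrite -!mulrA ler_wpM2l // ler_wpM2r ?mulr_ge0 //.
by rewrite addrC -lerBlDr (le_trans (lerB_dist _ _)) // ltW.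
Qed.

Lemma uniform_I2 (P : 'I_2 -> R -> R -> Prop) :
  (forall k r K r' K', r' <= r -> K <= K' -> P k r K -> P k r' K') ->
  (forall k, exists r K : R, [/\ 0 < r, 0 <= K & P k r K]) ->
  exists r K : R, [/\ 0 < r, 0 <= K & forall k, P k r K].
Proof.
move=> Pm H; have [r0 [K0 [r00 K00 P0]]] := H 0; have [r1 [K1 [r10 K10 P1]]] := H 1.
exists (Num.min r0 r1), (Num.max K0 K1); split; [by rewrite lt_min r00|by rewrite le_max K00|].
move=> k; have [->|->] := ord2P k; [apply: Pm P0|apply: Pm P1].
all: by rewrite ?ge_min ?le_max lexx ?orbT.
Qed.

Lemma Gam_bounds i y0 : cod i y0 -> exists r K : R, [/\ 0 < r, 0 < K &
  forall y z a b, `|y - y0| < r -> `|z - y0| < r ->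
   [/\ cod i y, `|Gam i y a b| <= K * `|a| * `|b|
     & `|Gam i y a b - Gam i z a b| <= K * `|y - z| * `|a| * `|b|]].
Proof.
move=> yi; have oc := @cod_open _ M i.
pose f (m n k : 'I_2) y := Gam i y (delta_mx 0 m) (delta_mx 0 n) 0 k.
have Cf m n k : Ck 1 (cod i) (f m n k) by apply: Ck_coord => //; exact: Gam_Ck.
have B m n k : exists r K : R, [/\ 0 < r, 0 <= K & forall y z, `|y - y0| < r -> `|z - y0| < r ->
    [/\ cod i y, `|f m n k y| <= K & `|f m n k y - f m n k z| <= K * `|y - z|]].
  have [r1 [K1 [r10 K10 H1]]] := Ck_bound1 oc yi (Cf m n k).
  have lip y z : `|y - y0| < r1 -> `|z - y0| < r1 -> `|f m n k y - f m n k z| <= K1 * `|y - z|.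
    move=> yr zr; have [|t /andP[t0 t1]] := mean_value_line (f := f m n k) (x := z) (v := y - z).
      by move=> t t01; have [+ _] := H1 _ 0 (seg_ball yr zr t01); exact: (Ck_differentiable (Cf m n k)).
    have -> : z + (y - z) = y by rewrite addrC subrK.
    move=> ->; have t01 : 0 <= t <= 1 by rewrite !ltW.
    by have [_] := H1 _ (y - z) (seg_ball yr zr t01).
  exists r1, (`|f m n k y0| + K1 * r1 + K1).
  have K1r : 0 <= K1 * r1 by rewrite mulr_ge0 // ltW.
  split=> //; first by rewrite !addr_ge0.
  move=> y z yr zr; have [yc _] := H1 y 0 yr; split=> //.
    have y0r : `|y0 - y0| < r1 by rewrite subrr normr0.
    have h1 := lip y y0 yr y0r; have h2 := lerB_dist (f m n k y) (f m n k y0).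
    have h3 : K1 * `|y - y0| <= K1 * r1 by rewrite ler_wpM2l // ltW.
    by move: (f m n k) h1 h2 h3 => F h1 h2 h3; clear -h1 h2 h3 K10; lra.
  apply: le_trans (lip y z yr zr) _; rewrite ler_wpM2r // lerDr addr_ge0 //.
pose P (m n k : 'I_2) (r K : R) := forall y z, `|y - y0| < r -> `|z - y0| < r ->
  [/\ cod i y, `|f m n k y| <= K & `|f m n k y - f m n k z| <= K * `|y - z|].
have Pm m n k (r K r' K' : R) : r' <= r -> K <= K' -> P m n k r K -> P m n k r' K'.
  move=> rr KK H y z yr zr; have [h1 h2 h3] := H y z (lt_le_trans yr rr) (lt_le_trans zr rr).
  by split=> //; [exact: le_trans KK|apply: le_trans h3 _; rewrite ler_wpM2r].
have [r [K [r0 K0 PK]]] : exists r K : R, [/\ 0 < r, 0 <= K & forall m n k, P m n k r K].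
  apply: (@uniform_I2 (fun m r K => forall n k, P m n k r K)) => [m r K r' K' ? ? H n k|m].
    exact: Pm (H n k).
  apply: (@uniform_I2 (fun n r K => forall k, P m n k r K)) => [n r K r' K' ? ? H k|n].
    exact: Pm (H k).
  by apply: (@uniform_I2 (P m n)) => [k|k]; [exact: Pm|exact: B].
have tab (e : R) (A : 'M[R]_2) a b : (forall m n, `|A m n| <= e) -> `|bf A a b| <= 4 * e * `|a| * `|b|.
  move=> eA; apply: le_trans (bf_norm_le _ _ _) _; rewrite !ler_wpM2r // ler_wpM2l //.
  rewrite [leLHS]/Num.Def.normr/= mx_normrE; apply: bigmax_le => [|[m n] _]; last exact: eA.
  by rewrite (le_trans _ (eA 0 0)).
exists r, (4 * K + 1); split=> // [|y z a b yr zr]; first by rewrite ltr_wpDl // mulr_ge0.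
have K1 : 4 * K <= 4 * K + 1 by rewrite lerDl.
have [c _ _] := PK 0 0 0 y z yr zr; split=> //.
  have : `|Gam i y a b| <= 4 * K * `|a| * `|b|.
    have H k : `|Gam i y a b 0 k| <= 4 * K * `|a| * `|b|.
      by rewrite Gam_coord; apply: (tab K) => m n; rewrite mxE; have [] := PK m n k y z yr zr.
    by apply: norm_row2_le; exact: H.
  by move=> /le_trans; apply; rewrite !ler_wpM2r.
have : `|Gam i y a b - Gam i z a b| <= 4 * (K * `|y - z|) * `|a| * `|b|.
  have H k : `|(Gam i y a b - Gam i z a b) 0 k| <= 4 * (K * `|y - z|) * `|a| * `|b|.
    rewrite mxE [X in _ + X]mxE !Gam_coord -bfBm; apply: (tab (K * `|y - z|)) => m n.
    by rewrite !mxE; have [] := PK m n k y z yr zr.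
  by apply: norm_row2_le; exact: H.
by move=> /le_trans; apply; rewrite !(mulrA 4) !ler_wpM2r.
Qed.

End LocalBounds.

(** * Curves of class C1 and their lengths *)

Section CurvesC1.
Context {R : realType} {M : surface R} (g : riemannian M).
Local Notation V := 'rV[R]_2.
Implicit Types (i p q : M) (y : V) (A B : set R) (c : R -> M).

Definition dchart i c (t : R) : V := 'D_1 (chart i \o c) t.
Definition speed c (t : R) : R := norm g (c t) (velocity c t).

Lemma C1_continuous k A c t : curve_Ck k A c -> A t -> {for t, continuous c}.
Proof. by move=> [H _]; exact: H. Qed.

Lemma C1_derive k A c t i : curve_Ck k.+1 A c -> A t -> dom i (c t) ->
  is_derive t 1 (chart i \o c) (dchart i c t).
Proof.
move=> [_ H] At ci; have [d _] := H i; apply: is_derive_dir; exact: d.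
Qed.

Lemma C1_dchart_continuous k A c t i : curve_Ck k.+1 A c -> A t -> dom i (c t) ->
  {for t, continuous (dchart i c)}.
Proof.
move=> [_ H] At ci; have [_ /(_ 1) d] := H i.
by apply: (Ck_continuous d).
Qed.

(** Although [curve_Ck] quantifies over all charts, one chart around each time is enough: the others
    are reached by a transition map, whose derivative is continuous. *)
Lemma C1_intro A c : open A -> (forall t, A t -> {for t, continuous c}) ->
  (forall t, A t -> exists i, [/\ dom i (c t), \forall s \near t, derivable (chart i \o c) s 1
     & {for t, continuous (dchart i c)}]) -> curve_Ck 1 A c.
Proof.
move=> oA cc H; split=> // j.
have near_dj t : A t -> dom j (c t) -> \forall s \near t, A s /\ dom j (c s).
  move=> At cj; have h1 : \forall s \near t, A s by exact: open_nbhs_nbhs.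
  by have h2 := near_dom (cc t At) cj; apply: filterS2 h1 h2.
have key t : A t -> dom j (c t) -> exists i, [/\ dom i (c t),
    {for t, continuous (dchart i c)} & \forall s \near t,
    is_derive (s : R) 1 (chart j \o c) (TD i j (chart i (c s)) (dchart i c s))].
  move=> At cj; have [i [ci di cdi]] := H t At; exists i; split=> //.
  have h1 := near_dj t At cj; have h2 := near_dom (cc t At) ci.
  apply: filterS3 h1 h2 di => s [As cjs] cis ds.
  exact: (is_derive_chart (cc s As) cis cjs (derivableP ds)).
have dj t : A t -> dom j (c t) -> differentiable (chart j \o c) t.
  move=> At cj; have [i [_ _ /nbhs_singleton[d _]]] := key t At cj.
  exact/derivable1_diffP.
split=> [t [At cj]|v t [At cj]]; first exact: dj.
have [i [ci cdi nd]] := key t At cj.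
have o : overlap i j (chart i (c t)) by exact: overlap_chart.
have cu : chart i (c s) @[s --> t] --> chart i (c t).
  exact: (@continuous_comp _ _ _ c (chart i) t (cc t At) (chart_continuous ci)).
have C : TD i j (chart i (c s)) (dchart i c s) @[s --> t] --> TD i j (chart i (c t)) (dchart i c t).
  exact: cvg_TD.
have E : \forall s \near t, v *: TD i j (chart i (c s)) (dchart i c s) = 'D_v (chart j \o c) s.
  have h1 := near_dj t At cj; apply: filterS2 h1 nd => s [As cjs] [_ <-].
  by rewrite (derivable1_real v (dj s As cjs)).
have C2 : {for t, continuous (fun s => v *: TD i j (chart i (c s)) (dchart i c s))}.
  exact: (cvgZ (cvg_cst v) C).
exact: (near_eq_continuous_for E C2).
Qed.

Lemma speedE c t i u : {for t, continuous c} -> dom i (c t) ->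
  is_derive t 1 (chart i \o c) u -> speed c t = Num.sqrt (bf (Gm g i (chart i (c t))) u u).
Proof. by move=> cc ci du; rewrite /speed /norm (inner_chart _ _ _ ci) (cmp_velocity cc ci du). Qed.

Lemma speed_ge0 c t : 0 <= speed c t.
Proof. exact: sqrtr_ge0. Qed.

Lemma speed_continuous k A c t : open A -> curve_Ck k.+1 A c -> A t -> {for t, continuous (speed c)}.
Proof.
move=> oA cA At; have cc s : A s -> {for s, continuous c} by exact: C1_continuous cA.
have ci := dom_center (c t); set i := c t in ci.
have cu : chart i (c s) @[s --> t] --> chart i (c t).
  exact: (@continuous_comp _ _ _ c (chart i) t (cc t At) (chart_continuous ci)).
have cd : dchart i c s @[s --> t] --> dchart i c t by exact: (C1_dchart_continuous cA At ci).
have yc : cod i (chart i (c t)) by exact: chart_cod.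
have C : bf (Gm g i (chart i (c s))) (dchart i c s) (dchart i c s) @[s --> t] -->
    bf (Gm g i (chart i (c t))) (dchart i c t) (dchart i c t).
  by apply: cvg_bf => //; exact: cvg_Gm.
have h1 : \forall s \near t, A s by exact: open_nbhs_nbhs.
have h2 := near_dom (cc t At) ci.
have E : \forall s \near t, (Num.sqrt \o (fun s => bf (Gm g i (chart i (c s))) (dchart i c s) (dchart i c s))) s = speed c s.
  apply: filterS2 h1 h2 => s As cis /=; exact: esym (speedE (cc s As) cis (C1_derive cA As cis)).
apply: near_eq_continuous_for E _.
by apply: (@continuous_comp _ _ _ _ Num.sqrt t C); exact: sqrt_continuous.
Qed.

Lemma C1_reparam A B c (f df : R -> R) : open A -> open B -> curve_Ck 1 A c ->
  (forall t : R, B t -> [/\ A (f t), is_derive t 1 f (df t) & {for t, continuous df}]) ->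
  [/\ curve_Ck 1 B (c \o f), forall t, B t -> speed (c \o f) t = `|df t| * speed c (f t)
    & forall t i, B t -> dom i (c (f t)) -> dchart i (c \o f) t = df t *: dchart i c (f t)].
Proof.
move=> oA oB cA H.
have cf t : B t -> {for t, continuous f} by move=> /H[_ d _]; exact: is_derive_continuous d.
have ccf t : B t -> {for t, continuous (c \o f)}.
  move=> Bt; apply: continuous_comp; [exact: cf|]; apply: C1_continuous cA _.
  by have [] := H t Bt.
have D t i : B t -> dom i (c (f t)) -> is_derive t 1 (chart i \o (c \o f)) (df t *: dchart i c (f t)).
  move=> Bt ci; have [Af d _] := H t Bt.
  exact: is_derive_time d (C1_derive cA Af ci).
have nearBd t i : B t -> dom i (c (f t)) -> \forall s \near t, B s /\ dom i (c (f s)).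
  move=> Bt ci; have h1 : \forall s \near t, B s by exact: open_nbhs_nbhs.
  by have h2 := near_dom (ccf t Bt) ci; apply: filterS2 h1 h2.
split; last first.
- by move=> t i Bt ci; have [_] := D t i Bt ci.
- move=> t Bt; have ci := dom_center (c (f t)); have [Af d _] := H t Bt.
  rewrite (speedE (ccf t Bt) ci (D t _ Bt ci)).
  rewrite (speedE (C1_continuous cA Af) ci (C1_derive cA Af ci)).
  by rewrite bfZl bfZr mulrA -expr2 sqrtrM ?sqr_ge0 // sqrtr_sqr.
- apply: C1_intro => // t Bt; have ci := dom_center (c (f t)); exists (c (f t)); split=> //.
    by apply: filterS (nearBd t _ Bt ci) => s [Bs cis]; case: (D s _ Bs cis).
  have [Af d cdf] := H t Bt.
  have E : \forall s \near t, df s *: dchart (c (f t)) c (f s) = dchart (c (f t)) (c \o f) s.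
    by apply: filterS (nearBd t _ Bt ci) => s [Bs cis]; case: (D s _ Bs cis) => _ <-.
  apply: near_eq_continuous_for E _; apply: cvgZ => //.
  apply: (@continuous_comp _ _ _ f (dchart (c (f t)) c) t (cf t Bt)).
  exact: C1_dchart_continuous cA Af ci.
Qed.

Lemma C1_chart_curve A i (y dy : R -> V) : open A ->
  (forall t : R, A t -> [/\ cod i (y t), is_derive t 1 y (dy t) & {for t, continuous dy}]) ->
  curve_Ck 1 A (param i \o y) /\
  forall t, A t -> speed (param i \o y) t = Num.sqrt (bf (Gm g i (y t)) (dy t) (dy t)).
Proof.
move=> oA H.
have cc t : A t -> {for t, continuous (param i \o y)}.
  move=> /H[yi d _]; apply: continuous_comp; first exact: is_derive_continuous d.
  exact: param_continuous.
have nA t : A t -> \forall s \near t, A s by move=> At; exact: open_nbhs_nbhs.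
have D t : A t -> is_derive t 1 (chart i \o (param i \o y)) (dy t).
  move=> At; have [_ d _] := H t At; apply: near_eq_is_derive d.
  by apply: filterS (nA t At) => s /H[yi _ _]; rewrite /= paramK.
split.
  apply: C1_intro => // t At; have [yi d cd] := H t At; exists i; split.
  - exact: param_dom.
  - by apply: filterS (nA t At) => s /D[].
  - apply: near_eq_continuous_for cd; apply: filterS (nA t At) => s As.
    by have [_ <-] := D s As.
move=> t At; have [yi _ _] := H t At.
by rewrite (speedE (cc t At) (param_dom yi) (D t At)) /= paramK.
Qed.

(** For each coordinate, both [H + m u_k] and [H - m u_k] are nondecreasing, and the norm is the
    maximum of the coordinates. *)
Lemma derive_dominated (u du : R -> V) (H h : R -> R) (m a b : R) : a <= b -> 0 < m ->
  (forall t : R, a <= t <= b -> is_derive t 1 u (du t)) ->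
  (forall t : R, a <= t <= b -> is_derive t 1 H (h t)) ->
  (forall t : R, a <= t <= b -> m * `|du t| <= h t) -> m * `|u b - u a| <= H b - H a.
Proof.
move=> ab m0 Du DH Dh; rewrite -ler_pdivlMl // mulrC.
have key k : `|(u b - u a) 0 k| <= (H b - H a) / m.
  have dk t : a <= t <= b -> is_derive t 1 (fun t => u t 0 k) (du t 0 k) by move=> /Du; exact: is_derive_coord.
  have bk t : a <= t <= b -> m * `|du t 0 k| <= h t.
    by move=> /Dh; apply: le_trans; apply: ler_wpM2l; [exact: ltW|exact: coord_le_norm].
  rewrite ler_pdivlMr // mulrC -[X in X * _](gtr0_norm m0) -normrM ler_norml !mxE; apply/andP; split.
    have N := @nondecreasing_derive R _ _ a b ab (fun t tab => is_deriveD (DH t tab) (is_deriveZ m (dk t tab))).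
    have : H a + m * u a 0 k <= H b + m * u b 0 k; last by lra.
    apply: N => t tab; have := bk t tab; rewrite -[X in X * _](gtr0_norm m0) -normrM ler_norml => /andP[h1 _].
    by rewrite /GRing.scale /=; lra.
  have N := @nondecreasing_derive R _ _ a b ab (fun t tab => is_deriveB (DH t tab) (is_deriveZ m (dk t tab))).
  have : H a - m * u a 0 k <= H b - m * u b 0 k; last by lra.
  apply: N => t tab; have := bk t tab; rewrite -[X in X * _](gtr0_norm m0) -normrM ler_norml => /andP[_ h1].
  by rewrite /GRing.scale /=; lra.
by apply: norm_row2_le; exact: key.
Qed.

Lemma near_speed c c' t : (\forall s \near t, c s = c' s) -> speed c t = speed c' t.
Proof.
move=> E; have e := nbhs_singleton E.
rewrite /speed /velocity e !derive1E; congr (norm g _ _); apply: near_eq_derive.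
by apply: filterS E => s /= ->.
Qed.

(** A curve of length at most [L], expressed without integrals: [h] majorises the speed and [H] is a
    primitive of [h]. Any majorant with an explicit primitive will do, which is how all upper bounds
    for the distance are obtained. *)
Definition reach p q (L : R) := exists (c : R -> M) (e : R) (H h : R -> R),
  [/\ 0 < e /\ curve_Ck 1 `]- e, 1 + e[ c, c 0 = p, c 1 = q,
    forall t : R, 0 <= t <= 1 -> is_derive t 1 H (h t) /\ speed c t <= h t & H 1 - H 0 <= L].

Lemma reach_le p q L L' : reach p q L -> L <= L' -> reach p q L'.
Proof.
by move=> [c [e [H [h [? ? ? ? HL]]]]] LL; exists c, e, H, h; split=> //; exact: le_trans LL.
Qed.

Lemma reach_sub A c (s t : R) (H h : R -> R) : open A -> curve_Ck 1 A c -> s <= t ->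
  (forall x : R, s <= x <= t -> A x) ->
  (forall x : R, s <= x <= t -> is_derive x 1 H (h x) /\ speed c x <= h x) ->
  reach (c s) (c t) (H t - H s).
Proof.
move=> oA cA st sA sH.
pose f (x : R) := s + (t - s) * x.
have df (x : R) : is_derive x 1 f (t - s).
  by rewrite /f; apply: is_derive_eq; rewrite /GRing.scale /=; ring.
have cf : continuous f by move=> x; exact: is_derive_continuous (df x).
pose B := f @^-1` A.
have oB : open B by apply: open_comp => // x _; exact: cf.
have B01 x : 0 <= x <= 1 -> B x /\ s <= f x <= t.
  move=> x01; have fx : s <= f x <= t by rewrite /f; move: x01; clear -st; nra.
  by split=> //; exact: sA.
have [|C1 S1 _] := @C1_reparam A B c f (fun=> t - s) oA oB cA.
  by move=> x Bx; split=> //; exact: cst_continuous.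
have [r0 r00 H0] : exists2 r, 0 < r & forall x, `|x - 0| < r -> B x.
  by apply: open_normP => //; have [] := B01 0 _; rewrite // lexx ler01.
have [r1 r10 H1] : exists2 r, 0 < r & forall x, `|x - 1| < r -> B x.
  by apply: open_normP => //; have [] := B01 1 _; rewrite // lexx ler01.
have e0 : 0 < Num.min r0 r1 by rewrite lt_min r00.
exists (c \o f), (Num.min r0 r1), (H \o f), (fun x => (t - s) * h (f x)); split.
- split=> //; have sub : `]- Num.min r0 r1, 1 + Num.min r0 r1[ `<=` B.
    move=> x /=; rewrite in_itv /= => /andP[x1 x2].
    have [x0|x0] := ltP x 0.
      by apply: H0; rewrite subr0 ltr0_norm // ltrNl (le_lt_trans _ x1) // lerN2 ge_min lexx.
    have [x1'|x1'] := leP x 1; first by have [] := B01 x _; rewrite // x0.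
    by apply: H1; rewrite gtr0_norm ?subr_gt0 // ltrBlDl (lt_le_trans x2) // lerD2l ge_min lexx orbT.
  have [c0 C] := C1; split=> [x /sub|i]; first exact: c0.
  by apply: Ck_sub (C i) => x [/sub].
- by rewrite /f /= mulr0 addr0.
- by rewrite /f /= mulr1 addrC subrK.
- move=> x x01; have [Bx sx] := B01 x x01; have [dH hH] := sH _ sx; split.
    exact: is_derive_time (df x) dH.
  by rewrite S1 // ger0_norm ?subr_ge0 // ler_wpM2l // subr_ge0.
- by rewrite /f /= mulr0 mulr1 addr0 [s + _]addrC subrK.
Qed.

Lemma is_derive0P (W : normedModType R) (f : R -> W) (m : R) : is_derive m 1 f 0 <->
  forall e, 0 < e -> \forall s \near m, `|f s - f m| <= e * `|s - m|.
Proof.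
split=> [d e e0|H].
  have D : differentiable f m by apply/derivable1_diffP; case: d.
  have E h : 'D_h f m = 0 by rewrite derivable1_real //; have [_ ->] := d; rewrite scaler0.
  rewrite (near_shift 0 m); apply: filterS (diff_eps D e0) => h /=.
  by rewrite E subr0 /= subr0 addrK.
have D : differentiable f m.
  have cL : continuous ('d (cst (0 : W)) m) by apply: diff_continuous; exact: differentiable_cst.
  apply: (@differentiable_eps R R W f m _ cL) => e e0.
  have := H e e0; rewrite (near_shift 0 m); apply: filterS => h /=.
  by rewrite diff_cst subr0 /= subr0 addrK.
apply: DeriveDef; first by apply/derivable1_diffP.
apply/eqP; rewrite -normr_le0; apply/ler_addgt0Pl => e e0; rewrite addr0.
have e2 : 0 < e / 2 by rewrite divr_gt0.
have H1 := H _ e2; rewrite (near_shift 0 m) in H1; have H2 := diff_eps D e2.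
have [r r0 Hr] := (near_normP _ _).1 (filterI H1 H2).
have h0 : 0 < r / 2 by rewrite divr_gt0.
have [] := Hr (r / 2) _; first by rewrite subr0 gtr0_norm //; lra.
move: (r / 2) h0 => h h0 /= h1 h2; rewrite subr0 /= addrK in h1.
rewrite derivable1_real // in h2.
rewrite -(ler_pM2l h0) -[X in X * _](gtr0_norm h0) -normrZ.
have := ler_normB (f (h + m) - f m) (f (h + m) - f m - h *: 'D_1 f m).
rewrite opprB addrC subrK => /le_trans; apply.
by rewrite (gtr0_norm h0) in h1 h2; move: h1 h2; move: (`|_|) (`|_|) => p q; clear; lra.
Qed.

Lemma C1_glue A A1 A2 c1 c2 c : open A1 -> open A2 -> curve_Ck 1 A1 c1 -> curve_Ck 1 A2 c2 ->
  (forall t, A1 t -> c t = c1 t) -> (forall t, A2 t -> c t = c2 t) -> A `<=` A1 `|` A2 ->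
  open A -> curve_Ck 1 A c.
Proof.
move=> oA1 oA2 C1 C2 E1 E2 AA oA.
have loc B b t : open B -> curve_Ck 1 B b -> (forall t, B t -> c t = b t) -> B t ->
    {for t, continuous c} /\ exists i, [/\ dom i (c t), \forall s \near t, derivable (chart i \o c) s 1
     & {for t, continuous (dchart i c)}].
  move=> oB Cb E Bt; have nB := open_near oB Bt; have cb := C1_continuous Cb Bt.
  have nE s : B s -> \forall x \near s, b x = c x by move=> Bs; apply: open_near oB Bs _ => x /E.
  split; first exact: near_eq_continuous_for (nE t Bt) cb.
  have ci := dom_center (b t); exists (b t); split; first by rewrite E.
    have near_B : \forall s \near t, B s by exact: nB.
    apply: filterS2 near_B (near_dom cb ci) => s Bs cs; have [d _] := C1_derive Cb Bs cs.
    by apply: near_eq_derivable d; apply: filterS (nE s Bs) => x /= ->.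
  apply: near_eq_continuous_for (C1_dchart_continuous Cb Bt ci); apply: nB => s Bs.
  by apply: near_eq_derive; apply: filterS (nE s Bs) => x /= ->.
by apply: C1_intro => // t /AA[At|At]; [have [] := loc _ _ _ oA1 C1 E1 At|have [] := loc _ _ _ oA2 C2 E2 At
  |have [] := loc _ _ _ oA1 C1 E1 At|have [] := loc _ _ _ oA2 C2 E2 At].
Qed.

(** Reparametrised by the smooth step, the curve moves only while [3 t] runs from [b] to [b + 1] and
    rests before and after, so that it can be concatenated with another one in class C1. *)
Lemma reach_stretch p q L (b : R) : reach p q L -> exists c (H h : R -> R) (l : R),
  let A : set R := [set t | -1 < 3 * t - b] in [/\ open A /\ curve_Ck 1 A c, l <= L,
    forall t : R, A t -> is_derive t 1 H (h t) /\ speed c t <= h t,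
    forall t, A t -> 3 * t <= b -> c t = p /\ H t = 0 & forall t, b + 1 <= 3 * t -> c t = q /\ H t = l].
Proof.
move=> [c [e [H [h [[e0 C] c0 c1 DH HL]]]]]; have [f [df [cdf Df f0 f1]]] := @smooth_step R.
have dl (t : R) : is_derive t 1 (fun t : R => 3 * t - b) 3.
  by apply: is_derive_eq; rewrite /GRing.scale /=; ring.
have cl t : {for t, continuous (fun t : R => 3 * t - b)} by exact: is_derive_continuous (dl t).
pose A : set R := [set t | -1 < 3 * t - b].
have oA : open A by apply: (@open_comp _ _ (fun t : R => 3 * t - b) [set x | -1 < x]) => [t _|]; [exact: cl|exact: open_gt].
have D (t : R) : A t -> is_derive t 1 (f \o (fun t : R => 3 * t - b)) (3 * df (3 * t - b)).
  by move=> At; apply: (is_derive_time (dl t) _); have [] := Df _ At.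
have oe : open (`]- e, 1 + e[%classic : set R) by exact: interval_open.
have in_e t : A t -> 0 <= f (3 * t - b) <= 1 by move=> At; have [] := Df _ At.
have [|K S _] := @C1_reparam _ A c (f \o (fun t : R => 3 * t - b)) (fun t => 3 * df (3 * t - b)) oe oA C.
  move=> t At; split; [|exact: D|].
    by have /andP[h0 h1] := in_e t At; rewrite /= in_itv /=; apply/andP; split; lra.
  by apply: cvgM; [exact: cvg_cst|exact: @continuous_comp _ _ _ (fun t : R => 3 * t - b) df t (cl t) (cdf _)].
exists (c \o (f \o (fun t : R => 3 * t - b))), (fun t => H (f (3 * t - b)) - H 0),
  (fun t => 3 * df (3 * t - b) * h (f (3 * t - b))), (H 1 - H 0); split=> //.
- move=> t At; have [dH hs] := DH _ (in_e t At); split; last first.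
    have [_ d0 _] := Df _ At; have k0 : 0 <= 3 * df (3 * t - b) by rewrite mulr_ge0.
    by rewrite S // ger0_norm // ler_wpM2l.
  by have := is_deriveB (is_derive_time (D t At) dH) (is_derive_cst (H 0) t 1); rewrite subr0.
- by move=> t At tb; rewrite /= f0 ?subr_le0 // subrr.
- by move=> t tb; rewrite /= f1 // lerBrDl.
Qed.

(** The first curve moves during [[0, 1/3]] and the second during [[2/3, 1]]; in between both rest
    at [q], and there they are glued. *)
Lemma reach_trans p q r L1 L2 : reach p q L1 -> reach q r L2 -> reach p r (L1 + L2).
Proof.
move=> /(@reach_stretch _ _ _ 0)[c1 [H1 [h1 [l1 [[oA1 C1] lL1 D1 s1 e1]]]]].
move=> /(@reach_stretch _ _ _ 2)[c2 [H2 [h2 [l2 [[oA2 C2] lL2 D2 s2 e2]]]]].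
pose c (t : R) := if t <= 2^-1 then c1 t else c2 t.
pose H (t : R) := if t <= 2^-1 then H1 t else H2 t + l1.
pose h (t : R) := if t <= 2^-1 then h1 t else h2 t.
pose B1 : set R := `](-3^-1), (2/3)[%classic; pose B2 : set R := `](3^-1), 2[%classic.
have BA1 t : B1 t -> -1 < 3 * t - 0 by rewrite /B1 /= in_itv /= => /andP[? ?]; lra.
have BA2 t : B2 t -> -1 < 3 * t - 2 by rewrite /B2 /= in_itv /= => /andP[? ?]; lra.
have E1 t : B1 t -> c t = c1 t /\ H t = H1 t.
  rewrite /B1 /= in_itv /= => /andP[t0 t1]; rewrite /c /H; case: leP => // th.
  by have [||-> ->] := s2 t; rewrite /=; [lra|lra|have [|-> ->] := e1 t; [lra|rewrite add0r]].
have E2 t : B2 t -> c t = c2 t /\ H t = H2 t + l1.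
  rewrite /B2 /= in_itv /= => /andP[t0 t1]; rewrite /c /H; case: leP => // th.
  by have [||-> ->] := s2 t; rewrite /=; [lra|lra|have [|-> ->] := e1 t; [lra|rewrite add0r]].
have oB1 : open B1 by exact: interval_open.
have oB2 : open B2 by exact: interval_open.
exists c, 4^-1, H, (fun t => if t <= 2^-1 then h1 t else h2 t); split.
- split; first by rewrite invr_gt0.
  apply: (C1_glue oB1 oB2 (c1 := c1) (c2 := c2)).
  + by have [k1 k2] := C1; split=> [t /BA1/k1//|i]; apply: Ck_sub (k2 i) => t [/BA1].
  + by have [k1 k2] := C2; split=> [t /BA2/k1//|i]; apply: Ck_sub (k2 i) => t [/BA2].
  + by move=> t /E1[].
  + by move=> t /E2[].
  + move=> t; rewrite /B1 /B2 /= !in_itv /= => /andP[t0 t1]; have [th|th] := leP t 2^-1; [left|right].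
      by apply/andP; split; lra.
    by apply/andP; split; lra.
  + exact: interval_open.
- by rewrite /c ifT ?invr_ge0 //; have [||] := s1 0; rewrite /= ?mulr0 ?subr0 //; lra.
- rewrite /c ifF; last by apply/negbTE; rewrite -ltNge; lra.
  by have [|-> _ //] := e2 1; lra.
- move=> t /andP[t0 t1]; have [th|th] := leP t 2^-1.
    have Bt : B1 t by rewrite /B1 /= in_itv /=; apply/andP; split; lra.
    have [d s] := D1 t (BA1 t Bt); split.
      by apply: near_eq_is_derive d; apply: open_near oB1 Bt _ => x /E1[_ ->].
    by rewrite (near_speed (c' := c1)) //; apply: open_near oB1 Bt _ => x /E1[->].
  have Bt : B2 t by rewrite /B2 /= in_itv /=; apply/andP; split; lra.
  have [d s] := D2 t (BA2 t Bt); split.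
    have := is_deriveD d (is_derive_cst l1 t 1); rewrite addr0 => d'.
    by apply: near_eq_is_derive d'; apply: open_near oB2 Bt _ => x /E2[_ ->].
  by rewrite (near_speed (c' := c2)) //; apply: open_near oB2 Bt _ => x /E2[->].
- have [|_ E] := (E2 1); first by rewrite /B2 /= in_itv /=; apply/andP; split; lra.
  have [|_ E0] := (E1 0); first by rewrite /B1 /= in_itv /=; apply/andP; split; lra.
  have [|_ h2l] := e2 1; first lra.
  by have [||_ h10] := s1 0; rewrite /= ?mulr0 ?subr0 //; lra.
Qed.

End CurvesC1.

(** * The Riemannian distance and its topology *)

Section Distance.
Context {R : realType} {M : surface R} (g : riemannian M).
Local Notation V := 'rV[R]_2.
Implicit Types (i p q : M) (y : V) (c : R -> M).
Local Notation reach := (reach g).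
Local Notation dist := (dist g).

Definition curve_from p q (l : R) := exists c : R -> M,
    [/\ exists2 e : R, 0 < e & curve_Ck 1 `]- e, 1 + e[ c,
        c 0 = p, c 1 = q & l = curve_length g 0 1 c].

Lemma distE p q : dist p q = inf [set l | curve_from p q l].
Proof. by []. Qed.

Lemma in_unit_itv (e x : R) : 0 < e -> 0 <= x <= 1 -> `]- e, 1 + e[%classic x.
Proof. by move=> e0 /andP[x0 x1]; rewrite /= in_itv /=; apply/andP; split; lra. Qed.

Lemma length_primitive c (e : R) : 0 < e -> curve_Ck 1 `]- e, 1 + e[ c ->
  exists H : R -> R, (forall t : R, 0 <= t <= 1 -> is_derive t 1 H (speed g c t)) /\
    curve_length g 0 1 c = H 1 - H 0.
Proof.
move=> e0 C; apply: primitive => // t t01.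
apply: (speed_continuous (k := 0) _ C); first exact: interval_open.
exact: in_unit_itv.
Qed.

Lemma curve_from_reach p q l : curve_from p q l -> reach p q l.
Proof.
move=> [c [[e e0 C] c0 c1 ->]]; have [H [DH ->]] := length_primitive e0 C.
by exists c, e, H, (speed g c); split=> // t t01; split=> //; exact: DH.
Qed.

Lemma reach_curve_from p q L : reach p q L -> exists2 l, curve_from p q l & l <= L.
Proof.
move=> [c [e [H [h [[e0 C] c0 c1 DH HL]]]]]; have [K [DK EK]] := length_primitive e0 C.
exists (curve_length g 0 1 c); first by exists c; split=> //; exists e.
apply: le_trans HL; rewrite EK.
have N := @nondecreasing_derive R _ _ 0 1 ler01 (fun t tab => is_deriveB (DH t tab).1 (DK t tab)).
have : (H - K) 0 <= (H - K) 1; last by rewrite !fctE; lra.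
by apply: N => t t01; rewrite subr_ge0; exact: (DH t t01).2.
Qed.

Lemma reach_ge0 p q L : reach p q L -> 0 <= L.
Proof.
move=> [c [e [H [h [[e0 C] c0 c1 DH HL]]]]]; apply: le_trans HL; rewrite subr_ge0.
apply: (@nondecreasing_derive R H h 0 1 ler01) => t t01; first exact: (DH t t01).1.
exact: le_trans (speed_ge0 g c t) (DH t t01).2.
Qed.

Lemma dist_le p q L : reach p q L -> dist p q <= L.
Proof.
move=> /reach_curve_from[l pl lL]; apply: le_trans lL; apply: ge_inf => //.
by exists 0 => k /curve_from_reach /reach_ge0.
Qed.

Lemma chart_reach i y0 : cod i y0 -> exists r K : R, [/\ 0 < r, 0 < K &
  forall y z, `|y - y0| < r -> `|z - y0| < r -> cod i y /\ reach (param i y) (param i z) (K * `|z - y|)].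
Proof.
move=> cy; have [r [L [r0 L0 H]]] := gram_upper g cy.
exists r, (Num.sqrt L); split=> //; first by rewrite sqrtr_gt0.
move=> y z yr zr; split; first by have [] := H y yr.
pose l (t : R) := y + t *: (z - y).
have dl (t : R) : is_derive t 1 l (z - y) by exact: is_derive_affine.
have lr (t : R) : 0 <= t <= 1 -> `|l t - y0| < r by move=> t01; exact: seg_ball.
pose A := l @^-1` [set w | `|w - y0| < r].
have oA : open A.
  apply: open_comp; first by move=> t _; exact: is_derive_continuous (dl t).
  by rewrite openE => w; exact: near_ball.
have [|C S] := @C1_chart_curve R M g A i l (fun=> z - y) oA.
  move=> t At; split; [by have [] := H _ At|exact: dl|exact: cst_continuous].
have lA t : 0 <= t <= 1 -> A t by exact: lr.
have dh (t : R) : is_derive t 1 (fun t => t * (Num.sqrt L * `|z - y|)) (Num.sqrt L * `|z - y|).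
  by apply: is_derive_eq; rewrite /GRing.scale /=; ring.
have := @reach_sub R M g A (param i \o l) 0 1 _ _ oA C ler01 lA _.
have l0 : l 0 = y by rewrite /l scale0r addr0.
have l1 : l 1 = z by rewrite /l scale1r addrC subrK.
rewrite /= l0 l1.
move=> /(_ (fun t => t * (Num.sqrt L * `|z - y|)) (fun=> Num.sqrt L * `|z - y|)).
rewrite mul1r mul0r subr0; apply => t t01; split; first exact: dh.
rewrite S; last exact: lA.
have [_ B] := H _ (lr t t01).
have -> : Num.sqrt L * `|z - y| = Num.sqrt (L * `|z - y| ^+ 2).
  by rewrite sqrtrM ?(ltW L0) // sqrtr_sqr ger0_norm.
apply: ler_wsqrtr; apply: le_trans (ler_norm _) _; apply: le_trans (B _ _) _.
by rewrite expr2 mulrA.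
Qed.

Lemma reach_refl p : reach p p 0.
Proof.
have ci := dom_center p; have [r [K [r0 K0 H]]] := chart_reach (chart_cod ci).
by have [||_] := H (chart p p) (chart p p); rewrite ?subrr ?normr0 // mulr0 chartK.
Qed.

Lemma near_reach p (e : R) : 0 < e -> \forall q \near p, exists L, [/\ L < e, reach p q L & reach q p L].
Proof.
move=> e0; have cp := chart_cod (dom_center p).
have [r [K [r0 K0 H]]] := chart_reach cp.
have cc := @chart_continuous _ M p p (dom_center p).
have h1 := nbhs_dom (dom_center p).
have rK : 0 < Num.min r (e / K) by rewrite lt_min r0 divr_gt0.
have h2 := near_cont cc rK.
apply: filterS2 h1 h2 => q dq; rewrite lt_min => /andP[q1 q2].
have pp : `|chart p p - chart p p| < r by rewrite subrr normr0.
exists (K * `|chart p q - chart p p|); split.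
- by rewrite mulrC -ltr_pdivlMr.
- by have [_] := H _ _ pp q1; rewrite !chartK //; exact: dom_center.
- have [_] := H _ _ q1 pp; rewrite !chartK //; last exact: dom_center.
  by rewrite -[X in K * X]normrN opprB.
Qed.

(** The points that can be reached from [p] form a set which is open and closed, because nearby
    points reach each other by segments in a chart; and [M] is connected. *)
Lemma reach_exists p q : exists L, reach p q L.
Proof.
have E : [set q | exists L, reach p q L] = [set: M].
  apply: (@surface_connected _ M).
  - by exists p, 0; exact: reach_refl.
  - exists [set q | exists L, reach p q L]; last by rewrite setTI.
    rewrite openE => x [L pL]; apply: filterS (near_reach x ltr01) => z [L' [_ xz _]].
    by exists (L + L'); exact: reach_trans pL xz.
  - exists [set q | exists L, reach p q L]; last by rewrite setTI.
    move=> x /(_ _ (near_reach x ltr01)) [z [[L pL] [L' [_ _ zx]]]].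
    by exists (L + L'); exact: reach_trans pL zx.
by have : [set: M] q by []; rewrite -E.
Qed.

Lemma dist_lt p q L : dist p q < L -> reach p q L.
Proof.
move=> dL; have hi : has_inf [set l | curve_from p q l].
  split; first by have [K /reach_curve_from[l pl _]] := reach_exists p q; exists l.
  by exists 0 => k /curve_from_reach /reach_ge0.
have e0 : 0 < L - dist p q by rewrite subr_gt0.
have [l pl] := inf_adherent e0 hi; rewrite -distE addrC subrK => lL.
exact: reach_le (curve_from_reach pl) (ltW lL).
Qed.

Lemma dist_ge0 p q : 0 <= dist p q.
Proof.
have [//|d0] := leP 0 (dist p q).
have /dist_lt /reach_ge0 : dist p q < dist p q / 2 by lra.
by lra.
Qed.

Lemma dist_refl p : dist p p = 0.
Proof. by apply/le_anti; rewrite dist_ge0 dist_le //; exact: reach_refl. Qed.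

Lemma dist_triangle p q r : dist p r <= dist p q + dist q r.
Proof.
apply/ler_addgt0Pl => e e0.
have h1 : reach p q (dist p q + e / 2) by apply: dist_lt; lra.
have h2 : reach q r (dist q r + e / 2) by apply: dist_lt; lra.
by have := dist_le (reach_trans h1 h2); lra.
Qed.

Lemma reach_sym p q L : reach p q L -> reach q p L.
Proof.
move=> [c [e [H [h [[e0 C] c0 c1 DH HL]]]]].
have oA : open (`]- e, 1 + e[%classic : set R) by exact: interval_open.
have df (t : R) : is_derive t 1 (fun t : R => 1 - t) (-1).
  by apply: is_derive_eq; rewrite /GRing.scale /=; ring.
have [|C' S _] := @C1_reparam R M g _ `]- e, 1 + e[ c (fun t => 1 - t) (fun=> -1) oA oA C.
  move=> t; rewrite /= !in_itv /= => /andP[t0 t1]; split; [by apply/andP; split; lra|exact: df|exact: cst_continuous].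
exists (c \o (fun t => 1 - t)), e, (fun t => - H (1 - t)), (fun t => h (1 - t)); split=> //.
- by rewrite /= subr0.
- by rewrite /= subrr.
- move=> t t01; have t01' : 0 <= 1 - t <= 1 by move: t01 => /andP[? ?]; apply/andP; split; lra.
  split; last first.
    rewrite S; last exact: in_unit_itv.
    by rewrite normrN1 mul1r; exact: (DH _ t01').2.
  have := is_deriveN (is_derive_time (df t) (DH _ t01').1).
  by rewrite scaleN1r opprK.
- by rewrite subrr subr0 opprK addrC.
Qed.

Lemma dist_sym p q : dist p q = dist q p.
Proof.
have H a b : dist a b <= dist b a.
  by apply/ler_addgt0Pl => e e0; apply: dist_le; apply: reach_sym; apply: dist_lt; lra.
by apply/le_anti; rewrite !H.
Qed.

Lemma near_dist p (e : R) : 0 < e -> \forall q \near p, dist p q < e.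
Proof.
move=> e0; apply: filterS (near_reach p e0) => q [L [Le pq _]].
exact: le_lt_trans (dist_le pq) Le.
Qed.

Lemma dist_diff p q p' q' : `|dist p q - dist p' q'| <= dist p p' + dist q q'.
Proof.
have h1 := dist_triangle p p' q; have h2 := dist_triangle p' q' q.
have h3 := dist_triangle p' p q'; have h4 := dist_triangle p q q'.
rewrite (dist_sym p' p) in h3; rewrite (dist_sym q' q) in h2.
by rewrite ler_norml; apply/andP; split; lra.
Qed.

(** As long as the curve stays in the coordinate ball, its speed is at least [m] times its
    coordinate speed, so leaving the ball would cost a length of at least [m * r]. The continuation
    in time is by [real_induction]. *)
Lemma stay i y0 : cod i y0 -> exists r m : R, [/\ 0 < r, 0 < m, forall y, `|y - y0| < r -> cod i y &
  forall p q L, dom i p -> `|chart i p - y0| < r -> reach p q L -> L < m * r ->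
    dom i q /\ m * `|chart i q - chart i p| <= L].
Proof.
move=> cy; have [r [l [r0 l0 H]]] := gram_lower g cy.
exists (r / 2), (Num.sqrt l); have m0 : 0 < Num.sqrt l by rewrite sqrtr_gt0.
have lm : Num.sqrt l ^+ 2 = l by rewrite sqr_sqrtr // ltW.
move: (Num.sqrt l) m0 lm => m m0 lm.
split=> //; first by rewrite divr_gt0.
  by move=> y yr; have [|//] := H y; apply: lt_trans yr _; lra.
move=> p q L dp pr pq Lm.
have L0 := reach_ge0 pq.
(* The radius [s0] stays positive even when [L] is 0, so that the closed ball of this radius falls
   under [compact_norm_ball]. *)
have [s0 [s00 Ls0 s0r]] : exists s0, [/\ 0 < s0, L / m <= s0 & s0 < r / 2].
  have : L / m < r / 2 by rewrite ltr_pdivrMr // mulrC.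
  by exists ((L / m + r / 2) / 2); have : 0 <= L / m by [rewrite divr_ge0 // ltW]; split; lra.
case: pq => c [e [Hh [h [[e0 C] c0 c1 DH HL]]]]; rewrite -c0 -c1 in dp pr *.
have cc t : 0 <= t <= 1 -> {for t, continuous c}.
  by move=> t01; apply: C1_continuous C _; exact: in_unit_itv.
have hge s : 0 <= s <= 1 -> 0 <= h s by move=> /DH[_]; exact: le_trans (speed_ge0 g c s).
have mono s t : 0 <= s -> s <= t -> t <= 1 -> Hh s <= Hh t.
  move=> sp st t1; apply: (nondecreasing_derive (df := h) st) => x /andP[x0 x1]; last by apply: hge; lra.
  by apply: (DH x _).1; lra.
pose near0 t := dom i (c t) /\ `|chart i (c t) - y0| < r.
have loc t : 0 <= t <= 1 -> near0 t -> exists2 d : R, 0 < d & forall s s', `|s - t| < d -> `|s' - t| < d ->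
    0 <= s -> s <= s' -> s' <= 1 -> dom i (c s') /\ m * `|chart i (c s') - chart i (c s)| <= Hh s' - Hh s.
  move=> t01 [dt rt]; have cu : {for t, continuous (chart i \o c)}.
    by apply: continuous_comp; [exact: cc|exact: chart_continuous].
  have rt0 : 0 < r - `|chart i (c t) - y0| by rewrite subr_gt0.
  have [d d0 Hd] := (near_normP t _).1 (filterI (near_dom (cc t t01) dt) (near_cont cu rt0)).
  exists d => // s s' sd sd' sp ss s1; split; first by have [] := Hd s' sd'.
  have K x : s <= x <= s' -> [/\ is_derive x 1 (chart i \o c) (dchart i c x), is_derive x 1 Hh (h x)
      & m * `|dchart i c x| <= h x].
    move=> /andP[x0 x1]; have x01 : 0 <= x <= 1 by lra.
    have [|dx nx] := Hd x; first by move: sd sd'; rewrite !ltr_norml => /andP[? ?] /andP[? ?]; lra.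
    have cd : is_derive x 1 (chart i \o c) (dchart i c x) by apply: (C1_derive C) => //; exact: in_unit_itv.
    split; [exact: cd|exact: (DH x x01).1|].
    apply: le_trans (DH x x01).2; rewrite (speedE g (cc x x01) dx cd).
    have [|_ B] := H (chart i (c x)).
      by have := ler_normD (chart i (c x) - chart i (c t)) (chart i (c t) - y0); rewrite addrA subrK; move: nx => /=; lra.
    have -> : m * `|dchart i c x| = Num.sqrt ((m * `|dchart i c x|) ^+ 2).
      by rewrite sqrtr_sqr ger0_norm // mulr_ge0 // ltW.
    by apply: ler_wsqrtr; rewrite exprMn lm; exact: B.
  by apply: (@derive_dominated R (chart i \o c) (dchart i c) Hh h m s s') => // x /K[].
pose P t := dom i (c t) /\ m * `|chart i (c t) - chart i (c 0)| <= Hh t - Hh 0.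
have ball t : 0 <= t <= 1 -> m * `|chart i (c t) - chart i (c 0)| <= Hh t - Hh 0 -> `|chart i (c t) - chart i (c 0)| <= s0.
  by move=> /andP[t0 t1] h'; apply: le_trans Ls0; rewrite ler_pdivlMr // mulrC (le_trans h') // (le_trans _ HL) // lerD2r mono.
have cod_ball z : `|z - chart i (c 0)| <= s0 -> cod i z /\ `|z - y0| < r.
  move=> zL; have zr : `|z - y0| < r.
    by have := ler_normD (z - chart i (c 0)) (chart i (c 0) - y0); rewrite addrA subrK; lra.
  by split=> //; have [] := H z zr.
have step s t : P s -> m * `|chart i (c t) - chart i (c s)| <= Hh t - Hh s ->
    m * `|chart i (c t) - chart i (c 0)| <= Hh t - Hh 0.
  move=> [_ h1] h2; have := ler_normD (chart i (c t) - chart i (c s)) (chart i (c s) - chart i (c 0)).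
  by rewrite addrA subrK => /(ler_wpM2l (ltW m0)); rewrite mulrDr; lra.
have [d1 l1] : P 1; last by split=> //; exact: le_trans HL.
apply: (@real_induction R P 1 ler01); last by rewrite lexx ler01.
- by split=> //; rewrite !subrr normr0 mulr0.
- move=> t /andP[t0 t1] Pt; have t01 : 0 <= t <= 1 by rewrite t0 ltW.
  have [dt lt] := Pt; have [d d0 Hd] := loc t t01 (conj dt (cod_ball _ (ball t t01 lt)).2).
  exists (d / 2); first by rewrite divr_gt0.
  move=> s /andP[ts sd] s1; have [||ds ls] := Hd t s _ _ t0 ts s1; [by rewrite subrr normr0|by rewrite ger0_norm; lra|].
  by split=> //; exact: step Pt ls.
- move=> t /andP[t0 t1] Pt; have t01 : 0 <= t <= 1 by rewrite t1 ltW.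
  (* Up to time [t] the curve runs in the image of a closed coordinate ball, which is compact, hence
     closed; so the point at time [t] has not left the chart. *)
  pose B : set V := [set z | `|z - chart i (c 0)| <= s0].
  have cB : compact (param i @` B).
    apply: continuous_compact; last exact: compact_norm_ball.
    by apply: within_continuous_in => z /cod_ball[zi _]; exact: param_continuous.
  have [z zB zt] : (param i @` B) (c t).
    apply: (compact_closed (@surface_hausdorff _ M) cB) => U nU.
    have [d d0 Hd] := (near_normP t _).1 (cc t t01 U nU); have [s [s1 st sd]] := left_close t0 d0.
    have s01 : 0 <= s <= 1 by lra.
    have [|ds ls] := Pt s; first by rewrite s1.
    exists (c s); split; last by apply: Hd; rewrite ltr0_norm; lra.
    by exists (chart i (c s)); [exact: ball|exact: chartK].
  have [zc zr] := cod_ball z zB; have dt : dom i (c t) by rewrite -zt; exact: param_dom.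
  have [|d d0 Hd] := loc t t01; first by split=> //; rewrite -zt paramK.
  have [s [s1 st sd]] := left_close t0 d0.
  have [||_ ls] := Hd s t _ _ s1 (ltW st) t1; [by rewrite ltr0_norm; lra|by rewrite subrr normr0|].
  by split=> //; apply: step ls; apply: Pt; rewrite s1.
Qed.

Lemma dist_local i y0 : cod i y0 -> exists r m : R, [/\ 0 < r, 0 < m, forall y, `|y - y0| < r -> cod i y &
  forall p q, dom i p -> `|chart i p - y0| < r -> dist p q < m * r ->
    dom i q /\ m * `|chart i q - chart i p| <= dist p q].
Proof.
move=> /stay[r [m [r0 m0 H S]]]; exists r, m; split=> // p q dp pr dr.
have D (e : R) : 0 < e -> dist p q + e < m * r -> dom i q /\ m * `|chart i q - chart i p| <= dist p q + e.
  by move=> e0 er; apply: (S p q _ dp pr) => //; apply: dist_lt; lra.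
have d0 : 0 < (m * r - dist p q) / 2 by lra.
have [|dq _] := D _ d0; first by lra.
split=> //; apply/ler_addgt0Pr => e e0.
have [ee|ee] := ltP (dist p q + e) (m * r); first by have [] := D e e0 ee.
by have [|_] := D _ d0; lra.
Qed.

Lemma dist_eq0 p q : dist p q = 0 -> p = q.
Proof.
move=> d; have [r [m [r0 m0 _ H]]] := dist_local (chart_cod (dom_center p)).
have [||dq] := H p q (dom_center p); first by rewrite subrr normr0.
  by rewrite d mulr_gt0.
rewrite d pmulr_rle0 // normr_le0 subr_eq0 => /eqP e.
by rewrite -(chartK (dom_center p)) -e chartK.
Qed.

(** Together with [near_dist] this identifies the topology of [M] with that of the distance. *)
Lemma near_distP p (U : set M) : nbhs p U -> exists2 e : R, 0 < e & forall q, dist p q < e -> U q.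
Proof.
move=> nU; have [r [m [r0 m0 _ H]]] := dist_local (chart_cod (dom_center p)).
have pc := param_continuous (chart_cod (dom_center p)).
rewrite /prop_for /continuous_at chartK in pc; last exact: dom_center.
have [s s0 Hs] := (near_normP (chart p p) _).1 (pc _ nU).
exists (Num.min (m * r) (m * s)); first by rewrite lt_min !mulr_gt0.
move=> q; rewrite lt_min => /andP[q1 q2].
have [||dq ql] := H p q (dom_center p) => //; first by rewrite subrr normr0.
rewrite -(chartK dq); apply: Hs; rewrite -(ltr_pM2l m0); exact: le_lt_trans ql q2.
Qed.

End Distance.

(** * A growth estimate for second-order equations *)

Section ODE.
Context {R : realType}.
Local Notation V := 'rV[R]_2.

(** The maximum [m] of [|u| + |du|] exceeds the initial value by at most [m / 8 + m / 8] on so short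
    an interval, hence is less than twice that value. The second bound then follows by integrating
    [ddu]. *)
Lemma ode_bound (u du ddu : R -> V) (a b k : R) : a <= b -> 0 <= k -> k * (b - a) <= 8^-1 ->
  b - a <= 8^-1 -> (forall t : R, a <= t <= b -> is_derive t 1 u (du t)) ->
  (forall t : R, a <= t <= b -> is_derive t 1 du (ddu t)) ->
  (forall t : R, a <= t <= b -> `|ddu t| <= k * (`|u t| + `|du t|)) ->
  forall t : R, a <= t <= b -> `|u t| + `|du t| <= 2 * (`|u a| + `|du a|) /\
    `|du t - du a| <= 2 * k * (b - a) * (`|u a| + `|du a|).
Proof.
move=> ab k0 kab ab8 Du Ddu H.
have cu t : a <= t <= b -> {for t, continuous (fun t => `|u t| + `|du t|)}.
  move=> tab; apply: cvgD; apply: cvg_norm.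
    exact: is_derive_continuous (Du t tab).
  exact: is_derive_continuous (Ddu t tab).
have [|s sab Hs] := @EVT_max R (fun t => `|u t| + `|du t|) a b ab.
  by apply: within_continuous_in => t; rewrite /= in_itv /=; exact: cu.
rewrite in_itv /= in sab; set m := `|u s| + `|du s| in Hs.
have m0 : 0 <= m by rewrite addr_ge0.
have Hm t : a <= t <= b -> `|u t| + `|du t| <= m by move=> tab; apply: Hs; rewrite in_itv.
have sub t x : a <= t <= b -> a <= x <= t -> a <= x <= b.
  by move=> /andP[h1 h2] /andP[h3 h4]; rewrite h3 (le_trans h4 h2).
have B1 t : a <= t <= b -> `|u t - u a| <= m * (b - a).
  move=> tab; have /andP[t1 t2] := tab.
  have -> // : `|u t - u a| <= m * (b - a).
  apply: (@le_trans _ _ (m * (t - a))); last by rewrite ler_wpM2l // lerD2r.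
  apply: (@derive_bound_norm R _ u du a t m t1 m0) => x xt; first exact: Du (sub t x tab xt).
  by apply: le_trans (Hm x (sub t x tab xt)); rewrite lerDr.
have B2 t : a <= t <= b -> `|du t - du a| <= k * m * (b - a).
  move=> tab; have /andP[t1 t2] := tab; have km := mulr_ge0 k0 m0.
  apply: (@le_trans _ _ (k * m * (t - a))); last by rewrite ler_wpM2l // lerD2r.
  apply: (@derive_bound_norm R _ du ddu a t (k * m) t1 km) => x xt; first exact: Ddu (sub t x tab xt).
  by apply: le_trans (H x (sub t x tab xt)) _; rewrite ler_wpM2l // Hm // (sub t x tab xt).
have mle : m <= 2 * (`|u a| + `|du a|).
  have h1 := B1 s sab; have h2 := B2 s sab.
  have h3 : m <= (`|u a| + `|du a|) + (`|u s - u a| + `|du s - du a|).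
    have e1 := ler_normD (u a) (u s - u a); have e2 := ler_normD (du a) (du s - du a).
    rewrite [u a + _]addrC subrK in e1; rewrite [du a + _]addrC subrK in e2.
    by rewrite /m; lra.
  have h4 : m * (b - a) <= m * 8^-1 by rewrite ler_wpM2l.
  have h5 : k * m * (b - a) <= m * 8^-1 by rewrite mulrAC mulrC ler_wpM2l.
  have := addr_ge0 (normr_ge0 (u a)) (normr_ge0 (du a)).
  by move: h1 h2 h3 h4 h5; lra.
move=> t tab; split; first by apply: le_trans (Hm t tab) mle.
apply: le_trans (B2 t tab) _.
rewrite (_ : 2 * k * (b - a) * _ = k * (b - a) * (2 * (`|u a| + `|du a|))); last by ring.
by rewrite mulrAC ler_wpM2l // mulr_ge0 // subr_ge0.
Qed.

End ODE.

(** * Geodesics: time changes, continuous dependence, uniqueness *)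

Section Geodesics.
Context {R : realType} {M : surface R} (g : riemannian M).
Local Notation V := 'rV[R]_2.
Implicit Types (i : M) (y v w : V) (A : set R) (c b : R -> M).
Local Notation dist := (dist g).
Local Notation G := (Gm g).
Local Notation Gam := (Gam g).

(* unit speed geodesics R -> M, in charts *)
Definition sol c := forall (t : R) i, dom i (c t) -> [/\ {for t, continuous c},
  is_derive t 1 (chart i \o c) (dchart i c t),
  is_derive t 1 (dchart i c) (- Gam i (chart i (c t)) (dchart i c t) (dchart i c t))
  & bf (G i (chart i (c t))) (dchart i c t) (dchart i c t) = 1].

Lemma sol_continuous c t : sol c -> {for t, continuous c}.
Proof. by move=> S; have [] := S t _ (dom_center _). Qed.

Lemma sol_near c t0 i (r : R) : sol c -> dom i (c t0) -> 0 < r -> exists2 d : R, 0 < d &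
  forall t, `|t - t0| < d -> dom i (c t) /\ `|chart i (c t) - chart i (c t0)| < r.
Proof.
move=> S ci r0; have [cc d _ _] := S t0 i ci.
have n2 := near_cont (is_derive_continuous d) r0.
exact: (near_normP t0 _).1 (filterI (near_dom cc ci) n2).
Qed.

Lemma geodesic_sol c : geodesic_on g [set: R] c -> sol c.
Proof.
move=> [C E] t i ci; have Tt : [set: R] t by [].
have cc s : {for s, continuous c} by exact: (C1_continuous (C 0%N)).
have oT : open ([set: R] `&` c @^-1` dom i).
  by rewrite setTI; apply: open_comp (@dom_open _ M i) => x _; exact: cc.
have D1 s : dom i (c s) -> is_derive s 1 (chart i \o c) (dchart i c s).
  by move=> cs; apply: (C1_derive (C 1%N)).
have [_ D] := C 2%N; have [_ /(_ 1) [dd _]] := D i.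
have D2 : is_derive t 1 (dchart i c) ('D_1 (dchart i c) t).
  by apply: is_derive_dir; apply: dd.
have nE : \forall s \near t, dchart i c s = cmp i (c s) (velocity c s).
  by apply: filterS (near_dom (cc t) ci) => s cs; rewrite (cmp_velocity (cc s) cs (D1 s cs)).
have D3 : is_derive t 1 (fun s => cmp i (c s) (velocity c s)) ('D_1 (dchart i c) t).
  exact: near_eq_is_derive nE D2.
have [n1 cov0] := E t Tt.
have := @cmp_cov_along R M g i c (velocity c) t _ _ (cc t) ci (D1 t ci) D3.
rewrite cov0 cmp0 // (cmp_velocity (cc t) ci (D1 t ci)) => e.
have {e} e : 'D_1 (dchart i c) t = - Gam i (chart i (c t)) (dchart i c t) (dchart i c t).
  by apply/eqP; rewrite -addr_eq0 -e.
rewrite e in D2; split; [exact: cc|exact: D1|exact: D2|].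
move: n1; rewrite /norm (inner_chart _ _ _ ci) (cmp_velocity (cc t) ci (D1 t ci)).
move: (bf _ _ _) => x sx; have x0 : 0 <= x.
  by rewrite leNgt; apply/negP => x0; move: sx; rewrite ltr0_sqrtr // => /eqP; rewrite eq_sym oner_eq0.
by rewrite -(sqr_sqrtr x0) sx expr1n.
Qed.

(** The condition [e ^+ 2 = 1] covers translations, with [e = 1], and reversals of time, with
    [e = -1]. *)
Lemma sol_affine c (a e : R) : e ^+ 2 = 1 -> sol c -> sol (fun t => c (a + e * t)) /\
  forall t i, dom i (c (a + e * t)) ->
    dchart i (fun t => c (a + e * t)) t = e *: dchart i c (a + e * t).
Proof.
move=> e2 S.
have df (t : R) : is_derive t 1 (fun t : R => a + e * t) e.
  by apply: is_derive_eq; rewrite /GRing.scale /=; ring.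
have cf t : {for t, continuous (fun t : R => a + e * t)} by exact: is_derive_continuous (df t).
have cc t : {for t, continuous (fun t => c (a + e * t))}.
  by apply: (@continuous_comp _ _ _ (fun t : R => a + e * t) c t (cf t)); exact: sol_continuous.
have D1 t i : dom i (c (a + e * t)) ->
    is_derive t 1 (chart i \o (fun t => c (a + e * t))) (e *: dchart i c (a + e * t)).
  move=> ci; have [_ d _ _] := S _ _ ci.
  exact: is_derive_time (df t) d.
have Dc t i : dom i (c (a + e * t)) ->
    dchart i (fun t => c (a + e * t)) t = e *: dchart i c (a + e * t).
  by move=> ci; have [_] := D1 t i ci.
split=> // t i ci; rewrite (Dc t i ci); split=> //; first exact: D1.
  have [_ _ d _] := S _ _ ci.
  have d2 : is_derive t 1 (fun t => e *: dchart i c (a + e * t))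
     (- Gam i (chart i (c (a + e * t))) (e *: dchart i c (a + e * t)) (e *: dchart i c (a + e * t))).
    by have := is_deriveZ e (is_derive_time (df t) d); rewrite GamZl GamZr !scalerN !scalerA.
  apply: near_eq_is_derive d2; apply: filterS (near_dom (cc t) ci) => s cs.
  by rewrite Dc.
have [_ _ _ u] := S _ _ ci.
by rewrite bfZl bfZr u mulr1 -expr2.
Qed.

Lemma dchart_affine c (a e t s : R) i : e ^+ 2 = 1 -> sol c -> a + e * t = s -> dom i (c s) ->
  dchart i (fun t => c (a + e * t)) t = e *: dchart i c s.
Proof. by move=> e2 S <-; exact: (sol_affine a e2 S).2. Qed.

Lemma sol_speed c t : sol c -> speed g c t = 1.
Proof.
by move=> S; have [cc d _ u] := S t _ (dom_center _); rewrite (speedE g cc (dom_center _) d) u sqrtr1.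
Qed.

Lemma sol_C1 c : sol c -> curve_Ck 1 [set: R] c.
Proof.
move=> S; apply: C1_intro; [exact: openT|by move=> t _; exact: sol_continuous|].
move=> t _; exists (c t); have cc := sol_continuous (t := t) S.
have [_ _ d _] := S t _ (dom_center _).
split; [exact: dom_center| |exact: is_derive_continuous d].
by apply: filterS (near_dom cc (dom_center _)) => s cs; have [_ []] := S s _ cs.
Qed.

Lemma sol_reach c (s t : R) : sol c -> s <= t -> reach g (c s) (c t) (t - s).
Proof.
move=> S st; apply: (@reach_sub R M g [set: R] c s t id (fun=> 1)) => //; [exact: openT|exact: sol_C1|].
by move=> x _; split; [exact: is_derive_id|rewrite sol_speed].
Qed.

Lemma sol_dist c (s t : R) : sol c -> s <= t -> dist (c s) (c t) <= t - s.
Proof. by move=> S st; apply: dist_le; exact: sol_reach. Qed.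

(** From [l |v|^2 <= 1]; the value [1 + l^-1] dominates the square root of [l^-1]. It is the
    constant [B] that bounds the coordinates of unit vectors in all later estimates. *)
Lemma unit_norm_le (l : R) (A : 'M[R]_2) v : 0 < l -> l * `|v| ^+ 2 <= bf A v v -> bf A v v <= 1 ->
  `|v| <= 1 + l^-1.
Proof.
move=> l0 h1 h2; have h3 := le_trans h1 h2.
have h4 : `|v| ^+ 2 <= l^-1 by rewrite -ler_pdivlMl // mulr1 in h3.
have l1 : 0 < l^-1 by rewrite invr_gt0.
by move: h4 l1; have := normr_ge0 v; move: (`|v|) (l^-1) => x z; clear; nra.
Qed.

(** By bilinearity the difference splits into a change of velocity in each slot and a change of base
    point. The factor on the right is the Lipschitz constant of the geodesic equation in the
    chart. *)
Lemma Gam_quad_lip i (K B : R) y z v w : 0 <= K -> 0 <= B ->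
  (forall a b : V, `|Gam i y a b| <= K * `|a| * `|b|) ->
  (forall a b : V, `|Gam i y a b - Gam i z a b| <= K * `|y - z| * `|a| * `|b|) ->
  `|v| <= B -> `|w| <= B ->
  `|Gam i y v v - Gam i z w w| <= (2 * K * B + K * B ^+ 2) * (`|y - z| + `|v - w|).
Proof.
move=> K0 B0 H1 H2 vB wB.
have -> : Gam i y v v - Gam i z w w = Gam i y (v - w) v + Gam i y w (v - w) + (Gam i y w w - Gam i z w w).
  have e1 : Gam i y v v = Gam i y (v - w) v + Gam i y w v by rewrite -GamDl subrK.
  have e2 : Gam i y w v = Gam i y w (v - w) + Gam i y w w by rewrite -GamDr subrK.
  rewrite e1 e2; move: (Gam i y (v - w) v) (Gam i y w (v - w)) (Gam i y w w) (Gam i z w w) => a b' s t.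
  by apply/rowP => k; rewrite !mxE; ring.
have h1 := H1 (v - w) v; have h2 := H1 w (v - w); have h3 := H2 w w.
have e1 := ler_normD (Gam i y (v - w) v + Gam i y w (v - w)) (Gam i y w w - Gam i z w w).
have e2 := ler_normD (Gam i y (v - w) v) (Gam i y w (v - w)).
apply: le_trans e1 _.
have k1 : K * `|v - w| * `|v| <= K * `|v - w| * B by rewrite ler_wpM2l // mulr_ge0.
have k2 : K * `|w| * `|v - w| <= K * B * `|v - w| by rewrite ler_wpM2r // ler_wpM2l.
have k3 : K * `|y - z| * `|w| * `|w| <= K * `|y - z| * B * B.
  by apply: ler_pM => //; rewrite ?mulr_ge0 // ler_wpM2l // mulr_ge0.
have k4 : 0 <= K * B ^+ 2 * `|v - w| by rewrite !mulr_ge0 // exprn_ge0.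
have k5 : 0 <= 2 * K * B * `|y - z| by rewrite !mulr_ge0.
move: h1 h2 h3 e2 k1 k2 k3 k4 k5; clear.
move: (`|_ + _|) (`|Gam i y (v - w) v|) (`|Gam i y w (v - w)|) (`|Gam i y w w - _|) => a b c d.
move: (`|v - w|) (`|y - z|) (`|v|) (`|w|) => x s t r; lra.
Qed.

Section Convergence.
Variables (T : Type) (F : set_system T) (FF : ProperFilter F) (cn : T -> R -> M).
Hypothesis cnS : forall n, sol (cn n).

(** Convergence of positions and velocities at time [t]; by [conv_chart] the choice of the chart
    does not matter. The filter is arbitrary: [sol_unique] takes a constant family, and minimisers
    converge along ultrafilters. *)
Definition conv c (t : R) := ((fun n => cn n t) @ F --> c t) /\
  exists i, dom i (c t) /\ ((fun n => dchart i (cn n) t) @ F --> dchart i c t).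

Lemma cvg_chart c t i : dom i (c t) -> ((fun n => cn n t) @ F --> c t) ->
  ((fun n => chart i (cn n t)) @ F --> chart i (c t)) /\ \forall n \near F, dom i (cn n t).
Proof.
move=> ci h; split; first exact: (@cvg_comp _ _ _ (fun n => cn n t) (chart i) _ _ _ h (chart_continuous ci)).
exact: h (nbhs_dom ci).
Qed.

Lemma conv_chart c t j : sol c -> conv c t -> dom j (c t) -> (fun n => dchart j (cn n) t) @ F --> dchart j c t.
Proof.
move=> S [h [i [ci di]]] cj.
have [h1 h2] := cvg_chart ci h; have [_ h3] := cvg_chart cj h.
have E b : sol b -> dom i (b t) -> dom j (b t) -> TD i j (chart i (b t)) (dchart i b t) = dchart j b t.
  move=> Sb bi bj; have [cb db _ _] := Sb t i bi.
  by have [_ <-] := is_derive_chart cb bi bj db.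
rewrite -(E c) //.
have C : (fun n => TD i j (chart i (cn n t)) (dchart i (cn n) t)) @ F --> TD i j (chart i (c t)) (dchart i c t).
  by apply: cvg_TD => //; exact: overlap_chart.
apply: cvg_trans C; apply: near_eq_cvg.
by apply: filterS2 h2 h3 => n n1 n2; apply: E.
Qed.

(** The difference of two solutions in a chart obeys [ode_bound], so the error at [s2] is at most
    twice the error at [s1]. That [cn n] remains in the chart is known beforehand from [dist_local],
    its speed being 1. *)
Lemma conv_local c t0 : sol c -> exists2 d : R, 0 < d & forall s1 s2 : R,
  `|s1 - t0| < d -> `|s2 - t0| < d -> s1 <= s2 -> conv c s1 -> conv c s2.
Proof.
move=> S; set i := c t0; have ci : dom i (c t0) := dom_center _.
set y0 := chart i (c t0); have cy : cod i y0 by exact: chart_cod.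
have [r1 [l [r10 l0 H1]]] := gram_lower g cy.
have [r2 [K [r20 K0 H2]]] := Gam_bounds g cy.
have [r3 [m [r30 m0 H3 H4]]] := dist_local g cy.
have [r [r0 rr1 rr2 rr3]] := lt_min3 r10 r20 r30.
pose B := 1 + l^-1; have B0 : 0 <= B by rewrite addr_ge0 // invr_ge0 ltW.
pose k := 2 * K * B + K * B ^+ 2.
have k0 : 0 <= k by rewrite addr_ge0 // !mulr_ge0 ?exprn_ge0 // ltW.
have r4 : 0 < r / 4 by rewrite divr_gt0.
have [d0 d00 Hd] := sol_near S ci r4.
have k1 : 0 < 16 * (k + 1) by rewrite mulr_gt0 // ltr_wpDl.
(* An interval of length [2 d] then satisfies both smallness conditions of [ode_bound], and a unit
   speed curve moves by at most [r / 8] in coordinates during that time. *)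
have [|||d [dpos dd1 dd2 dd3 dd4]] := lt_min4 d00 (_ : 0 < 16^-1) (_ : 0 < (16 * (k + 1))^-1) (_ : 0 < m * r / 16).
- by rewrite invr_gt0.
- by rewrite invr_gt0.
- by rewrite divr_gt0 // mulr_gt0.
have EB : B = 1 + l^-1 by []. have Ek : k = 2 * K * B + K * B ^+ 2 by [].
clearbody k B.
exists d; first exact: dpos.
move=> s1 s2 sd1 sd2 s12 cv.
have s12d : s2 - s1 <= 2 * d.
  by move: sd1 sd2; rewrite !ltr_norml => /andP[h1 h2] /andP[h3 h4]; lra.
have dist_t (s : R) : s1 <= s <= s2 -> `|s - t0| < d.
  by move=> /andP[h1 h2]; move: sd1 sd2; rewrite !ltr_norml => /andP[h3 h4] /andP[h5 h6]; apply/andP; split; lra.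
have inb s : s1 <= s <= s2 -> dom i (c s) /\ `|chart i (c s) - y0| < r / 4.
  by move=> /dist_t h; apply: Hd; exact: lt_trans h dd1.
have s11 : s1 <= s1 <= s2 by rewrite lexx.
have s22 : s1 <= s2 <= s2 by rewrite lexx andbT.
have [ci1 u1] := inb s1 s11; have [ci2 u2] := inb s2 s22.
have [h1 h2] := cvg_chart ci1 cv.1; have h3 := conv_chart S cv ci1.
have near_u : \forall n \near F, `|chart i (cn n s1) - chart i (c s1)| < r / 4.
  by move/cvg_normP : h1; apply.
have main : \forall n \near F, dom i (cn n s2) /\
   `|chart i (cn n s2) - chart i (c s2)| + `|dchart i (cn n) s2 - dchart i c s2| <=
   2 * (`|chart i (cn n s1) - chart i (c s1)| + `|dchart i (cn n) s1 - dchart i c s1|).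
  apply: filterS2 near_u h2 => n nu ndom.
  have Sn := @cnS n.
  have nr : `|chart i (cn n s1) - y0| < r / 2.
    have := ler_normD (chart i (cn n s1) - chart i (c s1)) (chart i (c s1) - y0); rewrite addrA subrK.
    by move: nu u1; lra.
  have inn s : s1 <= s <= s2 -> dom i (cn n s) /\ `|chart i (cn n s) - y0| < r.
    move=> /andP[ss1 ss2].
    have D := sol_dist Sn ss1.
    have Dm : dist (cn n s1) (cn n s) <= m * (r / 8).
      apply: le_trans D _; have -> : m * (r / 8) = 2 * (m * r / 16) by field.
      by move: s12d dd4; lra.
    have [||dn nn] := H4 _ (cn n s) ndom.
    - by apply: lt_le_trans nr _; lra.
    - apply: le_lt_trans Dm _; rewrite ltr_pM2l //; lra.
    split=> //; have {}nn := le_trans nn Dm; rewrite ler_pM2l // in nn.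
    have := ler_normD (chart i (cn n s) - chart i (cn n s1)) (chart i (cn n s1) - y0); rewrite addrA subrK.
    by move: nn nr; lra.
  have bnd b (s : R) : sol b -> dom i (b s) -> `|chart i (b s) - y0| < r -> `|dchart i b s| <= B.
    move=> Sb bi br; have [_ _ _ u] := Sb s i bi.
    have [_ HH] := H1 _ (lt_trans br rr1).
    by rewrite EB; apply: (unit_norm_le l0 (HH _)); rewrite u.
  have inb' s : s1 <= s <= s2 -> dom i (c s) /\ `|chart i (c s) - y0| < r.
    by move=> /inb[? ?]; split=> //; lra.
  have O := @ode_bound R ((chart i \o cn n) - (chart i \o c)) (dchart i (cn n) - dchart i c)
    (fun s => - Gam i (chart i (cn n s)) (dchart i (cn n) s) (dchart i (cn n) s)
      - (- Gam i (chart i (c s)) (dchart i c s) (dchart i c s))) s1 s2 k s12 k0.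
  have [|||||O1 _] := O _ _ _ _ _ s2 s22.
  - have k2 : 0 < k + 1 by lra.
    have : k * (s2 - s1) <= (k + 1) * (2 * d) by apply: ler_pM => //; [rewrite subr_ge0|lra].
    have : (k + 1) * (2 * d) <= 8^-1; last by lra.
    have : (k + 1) * (2 * d) <= (k + 1) * (2 * (16 * (k + 1))^-1) by rewrite !ler_pM2l // ltW.
    suff -> : (k + 1) * (2 * (16 * (k + 1))^-1) = 8^-1 by [].
    by field; rewrite gt_eqF.
  - by move: s12d dd2; lra.
  - move=> s ss; have [d1 _] := inn s ss; have [d2 _] := inb s ss.
    have [_ e1 _ _] := Sn s i d1; have [_ e2 _ _] := S s i d2.
    exact: is_deriveB e1 e2.
  - move=> s ss; have [d1 _] := inn s ss; have [d2 _] := inb s ss.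
    have [_ _ e1 _] := Sn s i d1; have [_ _ e2 _] := S s i d2.
    exact: is_deriveB e1 e2.
  - move=> s ss; have [d1 r1'] := inn s ss; have [d2 r2'] := inb' s ss.
    have Q : `|Gam i (chart i (cn n s)) (dchart i (cn n) s) (dchart i (cn n) s)
        - Gam i (chart i (c s)) (dchart i c s) (dchart i c s)| <=
       k * (`|chart i (cn n s) - chart i (c s)| + `|dchart i (cn n) s - dchart i c s|).
      rewrite Ek; apply: (Gam_quad_lip (ltW K0) B0 _ _ (bnd _ _ Sn d1 r1') (bnd _ _ S d2 r2')).
        by move=> a b; have [_ h _] := H2 _ _ a b (lt_trans r1' rr2) (lt_trans r1' rr2).
      by move=> a b; have [_ _ h] := H2 _ _ a b (lt_trans r1' rr2) (lt_trans r2' rr2).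
    by rewrite -opprD normrN !fctE.
  by have [dn _] := inn s2 s22; split=> //; move: O1; rewrite !fctE.
have small (e : R) : 0 < e -> \forall n \near F, dom i (cn n s2) /\
   `|chart i (cn n s2) - chart i (c s2)| + `|dchart i (cn n) s2 - dchart i c s2| < e.
  move=> e0; have e4 : 0 < e / 4 by rewrite divr_gt0.
  have f1 : \forall n \near F, `|chart i (cn n s1) - chart i (c s1)| < e / 4 by move/cvg_normP : h1; apply.
  have f2 : \forall n \near F, `|dchart i (cn n) s1 - dchart i c s1| < e / 4 by move/cvg_normP : h3; apply.
  apply: filterS3 main f1 f2 => n [hn hm] q1 q2; split; first exact: hn.
  apply: le_lt_trans hm _; have -> : e = 2 * (e / 4 + e / 4) by field.
  by rewrite ltr_pM2l // ltrD.
split.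
  have U : (fun n => chart i (cn n s2)) @ F --> chart i (c s2).
    apply/cvg_normP => e e0; apply: filterS (small e e0) => n [_]; apply: le_lt_trans.
      by rewrite lerDl.
  have P : (fun n => param i (chart i (cn n s2))) @ F --> c s2.
    have := @cvg_comp _ _ _ (fun n => chart i (cn n s2)) (param i) _ _ _ U (param_continuous (chart_cod ci2)).
    by rewrite (chartK ci2).
  apply: cvg_trans P; apply: near_eq_cvg.
  by apply: filterS (small 1 ltr01) => n [dn _]; rewrite chartK.
exists i; split; first exact: ci2.
apply/cvg_normP => e e0; apply: filterS (small e e0) => n [_]; apply: le_lt_trans.
by rewrite lerDr.
Qed.

Lemma conv_forward c : sol c -> conv c 0 -> forall t, 0 <= t -> conv c t.
Proof.
move=> S c0 t t0; apply: (@real_induction R (conv c) t t0 c0); last by rewrite t0 lexx.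
  move=> s /andP[s0 st] cs; have [d dp H] := conv_local s S.
  exists (d / 2); first by rewrite divr_gt0.
  move=> x /andP[x1 x2] _; apply: (H s x _ _ x1 cs); first by rewrite subrr normr0.
  by rewrite ger0_norm; lra.
move=> s /andP[s0 st] cs; have [d dp H] := conv_local s S.
have [x [x1 x2 x3]] := left_close s0 dp.
apply: (H x s _ _ (ltW x2)); [by rewrite ltr0_norm; lra|by rewrite subrr normr0|].
by apply: cs; rewrite x1 x2.
Qed.

End Convergence.

(** Continuous dependence is applied to the constant family [b]: it converges to [c t] and to [b t],
    and [M] is Hausdorff. Negative times follow by reversal. *)
Lemma sol_unique b c : sol b -> sol c -> b 0 = c 0 ->
  (exists i, dom i (c 0) /\ dchart i b 0 = dchart i c 0) -> forall t, b t = c t.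
Proof.
have fwd b' c' : sol b' -> sol c' -> b' 0 = c' 0 ->
    (exists i, dom i (c' 0) /\ dchart i b' 0 = dchart i c' 0) -> forall t, 0 <= t -> b' t = c' t.
  move=> Sb Sc e0 [i [ci de]] t t0.
  have cv : conv \oo (fun=> b') c' 0.
    split; first by rewrite e0; exact: cvg_cst.
    by exists i; split=> //; rewrite de; exact: cvg_cst.
  have [h _] := @conv_forward nat \oo _ (fun=> b') (fun=> Sb) c' Sc cv t t0.
  by apply: (cvg_unique (@surface_hausdorff _ M) _ h); exact: cvg_cst.
move=> Sb Sc e0 [i [ci de]] t; have [t0|t0] := leP 0 t; first by apply: fwd => //; exists i.
have e2 : (-1 : R) ^+ 2 = 1 by rewrite sqrrN expr1n.
have [Sb' _] := sol_affine 0 e2 Sb; have [Sc' _] := sol_affine 0 e2 Sc.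
have h0 : 0 + -1 * 0 = 0 :> R by ring.
have ht : 0 + -1 * - t = t :> R by ring.
have bi : dom i (b 0) by rewrite e0.
have E : exists i, dom i (c (0 + -1 * 0)) /\
    dchart i (fun t => b (0 + -1 * t)) 0 = dchart i (fun t => c (0 + -1 * t)) 0.
  exists i; rewrite (dchart_affine e2 Sb h0 bi) (dchart_affine e2 Sc h0 ci) de h0; split; [exact: ci|reflexivity].
have H := fwd _ _ Sb' Sc' _ E (- t); rewrite h0 ht in H.
by apply: (H e0); lra.
Qed.

Lemma conv_backward (T : Type) (F : set_system T) (FF : ProperFilter F) (cn : T -> R -> M) c :
  (forall n, sol (cn n)) -> sol c -> conv F cn c 0 -> forall t, conv F cn c t.
Proof.
move=> Sn S cv t; have [t0|t0] := leP 0 t; first exact: (conv_forward FF Sn S cv t0).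
have e2 : (-1 : R) ^+ 2 = 1 by rewrite sqrrN expr1n.
have h0 : 0 + -1 * 0 = 0 :> R by ring.
have [S' _] := sol_affine 0 e2 S.
have Sn' n : sol (fun t => cn n (0 + -1 * t)) := (sol_affine 0 e2 (Sn n)).1.
have key (s s' : R) : conv F cn c s -> 0 + -1 * s' = s ->
   conv F (fun n s => cn n (0 + -1 * s)) (fun s => c (0 + -1 * s)) s'.
  move=> [h [i [ci di]]] e; split; first by rewrite e; exact: h.
  exists i; rewrite (dchart_affine e2 S e ci) e; split; first exact: ci.
  have [_ nd] := cvg_chart ci h.
  have C : (fun n => -1 *: dchart i (cn n) s) @ F --> -1 *: dchart i c s.
    by apply: cvgZ; [exact: cvg_cst|exact: di].
  apply: cvg_trans C; apply: near_eq_cvg; apply: filterS nd => n nn.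
  exact: esym (dchart_affine e2 (Sn n) e nn).
have ht : 0 + -1 * - t = t :> R by ring.
have t0' : 0 <= - t by lra.
have [h [i [ci di]]] := conv_forward FF Sn' S' (key 0 0 cv h0) t0'.
rewrite ht in h ci; split; first exact: h.
exists i; split; first exact: ci.
rewrite (dchart_affine e2 S ht ci) in di; have [_ nd] := cvg_chart ci h.
have C : (fun n => -1 *: dchart i (fun s => cn n (0 + -1 * s)) (- t)) @ F --> -1 *: (-1 *: dchart i c t).
  by apply: cvgZ; [exact: cvg_cst|exact: di].
rewrite scalerA mulrNN mulr1 scale1r in C; apply: cvg_trans C; apply: near_eq_cvg; apply: filterS nd => n nn.
by rewrite (dchart_affine e2 (Sn n) ht nn) scalerA mulrNN mulr1 scale1r.
Qed.

Lemma complete_sol i p w : complete g -> dom i p -> bf (G i (chart i p)) w w = 1 ->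
  exists c, [/\ geodesic_on g [set: R] c, c 0 = p & dchart i c 0 = w].
Proof.
move=> cpl pi wu; have cy := chart_cod pi.
have [|c [C c0 v0]] := cpl p (psh i (chart i p) w).
  rewrite /norm (inner_chart _ _ _ pi).
  by rewrite -{2 4}(chartK pi) cmp_psh // wu sqrtr1.
exists c; split=> //; have S := geodesic_sol C.
have ci : dom i (c 0) by rewrite c0.
have [cc d _ _] := S 0 i ci.
rewrite -(cmp_velocity cc ci d) v0 c0.
by rewrite -{1}(chartK pi) cmp_psh.
Qed.

End Geodesics.

(** * First variation of length *)

Section FirstVariation.
Context {R : realType} {M : surface R} (g : riemannian M).
Local Notation V := 'rV[R]_2.
Implicit Types (i : M) (y v : V).
Local Notation dist := (dist g).
Local Notation G := (Gm g).
Local Notation DG := (DG g).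
Local Notation Gam := (Gam g).

Lemma bf_entry_le (A : 'M[R]_2) u v (K : R) : (forall m n, `|A m n| <= K) ->
  `|bf A u v| <= 4 * K * `|u| * `|v|.
Proof.
move=> H; have K0 : 0 <= K := le_trans (normr_ge0 _) (H 0 0).
have T m n : `|u 0 m * A m n * v 0 n| <= K * `|u| * `|v|.
  rewrite !normrM [`|u 0 m| * _]mulrC; apply: ler_pM; rewrite ?mulr_ge0 ?coord_le_norm //.
  by apply: ler_pM; rewrite ?coord_le_norm.
rewrite bfE; have := T 0 0; have := T 0 1; have := T 1 0; have := T 1 1.
move: (u 0 0 * _ * _) (u 0 0 * _ * _) (u 0 1 * _ * _) (u 0 1 * _ * _) => a b c d h1 h2 h3 h4.
have e1 := ler_normD (a + b + c) d; have e2 := ler_normD (a + b) c; have e3 := ler_normD a b.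
move: h1 h2 h3 h4 e1 e2 e3; rewrite -!mulrA; move: (K * _) (`|a|) (`|b|) (`|c|) (`|d|) => k x1 x2 x3 x4.
by move: (`|_|) (`|_|) (`|_|) => x5 x6 x7; clear; lra.
Qed.

Definition DDG i y v : 'M[R]_2 := locked (fun i y v => 'D_v (fun z => DG i z v) y) i y v.

Lemma Gm_entry_Ck n i (a b : 'I_2) : Ck n (cod i) (fun y => G i y a b : R).
Proof. by apply: Ck_coord; [exact: cod_open|exact: Gm_Ck]. Qed.

Lemma Gm_entry_derive i y v (a b : 'I_2) : cod i y -> 'D_v (fun z => G i z a b : R) y = DG i y v a b.
Proof. by move=> cy; have [_ ->] := is_derive_coord a b (is_derive_Gm g v cy). Qed.

Lemma DG_entry_Ck n i v (a b : 'I_2) : Ck n (cod i) (fun y => DG i y v a b : R).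
Proof.
apply: (@Ck_ext R V R n _ (fun y => bf (DG i y v) (delta_mx 0 a) (delta_mx 0 b))).
- exact: (@cod_open _ M i).
- by move=> y _; rewrite bf_delta.
- exact: GmDG_Ck.
Qed.

Lemma is_derive_DG i y v : cod i y -> is_derive y v (fun z => DG i z v) (DDG i y v).
Proof.
move=> cy; rewrite /DDG -lock; apply: is_derive_dir; apply: differentiable_mx => a b.
by apply: (Ck_differentiable (DG_entry_Ck 1 i v a b)).
Qed.

Lemma DG_entry_derive i y v (a b : 'I_2) : cod i y ->
  'D_v ('D_v (fun z => G i z a b : R)) y = DDG i y v a b.
Proof.
move=> cy; have [_ <-] := is_derive_coord a b (is_derive_DG v cy).
apply: (@derive_eq_on R V R (cod i)) => //; first exact: (@cod_open _ M i).
by move=> z cz; exact: Gm_entry_derive.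
Qed.

Lemma gram_taylor_entry i y0 (a b : 'I_2) : cod i y0 -> exists r C : R, [/\ 0 < r, 0 <= C &
  forall z v, `|z - y0| < r -> `|z + v - y0| < r -> cod i z /\ [/\
   `|DG i z v a b| <= C * `|v|, `|DDG i z v a b| <= C * `|v| ^+ 2,
   `|G i (z + v) a b - G i z a b| <= C * `|v|,
   `|G i (z + v) a b - G i z a b - DG i z v a b| <= C * `|v| ^+ 2 &
   `|G i (z + v) a b - G i z a b - DG i z v a b - 2^-1 * DDG i z v a b| <= C * `|v| ^+ 3]].
Proof.
move=> cy; have oc : open (cod i) := @cod_open _ M i.
pose f y : R := G i y a b.
have [r1 [K1 [r10 K10 H1]]] := Ck_bound1 oc cy (Gm_entry_Ck 1 i a b).
have [r2 [K2 [r20 K20 H2]]] := Ck_bound2 oc cy (Gm_entry_Ck 2 i a b).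
have [r3 [K3 [r30 K30 H3]]] := Ck_bound3 oc cy (Gm_entry_Ck 3 i a b).
exists (Num.min r1 (Num.min r2 r3)), (K1 + K2 + K3); split.
- by rewrite !lt_min r10 r20.
- by rewrite !addr_ge0.
move=> z v zr vr.
have in_b (t : R) : 0 <= t <= 1 -> [/\ `|z + t *: v - y0| < r1, `|z + t *: v - y0| < r2 & `|z + t *: v - y0| < r3].
  move=> t01; have := seg_ball vr zr t01; rewrite [z + v]addrC addrK.
  by rewrite !lt_min => /and3P.
have [z1 z2 z3] := in_b 0 (introT andP (conj (lexx 0) ler01)); rewrite scale0r addr0 in z1 z2 z3.
have cz : cod i z by have [] := H1 z 0 z1.
have ct (t : R) : 0 <= t <= 1 -> cod i (z + t *: v) by move=> /in_b[h _ _]; have [] := H1 _ 0 h.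
have df (t : R) : 0 <= t <= 1 -> [/\ differentiable f (z + t *: v), differentiable ('D_v f) (z + t *: v)
    & differentiable ('D_v ('D_v f)) (z + t *: v)].
  move=> /ct c; have [d1 /(_ v) [d2 /(_ v) [d3 _]]] := Gm_entry_Ck 3 i a b.
  by split; [exact: d1|exact: d2|exact: d3].
have nv := normr_ge0 v.
have N2 : 0 <= `|v| ^+ 2 by rewrite exprn_ge0.
have N3 : 0 <= `|v| ^+ 3 by rewrite exprn_ge0.
have E1 : 'D_v f z = DG i z v a b by exact: Gm_entry_derive.
have E2 : 'D_v ('D_v f) z = DDG i z v a b by exact: DG_entry_derive.
rewrite -E1 -E2; split; first exact: cz.
split.
- have [_ h] := H1 z v z1; apply: le_trans h _; apply: ler_wpM2r => //; lra.
- have [_ h] := H2 z v v z2; apply: le_trans h _; rewrite -mulrA -expr2; apply: ler_wpM2r => //; lra.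
- have [|t t01 ->] := @mean_value_line R V f z v.
    by move=> t t01; have [] := df t t01.
  have /andP[t0 t1] := t01; have [|h _ _] := in_b t; first by rewrite !ltW.
  have [_ h'] := H1 _ v h; apply: le_trans h' _; apply: ler_wpM2r => //; lra.
- apply: (taylor2 (f := f)) => [t t01|t t01]; first by have [] := df t t01.
  have [_ h _] := in_b t t01; have [_ h'] := H2 _ v v h.
  by apply: le_trans h' _; rewrite -mulrA -expr2; apply: ler_wpM2r => //; lra.
- apply: (taylor3 (f := f)) => [t t01|t t01]; first by have [] := df t t01.
  have [_ _ h] := in_b t t01; have [_ h'] := H3 _ v v v h.
  by apply: le_trans h' _; rewrite -!mulrA -expr2 -exprS; apply: ler_wpM2r => //; lra.
Qed.

Lemma uniform_I22 (P : 'I_2 -> 'I_2 -> R -> R -> Prop) :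
  (forall m n r K r' K', r' <= r -> K <= K' -> P m n r K -> P m n r' K') ->
  (forall m n, exists r K : R, [/\ 0 < r, 0 <= K & P m n r K]) ->
  exists r K : R, [/\ 0 < r, 0 <= K & forall m n, P m n r K].
Proof.
move=> Pm H; apply: (@uniform_I2 _ (fun m r K => forall n, P m n r K)) => [m r K r' K' rr KK HP n|m].
  exact: Pm (HP n).
by apply: (@uniform_I2 _ (P m)) => // n; exact: Pm.
Qed.

Lemma gram_taylor i y0 : cod i y0 -> exists r C : R, [/\ 0 < r, 0 < C &
  forall z v a b, `|z - y0| < r -> `|z + v - y0| < r -> cod i z /\ [/\
   `|bf (DG i z v) a b| <= C * `|v| * `|a| * `|b|,
   `|bf (DDG i z v) a b| <= C * `|v| ^+ 2 * `|a| * `|b|,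
   `|bf (G i (z + v)) a b - bf (G i z) a b| <= C * `|v| * `|a| * `|b|,
   `|bf (G i (z + v)) a b - bf (G i z) a b - bf (DG i z v) a b| <= C * `|v| ^+ 2 * `|a| * `|b| &
   `|bf (G i (z + v)) a b - bf (G i z) a b - bf (DG i z v) a b - 2^-1 * bf (DDG i z v) a b|
      <= C * `|v| ^+ 3 * `|a| * `|b|]].
Proof.
move=> cy.
have [m n r C r' C' rr CC H z v zr vr|r [C [r0 C0 H]]] := uniform_I22 _ (fun a b => gram_taylor_entry a b cy).
  have [cz [h1 h2 h3 h4 h5]] := H z v (lt_le_trans zr rr) (lt_le_trans vr rr); split=> //.
  by split; [apply: le_trans h1 _|apply: le_trans h2 _|apply: le_trans h3 _|apply: le_trans h4 _|apply: le_trans h5 _];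
    rewrite ler_wpM2r ?exprn_ge0.
exists r, (4 * (C + 1)); split; [exact: r0|by rewrite mulr_gt0 // ltr_wpDl|].
move=> z v a b zr vr; have [cz _] := H 0 0 z v zr vr; split; first exact: cz.
have up (N : R) (X : 'M[R]_2) : 0 <= N -> (forall m n, `|X m n| <= C * N) -> `|bf X a b| <= 4 * (C + 1) * N * `|a| * `|b|.
  move=> N0 XN; rewrite -[4 * _ * N]mulrA; apply: bf_entry_le => m n; apply: le_trans (XN m n) _.
  by rewrite ler_wpM2r // lerDl.
rewrite -bfZm -!bfBm; split; apply: up; rewrite ?exprn_ge0 // => m n.
all: by have [_ []] := H m n z v zr vr; rewrite ?mxE.
Qed.

(** This is the geodesic equation in its variational form: the derivative on the right is the part
    linear in [Y] of half the energy density of [u + Y], so that this part integrates to a boundary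
    term. *)
Lemma geo_pairing i (u du Y : R -> V) (t : R) dY : cod i (u t) -> is_derive t 1 u (du t) ->
  is_derive t 1 du (- Gam i (u t) (du t) (du t)) -> is_derive t 1 Y dY ->
  is_derive t 1 (fun s => bf (G i (u s)) (du s) (Y s))
    (2^-1 * bf (DG i (u t) (Y t)) (du t) (du t) + bf (G i (u t)) (du t) dY).
Proof.
move=> ci Du Ddu DY.
have dG : is_derive t 1 (fun s => G i (u s)) (DG i (u t) (du t)).
  by rewrite -DGE; apply: (is_derive_comp Du); exact: Gm_differentiable.
apply: (is_derive_subst (is_derive_bf dG Ddu DY)).
have := koszul g (du t) (du t) (Y t) ci; rewrite bfNl.
by move: (bf _ _ _) (bf _ _ _) (bf _ _ _) (bf _ _ _) => a b c d; clear; lra.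
Qed.

Lemma Gm_ge0 i y v : cod i y -> 0 <= bf (G i y) v v.
Proof.
by move=> cy; have [->|v0] := eqVneq v 0; [rewrite bf0l|exact: ltW (Gm_gt0 g cy v0)].
Qed.

(** Since [sqrt e <= (e + 1) / 2], an energy density of at most [2 h - 1] means a speed of at most
    [h]; no square root has to be expanded. For curves near a unit speed geodesic the loss is of
    higher order. *)
Lemma energy_reach i (b db : R -> V) (H h : R -> R) (A : set R) (s t : R) : open A -> s <= t ->
  (forall x : R, A x -> [/\ cod i (b x), is_derive x 1 b (db x) & {for x, continuous db}]) ->
  (forall x : R, s <= x <= t -> [/\ A x, is_derive x 1 H (h x) &
     bf (G i (b x)) (db x) (db x) <= 2 * h x - 1]) ->
  reach g (param i (b s)) (param i (b t)) (H t - H s).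
Proof.
move=> oA st HA Hst; have [C S] := C1_chart_curve g oA HA.
apply: (reach_sub (h := h) oA C st) => x xst; have [Ax dH e] := Hst x xst; first by [].
split; first exact: dH.
rewrite S //; have [cx _ _] := HA x Ax; have k0 := Gm_ge0 (db x) cx; move: k0 e.
move: (bf _ _ _) => k k0 e; have := sqr_ge0 (Num.sqrt k - 1); rewrite sqrrB sqr_sqrtr // expr1n mulr1.
by move: e; move: (Num.sqrt k) => q; lra.
Qed.

(** The linear part of the energy of [u + Y] is integrated exactly by [geo_pairing], which leaves
    only the remainder [k], with primitive [K], to be estimated by the user of the lemma. *)
Lemma variation_reach c i (t0 t1 t2 r d : R) (Y dY : R -> V) (K k : R -> R) : sol g c ->
  let u := chart i \o c in let du := dchart i c in
  (forall y, `|y - u t0| < r -> cod i y) ->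
  (forall t, `|t - t0| < d -> dom i (c t) /\ `|u t - u t0| < r / 2) ->
  (forall t : R, `|t - t0| < d -> is_derive t 1 Y (dY t) /\ {for t, continuous dY}) -> t1 <= t2 ->
  (forall t : R, t1 <= t <= t2 -> [/\ `|t - t0| < d, `|Y t| < r / 2, is_derive t 1 K (k t) &
    bf (G i (u t + Y t)) (du t + dY t) (du t + dY t) <=
      2 * (2^-1 * bf (DG i (u t) (Y t)) (du t) (du t) + bf (G i (u t)) (du t) (dY t) + k t) - 1]) ->
  dist (param i (u t1 + Y t1)) (param i (u t2 + Y t2)) <=
    bf (G i (u t2)) (du t2) (Y t2) + K t2 - (bf (G i (u t1)) (du t1) (Y t1) + K t1).
Proof.
move=> S u du cr Hd DY t12 HK.
pose B : set R := interior [set t | `|t - t0| < d /\ `|Y t| < r / 2].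
have inB t : t1 <= t <= t2 -> B t.
  move=> /HK[td Yr _ _]; have cY := is_derive_continuous (DY t td).1.
  have Y0 : `|Y t - 0| < r / 2 by rewrite subr0.
  have n2 : \forall s \near t, `|Y s - 0| < r / 2 by exact: cY _ (near_ball Y0).
  by apply: filterS2 (near_ball td) n2 => s; rewrite /= subr0.
have inr t : B t -> `|t - t0| < d /\ cod i (u t + Y t).
  move=> /interior_subset[td Yt]; split=> //; apply: cr; have [_ ut] := Hd t td.
  by have := ler_normD (u t - u t0) (Y t); rewrite addrAC; move: ut Yt; clear; lra.
apply: dist_le; apply: (@energy_reach i (u + Y) (du + dY) (fun t => bf (G i (u t)) (du t) (Y t) + K t)
  (fun t => 2^-1 * bf (DG i (u t) (Y t)) (du t) (du t) + bf (G i (u t)) (du t) (dY t) + k t) B _ _ _ t12).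
- exact: open_interior.
- move=> t /inr[td cY]; have [ct _] := Hd t td; have [_ D1 D2 _] := S t i ct; have [D3 c3] := DY t td.
  by split; [exact: cY|exact: is_deriveD D1 D3|apply: cvgD; [exact: is_derive_continuous D2|exact: c3]].
- move=> t tt; have [td _ dK e] := HK t tt; have [ct _] := Hd t td; have [_ D1 D2 _] := S t i ct.
  split; [exact: inB|exact: is_deriveD (geo_pairing (chart_cod ct) D1 D2 (DY t td).1) dK|exact: e].
Qed.

(* The straight-line interpolation [u + lam *: d], estimated by its energy. *)
Lemma first_variation c (t0 : R) i : sol g c -> dom i (c t0) -> exists2 L0 : R, 0 < L0 &
  forall L, 0 < L <= L0 -> exists r C : R, [/\ 0 < r, 0 < C & forall d : V, `|d| < r ->
    cod i (chart i (c t0) + d) /\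
    dist (param i (chart i (c t0) + d)) (c (t0 + L)) <=
      L - bf (G i (chart i (c t0))) (dchart i c t0) d + C * `|d| ^+ 2].
Proof.
move=> S ci; set y0 := chart i (c t0); have cy : cod i y0 by exact: chart_cod.
have [r1 [C1 [r10 C10 H1]]] := gram_taylor cy.
have [r2 [l [r20 l0 H2]]] := gram_lower g cy.
have [r3 [La [r30 La0 H3]]] := gram_upper g cy.
have [r [r0 rr1 rr2 rr3]] := lt_min3 r10 r20 r30.
pose u := chart i \o c; pose du := dchart i c.
have r4 : 0 < r / 2 by rewrite divr_gt0.
have [d0 d00 Hd] := sol_near S ci r4.
exists (d0 / 2); first by rewrite divr_gt0.
move=> L /andP[L0 Ld].
pose B := 1 + l^-1; have B0 : 0 <= B by rewrite addr_ge0 // invr_ge0 ltW.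
(* The three terms bound the quadratic remainder of the metric along [du], its mixed part with [dY],
   counted twice, and the square of [dY]. Each factor [L^-1] comes from the slope of the
   interpolation. *)
pose K := C1 * B ^+ 2 + 2 * C1 * B * L^-1 + La * L^-1 ^+ 2.
have Li : 0 < L^-1 by rewrite invr_gt0.
have K0 : 0 < K.
  by rewrite ltr_wpDl // ?mulr_gt0 ?exprn_gt0 // addr_ge0 // !mulr_ge0 ?exprn_ge0 // ltW.
exists (r / 4), (2^-1 * K * L); split; [by rewrite divr_gt0|by rewrite !mulr_gt0|].
move=> d dr.
have r42 : r / 4 < r / 2 by lra.
split; first by have [] := H2 (y0 + d) _; rewrite // addrAC subrr add0r; apply: lt_trans rr2; lra.
pose lam (t : R) := 1 - (t - t0) / L.
pose dY := - L^-1 *: d; pose Y (t : R) := (d + (t0 / L) *: d) + t *: dY.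
have YE t : Y t = lam t *: d.
  by apply/rowP => k; rewrite /Y /lam /dY !mxE; field; rewrite gt_eqF.
have DY (t : R) : is_derive t 1 Y dY by exact: is_derive_affine.
have dYn : `|dY| = L^-1 * `|d| by rewrite /dY normrZ normrN gtr0_norm.
have tL : t0 <= t0 + L by lra.
have EK : K = C1 * B ^+ 2 + 2 * C1 * B * L^-1 + La * L^-1 ^+ 2 by [].
have EB : B = 1 + l^-1 by [].
clearbody K B.
have := @variation_reach c i t0 t0 (t0 + L) r d0 Y (fun=> dY) (fun t => (1 + 2^-1 * K * `|d| ^+ 2) * t)
  (fun=> 1 + 2^-1 * K * `|d| ^+ 2) S.
have Y1 : Y (t0 + L) = 0.
  by rewrite YE /lam addrAC subrr add0r divff ?gt_eqF // subrr scale0r.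
have Y0 : Y t0 = d by rewrite YE /lam subrr mul0r subr0 scale1r.
have dL : `|t0 + L - t0| < d0 by rewrite addrAC subrr add0r gtr0_norm //; move: Ld d00; clear; lra.
have [cL _] := Hd _ dL.
rewrite /= Y1 Y0 bf0r !addr0 chartK // => VR; apply: le_trans (VR _ Hd _ tL _) _; first last.
- by rewrite -/y0; move: (bf _ _ _) (`|d| ^+ 2) => x1 x2; lra.
- move=> t /andP[t1 t2].
  have lt : 0 <= lam t <= 1.
    have q0 : 0 <= (t - t0) / L by rewrite divr_ge0 ?subr_ge0 // ltW.
    have q1 : (t - t0) / L <= 1 by rewrite ler_pdivrMr // mul1r; lra.
    by rewrite /lam; move: q0 q1; clear; move: (_ / L) => q q0 q1; apply/andP; split; lra.
  have Yd : `|Y t| <= `|d|.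
    rewrite YE normrZ ger0_norm; last by have /andP[] := lt.
    by rewrite -[leRHS]mul1r ler_wpM2r //; have /andP[] := lt.
  have td : `|t - t0| < d0 by rewrite ger0_norm ?subr_ge0 //; move: t2 Ld d00; clear; lra.
  have Yr : `|Y t| < r / 2 by apply: le_lt_trans Yd (lt_trans dr r42).
  have [ct ut] := Hd t td; have [_ _ _ un] := S t i ct; rewrite -/(u t) -/(du t).
  have ub : `|u t + Y t - y0| < r.
    by have := ler_normD (u t - y0) (Y t); rewrite addrAC; move: ut Yr; rewrite -/(u t); clear; lra.
  split; [exact: td|exact: Yr| |].
    have := is_deriveZ (1 + 2^-1 * K * `|d| ^+ 2) (is_derive_id t (1 : R)).
    by rewrite /GRing.scale /= mulr1.
have ur : `|u t - y0| < r by move: ut r0; rewrite -/(u t); clear; lra.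
  have dB : `|du t| <= B.
    have [_ h2] := H2 _ (lt_trans ur rr2).
    by rewrite EB; apply: (unit_norm_le l0 (h2 _)); rewrite un.
  have T a b := H1 (u t) (Y t) a b (lt_trans ur rr1) (lt_trans ub rr1).
  have [_ [_ _ _ T2 _]] := T (du t) (du t); have [_ [_ _ T1 _ _]] := T (du t) dY.
  have [_ h3] := H3 _ (lt_trans ub rr3); have {h3} T3 := h3 dY dY.
  rewrite un in T2.
  rewrite !bfDl !bfDr (GmC g i (u t + Y t) dY (du t)).
  have q1 := le_trans (ler_norm _) T2; have q2 := le_trans (ler_norm _) T1.
  have q3 := le_trans (ler_norm _) T3.
  have p1 : C1 * `|Y t| ^+ 2 * `|du t| * `|du t| <= C1 * B ^+ 2 * `|d| ^+ 2.
    rewrite (_ : C1 * `|Y t| ^+ 2 * `|du t| * `|du t| = C1 * (`|Y t| ^+ 2 * `|du t| ^+ 2)); last by ring.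
    rewrite (_ : C1 * B ^+ 2 * `|d| ^+ 2 = C1 * (`|d| ^+ 2 * B ^+ 2)); last by ring.
    by rewrite ler_pM2l //; apply: ler_pM; rewrite ?exprn_ge0 // ler_pXn2r // nnegrE.
  have p2 : C1 * `|Y t| * `|du t| * `|dY| <= C1 * B * L^-1 * `|d| ^+ 2.
    rewrite dYn (_ : C1 * B * L^-1 * `|d| ^+ 2 = C1 * (`|d| * B * (L^-1 * `|d|))); last by ring.
    rewrite -!mulrA ler_pM2l // mulrA [leRHS]mulrA; apply: ler_pM; rewrite ?mulr_ge0 ?(ltW Li) //.
    exact: ler_pM.
  have p3 : La * `|dY| * `|dY| = La * L^-1 ^+ 2 * `|d| ^+ 2 by rewrite dYn; ring.
  rewrite p3 in q3; move: q1 q2 q3 p1 p2; rewrite EK; clear.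
  move: (bf _ _ _) (bf _ _ _) (bf _ _ _) (bf _ _ _) (bf _ _ _).
  move: (C1 * `|Y t| ^+ 2 * `|du t| * `|du t|) (C1 * `|Y t| * `|du t| * `|dY|) (`|d| ^+ 2) => x1 x2 x3.
  move: (C1 * B ^+ 2) => x4; rewrite -(mulrA 2 C1 B) -(mulrA 2 (C1 * B)).
  move: (C1 * B * L^-1) (La * L^-1 ^+ 2) => x5 x6 a1 a2 a3 a4 a5; lra.
- by move=> t _; split; [exact: DY|exact: cst_continuous].
- by move=> y yr; have [] := H2 y (lt_trans yr rr2).
Qed.

End FirstVariation.

(** * Short geodesics minimise *)

Section Calibration.
Context {R : realType} {M : surface R} (g : riemannian M).
Local Notation V := 'rV[R]_2.
Implicit Types (p : M) (v w : V).
Local Notation dist := (dist g).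
Local Notation G := (Gm g).
Local Notation DG := (DG g).
Local Notation Gam := (Gam g).
Local Notation E := (1%:M : 'M[R]_2).

Lemma dotE (u v : V) : bf E u v = dot u v.
Proof. by rewrite bfE !mxE /dot /=; ring. Qed.

Lemma dot_ge (u : V) : `|u| ^+ 2 <= bf E u u.
Proof.
rewrite dotE /dot -!expr2 norm_row2; have := sqr_ge0 (u 0 0); have := sqr_ge0 (u 0 1).
by rewrite /Num.max; case: ifP => _; rewrite real_normK ?num_real //; lra.
Qed.

Lemma square_young (a b l : R) : 0 < l -> 2 * a * b <= l * b ^+ 2 + a ^+ 2 / l.
Proof.
move=> l0; have := sqr_ge0 (l * b - a); have li : 0 < l^-1 by rewrite invr_gt0.
move=> h; have := mulr_ge0 (ltW li) h.
rewrite (_ : l^-1 * (l * b - a) ^+ 2 = l * b ^+ 2 - 2 * a * b + a ^+ 2 / l); last by field; rewrite gt_eqF.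
by lra.
Qed.

(* The convexity inequality behind minimality: [kap] absorbs the error terms
   of the Taylor expansion of the metric. *)
Lemma calibration_pointwise (l C B kap t x e : R) : 0 < l -> 0 < C -> 0 <= B -> 0 <= x -> 0 <= e ->
  kap = 1 + 2 * C * B ^+ 2 + 4 * C ^+ 2 * B ^+ 2 / l -> 
  C * x + 2 * C * x ^+ 2 <= l / 4 -> 0 <= t -> 16 * (kap * t) ^+ 2 <= l -> 
  forall (gww guu gud gdd dd0 dde dee zz ze : R),
  (* [gww = G(u+z)(w,w)], with [w = du + eta] *)
  l * e ^+ 2 <= guu -> gdd = 1 ->
  dd0 + 2 * dde + dee - C * x ^+ 2 * (B + e) ^+ 2 <= gww - (guu + 2 * gud + gdd) ->
  `|dde| <= C * x * B * e -> `|dee| <= C * x * e ^+ 2 -> x ^+ 2 <= zz -> `|ze| <= 2 * x * e ->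
  dd0 + 2 * (gdd + gud) - 2 - kap * zz - 2 * (kap * t) * ze <= gww - 1.
Proof.
move=> l0 C0 B0 x0 e0 Ek Hx t0 Ht gww guu gud gdd dd0 dde dee zz ze H1 -> H2 H3 H4 H5 H6.
have k0 : 0 < kap.
  rewrite Ek -addrA ltr_wpDr ?ltr01 // addr_ge0 // !mulr_ge0 ?exprn_ge0 ?invr_ge0 // ltW //.
have y1 := square_young (4 * C * B * x) e (l := l) l0.
have li : 0 < l^-1 by rewrite invr_gt0.
have kt : 0 <= kap * t by rewrite mulr_ge0 // ltW.
have a1 : - dde <= C * x * B * e by have := ler_norm (- dde); rewrite normrN; lra.
have a2 : - dee <= C * x * e ^+ 2 by have := ler_norm (- dee); rewrite normrN; lra.
have a3 : - ze <= 2 * x * e by have := ler_norm (- ze); rewrite normrN; lra.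
have a4 : (kap * t) * - ze <= (kap * t) * (2 * x * e) by rewrite ler_wpM2l.
have a5 : kap * x ^+ 2 <= kap * zz by rewrite ler_wpM2l // ltW.
have a6 : (C * x + 2 * C * x ^+ 2) * e ^+ 2 <= l / 4 * e ^+ 2 by rewrite ler_wpM2r // sqr_ge0.
have b1 := square_young (4 * (kap * t) * x) e (l := l) l0.
have b2 : (4 * (kap * t) * x) ^+ 2 / l <= x ^+ 2.
  rewrite ler_pdivrMr // (_ : (4 * (kap * t) * x) ^+ 2 = x ^+ 2 * (16 * (kap * t) ^+ 2)); last by ring.
  by rewrite ler_wpM2l // sqr_ge0.
have b3 : (4 * C * B * x) ^+ 2 / l = 4 * ((4 * C ^+ 2 * B ^+ 2 / l) * x ^+ 2) by ring.
have b4 : C * x ^+ 2 * (B + e) ^+ 2 <= 2 * C * B ^+ 2 * x ^+ 2 + 2 * C * x ^+ 2 * e ^+ 2.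
  have := sqr_ge0 (B - e); have := mulr_ge0 (ltW C0) (sqr_ge0 x).
  move=> c1 c2; have := mulr_ge0 c1 c2; move: c1 c2; rewrite !expr2; lra.
rewrite b3 in y1; rewrite Ek mulrDl mulrDl mul1r in a5.
move: H1 H2 a1 a2 a4 a5 a6 b1 b2 b4 y1.
have -> : 2 * (4 * C * B * x) * e = 8 * (C * x * B * e) by ring.
have -> : 2 * (4 * (kap * t) * x) * e = 4 * ((kap * t) * (2 * x * e)) by ring.
have -> : (C * x + 2 * C * x ^+ 2) * e ^+ 2 = C * x * e ^+ 2 + 2 * C * x ^+ 2 * e ^+ 2 by ring.
have -> : 2 * (kap * t) * ze = - (2 * (kap * t * - ze)) by ring.
have := sqr_ge0 x; have := sqr_ge0 e.
rewrite -Ek.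
move: (C * x * B * e) (C * x * e ^+ 2) (kap * t * (2 * x * e)) (kap * t * - ze) (kap * zz).
move: (C * x ^+ 2 * (B + e) ^+ 2) (2 * C * B ^+ 2 * x ^+ 2) (2 * C * x ^+ 2 * e ^+ 2).
move: (4 * C ^+ 2 * B ^+ 2 / l * x ^+ 2) ((4 * (kap * t) * x) ^+ 2 / l) (x ^+ 2) => y2 y3 x2.
clear; move: (e ^+ 2) => e2 z1 z2 z3 z4 z5 z6 z7 z8.
rewrite (_ : l / 4 * e2 = l * e2 / 4); last by ring.
move: (l * e2) => z9; lra.
Qed.


(** A competitor [c'] shorter than [T] is compared with [c] on a clock [tau], which runs slightly
    faster than its length and reaches [T] at the end. The function [phi] of the displacement [z]
    vanishes at both ends, while [calibration_pointwise] makes its derivative negative. *)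
Lemma calibration p : exists2 T0 : R, 0 < T0 & forall c T, sol g c -> c 0 = p -> 0 <= T <= T0 ->
  T <= dist p (c T).
Proof.
have pi := dom_center p; set y0 := chart p p; have cy : cod p y0 := chart_cod pi.
have [r1 [C [r10 C0 H1]]] := gram_taylor g cy.
have [r2 [l [r20 l0 H2]]] := gram_lower g cy.
have [r3 [m [r30 m0 H3 H4]]] := dist_local g cy.
have [r [r0 rr1 rr2 rr3]] := lt_min3 r10 r20 r30.
have [B EB] : exists B : R, B = 1 + l^-1 by exists (1 + l^-1).
have B0 : 0 <= B by rewrite EB addr_ge0 // invr_ge0 ltW.
have [kap Ek] : exists kap : R, kap = 1 + 2 * C * B ^+ 2 + 4 * C ^+ 2 * B ^+ 2 / l by eexists; reflexivity.
have k0 : 0 < kap.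
  by rewrite Ek -addrA ltr_wpDr ?ltr01 // addr_ge0 // !mulr_ge0 ?exprn_ge0 ?invr_ge0 // ltW.
(* The first bound keeps both curves in the chart, the second gives [|z| <= 1], and the last two are
   the smallness conditions of [calibration_pointwise] on [x] and on [kap * t]. *)
have [T0 [T00 q1 q2 q3 q4]] : exists T0, [/\ 0 < T0, T0 <= m * r / 4, T0 <= m / 2, T0 <= m * (l / (24 * C))
    & 4 * (kap * T0) <= 1 /\ 4 * (kap * T0) <= l].
  pose k4 := (4 * kap)^-1; have k40 : 0 < k4 by rewrite invr_gt0 mulr_gt0.
  have [||||T0 [T00 q1 q2 q3 q4]] := lt_min4 (_ : 0 < m * r / 4) (_ : 0 < m / 2) (_ : 0 < m * (l / (24 * C)))
    (_ : 0 < Num.min k4 (l * k4)).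
  - by rewrite divr_gt0 // mulr_gt0.
  - by rewrite divr_gt0.
  - by rewrite mulr_gt0 // divr_gt0 // mulr_gt0.
  - by rewrite lt_min k40 mulr_gt0.
  exists T0; split; [exact: T00|exact: ltW|exact: ltW|exact: ltW|]; move: q4; rewrite lt_min => /andP[q5 q6].
  by rewrite mulrA [_ * T0]mulrC -!ler_pdivlMr ?mulr_gt0 // div1r !ltW.
exists T0; first exact: T00.
move=> c T S c0 /andP[T1 T2]; rewrite leNgt; apply/negP => dT.
have [L [L1 L2]] : exists L, dist p (c T) < L /\ L < T.
  by exists ((dist p (c T) + T) / 2); move: dT; clear; lra.
have [c' [e [H [h [[e0 Cc] c'0 c'1 DH HL]]]]] := dist_lt L1.
(* The margin [ep] makes the clock strictly increasing even where the majorant [h] of the speed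
   vanishes. *)
have [ep [ep0 epE]] : exists ep : R, 0 < ep /\ L + ep < T.
  by exists ((T - L) / 2); move: L2; clear; lra.
have hge (s : R) : 0 <= s <= 1 -> 0 <= h s.
  by move=> s01; exact: le_trans (speed_ge0 g c' s) (DH s s01).2.
have oA : open (`]- e, 1 + e[%classic : set R) by exact: interval_open.
have monoH (s t : R) : 0 <= s -> s <= t -> t <= 1 -> H s <= H t.
  move=> s0 st t1; apply: (@nondecreasing_derive R H h s t st) => x /andP[x1 x2].
    by apply: (DH x _).1; apply/andP; split; [exact: le_trans x1|exact: le_trans t1].
  by apply: hge; apply/andP; split; [exact: le_trans x1|exact: le_trans t1].
have bs (s : R) : 0 <= s <= 1 -> dom p (c' s) /\ m * `|chart p (c' s) - y0| <= T0.
  move=> /andP[s0 s1].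
  have RS : reach g (c' 0) (c' s) (H s - H 0).
    apply: (reach_sub oA Cc s0) => x /andP[x1 x2].
      by apply: in_unit_itv => //; rewrite x1 (le_trans x2 s1).
    by apply: DH; rewrite x1 (le_trans x2 s1).
  have D : dist p (c' s) <= T0.
    rewrite -c'0; apply: le_trans (dist_le RS) _.
    by have := monoH s 1 s0 s1 (lexx 1); move: HL L2 T2; clear; lra.
  have [||d1 d2] := H4 p (c' s) pi; first by rewrite subrr normr0.
    apply: le_lt_trans D _; apply: le_lt_trans q1 _; rewrite -mulrA ltr_pM2l //.
    by move: r0 rr3; clear; lra.
  by split; [exact: d1|exact: le_trans d2 D].
have us (t : R) : 0 <= t <= T -> dom p (c t) /\ m * `|chart p (c t) - y0| <= T0.
  move=> /andP[t0 tT].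
  have D : dist p (c t) <= T0.
    rewrite -c0; apply: le_trans (sol_dist S t0) _; rewrite subr0; exact: le_trans tT T2.
  have [||d1 d2] := H4 p (c t) pi; first by rewrite subrr normr0.
    apply: le_lt_trans D _; apply: le_lt_trans q1 _; rewrite -mulrA ltr_pM2l //.
    by move: r0 rr3; clear; lra.
  by split; [exact: d1|exact: le_trans d2 D].
have HLe : 0 < H 1 - H 0 + ep.
  by have := monoH 0 1 (lexx 0) ler01 (lexx 1); move: ep0; clear; lra.
have HT : H 1 - H 0 + ep < T by move: HL epE; clear; lra.
have [q [q0 qE]] : exists q : R, 1 < q /\ q * (H 1 - H 0 + ep) = T.
  exists (T / (H 1 - H 0 + ep)); split; first by rewrite ltr_pdivlMr // mul1r.
  by rewrite divfK // gt_eqF.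
pose tau (s : R) := q * (H s - H 0 + ep * s).
have dtau (s : R) : 0 <= s <= 1 -> is_derive s 1 tau (q * (h s + ep)).
  move=> s01.
  have d1 := is_deriveD (is_deriveB (DH s s01).1 (is_derive_cst (H 0) s 1)) (is_deriveZ ep (is_derive_id s 1)).
  apply: (is_derive_subst (is_deriveZ q d1)).
  by rewrite /GRing.scale /= subr0 mulr1.
have qp : 0 < q by exact: lt_trans q0.
have tau01 (s : R) : 0 <= s <= 1 -> 0 <= tau s <= T.
  move=> /andP[s0 s1]; have h0 := monoH 0 s (lexx 0) s0 s1; have h1 := monoH s 1 s0 s1 (lexx 1).
  have es : 0 <= ep * s by rewrite mulr_ge0 // ltW.
  have es1 : ep * s <= ep by rewrite ler_piMr // ltW.
  rewrite /tau mulr_ge0 ?(ltW qp) //=; last by move: h0 es; clear; lra.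
  by rewrite -qE ler_pM2l //; move: h1 es1; clear; lra.
pose u := chart p \o c; pose du := dchart p c; pose b := chart p \o c'; pose db := dchart p c'.
pose z (s : R) := b s - u (tau s).
(* Differentiating the weight [tau s] of the second term yields [- kap |z|^2] times the clock speed,
   which absorbs the quadratic Taylor errors; the remaining contribution of this term is small
   because [tau s <= T0]. *)
pose phi (s : R) := 2 * bf (G p (u (tau s))) (du (tau s)) (z s) - kap * (tau s * bf E (z s) (z s)).
pose dphi (s : R) := let sg := q * (h s + ep) in let w := db s - sg *: du (tau s) in
  2 * (bf (DG p (u (tau s)) (sg *: du (tau s))) (du (tau s)) (z s)
    + bf (G p (u (tau s))) (sg *: - Gam p (u (tau s)) (du (tau s)) (du (tau s))) (z s)
    + bf (G p (u (tau s))) (du (tau s)) w)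
  - kap * (tau s * (bf 0 (z s) (z s) + bf E w (z s) + bf E (z s) w) + bf E (z s) (z s) * (q * (h s + ep))).
have Dphi (s : R) : 0 <= s <= 1 -> is_derive s 1 phi (dphi s).
  move=> s01; have [dp _] := us _ (tau01 s s01); have [dp' _] := bs s s01.
  have [_ D1 D2 _] := S _ _ dp; have Dt := dtau s s01.
  have Du := is_derive_time Dt D1; have Ddu := is_derive_time Dt D2.
  have Db : is_derive s 1 b (db s).
    by apply: (C1_derive Cc); [exact: in_unit_itv|exact: dp'].
  have Dz := is_deriveB Db Du.
  have cu : cod p (u (tau s)) by exact: chart_cod.
  have dG : is_derive s 1 (fun s => G p (u (tau s))) (DG p (u (tau s)) (q * (h s + ep) *: du (tau s))).
    by rewrite -DGE; apply: (is_derive_comp Du); exact: Gm_differentiable.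
  have P1 := is_derive_bf dG Ddu Dz.
  have P2 := is_derive_bf (is_derive_cst E s 1) Dz Dz.
  exact: (is_deriveB (is_deriveZ 2 P1) (is_deriveZ kap (is_deriveM Dt P2))).
have neg (s : R) : 0 <= s <= 1 -> dphi s < 0.
  move=> s01; have [dp ul] := us _ (tau01 s s01); have [dp' bl] := bs s s01.
  have [_ D1 D2 un] := S _ _ dp.
  have [cc' db' _] : [/\ {for s, continuous c'}, is_derive s 1 (chart p \o c') (db s) & True].
    split=> //; first by apply: C1_continuous Cc _; exact: in_unit_itv.
    by apply: (C1_derive Cc); [exact: in_unit_itv|exact: dp'].
  have spd := (DH s s01).2; rewrite (speedE g cc' dp' db') in spd.
  have cu : cod p (u (tau s)) by exact: chart_cod.
  have cb : cod p (b s) by exact: chart_cod.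
  have hs := hge s s01.
  rewrite /dphi; set sg := q * (h s + ep).
  have sg0 : h s < sg.
    have he : 0 < h s + ep by move: hs ep0; clear; lra.
    have : h s + ep < sg by rewrite /sg ltr_pMl.
    by move: ep0; clear; lra.
  have sgp : 0 < sg by exact: le_lt_trans hs sg0.
  have tt := tau01 s s01; have /andP[tt0 tt1] := tt.
  have bE : b s = u (tau s) + z s by rewrite /z addrC subrK.
  move: (z s) bE => z0 bE; move: (tau s) tt tt0 tt1 dp ul D1 D2 un cu bE => t tt t0 tT dp ul D1 D2 un cu bE.
  (* Measured by the clock, the competitor has velocity [om = du t + eta], of Riemannian norm less
     than 1; after division by [sg] the derivative of [phi] is the left-hand side of the pointwise
     inequality. *)
  pose om := sg^-1 *: db s; pose eta := om - du t.
  have wE : db s = sg *: (du t + eta).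
    by rewrite /eta addrC subrK /om scalerA divff ?scale1r // gt_eqF.
  have omE : om = du t + eta by rewrite /eta addrC subrK.
  have we : db s - sg *: du t = sg *: eta by rewrite wE scalerDr addrAC subrr add0r.
  have r42 : r / 4 < r by move: r0; clear; lra.
  have small x : m * x <= T0 -> x <= r / 4.
    by move=> mx; have := le_trans mx q1; rewrite -mulrA ler_pM2l.
  have ur : `|u t - y0| < r by apply: le_lt_trans r42; exact: small.
  have br : `|u t + z0 - y0| < r by rewrite -bE; apply: le_lt_trans r42; exact: small.
  have [_ low] := H2 _ (lt_trans ur rr2).
  have vB : `|du t| <= B by rewrite EB; apply: (unit_norm_le l0 (low _)); rewrite un.
  have TT a' b' := H1 (u t) z0 a' b' (lt_trans ur rr1) (lt_trans br rr1).
  have [_ [_ _ _ Tay _]] := TT om om.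
  have [_ [de _ _ _ _]] := TT (du t) eta; have [_ [ee _ _ _ _]] := TT eta eta.
  have zn : m * `|z0| <= 2 * T0.
    have : m * `|z0| <= m * (`|b s - y0| + `|u t - y0|).
      rewrite ler_pM2l //; have -> : z0 = (b s - y0) - (u t - y0).
        by rewrite bE opprB addrA subrK addrAC subrr add0r.
      exact: ler_normB.
    by move: ul bl; rewrite mulrDr /u /b /=; clear; lra.
  have z1 : `|z0| <= 1 by rewrite -(ler_pM2l m0); move: zn q2; clear; lra.
  have zl : 12 * (C * `|z0|) <= l.
    have h1 : m * `|z0| <= m * (2 * (l / (24 * C))) by move: zn q3; rewrite mulrCA; clear; lra.
    rewrite ler_pM2l // in h1; have h2 : 12 * (C * `|z0|) <= 12 * (C * (2 * (l / (24 * C)))) by rewrite !ler_pM2l.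
    suff e3 : 12 * (C * (2 * (l / (24 * C)))) = l by rewrite e3 in h2.
    by field; rewrite gt_eqF.
  have zx : C * `|z0| + 2 * C * `|z0| ^+ 2 <= l / 4.
    have : C * `|z0| ^+ 2 <= C * `|z0| by rewrite ler_pM2l // expr2 ler_piMr.
    by move: zl; rewrite -(mulrA 2 C); clear; lra.
  have kt2 : 16 * (kap * t) ^+ 2 <= l.
    have k1 : 4 * (kap * t) <= 4 * (kap * T0) by rewrite !ler_pM2l //; exact: le_trans tT T2.
    have k2 : 0 <= 4 * (kap * t) by rewrite !mulr_ge0 // ltW.
    have [q5 q6] := q4; have k3 := le_trans k1 q5; have k4 := le_trans k1 q6.
    have -> : 16 * (kap * t) ^+ 2 = (4 * (kap * t)) * (4 * (kap * t)) by ring.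
    by apply: le_trans k4; rewrite ler_piMr.
  have gw1 : bf (G p (b s)) om om < 1.
    have kk := Gm_ge0 g (db s) cb.
    have h2 : bf (G p (b s)) (db s) (db s) < sg ^+ 2.
      rewrite -(sqr_sqrtr kk) ltr_pXn2r ?nnegrE ?sqrtr_ge0 ?(ltW sgp) //.
      exact: le_lt_trans spd sg0.
    rewrite /om bfZl bfZr mulrA -expr2 exprVn mulrC ltr_pdivrMr ?mul1r ?exprn_gt0 //.
  clearbody eta; clearbody om.
  have CP := @calibration_pointwise l C B kap t `|z0| `|eta| l0 C0 B0 (normr_ge0 _) (normr_ge0 _) Ek zx t0 kt2
    (bf (G p (b s)) om om) (bf (G p (u t)) eta eta) (bf (G p (u t)) (du t) eta) (bf (G p (u t)) (du t) (du t))
    (bf (DG p (u t) z0) (du t) (du t)) (bf (DG p (u t) z0) (du t) eta) (bf (DG p (u t) z0) eta eta)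
    (bf E z0 z0) (bf E z0 eta) (low eta) un.
  have tay : bf (DG p (u t) z0) (du t) (du t) + 2 * bf (DG p (u t) z0) (du t) eta + bf (DG p (u t) z0) eta eta
      - C * `|z0| ^+ 2 * (B + `|eta|) ^+ 2 <= bf (G p (b s)) om om
      - (bf (G p (u t)) eta eta + 2 * bf (G p (u t)) (du t) eta + bf (G p (u t)) (du t) (du t)).
    have on : `|om| <= B + `|eta| by rewrite omE; apply: le_trans (ler_normD _ _) _; rewrite lerD2r.
    have h1 : C * `|z0| ^+ 2 * `|om| * `|om| <= C * `|z0| ^+ 2 * (B + `|eta|) ^+ 2.
      rewrite -[X in X <= _]mulrA; apply: ler_wpM2l; first by rewrite mulr_ge0 ?exprn_ge0 // ltW.
      by rewrite -expr2 ler_pXn2r ?nnegrE // addr_ge0.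
    have := ler_norm (- (bf (G p (u t + z0)) om om - bf (G p (u t)) om om - bf (DG p (u t) z0) om om)).
    rewrite normrN => h2; have {h2} := le_trans (le_trans h2 Tay) h1.
    rewrite -bE omE !(bfDl (G p (u t))) !(bfDr (G p (u t))) !(bfDl (DG p _ _)) !(bfDr (DG p _ _)).
    rewrite (GmC g p (u t) eta (du t)) (DGC g z0 eta (du t) cu).
    move: (bf _ _ _) (bf _ _ _) (bf _ _ _) (bf _ _ _) (bf _ _ _) (bf _ _ _) (bf _ _ _) (_ * _ * _).
    by clear => x1 x2 x3 x4 x5 x6 x7 x8; lra.
  have dde : `|bf (DG p (u t) z0) (du t) eta| <= C * `|z0| * B * `|eta|.
    by apply: le_trans de _; rewrite ler_wpM2r // ler_wpM2l // mulr_ge0 // ltW.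
  have dee : `|bf (DG p (u t) z0) eta eta| <= C * `|z0| * `|eta| ^+ 2 by rewrite expr2 mulrA.
  have dn : `|bf E z0 eta| <= 2 * `|z0| * `|eta| by rewrite dotE; exact: dot_norm_le.
  have {}CP := CP tay dde dee (dot_ge z0) dn.
  rewrite un in CP.
  have EC : bf E eta z0 = bf E z0 eta by rewrite !dotE /dot; ring.
  have B00 : bf 0 z0 z0 = 0 by rewrite bfE !mxE; ring.
  have KZ := koszul g (du t) (du t) z0 cu.
  rewrite we DGZ // bfZm bfZl bfNl bfZr (bfZl E) (bfZr E) EC B00 -/sg.
  have val : 2 * (sg * bf (DG p (u t) (du t)) (du t) z0 + sg * - bf (G p (u t)) (Gam p (u t) (du t) (du t)) z0
      + sg * bf (G p (u t)) (du t) eta)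
    - kap * (t * (0 + sg * bf E z0 eta + sg * bf E z0 eta) + bf E z0 z0 * sg)
    = sg * (bf (DG p (u t) z0) (du t) (du t) + 2 * (1 + bf (G p (u t)) (du t) eta) - 2 - kap * bf E z0 z0 - 2 * (kap * t) * bf E z0 eta).
    have -> : bf (DG p (u t) z0) (du t) (du t) = 2 * bf (DG p (u t) (du t)) (du t) z0 - 2 * bf (G p (u t)) (Gam p (u t) (du t) (du t)) z0.
      by rewrite KZ; ring.
    ring.
  rewrite val; rewrite pmulr_rlt0 //; apply: le_lt_trans CP _.
  by rewrite subr_lt0.
have [s /andP[s0 s1] Es] := mean_value ltr01 Dphi.
have := neg s (introT andP (conj (ltW s0) (ltW s1))); rewrite subr0 mulr1 in Es; rewrite -Es.
have t0E : tau 0 = 0 by rewrite /tau subrr mulr0 addr0 mulr0.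
have t1E : tau 1 = T by rewrite /tau mulr1 -qE.
have z0E : z 0 = 0 by rewrite /z t0E /b /u /= c'0 c0 subrr.
have z1E : z 1 = 0 by rewrite /z t1E /b /u /= c'1 subrr.
by rewrite /phi z0E z1E !bf0r !mulr0 subrr ltxx.
Qed.

End Calibration.

(** * Existence of minimising geodesics *)

Section HopfRinow.
Context {R : realType} {M : surface R} (g : riemannian M).
Local Notation V := 'rV[R]_2.
Implicit Types (i p q : M) (y v w : V).
Local Notation dist := (dist g).
Local Notation G := (Gm g).
Local Notation Gam := (Gam g).

(** The map [h] is the exponential map at [T *: w] in coordinates, divided by [T]. By [ode_bound] it
    is close to the identity, so it takes every small value, and [calibration] identifies the length
    of the resulting geodesic with the distance. *)
Lemma short_geodesic p : complete g -> exists2 rho : R, 0 < rho & forall q, dist p q < rho ->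
  exists c, [/\ geodesic_on g [set: R] c, c 0 = p & c (dist p q) = q].
Proof.
move=> cpl; have pi := dom_center p; set y0 := chart p p; have cy : cod p y0 := chart_cod pi.
have [T0 T00 cal] := calibration g p.
have [r1 [Lam [r10 Lam0 H1]]] := gram_upper g cy.
have [r4 [l [r40 l0 H4]]] := gram_lower g cy.
have [r2 [K [r20 K0 H2]]] := Gam_bounds g cy.
have [r3 [m [r30 m0 H3 Hd]]] := dist_local g cy.
have [r [r0 rr4 rr2 rr3]] := lt_min3 r40 r20 r30.
(* Geodesics have unit speed here; initial velocity [w] is realised by running the geodesic in the
   direction of [w] at speed [lam w], the Riemannian length of [w]. *)
pose lam w := Num.sqrt (bf (G p y0) w w).
have lam0 w : 0 <= lam w := sqrtr_ge0 _.
have lam2 w : lam w ^+ 2 = bf (G p y0) w w by rewrite sqr_sqrtr // Gm_ge0.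
have lamgt w : w != 0 -> 0 < lam w by move=> w0; rewrite sqrtr_gt0; exact: Gm_gt0.
have [La [La0 LaE]] : exists La, 0 < La /\ forall w, `|w| <= 1 -> lam w <= La.
  exists (Num.sqrt Lam); split; first by rewrite sqrtr_gt0.
  move=> w w1; apply: ler_wsqrtr; have [|_ h] := H1 y0; first by rewrite subrr normr0.
  apply: le_trans (ler_norm _) _; apply: le_trans (h w w) _.
  by rewrite -mulrA ler_piMr ?(ltW Lam0) // mulr_ile1.
have E1 w : w != 0 -> exists c, [/\ geodesic_on g [set: R] c, c 0 = p & lam w *: dchart p c 0 = w].
  move=> w0; have lw := lamgt w w0.
  have [|c [C c0 cd]] := complete_sol (w := (lam w)^-1 *: w) cpl pi.
    by rewrite -/y0 bfZl bfZr mulrA -lam2 expr2; field; rewrite gt_eqF.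
  by exists c; split=> //; rewrite cd scalerA divff ?scale1r // gt_eqF.
have E2 w : exists c, [/\ geodesic_on g [set: R] c, c 0 = p & lam w *: dchart p c 0 = w].
  (* For [w = 0] any geodesic through [p] serves, as it is run at speed 0. *)
  have [->|w0] := eqVneq w 0; last exact: E1.
  have d0 : (delta_mx 0 0 : V) != 0.
    by apply/eqP => /rowP/(_ 0); rewrite !mxE /= => /eqP; rewrite oner_eq0.
  have [c [C c0 _]] := E1 _ d0; exists c; split=> //.
  by rewrite /lam bf0l sqrtr0 scale0r.
have [cw Hcw] := choice E2.
have [B EB] : exists B, B = La * (1 + l^-1) by eexists; reflexivity.
have B0 : 0 <= B by rewrite EB mulr_ge0 ?(ltW La0) // addr_ge0 // invr_ge0 ltW.
pose k := 2 * K * B + K * B ^+ 2.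
have k0 : 0 <= k by rewrite addr_ge0 // !mulr_ge0 ?exprn_ge0 // ltW.
(* The conditions on [T] are, in order, that [calibration] applies up to time [lam w * T], that the
   geodesics remain in the chart, and the two requirements of [ode_bound]. *)
have [T [T1 T2 T3 T4 T5]] : exists T, [/\ 0 < T, La * T <= T0, La * T <= m * (r / 2), k * T <= 8^-1 & T <= 8^-1].
  have k1 : 0 < 8 * (k + 1) by rewrite mulr_gt0 // ltr_wpDl.
  have [||||T [T1 t1 t2 t3 t4]] := lt_min4 (_ : 0 < T0 / La) (_ : 0 < m * (r / 2) / La) (_ : 0 < (8 * (k + 1))^-1)
    (_ : 0 < 8^-1).
  - by rewrite divr_gt0.
  - by rewrite divr_gt0 // mulr_gt0 // divr_gt0.
  - by rewrite invr_gt0.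
  - by rewrite invr_gt0.
  exists T; split.
  - exact: T1.
  - by rewrite mulrC -ler_pdivlMr // ltW.
  - by rewrite mulrC -ler_pdivlMr // ltW.
  - apply: (@le_trans _ _ ((k + 1) * T)); first by rewrite ler_wpM2r ?(ltW T1) // lerDl.
    apply: (@le_trans _ _ ((k + 1) * (8 * (k + 1))^-1)); first by rewrite ler_pM2l ?ltW // ltr_wpDl.
    by rewrite invfM mulrCA divff ?mulr1 // gt_eqF // ltr_wpDl.
  - exact: ltW.
pose U w (t : R) := chart p (cw w (lam w * t)).
pose dU w (t : R) := lam w *: dchart p (cw w) (lam w * t).
have Scw w : sol g (cw w) by have [C _ _] := Hcw w; exact: geodesic_sol.
have inU w t : `|w| <= 1 -> 0 <= t <= T -> dom p (cw w (lam w * t)) /\ `|U w t - y0| < r.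
  move=> w1 /andP[t0 tT]; have [C c0 _] := Hcw w.
  have D : dist p (cw w (lam w * t)) <= m * (r / 2).
    rewrite -{1}c0; apply: le_trans (sol_dist (Scw w) _) _; first by rewrite mulr_ge0.
    rewrite subr0; apply: le_trans T3; apply: ler_pM => //; exact: LaE.
  have r2r : r / 2 < r by move: r0; clear; lra.
  have [||d1 d2] := Hd p (cw w (lam w * t)) pi; first by rewrite subrr normr0.
    by apply: le_lt_trans D _; rewrite ltr_pM2l //; exact: lt_trans r2r rr3.
  split; first exact: d1.
  by apply: le_lt_trans r2r; rewrite -(ler_pM2l m0); exact: le_trans d2 D.
have DU w t : `|w| <= 1 -> 0 <= t <= T -> [/\ is_derive t 1 (U w) (dU w t),
    is_derive t 1 (dU w) (- Gam p (U w t) (dU w t) (dU w t)) & `|dU w t| <= B].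
  move=> w1 tT; have [dt ut] := inU w t w1 tT.
  have [_ D1 D2 un] := Scw w _ _ dt.
  have dl : is_derive t 1 (fun t : R => lam w * t) (lam w).
    by apply: is_derive_eq; rewrite /GRing.scale /=; ring.
  split; first exact: (is_derive_time dl D1).
    apply: (is_derive_subst (is_deriveZ (lam w) (is_derive_time dl D2))).
    by rewrite /dU GamZl GamZr !scalerN !scalerA.
  rewrite EB /dU normrZ ger0_norm //; apply: ler_pM => //; first exact: LaE.
  have [_ h] := H4 _ (lt_trans ut rr4).
  by apply: (unit_norm_le l0 (h _)); rewrite un.
have U0 w : U w 0 = y0 by have [_ c0 _] := Hcw w; rewrite /U mulr0 c0.
have dU0 w : dU w 0 = w by have [_ _ c0] := Hcw w; rewrite /dU mulr0 c0.
have UE w t : U w t = chart p (cw w (lam w * t)) by [].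
clearbody U dU.
pose h w := T^-1 *: (U w T - y0).
have T00' : 0 <= T <= T by rewrite (ltW T1) lexx.
have lip w w' : `|w - 0| <= 1 -> `|w' - 0| <= 1 -> `|h w - h w' - (w - w')| <= 2^-1 * `|w - w'|.
  rewrite !subr0 => w1 w1'.
  have O := @ode_bound R (fun t => U w t - U w' t) (fun t => dU w t - dU w' t) (fun t => - Gam p (U w t) (dU w t) (dU w t)
     - (- Gam p (U w' t) (dU w' t) (dU w' t))) 0 T k (ltW T1) k0.
  rewrite subr0 in O.
  have {}O t : 0 <= t <= T -> `|dU w t - dU w' t - (w - w')| <= 4^-1 * `|w - w'|.
    move=> tT; have [|||_] := O T4 T5 _ _ _ t tT.
    - by move=> s sT; have [d1 _ _] := DU w s w1 sT; have [d2 _ _] := DU w' s w1' sT; exact: is_deriveB d1 d2.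
    - by move=> s sT; have [_ d1 _] := DU w s w1 sT; have [_ d2 _] := DU w' s w1' sT; exact: is_deriveB d1 d2.
    - move=> s sT; have [_ _ b1] := DU w s w1 sT; have [_ _ b2] := DU w' s w1' sT.
      have [_ u1] := inU w s w1 sT; have [_ u2] := inU w' s w1' sT.
      rewrite -opprD normrN; apply: (Gam_quad_lip (ltW K0) B0 _ _ b1 b2).
        by move=> a b; have [_ h1 _] := H2 _ _ a b (lt_trans u1 rr2) (lt_trans u1 rr2).
      by move=> a b; have [_ _ h1] := H2 _ _ a b (lt_trans u1 rr2) (lt_trans u2 rr2).
    cbv beta; rewrite (U0 w) (U0 w') (dU0 w) (dU0 w') subrr normr0 add0r => /le_trans; apply.
    have -> : 2 * k * T * `|w - w'| = (2 * (k * T)) * `|w - w'| by ring.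
    by rewrite ler_wpM2r //; move: T4; clear; lra.
  have := @derive_bound_norm R 2 (fun t => U w t - U w' t - t *: (w - w')) (fun t => dU w t - dU w' t - (w - w'))
    0 T (4^-1 * `|w - w'|) (ltW T1).
  rewrite mulr_ge0 // => /(_ isT) BN.
  have {}BN : `|U w T - U w' T - T *: (w - w')| <= 4^-1 * `|w - w'| * T.
    have := BN _ O; rewrite !U0 subrr scale0r !subr0; apply.
    move=> t tT; have [d1 _ _] := DU w t w1 tT; have [d2 _ _] := DU w' t w1' tT.
    have dl : is_derive t 1 (fun t : R => t *: (w - w')) (w - w').
      have := @is_derive_affine R 0 (w - w') t.
      by rewrite (_ : (fun s : R => _) = fun s : R => s *: (w - w')) //; apply/funext => s; rewrite add0r.
    exact: is_deriveB (is_deriveB d1 d2) dl.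
  have -> : h w - h w' - (w - w') = T^-1 *: (U w T - U w' T - T *: (w - w')).
    have hd : h w - h w' = T^-1 *: (U w T - U w' T) by rewrite /h -scalerBr opprB addrA subrK.
    by rewrite hd [RHS]scalerBr scalerA mulVf ?gt_eqF // scale1r.
  rewrite normrZ gtr0_norm ?invr_gt0 // mulrC ler_pdivrMr //; apply: le_trans BN _.
  by rewrite ler_wpM2r ?(ltW T1) // ler_wpM2r // lef_pV2 ?posrE // ler_nat.
have T8 : 0 < m * (T / 8) by rewrite mulr_gt0 // divr_gt0.
exists (Num.min (m * r3) (m * (T / 8))); first by rewrite lt_min T8 mulr_gt0.
move=> q; rewrite lt_min => /andP[q1 q2].
have [||dq qn] := Hd p q pi; [by rewrite subrr normr0|exact: q1|].
have qn8 : `|chart p q - y0| <= T / 8 by rewrite -(ler_pM2l m0); exact: le_trans qn (ltW q2).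
have h00 : h 0 = 0.
  by rewrite /h UE /lam bf0l sqrtr0 mul0r; have [_ -> _] := Hcw 0; rewrite subrr scaler0.
have [|w w1 hw] := @near_identity_surjective R h 0 1 (T^-1 *: (chart p q - y0)) ltr01 lip.
  rewrite h00 subr0 normrZ gtr0_norm ?invr_gt0 // mulrC ler_pdivrMr //.
  by rewrite mul1r [_ * T]mulrC.
rewrite subr0 in w1.
have UT : U w T = chart p q.
  have := congr1 (fun z => T *: z) hw; rewrite /h !scalerA divff ?gt_eqF // !scale1r => /(congr1 (fun z => z + y0)).
  by rewrite !subrK.
have [C c0 _] := Hcw w; have [dw _] := inU w T w1 T00'.
have cq : cw w (lam w * T) = q by rewrite -(chartK dw) -UE UT chartK.
have lT : 0 <= lam w * T by rewrite mulr_ge0 // ltW.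
have lT0 : 0 <= lam w * T <= T0.
  by rewrite lT; apply: le_trans T2; rewrite ler_pM2r //; exact: LaE.
have s1 := cal _ _ (Scw w) c0 lT0; have s2 := sol_dist (Scw w) lT.
rewrite c0 subr0 in s2; rewrite cq in s1 s2.
exists (cw w); split=> //; have -> : dist p q = lam w * T; last exact: cq.
by apply/le_anti; rewrite s1 s2.
Qed.

Lemma dist_continuous p : continuous (dist p).
Proof.
move=> x; apply/cvgrPdist_lt => e e0; apply: filterS (near_dist g x e0) => y.
by apply: le_lt_trans; apply: le_trans (dist_diff g p x p y) _; rewrite dist_refl add0r.
Qed.

Lemma sphere_cross p q (L a : R) : reach g p q L -> 0 <= a <= dist p q ->
  exists x, dist p x = a /\ dist p x + dist x q <= L.
Proof.
move=> [c [e [H [h [[e0 C] c0 c1 DH HL]]]]] a01.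
have cc t : 0 <= t <= 1 -> {for t, continuous (fun t => dist p (c t))}.
  move=> t01; apply: (@continuous_comp _ _ _ c (dist p)); last exact: dist_continuous.
  by apply: C1_continuous C _; exact: in_unit_itv.
have [||t] := @IVT R (fun t => dist p (c t)) 0 1 a ler01.
  by apply: within_continuous_in => t; rewrite /= in_itv /=; exact: cc.
  rewrite c0 c1 dist_refl (min_idPl (dist_ge0 g p q)) (max_idPr (dist_ge0 g p q)) //.
rewrite in_itv /= => t01 ta; exists (c t); split=> //.
have oA : open (`]- e, 1 + e[%classic : set R) by exact: interval_open.
have /andP[t0 t1] := t01.
have r1 : reach g (c 0) (c t) (H t - H 0).
  apply: (reach_sub oA C t0) => x /andP[x1 x2]; first by apply: in_unit_itv => //; rewrite x1 (le_trans x2 t1).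
  by apply: DH; rewrite x1 (le_trans x2 t1).
have r2 : reach g (c t) (c 1) (H 1 - H t).
  apply: (reach_sub oA C t1) => x /andP[x1 x2]; first by apply: in_unit_itv => //; rewrite x2 (le_trans t0 x1).
  by apply: DH; rewrite x2 (le_trans t0 x1).
have := dist_le r1; have := dist_le r2; rewrite c0 c1; move: HL; clear; lra.
Qed.

(** Almost shortest curves from [p] to [q] cross the sphere of radius [rho], which is compact
    because it lies in a chart. A point of the sphere closest to [q] therefore splits the distance
    exactly. *)
Lemma sphere_min p q : exists2 rho0 : R, 0 < rho0 & forall rho, 0 < rho -> rho < rho0 -> rho <= dist p q ->
  exists x, dist p x = rho /\ dist x q = dist p q - rho.
Proof.
have pi := dom_center p; have cy : cod p (chart p p) := chart_cod pi.
have [r [m [r0 m0 H1 Hd]]] := dist_local g cy.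
exists (m * r); first by rewrite mulr_gt0.
move=> rho rho0 rhor rhod.
pose K := param p @` [set y | `|y - chart p p| <= rho / m] `&` [set x | dist p x = rho].
have rm : 0 < rho / m by rewrite divr_gt0.
have rmr : rho / m < r by rewrite ltr_pdivrMr // mulrC.
have cK : compact K.
  apply: compact_closedI.
    apply: continuous_compact; last exact: compact_norm_ball.
    apply: within_continuous_in => y /= yr; apply: param_continuous; apply: H1; exact: le_lt_trans yr rmr.
  apply: (@closed_comp _ _ (dist p) [set rho]); first by move=> x _; exact: dist_continuous.
  exact: closed_eq.
have inK x : dist p x = rho -> K x.
  move=> dx; split=> //; have [||dx1 dx2] := Hd p x pi; first by rewrite subrr normr0.
    by rewrite dx.
  exists (chart p x); last by rewrite chartK.
  by rewrite /= ler_pdivlMr // mulrC -dx.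
have cross (e : R) : 0 < e -> exists x, K x /\ rho + dist x q <= dist p q + e.
  move=> e0; have pq : reach g p q (dist p q + e) by apply: dist_lt; rewrite ltrDl.
  have [|x [xr xl]] := sphere_cross pq (a := rho); first by rewrite (ltW rho0).
  by exists x; split; [exact: inK|rewrite -xr].
have K0 : K !=set0 by have [x [Kx _]] := cross 1 ltr01; exists x.
have [|x /set_mem Kx Hx] := @compact_EVT_min M R (fun x => dist x q) K K0 cK.
  apply/continuous_subspaceT => x; rewrite (_ : (fun x => dist x q) = dist q); first exact: dist_continuous.
  by apply/funext => z; exact: dist_sym.
exists x; have [_ dx] := Kx; split=> //; apply/le_anti; apply/andP; split.
  rewrite lerBrDl; apply/ler_addgt0Pr => e e0; have [z [Kz zl]] := cross e e0.
  by apply: le_trans zl; rewrite lerD2l; apply: Hx; exact: mem_set.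
by have := dist_triangle g p x q; rewrite dx; clear; lra.
Qed.

(** The squared norm of [v - w] equals [2 - 2 <w, v>], which is not positive. *)
Lemma unit_cauchy i y v w : cod i y -> bf (G i y) v v = 1 -> bf (G i y) w w = 1 ->
  1 <= bf (G i y) w v -> v = w.
Proof.
move=> cy v1 w1 h; apply/eqP; rewrite -subr_eq0; apply/negPn/negP => n0.
have := Gm_gt0 g cy n0; rewrite !bfBl !bfBr v1 w1 (GmC g i y v w); move: h; clear.
by move: (bf _ _ _) => x; lra.
Qed.

(* Cutting the corner at [c t0] would shorten the broken geodesic. *)
Lemma no_corner c b (t0 rho : R) : sol g c -> sol g b -> b 0 = c t0 -> 0 < rho ->
  (exists2 d : R, 0 < d & forall s, 0 < s < d -> s + rho <= dist (c (t0 - s)) (b rho)) ->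
  dchart (c t0) c t0 = dchart (c t0) b 0.
Proof.
move=> Sc Sb bc rho0 [d d0 Hd]; set i := c t0; have ci : dom i (c t0) := dom_center _.
have bi : dom i (b 0) by rewrite bc.
set y0 := chart i (c t0); have cy : cod i y0 := chart_cod ci.
have [cc Dc _ vn] := Sc t0 i ci; have [_ _ _ wn] := Sb 0 i bi.
rewrite bc -/y0 in wn; rewrite -/y0 in vn.
set v := dchart i c t0 in Dc vn *; set w := dchart i b 0 in wn *.
apply: (unit_cauchy cy vn wn); rewrite leNgt; apply/negP => gam.
have [L0 L00 FV] := first_variation Sb bi.
have LL : 0 < Num.min L0 rho <= L0 by rewrite lt_min L00 rho0 ge_min lexx.
have Lr : Num.min L0 rho <= rho by rewrite ge_min lexx orbT.
have [r [C [r0 C0 {}FV]]] := FV _ LL.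
move: (Num.min L0 rho) LL Lr FV => L /andP[Lp _] Lr FV.
rewrite bc -/y0 -/w add0r in FV.
pose Kw := 4 * `|G i y0| * `|w|; have Kw0 : 0 <= Kw by rewrite !mulr_ge0.
have Kwb z : `|bf (G i y0) w z| <= Kw * `|z| by exact: bf_norm_le.
set ga := bf (G i y0) w v in gam.
(* The linearisation error of [c], through [ep], and the quadratic term of the first variation each
   consume a quarter of the gap [1 - ga], so that half of it remains. *)
have [ep [ep0 ep1 ep2]] : exists ep : R, [/\ 0 < ep, ep <= 1 & Kw * ep <= (1 - ga) / 4].
  have k1 : 0 < 4 * (Kw + 1) by rewrite mulr_gt0 // ltr_wpDl.
  exists (Num.min 1 ((1 - ga) / (4 * (Kw + 1)))); split.
  - by rewrite lt_min ltr01 divr_gt0 // subr_gt0.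
  - by rewrite ge_min lexx.
  - apply: (@le_trans _ _ ((Kw + 1) * ((1 - ga) / (4 * (Kw + 1))))).
      apply: ler_pM => //; [by rewrite le_min ler01 divr_ge0 ?subr_ge0 ?ltW|by rewrite lerDl|by rewrite ge_min lexx orbT].
    by rewrite le_eqVlt; apply/orP; left; apply/eqP; field; rewrite gt_eqF // ltr_wpDl.
have DF : is_derive (0 : R) 1 (fun s : R => chart i (c (t0 - s)) + s *: v) 0.
  have dl : is_derive (0 : R) 1 (fun s : R => t0 - s) (-1).
    by apply: is_derive_eq; rewrite /GRing.scale /=; ring.
  have Dc' : is_derive (t0 - 0) 1 (chart i \o c) v by rewrite subr0.
  have d1 := is_derive_time (tau := fun s : R => t0 - s) dl Dc'.
  have d2 := @is_derive_affine R 0 v 0.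
  apply: (is_derive_subst (f := (fun s : R => chart i (c (t0 - s)) + s *: v))); last first.
    by rewrite -(addNr v) -[in X in X + _](scaleN1r v).
  rewrite (_ : (fun s : R => chart i (c (t0 - s)) + s *: v) = ((chart i \o c) \o (fun s : R => t0 - s)) + (fun s : R => 0 + s *: v)).
    exact: is_deriveD d1 d2.
  by apply/funext => s; rewrite !fctE /= add0r.
have ndom : \forall s \near (0 : R), dom i (c (t0 - s)).
  have cl : {for 0, continuous (fun s : R => c (t0 - s))}.
    apply: (@continuous_comp _ _ _ (fun s : R => t0 - s) c); last by rewrite subr0; exact: cc.
    have dl : is_derive (0 : R) 1 (fun s : R => t0 - s) (-1).
      by apply: is_derive_eq; rewrite /GRing.scale /=; ring.
    exact: is_derive_continuous dl.
  by apply: near_dom cl _; rewrite subr0.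
have nF := (is_derive0P _ _).1 DF ep ep0.
have [s1 s10 Hs] := (near_normP _ _).1 (filterI ndom nF).
pose nv := `|v| + 1; have nv0 : 0 < nv by rewrite ltr_wpDl.
have [s [sp ss1 sd sr sC]] : exists s : R, [/\ 0 < s, s < s1, s < d, s * nv < r & C * (s * nv ^+ 2) <= (1 - ga) / 4].
  pose a1 := (1 - ga) / 4 / (C * nv ^+ 2).
  have a10 : 0 < a1 by rewrite !divr_gt0 ?subr_gt0 // mulr_gt0 // exprn_gt0.
  have [|s [sp ss1 sd sr sa]] := lt_min4 s10 d0 (_ : 0 < r / nv) a10; first by rewrite divr_gt0.
  by exists s; split; rewrite -?ltr_pdivlMr // mulrCA -ler_pdivlMr ?mulr_gt0 ?exprn_gt0 // ltW.
have [|dcs] := Hs s; first by rewrite subr0 gtr0_norm.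
rewrite !subr0 scale0r addr0 -/y0 (gtr0_norm sp) => cs.
pose ds := chart i (c (t0 - s)) - y0; pose rs := ds + s *: v.
have rsn : `|rs| <= ep * s by rewrite /rs /ds addrAC.
have dsE : ds = rs - s *: v by rewrite /rs addrK.
have dsn : `|ds| <= s * nv.
  rewrite dsE; apply: le_trans (ler_normB _ _) _; rewrite normrZ (gtr0_norm sp) /nv mulrDr mulr1 addrC lerD2l.
  by apply: le_trans rsn _; rewrite ler_piMl // ltW.
have [|_ fv] := FV ds; first exact: le_lt_trans dsn sr.
rewrite {1}/ds addrC subrK chartK // in fv.
have hd := Hd s (introT andP (conj sp sd)).
have tri := dist_triangle g (c (t0 - s)) (b L) (b rho).
have dbb := sol_dist Sb Lr.
have dq : C * `|ds| ^+ 2 <= s * ((1 - ga) / 4).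
  have snv : 0 <= s * nv := le_trans (normr_ge0 _) dsn.
  have h1 : `|ds| ^+ 2 <= (s * nv) ^+ 2 by rewrite !expr2; exact: ler_pM.
  apply: (@le_trans _ _ (C * (s * nv) ^+ 2)); first by rewrite ler_pM2l.
  by rewrite (_ : C * (s * nv) ^+ 2 = s * (C * (s * nv ^+ 2))) ?ler_pM2l //; ring.
have gw : - bf (G i y0) w ds <= s * ga + s * ((1 - ga) / 4).
  have h1 : `|bf (G i y0) w rs| <= Kw * (ep * s) by apply: le_trans (Kwb rs) _; rewrite ler_wpM2l.
  have h2 : - bf (G i y0) w rs <= Kw * (ep * s).
    by apply: le_trans h1; rewrite -normrN; exact: ler_norm.
  rewrite dsE bfBr bfZr -/ga opprB lerD2l; apply: (le_trans h2).
  by rewrite mulrA mulrC ler_pM2l.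
have sg : 0 < s * (1 - ga) by rewrite mulr_gt0 // subr_gt0.
move: fv hd tri dbb dq gw sg; rewrite mulrBr mulr1.
have -> : s * ((1 - ga) / 4) = (s - s * ga) / 4 by ring.
move: (dist _ _) (dist _ _) (dist _ _) (C * _) (bf _ _ _) (s * ga); clear.
by move=> x1 x2 x3 x4 x5 x6; lra.
Qed.

(** A short step from [p] to a point that splits the distance to [q] determines [c]. At a later time
    another such step starts from [c t]; it forms no corner with [c], hence continues it by
    uniqueness, and [dist (c t) q <= D - t] propagates up to [D]. *)
Lemma hopf_rinow p q : complete g -> p <> q ->
  exists c, [/\ geodesic_on g [set: R] c, c 0 = p & c (dist p q) = q].
Proof.
move=> cpl pq; set D := dist p q.
have D0 : 0 < D.
  by rewrite lt_neqAle dist_ge0 andbT eq_sym; apply/eqP => /dist_eq0.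
have step x : 0 < dist x q -> exists rho b, [/\ 0 < rho, rho <= dist x q, geodesic_on g [set: R] b, b 0 = x
    & dist (b rho) q = dist x q - rho].
  move=> xq; have [r1 r10 S1] := short_geodesic x cpl; have [r2 r20 S2] := sphere_min x q.
  have [mn [mn0 m1 m2 m3]] := lt_min3 r10 r20 xq.
  have [z [z1 z2]] := S2 _ mn0 m2 (ltW m3); have [|b [gb b0 bz]] := S1 z; first by rewrite z1.
  by exists mn, b; split; [|exact: ltW| | |rewrite -z1 bz z1].
have [rho [c [rho0 rhoD gc c0 crho]]] := step p D0.
have Sc := geodesic_sol gc.
have along b x (s r : R) : sol g b -> 0 <= s <= r -> dist (b r) q <= x - r -> dist (b s) q <= x - s.
  move=> Sb /andP[s0 sr] h; have := dist_triangle g (b s) (b r) q; have := sol_dist Sb sr.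
  by move: h; clear; lra.
have P : forall t, 0 <= t <= D -> dist (c t) q <= D - t.
  apply: real_induction; first exact: ltW.
  - by rewrite c0 subr0.
  (* At time 0 nothing lies behind the point for [no_corner] to compare with; there the first step
     itself gives the bound. *)
  - move=> t /andP[t0 tD] Pt; have [t0'|tp] := leP t 0.
      have -> : t = 0 by apply/le_anti; rewrite t0 t0'.
      exists rho; first exact: rho0.
      move=> s; rewrite add0r => sr _; apply: (along c D s rho Sc sr).
      by rewrite crho.
    have ct : dist (c t) q = D - t.
      apply/le_anti; rewrite Pt /=.
      have := dist_triangle g p (c t) q; have := sol_dist Sc t0; rewrite c0 -/D; clear; lra.
    have [|r [b [r0 rD gb b0 br]]] := step (c t); first by rewrite ct subr_gt0.
    have Sb := geodesic_sol gb.
    have NC : dchart (c t) c t = dchart (c t) b 0.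
      apply: (no_corner Sc Sb b0 r0); exists t => // s /andP[s0 st].
      have h1 : dist p (c (t - s)) <= t - s.
        rewrite -c0; have ts : 0 <= t - s by rewrite subr_ge0 ltW.
        by have := sol_dist Sc ts; rewrite subr0.
      have h2 := dist_triangle g p (c (t - s)) q; have h3 := dist_triangle g (c (t - s)) (b r) q.
      by move: h1 h2 h3; rewrite br ct -/D; clear; lra.
    have e2 : (1 : R) ^+ 2 = 1 by rewrite expr1n.
    have [Sct _] := sol_affine t e2 Sc.
    have t0E : t + 1 * 0 = t by ring.
    have bt s : b s = c (t + 1 * s).
      apply: (sol_unique Sb Sct); first by rewrite b0 t0E.
      exists (c t); rewrite t0E; split; first exact: dom_center.
      by rewrite (dchart_affine e2 Sc t0E (dom_center _)) scale1r.
    exists r; first exact: r0.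
    move=> s /andP[ts st] sD; have bs : b (s - t) = c s by rewrite bt mul1r addrC subrK.
    have := along b (D - t) (s - t) r Sb; rewrite br ct bs opprB addrA subrK; apply; last by [].
    by apply/andP; split; move: ts st; clear; lra.
  - move=> t /andP[t0 tD] Pt; apply/ler_addgt0Pr => e e0.
    have e2 : 0 < e / 2 by [rewrite divr_gt0]; have [s [s1 s2 s3]] := left_close t0 e2; have := Pt s (introT andP (conj s1 s2)).
    have := dist_triangle g (c t) (c s) q; have := sol_dist Sc (ltW s2); rewrite (dist_sym g (c s)).
    by move: s3; clear; lra.
exists c; split=> //; apply: (dist_eq0 (g := g)); apply/le_anti; rewrite dist_ge0 andbT.
by have := P D; rewrite (ltW D0) lexx subrr => /(_ isT).
Qed.

End HopfRinow.

(** * Segments *)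

Section Connected.
Context {R : realType} {V : normedModType R}.
Implicit Types (x y z v : V) (A : set V).

Definition segment x y : set V := (fun t : R => x + t *: (y - x)) @` `[0, 1].

Lemma segment_l x y : segment x y x.
Proof. by exists 0; rewrite ?scale0r ?addr0 //= in_itv /= lexx ler01. Qed.

Lemma segment_r x y : segment x y y.
Proof. by exists 1; rewrite ?scale1r ?[x + _]addrC ?subrK //= in_itv /= lexx ler01. Qed.

Lemma line_continuous x v : continuous (fun t : R => x + t *: v).
Proof.
move=> t; have d := @is_derive_line R V V id x v t; apply: is_derive_continuous.
by apply: d; exact: ex_diff.
Qed.

Lemma segment_connected x y : connected (segment x y).
Proof.
apply: connected_continuous_connected.
  by apply/connected_intervalP; exact: interval_is_interval.
exact/continuous_subspaceT/line_continuous.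
Qed.

Lemma compact_segment x y : compact (segment x y).
Proof.
apply: continuous_compact; last exact: segment_compact.
exact/continuous_subspaceT/line_continuous.
Qed.

Lemma ball_segment x (r : R) y z u : `|y - x| < r -> `|z - x| < r -> segment y z u -> `|u - x| < r.
Proof. by move=> yr zr [t] /=; rewrite in_itv /= => t01 <-; exact: seg_ball. Qed.

Lemma connectedU2 A B z : connected A -> connected B -> A z -> B z -> connected (A `|` B).
Proof. by move=> cA cB Az Bz; apply: connectedU => //; exists z. Qed.

End Connected.

(** * A mountain pass principle on the periodic strip *)

Section MountainPass.
Context {R : realType}.
Local Notation P := (R * R)%type.
Variables (d : P -> R) (T : R).
Implicit Types (x y z : P) (w : R) (C : set P).

Definition strip : set P := [set x | x.1 <= x.2 <= x.1 + T].
Definition sublevel w : set P := [set x | strip x /\ d x <= w].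

(** Near [x] the set [d < W] is present and, as far as linking strictly below [W] is concerned, in
    one piece. The joining set [C] may leave [U]; only its level matters. A single bound [w < W] for
    each [C] keeps finite unions below [W]. *)
Definition pass_free W x := closure [set y | strip y /\ d y < W] x /\
  exists2 U, nbhs x U & forall y z, U y -> U z -> strip y -> strip z -> d y < W -> d z < W ->
  exists w C, [/\ w < W, connected C, C y /\ C z & C `<=` sublevel w].

Hypotheses (T0 : 0 < T) (dc : continuous d).
Hypothesis d_edge1 : forall t, d (t, t) = 0.
Hypothesis d_edge2 : forall t, d (t, t + T) = 0.
Hypothesis d_pos : forall x, x.1 < x.2 < x.1 + T -> 0 < d x.
Hypothesis d_per : forall t s, d (t + T, s + T) = d (t, s).

Definition linked w := exists C, [/\ connected C, C `<=` sublevel w,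
  exists t, C (t, t) & exists t, C (t, t + T)].
Definition level := inf [set w | linked w].
Let W := level.

(** The points linked to the first edge strictly below the min-max level. The second edge has none,
    by the definition of [level]. *)
Definition low : set P := [set y | exists w C, [/\ w < W, connected C, C `<=` sublevel w,
  C y & exists t, C (t, t)]].

Lemma shift_continuous (a : R) : continuous (fun x : P => (x.1 + a, x.2 + a)).
Proof.
move=> x; rewrite (_ : (fun x : P => _) = fun x => x + (a, a)) //.
by apply: cvgD; [exact: cvg_id|exact: cvg_cst].
Qed.

Lemma strip_shift (a : R) x : strip (x.1 + a, x.2 + a) <-> strip x.
Proof. by rewrite /strip /=; split=> /andP[h1 h2]; apply/andP; split; lra. Qed.

Definition per (a : R) := forall x, d (x.1 + a, x.2 + a) = d x.

Lemma shiftK (a : R) x : ((x.1 - a, x.2 - a).1 + a, (x.1 - a, x.2 - a).2 + a) = x.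
Proof. by rewrite /= !subrK; case: x. Qed.

Lemma perN a : per a -> per (- a).
Proof. by move=> pa x; rewrite -(pa (x.1 - a, x.2 - a)) shiftK. Qed.

Lemma per_nat (n : nat) : per (n%:R * T).
Proof.
elim: n => [|n IH] x; first by rewrite mul0r !addr0; case: x.
rewrite -natr1 mulrDl mul1r !addrA.
by rewrite d_per -[RHS]IH.
Qed.

Lemma per_int (n : int) : per (n%:~R * T).
Proof.
case: n => n; first exact: per_nat.
by rewrite NegzE mulrNz mulNr; apply: perN; exact: per_nat.
Qed.

Lemma low_shift a x : per a -> low x -> low (x.1 + a, x.2 + a).
Proof.
move=> pa [w [C [wW cC Cw Cx [t Ct]]]].
exists w, ((fun x : P => (x.1 + a, x.2 + a)) @` C); split=> //.
- by apply: connected_continuous_connected => //; apply/continuous_subspaceT; exact: shift_continuous.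
- by move=> _ [y /Cw[sy dy] <-]; split; [exact/strip_shift|rewrite pa].
- by exists x.
- by exists (t + a), (t, t).
Qed.

(** With [low] or its complement for [Q], these are the two sides into which the sublevel set falls
    if all its points are pass-free. A point at level [W] belongs to a side according to the points
    strictly below [W] around it. *)
Definition side (Q : set P) : set P := [set x | sublevel W x /\
  \forall y \near x, strip y -> d y < W -> Q y].

Lemma near_shift2 a x (Q : P -> Prop) : (\forall y \near x, Q y) ->
  \forall y \near (x.1 + a, x.2 + a), Q (y.1 - a, y.2 - a).
Proof.
move=> nQ; have := @shift_continuous (- a) (x.1 + a, x.2 + a); rewrite /continuous_at /=.
by rewrite -!addrA !subrr !addr0 => h; apply: h; case: x nQ.
Qed.

Definition shift_closed (Q : set P) := forall a x, per a -> Q x -> Q (x.1 + a, x.2 + a).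

Lemma highC_shift : shift_closed (~` low).
Proof.
move=> a x pa nl lx; apply: nl; have := low_shift (perN pa) lx.
by rewrite /= !addrK; case: x {lx}.
Qed.

Lemma side_shift Q : shift_closed Q -> shift_closed (side Q).
Proof.
move=> Qs a x pa [[sx dx] nx]; split; first by split; [exact/strip_shift|rewrite pa].
apply: filterS (near_shift2 a nx) => y h sy dy; rewrite -(shiftK a y).
by apply: (Qs) => //; apply: h; [exact/strip_shift|rewrite (perN pa)].
Qed.

(** In a small ball around such a point segments stay in the strip, which is convex, and below a
    level between [d x] and [W]. *)
Lemma below_pass_free x : strip x -> d x < W -> pass_free W x.
Proof.
move=> sx dx; split; first by apply: subset_closure.
have m0 : d x < (d x + W) / 2 < W by apply/andP; split; lra.
have /andP[m1 m2] := m0.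
have nw : \forall y \near x, d y < (d x + W) / 2 by exact: (dc (lt_nbhsl m1)).
have [r r0 H] := (near_normP x _).1 nw.
exists [set y | `|y - x| < r]; first by apply: (@near_ball _ _ x); rewrite subrr normr0.
move=> u1 u2 n1 n2 su1 su2 d1 d2.
exists ((d x + W) / 2), (segment u1 u2); split=> //.
- exact: segment_connected.
- by split; [exact: segment_l|exact: segment_r].
- move=> z zs; split; last by apply: ltW; apply: H; apply: ball_segment zs.
  case: zs => t; rewrite /= in_itv /= => /andP[t0 t1] <-.
  move: su1 su2; rewrite /strip /= /GRing.scale /= => /andP[a1 a2] /andP[b1 b2].
  by apply/andP; split; nra.
Qed.

Lemma low_trans y z w C : w < W -> connected C -> C y -> C z -> C `<=` sublevel w ->
  low y -> low z.
Proof.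
move=> wW cC Cy Cz Cw [w' [C' [w'W cC' C'w C'y [t Ct]]]].
exists (Num.max w w'), (C `|` C'); split.
- by rewrite gt_max wW.
- exact: (connectedU2 cC cC' Cy C'y).
- by move=> u [/Cw|/C'w] [su du]; split=> //; rewrite le_max du ?orbT.
- by left.
- by exists t; right.
Qed.

Lemma pass_free_side x : strip x -> d x <= W -> pass_free W x -> side low x \/ side (~` low) x.
Proof.
move=> sx dx [cl [U nU HU]].
have [y [[sy dy] Uy]] := cl U nU.
have [ly|nly] := pselect (low y); [left|right]; split=> //; apply: filterS nU => z Uz sz dz.
  have [w [C [wW cC [Cy Cz] Cw]]] := HU y z Uy Uz sy sz dy dz.
  exact: (low_trans wW cC Cy Cz Cw ly).
move=> lz; apply: nly; have [w [C [wW cC [Cy Cz] Cw]]] := HU y z Uy Uz sy sz dy dz.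
exact: (low_trans wW cC Cz Cy Cw lz).
Qed.

Lemma side_disjoint x : side low x -> side (~` low) x -> closure [set y | strip y /\ d y < W] x -> False.
Proof.
move=> [_ h1] [_ h2] cl; have [y [[sy dy] [k1 k2]]] := cl _ (filterI h1 h2).
exact: (k2 sy dy (k1 sy dy)).
Qed.

Lemma reduce (a : R) : exists2 b, per b & 0 <= a + b <= T.
Proof.
exists ((- Num.floor (a / T))%:~R * T); first exact: per_int.
have /andP[h1 h2] := floor_itv (a / T).
rewrite rmorphN /= mulNr; rewrite ler_pdivlMr // in h1.
rewrite intrD ltr_pdivrMr // mulrDl mul1r in h2.
by apply/andP; split; lra.
Qed.

Lemma pair_continuous (b c : R) : continuous (fun s : R => (s + b, s + c)).
Proof.
by move=> s; exact: cvg_pair (cvgD cvg_id (cvg_cst b)) (cvgD cvg_id (cvg_cst c)).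
Qed.

Lemma vertical_continuous (b : R) : continuous (fun s : R => (b, s)).
Proof.
by move=> s; exact: cvg_pair (cvg_cst b) cvg_id.
Qed.

Lemma gap_continuous : continuous (fun x : P => x.2 - x.1).
Proof. by move=> x; apply: cvgB; [exact: cvg_snd|exact: cvg_fst]. Qed.

Lemma strip_edge1 t : strip (t, t).
Proof. by rewrite /strip /= lexx lerDl ltW. Qed.

Lemma strip_edge2 t : strip (t, t + T).
Proof. by rewrite /strip /= lexx lerDl ltW. Qed.

Lemma linked_nonempty : exists w, linked w.
Proof.
have [||c cT Hc] := @EVT_max R (fun s => d (0, s)) 0 T; first exact: ltW.
  apply/continuous_subspaceT => s; apply: (@continuous_comp _ _ _ (fun s : R => (0, s)) d s).
    exact: vertical_continuous.
  exact: dc.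
exists (d (0, c)), ((fun s : R => (0, s)) @` `[0, T]); split.
- apply: connected_continuous_connected; first by apply/connected_intervalP; exact: interval_is_interval.
  exact/continuous_subspaceT/vertical_continuous.
- by move=> _ [s sT <-]; split; [move: sT; rewrite /strip /= in_itv /= add0r|exact: Hc].
- by exists 0, 0; rewrite //= in_itv /= lexx ltW.
- by exists 0, T; rewrite /= ?in_itv /= ?lexx ?ltW // add0r.
Qed.

Lemma linked_mid w C : connected C -> C `<=` sublevel w -> (exists t, C (t, t)) ->
  (exists t, C (t, t + T)) -> exists t, C (t, t + T / 2).
Proof.
move=> cC Cw [t Ct] [s Cs].
have cI : connected ((fun x : P => x.2 - x.1) @` C).
  by apply: connected_continuous_connected => //; exact/continuous_subspaceT/gap_continuous.
have I := (connected_intervalP _).1 cI.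
have [|||z Cz zT] := I 0 T _ _ (T / 2).
- by exists (t, t) => //=; rewrite subrr.
- by exists (s, s + T) => //=; rewrite addrC addKr.
- by rewrite divr_ge0 ?(ltW T0) //= ler_pdivrMr // ler_peMr ?(ltW T0) // ler1n.
by exists z.1; rewrite -zT addrC subrK; case: z Cz {zT}.
Qed.

(** A linking set crosses the middle line of the strip, the gap [x.2 - x.1] being continuous on it,
    and on that line [d] is periodic with a positive minimum. *)
Lemma linked_lbound : exists2 mu, 0 < mu & forall w, linked w -> mu <= w.
Proof.
have [||c cT Hc] := @EVT_min R (fun s => d (s + 0, s + T / 2)) 0 T; first exact: ltW.
  apply/continuous_subspaceT => s; apply: (@continuous_comp _ _ _ (fun s : R => (s + 0, s + T / 2)) d s).
    exact: pair_continuous.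
  exact: dc.
exists (d (c + 0, c + T / 2)).
  apply: d_pos; rewrite /= addr0; apply/andP; split; rewrite ?ltrDl ?ltrD2l ?divr_gt0 //.
  exact: half_lt.
move=> w [C [cC Cw C1 C2]]; have [t Ct] := linked_mid cC Cw C1 C2.
have [b pb tb] := reduce t; have [_ dw] := Cw _ Ct.
apply: le_trans dw; rewrite -(pb (t, _)) /=.
have := Hc (t + b); rewrite in_itv /= tb addr0 => /(_ isT).
by rewrite addr0 [t + T / 2 + b]addrAC.
Qed.

Lemma level_gt0 : 0 < W.
Proof.
have [mu mu0 H] := linked_lbound; apply: lt_le_trans mu0 _.
by apply: lb_le_inf; [exact: linked_nonempty|move=> w /H].
Qed.

Lemma level_le w : linked w -> W <= w.
Proof. by move=> lw; apply: ge_inf => //; have [mu _ H] := linked_lbound; exists mu => v /H. Qed.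

Lemma level_approx w : W < w -> exists2 w', linked w' & w' < w.
Proof.
move=> Ww; have hi : has_inf [set w | linked w].
  by split; [exact: linked_nonempty|have [mu _ H] := linked_lbound; exists mu => v /H].
have e0 : 0 < w - W by rewrite subr_gt0.
by have [w' lw' h] := inf_adherent e0 hi; exists w' => //; move: h; rewrite addrC subrK.
Qed.

Lemma low_edge t : low (t, t).
Proof.
exists 0, [set (t, t)]; split=> //; [exact: level_gt0|exact: connected1| |by exists t].
by move=> _ ->; split; [exact: strip_edge1|rewrite d_edge1].
Qed.

Lemma not_low_edge t : ~ low (t, t + T).
Proof.
move=> [w [C [wW cC Cw Ct [s Cs]]]].
have : linked w by exists C; split; [| |exists s|exists t].
by move=> /level_le; rewrite leNgt wW.
Qed.

(** An open neighbourhood of those points around which the sublevel set belongs to [S]. The factor 2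
    is that of the usual separation argument: disjoint sets have disjoint neighbourhoods, by
    [nb_disjoint]. *)
Definition nb (S : set P) : set P := [set z | exists x (r : R), [/\ 0 < r, S x, `|z - x| < r &
  forall y, `|y - x| < 2 * r -> sublevel W y -> S y]].

Lemma nb_open S : open (nb S).
Proof.
rewrite openE => z [x [r [r0 Sx zr H]]]; apply: filterS (near_ball zr) => y yx.
by exists x, r.
Qed.

Lemma nb_shift S : shift_closed S -> shift_closed (nb S).
Proof.
move=> Sa a z pa [x [r [r0 Sx zr H]]]; exists (x.1 + a, x.2 + a), r; split=> //; first exact: Sa.
  have -> : (z.1 + a, z.2 + a) - (x.1 + a, x.2 + a) = z - x; last by [].
  apply/eqP; rewrite -pair_eqE /=; apply/andP; split; apply/eqP => /=; ring.
move=> y yr [sy dy]; rewrite -(shiftK a y); apply: Sa => //; apply: H; last first.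
  by split; [exact/strip_shift|rewrite (perN pa)].
have -> : (y.1 - a, y.2 - a) - x = y - (x.1 + a, x.2 + a); last by [].
apply/eqP; rewrite -pair_eqE /=; apply/andP; split; apply/eqP => /=; ring.
Qed.

Lemma side_nb Q x : side Q x -> nb (side Q) x.
Proof.
move=> lx; have [_ nx] := lx; have [r r0 H] := (near_normP x _).1 (near_join nx).
exists x, (r / 2); split=> //; [by rewrite divr_gt0|by rewrite subrr normr0 divr_gt0|].
by move=> y yr sy; split=> //; apply: H; rewrite mulrC divfK in yr.
Qed.

Lemma nb_disjoint S S' z : (forall x, S x -> sublevel W x) -> (forall x, S' x -> sublevel W x) ->
  (forall x, S x -> S' x -> False) -> nb S z -> nb S' z -> False.
Proof.
move=> SW SW' D [x [r [r0 Sx zr H]]] [x' [r' [r'0 Sx' zr' H']]].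
have E (p q : P) : `|p - q| <= `|z - p| + `|z - q|.
  have := ler_normB (z - q) (z - p); rewrite opprB addrAC.
  by have -> : z + (p - z) = p; [rewrite addrC subrK|rewrite [X in _ <= X -> _]addrC].
have h := E x' x; have h' := E x x'.
have [rr|rr] := leP r' r.
  apply: (D x') => //; apply: H; last exact: SW'.
  by move: zr zr' rr h; lra.
apply: (D x) => //; apply: H'; last exact: SW.
by move: zr zr' rr h'; lra.
Qed.

(** If all points at level [W] were pass-free, the sublevel set of [W] would be covered by the
    disjoint open sets [nl] and [nh], containing one edge each. Every linking set has a point
    outside both, and there the minimum of [d] exceeds [W], although linking sets exist at levels
    arbitrarily close to [W]. *)
Lemma level_point : exists x, [/\ strip x, 0 < d x, d x = W & ~ pass_free W x].
Proof.
apply: contrapT => no.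
have W0 := level_gt0.
have pf x : strip x -> d x <= W -> pass_free W x.
  move=> sx; rewrite le_eqVlt => /orP[/eqP dx|]; last exact: below_pass_free.
  by apply: contrapT => h; apply: no; exists x; split=> //; rewrite dx.
have sides x : sublevel W x -> side low x \/ side (~` low) x.
  by move=> [sx dx]; apply: pass_free_side => //; exact: pf.
have disj x : side low x -> side (~` low) x -> False.
  move=> l h; have [[sx dx] _] := l; have [cl _] := pf x sx dx; exact: side_disjoint l h cl.
pose nl := nb (side low); pose nh := nb (side (~` low)).
have nd z : nl z -> nh z -> False.
  by apply: nb_disjoint disj => x [].
have nl_shift : shift_closed nl by apply: nb_shift; apply: side_shift => a x; exact: low_shift.
have nh_shift : shift_closed nh by apply: nb_shift; apply: side_shift; exact: highC_shift.
have lowE t : nl (t, t).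
  apply: side_nb; have [|//|[_ /nbhs_singleton h]] := sides (t, t).
    by split; [exact: strip_edge1|rewrite d_edge1 ltW].
  exfalso; apply: h; last exact: low_edge; rewrite ?d_edge1 //.
  exact: strip_edge1.
have highE t : nh (t, t + T).
  apply: side_nb; have st := strip_edge2 t.
  have [|[_ /nbhs_singleton h]|//] := sides (t, t + T); first by split=> //; rewrite d_edge2 ltW.
  by have := h st; rewrite d_edge2 => /(_ W0) /not_low_edge.
(* A connected set that meets the disjoint open sets [nl] and [nh] is not covered by them. *)
have between w : linked w -> exists x, [/\ strip x, d x <= w, ~ nl x & ~ nh x].
  move=> [C [cC Cw [t Ct] [s Cs]]]; apply: contrapT => h.
  have cov x : C x -> nl x \/ nh x.
    move=> Cx; apply: contrapT => nx; apply: h; exists x; have [sx dx] := Cw x Cx.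
    by split=> // n; apply: nx; [left|right].
  have := cC (C `&` nl); rewrite predeqE => E.
  have ne : C `&` nl !=set0 by exists (t, t).
  have o1 : exists2 D, open D & C `&` nl = C `&` D.
    by exists (nl) => //; exact: nb_open.
  have o2 : exists2 D, closed D & C `&` nl = C `&` D.
    exists (~` nh); first exact/open_closedC/nb_open.
    rewrite predeqE => x; split=> [[Cx lx]|[Cx hx]]; split=> //; first by move=> /(nd _ lx).
    by have [] := cov x Cx.
  by have [_ /(_ Cs) [_ /nd]] := E ne o1 o2 (s, s + T); apply.
(* Modulo the period the first coordinate lies in [[0, T]], and then the second one in [[0, 2 T]];
   this makes the complement of both sides compact. *)
pose K := [set x | (`[0, T] `*` `[0, 2 * T]) x /\ [/\ strip x, ~ nl x & ~ nh x]].
have K_of x : strip x -> ~ nl x -> ~ nh x -> exists2 y, K y & d y = d x.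
  move=> sx lx hx; have [b pb xb] := reduce x.1.
  exists (x.1 + b, x.2 + b); last exact: pb.
  split; last split.
  - move: sx; rewrite /strip /= !in_itv /= => /andP[h1 h2]; rewrite xb; split=> //.
    by move: xb => /andP[h3 h4]; apply/andP; split; lra.
  - exact/strip_shift.
  - move=> /(nl_shift _ _ (perN pb)) /=; rewrite !addrK => h; apply: lx.
    by case: x h {sx hx xb}.
  - move=> /(nh_shift _ _ (perN pb)) /=; rewrite !addrK => h; apply: hx.
    by case: x h {sx lx xb}.
have cK : compact K.
  have -> : K = (`[0, T] `*` `[0, 2 * T]) `&` ([set x : P | 0 <= x.2 - x.1] `&` [set x : P | x.2 - x.1 <= T]
      `&` (~` nl `&` ~` nh)).
    rewrite predeqE => x; rewrite /K /strip /=; split.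
      move=> [h [/andP[h1 h2] h3 h4]]; split=> //; split; last by split.
      by split=> /=; lra.
    move=> [h [[/= h1 h2] [h3 h4]]]; split=> //; split=> //.
    by apply/andP; split; lra.
  apply: compact_closedI; first by apply: compact_setX; exact: segment_compact.
  apply: closedI; first apply: closedI.
  - by apply: (@closed_comp _ _ (fun x : P => x.2 - x.1) [set y | 0 <= y]) => [x _|]; [exact: gap_continuous|exact: closed_ge].
  - by apply: (@closed_comp _ _ (fun x : P => x.2 - x.1) [set y | y <= T]) => [x _|]; [exact: gap_continuous|exact: closed_le].
  - by apply: closedI; apply: open_closedC; exact: nb_open.
have K0 : K !=set0.
  have [w /between[x [sx _ lx hx]]] := linked_nonempty.
  by have [y Ky _] := K_of x sx lx hx; exists y.
have [|y /set_mem Ky Hy] := compact_EVT_min K0 cK _ (f := d).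
  exact/continuous_subspaceT.
have Wd : W < d y.
  rewrite ltNge; apply/negP => dW; have [_ [sy ly hy]] := Ky.
  by have [/side_nb|/side_nb] := sides y (conj sy dW).
have [w lw wd] := level_approx Wd.
have [x [sx dx lx hx]] := between w lw.
have [z Kz dz] := K_of x sx lx hx.
by have := Hy z (mem_set Kz); rewrite dz => h; have := le_lt_trans (le_trans h dx) wd; rewrite ltxx.
Qed.

End MountainPass.

(** * Orders of vanishing at the origin *)

Section BigO.
Context {R : realType}.
Local Notation V := 'rV[R]_2.

Definition isO (W : normedModType R) (k : nat) (f : V -> W) := exists C r : R,
  [/\ 0 <= C, 0 < r & forall s, `|s| < r -> `|f s| <= C * `|s| ^+ k].

Lemma isO_le (W : normedModType R) k l (f : V -> W) : (k <= l)%N -> isO l f -> isO k f.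
Proof.
move=> kl [C [r [C0 r0 H]]]; exists C, (Num.min r 1); split=> //; first by rewrite lt_min r0 ltr01.
move=> s; rewrite lt_min => /andP[s1 s2]; apply: le_trans (H s s1) _.
by apply: ler_wpM2l C0 _ _ _; apply: ler_wiXn2l (normr_ge0 s) (ltW s2) _ _ kl.
Qed.

Lemma isO_add (W : normedModType R) k (f h : V -> W) : isO k f -> isO k h -> isO k (fun s => f s + h s).
Proof.
move=> [C [r [C0 r0 H]]] [C' [r' [C'0 r'0 H']]].
exists (C + C'), (Num.min r r'); split; [by rewrite addr_ge0|by rewrite lt_min r0|].
move=> s; rewrite lt_min => /andP[s1 s2]; apply: le_trans (ler_normD _ _) _.
by rewrite mulrDl lerD // ?H ?H'.
Qed.

Lemma isO_bilin (W1 W2 W : normedModType R) k l (b : W1 -> W2 -> W) (f : V -> W1) (h : V -> W2) (K : R) :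
  (forall x y, `|b x y| <= K * `|x| * `|y|) -> isO k f -> isO l h -> isO (k + l) (fun s => b (f s) (h s)).
Proof.
move=> Hb [C [r [C0 r0 H]]] [C' [r' [C'0 r'0 H']]].
exists (`|K| * C * C'), (Num.min r r'); split; [by rewrite !mulr_ge0|by rewrite lt_min r0|].
move=> s; rewrite lt_min => /andP[s1 s2]; apply: le_trans (Hb _ _) _.
apply: (@le_trans _ _ (`|K| * `|f s| * `|h s|)); first by rewrite !ler_wpM2r // ler_norm.
have -> : `|K| * C * C' * `|s| ^+ (k + l) = `|K| * (C * `|s| ^+ k) * (C' * `|s| ^+ l) by rewrite exprD; ring.
by apply: ler_pM; rewrite ?mulr_ge0 ?H' // ler_wpM2l // H.
Qed.

Lemma isO_lin (W1 W : normedModType R) k (b : W1 -> W) (f : V -> W1) (K : R) :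
  (forall x, `|b x| <= K * `|x|) -> isO k f -> isO k (fun s => b (f s)).
Proof.
move=> Hb [C [r [C0 r0 H]]]; exists (`|K| * C), r; split; [by rewrite mulr_ge0|by []|].
move=> s s1; apply: le_trans (Hb _) _; apply: (@le_trans _ _ (`|K| * `|f s|)).
  by rewrite ler_wpM2r // ler_norm.
by rewrite -mulrA ler_wpM2l // H.
Qed.

Lemma isO_ext (W : normedModType R) k (f h : V -> W) : (forall s, f s = h s) -> isO k f -> isO k h.
Proof. by move=> E [C [r [C0 r0 H]]]; exists C, r; split=> // s /H; rewrite E. Qed.

Lemma isO_near (W : normedModType R) k (f h : V -> W) (r : R) : 0 < r -> (forall s, `|s| < r -> f s = h s) ->
  isO k f -> isO k h.
Proof.
move=> r0 E [C [r' [C0 r'0 H]]]; exists C, (Num.min r r'); split; [by []|by rewrite lt_min r0|].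
by move=> s; rewrite lt_min => /andP[s1 s2]; rewrite -E // H.
Qed.

Lemma isO_comp (W : normedModType R) k (E : V -> W) (f : V -> V) : isO k E -> isO 1 f ->
  isO k (fun s => E (f s)).
Proof.
move=> [C [r [C0 r0 H]]] [C' [r' [C'0 r'0 H']]].
have c1 : 0 < C' + 1 by rewrite ltr_wpDl.
exists (C * C' ^+ k), (Num.min r' (r / (C' + 1))); split.
- by rewrite mulr_ge0 // exprn_ge0.
- by rewrite lt_min r'0 divr_gt0.
move=> s; rewrite lt_min => /andP[s1 s2]; have fs := H' s s1; rewrite expr1 in fs.
have fr : `|f s| < r.
  apply: le_lt_trans fs _; apply: (@le_lt_trans _ _ ((C' + 1) * `|s|)).
    by rewrite ler_wpM2r // lerDl.
  by rewrite mulrC -ltr_pdivlMr.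
apply: le_trans (H _ fr) _; rewrite -mulrA -exprMn ler_wpM2l //.
by apply: lerXn2r; rewrite ?nnegrE ?mulr_ge0.
Qed.

Lemma isO_small (W : normedModType R) k (f : V -> W) (e : R) : isO k.+1 f -> 0 < e ->
  exists2 r : R, 0 < r & forall s, `|s| < r -> `|f s| < e.
Proof.
move=> /(isO_le (ltn0Sn k)) [C [r [C0 r0 H]]] e0; have c1 : 0 < C + 1 by rewrite ltr_wpDl.
exists (Num.min r (e / (C + 1))); first by rewrite lt_min r0 divr_gt0.
move=> s; rewrite lt_min => /andP[s1 s2]; apply: le_lt_trans (H s s1) _; rewrite expr1.
apply: (@le_lt_trans _ _ ((C + 1) * `|s|)); first by rewrite ler_wpM2r // lerDl.
by rewrite mulrC -ltr_pdivlMr.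
Qed.

Lemma linear_bound (W : normedModType R) (L : V -> W) : (forall u v, L (u + v) = L u + L v) ->
  (forall (a : R) u, L (a *: u) = a *: L u) -> exists2 K : R, 0 <= K & forall v, `|L v| <= K * `|v|.
Proof.
move=> LD LZ; exists (`|L (delta_mx 0 0)| + `|L (delta_mx 0 1)|); first by rewrite addr_ge0.
move=> v; rewrite {1}(row2_delta v) LD !LZ; apply: le_trans (ler_normD _ _) _.
by rewrite !normrZ mulrDl; apply: lerD; rewrite mulrC ler_wpM2l // coord_le_norm.
Qed.

Lemma bilinear_bound (W : normedModType R) (b : V -> V -> W) :
  (forall u u' v, b (u + u') v = b u v + b u' v) -> (forall (a : R) u v, b (a *: u) v = a *: b u v) ->
  (forall u v v', b u (v + v') = b u v + b u v') -> (forall (a : R) u v, b u (a *: v) = a *: b u v) ->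
  exists2 K : R, 0 <= K & forall u v, `|b u v| <= K * `|u| * `|v|.
Proof.
move=> Dl Zl Dr Zr.
have [K0 K00 H0] := linear_bound (Dr (delta_mx 0 0)) (fun a => Zr a (delta_mx 0 0)).
have [K1 K10 H1] := linear_bound (Dr (delta_mx 0 1)) (fun a => Zr a (delta_mx 0 1)).
exists (K0 + K1); first by rewrite addr_ge0.
move=> u v; rewrite {1}(row2_delta u) Dl !Zl; apply: le_trans (ler_normD _ _) _.
rewrite !normrZ !mulrDl; apply: lerD.
  by rewrite mulrAC mulrC; apply: ler_pM; rewrite ?coord_le_norm.
by rewrite mulrAC mulrC; apply: ler_pM; rewrite ?coord_le_norm.
Qed.

Lemma Ck_taylor3 (U : set V) (f : V -> R) x : open U -> U x -> Ck 3 U f ->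
  exists2 r : R, 0 < r & (forall v, `|v| < r -> U (x + v)) /\
    isO 3 (fun v => f (x + v) - f x - 'D_v f x - 2^-1 * 'D_v ('D_v f) x).
Proof.
move=> oU Ux C3; have [r [K [r0 K0 H]]] := Ck_bound3 oU Ux C3.
exists r; first exact: r0.
have inb (v : V) (t : R) : `|v| < r -> 0 <= t <= 1 -> `|x + t *: v - x| < r.
  move=> vr /andP[t0 t1]; rewrite addrAC subrr add0r normrZ ger0_norm //.
  by apply: le_lt_trans vr; rewrite ler_piMl.
split=> [v vr|].
  by have := inb v 1 vr; rewrite scale1r => /(_ (introT andP (conj ler01 (lexx 1)))) /(H _ 0 0 0)[].
exists K, r; split=> // v vr.
apply: (taylor3 (f := f)) => t t01.
  have [Ut _] := H _ 0 0 0 (inb v t vr t01).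
  by have [d1 /(_ v) [d2 /(_ v) [d3 _]]] := C3; split; [exact: d1|exact: d2|exact: d3].
have [_ h] := H _ v v v (inb v t vr t01).
by apply: le_trans h _; rewrite (_ : `|v| ^+ 3 = `|v| * `|v| * `|v|) ?mulrA //; ring.
Qed.

Lemma isO_row (k : nat) (f : V -> V) : (forall j : 'I_2, isO k (fun s => f s 0 j : R)) -> isO k f.
Proof.
move=> H; have [C0 [r0 [C00 r00 H0]]] := H 0; have [C1 [r1 [C10 r10 H1]]] := H 1.
exists (C0 + C1), (Num.min r0 r1); split; [by rewrite addr_ge0|by rewrite lt_min r00|].
move=> s; rewrite lt_min => /andP[s1 s2]; have N : 0 <= `|s| ^+ k by rewrite exprn_ge0.
apply: norm_row2_le.
  by apply: le_trans (H0 s s1) _; rewrite ler_wpM2r // lerDl.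
by apply: le_trans (H1 s s2) _; rewrite ler_wpM2r // lerDr.
Qed.

End BigO.

(** * Second-order expansions of transition maps and of the metric *)

Section SecondOrder.
Context {R : realType} {M : surface R} (g : riemannian M).
Local Notation V := 'rV[R]_2.
Implicit Types (i k p : M) (y v : V).
Local Notation G := (Gm g).
Local Notation DG := (DG g).
Local Notation DDG := (DDG g).
Local Notation Gam := (Gam g).
Local Notation DGam := (DGam g).
Local Notation Rm := (Rm g).

Lemma trans_taylor i k y : overlap i k y -> exists2 r : R, 0 < r &
  (forall v, `|v| < r -> overlap i k (y + v)) /\
  isO 3 (fun v => trans i k (y + v) - trans i k y - TD i k y v - 2^-1 *: D2 i k y v v).
Proof.
move=> oy; have oU : open (overlap i k) := @overlap_open R M i k.
have Cc (l : 'I_2) : Ck 3 (overlap i k) (fun z => trans i k z 0 l : R).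
  by apply: Ck_coord => //; exact: trans_Ck.
have [r0 r00 [U0 O0]] := Ck_taylor3 oU oy (Cc 0).
have [r1 r10 [U1 O1]] := Ck_taylor3 oU oy (Cc 1).
exists r0; first exact: r00.
split; first exact: U0.
have E1 (l : 'I_2) z v : overlap i k z -> 'D_v (fun z => trans i k z 0 l : R) z = TD i k z v 0 l.
  by move=> oz; have [_ ->] := is_derive_coord 0 l (is_derive_trans v oz).
have E2 (l : 'I_2) v : 'D_v ('D_v (fun z => trans i k z 0 l : R)) y = D2 i k y v v 0 l.
  have [_ <-] := is_derive_coord 0 l (is_derive_TD v v oy).
  by apply: (@derive_eq_on R V R (overlap i k)) => // z oz; exact: E1.
have E (l : 'I_2) v : trans i k (y + v) 0 l - trans i k y 0 l - 'D_v (fun z => trans i k z 0 l : R) y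
     - 2^-1 * 'D_v ('D_v (fun z => trans i k z 0 l : R)) y =
   (trans i k (y + v) - trans i k y - TD i k y v - 2^-1 *: D2 i k y v v) 0 l.
  by rewrite E1 // E2 !mxE.
apply: isO_row => l; have [->|->] := ord2P l; first exact: isO_ext (E 0) O0.
exact: isO_ext (E 1) O1.
Qed.

(** Metric compatibility is differentiated once more along the constant direction [X]. *)
Lemma DDG_Gam i y X v : cod i y -> bf (DDG i y X) v v =
  2 * (bf (G i y) (Gam i y X (Gam i y X v)) v + bf (G i y) (Gam i y X v) (Gam i y X v)
       + bf (G i y) (DGam i y X X v) v).
Proof.
move=> cy.
have D1 : is_derive y X (fun z => bf (DG i z X) v v) (bf (DDG i y X) v v).
  apply: (is_derive_subst (is_derive_bf (is_derive_DG g X cy) (is_derive_cst v y X) (is_derive_cst v y X))).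
  by rewrite bf0l bf0r !addr0.
have D2' : is_derive y X (fun z => 2 * bf (G i z) (Gam i z X v) v)
    (2 * (bf (DG i y X) (Gam i y X v) v + bf (G i y) (DGam i y X X v) v + bf (G i y) (Gam i y X v) 0)).
  exact: (is_deriveZ 2 (is_derive_bf (is_derive_Gm g X cy) (is_derive_Gam g X X v cy) (is_derive_cst v y X))).
have [_ <-] := D1.
have -> : 2 * (bf (G i y) (Gam i y X (Gam i y X v)) v + bf (G i y) (Gam i y X v) (Gam i y X v)
     + bf (G i y) (DGam i y X X v) v) = 'D_X (fun z => 2 * bf (G i z) (Gam i z X v) v) y.
  have [_ ->] := D2'; rewrite bf0r (metric_compat g X (Gam i y X v) v cy).
  by move: (bf _ _ _) (bf _ _ _) (bf _ _ _) => a b c; ring.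
apply: (@derive_eq_on R V R (cod i)) => //; first exact: (@cod_open _ M i).
move=> z cz; rewrite (metric_compat g X v v cz) (GmC g i z v (Gam i z X v)).
by move: (bf _ _ _) => a; ring.
Qed.

(* The second variation density: with [v] the velocity of a geodesic and [X']
   the derivative of the components of [X], the last bracket is the derivative
   of [<v, Gamma(X, X)>]. *)
Lemma second_variation_identity i p v X X' : dom i p -> let y := chart i p in
  let nX := X' + Gam i y v X in
  bf (G i y) X' X' + 2 * bf (DG i y X) v X' + 2^-1 * bf (DDG i y X) v v =
  bf (G i y) nX nX - gauss_curvature g p * (bf (G i y) X X * bf (G i y) v v - bf (G i y) X v ^+ 2)
  + (bf (DG i y v) v (Gam i y X X) + bf (G i y) (- Gam i y v v) (Gam i y X X)
     + bf (G i y) v (DGam i y v X X + Gam i y X' X + Gam i y X X')).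
Proof.
move=> pi y nX; have cy : cod i y := chart_cod pi.
rewrite -(gauss_curvatureE g X v pi) -/y.
(* In the form [<R(X, v) X, v>] the derivatives of [Gam] are those that occur in [DDG_Gam] and in
   the last bracket. *)
have sk : bf (G i y) (Rm i y X v v) X = - bf (G i y) (Rm i y X v X) v by exact: Rm_skew2.
rewrite sk DDG_Gam // (metric_compat g X v X' cy) (metric_compat g v v (Gam i y X X) cy) /nX /Rm.
rewrite (GamC g v X cy) (GamC g X' X cy) (DGamC g X X v cy).
rewrite !(bfDl, bfDr, bfNl, bfNr).
rewrite ?(GmC g i y (Gam i y X v) X') ?(GmC g i y (Gam i y X (Gam i y X v)) v).
rewrite ?(GmC g i y (DGam i y X v X) v) ?(GmC g i y (DGam i y v X X) v) ?(GmC g i y (Gam i y v (Gam i y X X)) v).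
by repeat (match goal with |- context [bf ?A ?a ?b] => generalize (bf A a b); intro end); field.
Qed.

(** The map [X |-> DDG i z X] is quadratic; its increment is polarised, and [Ck_bound2] bounds the
    bilinear form. *)
Lemma DDG_entry_bound i y0 (a b : 'I_2) : cod i y0 -> exists r C : R, [/\ 0 < r, 0 <= C &
  forall z X Y, `|z - y0| < r -> `|DDG i z Y a b - DDG i z X a b| <= C * `|Y - X| * (`|Y| + `|X|)].
Proof.
move=> cy; have oc : open (cod i) := @cod_open _ M i.
have C2 := Gm_entry_Ck g 2 i a b.
have [r [K [r0 K0 H]]] := Ck_bound2 oc cy C2.
exists r, K; split=> // z X Y zr.
have [cz _] := H z 0 0 zr.
have [df /(_ _) dDf] := C2; pose f z : R := G i z a b.
have dd v : differentiable ('D_v f) z by have [d _] := dDf v; exact: d.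
rewrite -!DG_entry_derive // -/f.
have e1 : 'D_Y ('D_Y f) z = 'D_(Y - X) ('D_Y f) z + 'D_X ('D_Y f) z.
  by have := deriveDr (Y - X) X (dd Y); rewrite subrK.
have e2 : 'D_X ('D_Y f) z = 'D_X ('D_(Y - X) f) z + 'D_X ('D_X f) z.
  have [_ <-] := is_deriveD (is_derive_dir X (dd (Y - X))) (is_derive_dir X (dd X)).
  apply: (@derive_eq_on R V R (cod i)) => // x cx; rewrite !fctE.
  by have := deriveDr (Y - X) X (df x cx); rewrite subrK.
rewrite e1 e2 addrA addrK; apply: le_trans (ler_normD _ _) _.
have [_ h1] := H z (Y - X) Y zr; have [_ h2] := H z X (Y - X) zr.
apply: le_trans (lerD h1 h2) _; rewrite mulrDr lerD2l.
by rewrite -mulrA [`|X| * _]mulrC mulrA.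
Qed.

Lemma DDG_bound i y0 : cod i y0 -> exists r C : R, [/\ 0 < r, 0 <= C &
  forall z X Y a b, `|z - y0| < r -> `|bf (DDG i z Y) a b - bf (DDG i z X) a b| <=
    C * `|Y - X| * (`|Y| + `|X|) * `|a| * `|b|].
Proof.
move=> cy.
have [m n r C r' C' rr CC H z X Y zr|r [C [r0 C0 H]]] := uniform_I22 _ (fun a b => DDG_entry_bound a b cy).
  by apply: le_trans (H z X Y (lt_le_trans zr rr)) _; rewrite -!mulrA ler_wpM2r // mulr_ge0 ?addr_ge0.
exists r, (4 * C); split; [exact: r0|by rewrite mulr_ge0|move=> z X Y a b zr].
rewrite -bfBm -[4 * C * _ * _]mulrA -[4 * C * _]mulrA; apply: bf_entry_le => m n.
by rewrite !mxE mulrA; exact: H.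
Qed.

End SecondOrder.

(** * Second variation over a short interval *)

Section Variation.
Context {R : realType} {M : surface R} (g : riemannian M).
Local Notation V := 'rV[R]_2.
Implicit Types (i k : M) (y v s : V) (c : R -> M) (X : 'I_2 -> R -> V) (z : V -> M) (b : V -> R).
Local Notation dist := (dist g).
Local Notation G := (Gm g).
Local Notation DG := (DG g).
Local Notation DDG := (DDG g).
Local Notation Gam := (Gam g).

(** Two fields are carried at once, as index two requires; a single field is treated by taking it
    twice. *)
Definition fields c (a e : R) X := [/\ sol g c, 0 < a, 0 < e,
  forall (j : 'I_2), field_along_smooth `]- e, a + e[ c (X j) &
  forall j (t : R), 0 <= t <= a -> inner g (c t) (X j t) (velocity c t) = 0].

Definition comb X s (t : R) : V := \sum_(j < 2) s 0 j *: X j t.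

Definition xf c X i s (t : R) : V := s 0 0 *: cmp i (c t) (X 0 t) + s 0 1 *: cmp i (c t) (X 1 t).

Definition dxf c X i s (t : R) : V :=
  s 0 0 *: 'D_1 (fun t => cmp i (c t) (X 0 t)) t + s 0 1 *: 'D_1 (fun t => cmp i (c t) (X 1 t)) t.

(** The pairing of the velocity with [Gamma(X_s, X_s)]. It depends on the chart, and half of it
    turns the coordinate displacement of an end point into a second-order boundary term that does
    not. *)
Definition gamf c X i s (t : R) : R := bf (G i (chart i (c t))) (dchart i c t)
  (Gam i (chart i (c t)) (xf c X i s t) (xf c X i s t)).

Definition qdens c X s (t : R) : R := norm g (c t) (cov_along g c (comb X s) t) ^+ 2
  - gauss_curvature g (c t) * norm g (c t) (comb X s t) ^+ 2.

Lemma in_itv_ext (a e t : R) : 0 < e -> 0 <= t <= a -> `]- e, a + e[%classic t.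
Proof. by move=> e0 /andP[t0 t1]; rewrite /= in_itv /=; apply/andP; split; move: e0 t0 t1; clear; lra. Qed.

Lemma field_C1 c (a e : R) X i j (t : R) : fields c a e X -> `]- e, a + e[%classic t -> dom i (c t) ->
  is_derive t 1 (fun t => cmp i (c t) (X j t)) ('D_1 (fun t => cmp i (c t) (X j t)) t) /\
  {for t, continuous (fun t => 'D_1 (fun t => cmp i (c t) (X j t)) t)}.
Proof.
move=> [_ _ _ H _] At ci; have := H j i 1%N.
have -> : (fun t => comp i (c t) (X j t)) = (fun t => cmp i (c t) (X j t)).
  by apply/funext => x; rewrite cmpE.
move=> [d /(_ 1) cd]; split; first by apply: is_derive_dir; exact: d.
exact: cd.
Qed.

Lemma xf_derive c (a e : R) X i s (t : R) : fields c a e X -> `]- e, a + e[%classic t -> dom i (c t) ->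
  is_derive t 1 (xf c X i s) (dxf c X i s t) /\ {for t, continuous (dxf c X i s)}.
Proof.
move=> F At ci; have [d0 c0] := field_C1 0 F At ci; have [d1 c1] := field_C1 1 F At ci.
split; first exact: (is_deriveD (is_deriveZ (s 0 0) d0) (is_deriveZ (s 0 1) d1)).
by apply: cvgD; apply: cvgZ; [exact: cvg_cst|exact: c0|exact: cvg_cst|exact: c1].
Qed.

Lemma xf_comb c X i s t : dom i (c t) -> cmp i (c t) (comb X s t) = xf c X i s t.
Proof.
by move=> ci; rewrite /comb sum_ord2 cmpD // !cmpZ.
Qed.

Lemma xf_TD c X i k s t : dom i (c t) -> dom k (c t) -> TD i k (chart i (c t)) (xf c X i s t) = xf c X k s t.
Proof. by move=> ci ck; rewrite -!xf_comb // TD_cmp. Qed.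

Lemma xf_normal c (a e : R) X i s (t : R) : fields c a e X -> 0 <= t <= a -> dom i (c t) ->
  bf (G i (chart i (c t))) (xf c X i s t) (dchart i c t) = 0.
Proof.
move=> [S a0 e0 _ H] ta ci; have [cc d _ _] := S t i ci.
have h j : bf (G i (chart i (c t))) (cmp i (c t) (X j t)) (dchart i c t) = 0.
  by rewrite -(H j t ta) (inner_chart _ _ _ ci) (cmp_velocity cc ci d).
by rewrite /xf bfDl !bfZl !h !mulr0 addr0.
Qed.

Lemma qdens_chart c (a e : R) X i s (t : R) : fields c a e X -> `]- e, a + e[%classic t -> dom i (c t) ->
  let y := chart i (c t) in let n := dxf c X i s t + Gam i y (dchart i c t) (xf c X i s t) in
  qdens c X s t = bf (G i y) n n - gauss_curvature g (c t) * bf (G i y) (xf c X i s t) (xf c X i s t).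
Proof.
move=> F At ci y n; have [S a0 e0 _ _] := F; have [cc d _ _] := S t i ci.
have [dx _] := xf_derive s F At ci.
have dx' : is_derive t 1 (fun r => cmp i (c r) (comb X s r)) (dxf c X i s t).
  apply: near_eq_is_derive dx; apply: filterS (near_dom cc ci) => r cr; exact: esym (xf_comb X s cr).
have nE := @cmp_cov_along R M g i c (comb X s) t _ _ cc ci d dx'.
rewrite /qdens /norm !sqr_sqrtr; last 2 first.
- by rewrite (inner_chart _ _ _ ci); apply: Gm_ge0; exact: chart_cod.
- by rewrite (inner_chart _ _ _ ci); apply: Gm_ge0; exact: chart_cod.
by rewrite !(inner_chart _ _ _ ci) nE xf_comb.
Qed.

(** By [second_variation_identity], the second-order part of the energy in coordinates and the
    invariant density [qdens] differ by a total derivative, namely that of [gamf]. Normality of the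
    field removes the term [<X, v>]. *)
Lemma gamf_derive c (a e : R) X i s (t : R) : fields c a e X -> 0 <= t <= a -> dom i (c t) ->
  let y := chart i (c t) in let v := dchart i c t in let x := xf c X i s t in let dx := dxf c X i s t in
  is_derive t 1 (gamf c X i s)
    (bf (G i y) dx dx + 2 * bf (DG i y x) v dx + 2^-1 * bf (DDG i y x) v v - qdens c X s t).
Proof.
move=> F ta ci y v x dx; have [S a0 e0 _ _] := F; have [cc d dd un] := S t i ci.
have At := in_itv_ext e0 ta; have [Dx _] := xf_derive s F At ci.
have cy : cod i y := chart_cod ci.
have dG : is_derive t 1 (fun r => G i (chart i (c r))) (DG i y v).
  by rewrite -DGE; apply: (is_derive_comp d); exact: Gm_differentiable.
have DP := @Gam_path R M g R i (chart i \o c) (xf c X i s) (xf c X i s) t 1 _ _ _ cy d Dx Dx.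
apply: (is_derive_subst (is_derive_bf dG dd DP)).
rewrite (second_variation_identity g v x dx ci) -/y (qdens_chart s F At ci) -/y -/v -/x -/dx un.
rewrite (xf_normal s F ta ci) expr0n /= subr0 mulr1.
have id (p1 p2 p3 m : R) : p1 + p2 + p3 = m + (p1 + p2 + p3) - m by ring.
exact: id.
Qed.

Lemma xf_le c X i s t : `|xf c X i s t| <= (`|cmp i (c t) (X 0 t)| + `|cmp i (c t) (X 1 t)|) * `|s|.
Proof.
apply: le_trans (ler_normD _ _) _; rewrite !normrZ mulrDl.
by apply: lerD; rewrite mulrC ler_wpM2l // coord_le_norm.
Qed.

Lemma xf_isO c X i t : isO 1 (fun s => xf c X i s t).
Proof.
exists (`|cmp i (c t) (X 0 t)| + `|cmp i (c t) (X 1 t)|), 1; split; [by rewrite addr_ge0|exact: ltr01|].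
by move=> s _; rewrite expr1; exact: xf_le.
Qed.

(* [z s] is a point displaced from [c t] by [X_s] up to second order, and [b s]
   the boundary term it contributes to the length, up to third order *)
Definition adm c X (t : R) z b i := [/\ dom i (c t),
  exists2 r : R, 0 < r & forall s, `|s| < r -> dom i (z s),
  isO 2 (fun s => chart i (z s) - chart i (c t) - xf c X i s t) &
  isO 3 (fun s => bf (G i (chart i (c t))) (dchart i c t) (chart i (z s) - chart i (c t))
                  + 2^-1 * gamf c X i s t - b s)].

Lemma adm_exists c X t : exists z b, adm c X t z b (c t).
Proof.
have ci := dom_center (c t); set i := c t in ci *; set y := chart i (c t).
have cy : cod i y := chart_cod ci.
have [r r0 H] := open_normP (@cod_open _ M i) cy.
have [r' r'0 H'] := isO_small (xf_isO c X i t) r0.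
have cod_s s : `|s| < r' -> cod i (y + xf c X i s t).
  by move=> sr; apply: H; rewrite addrAC subrr add0r; exact: H'.
exists (fun s => param i (y + xf c X i s t)),
  (fun s => bf (G i y) (dchart i c t) (xf c X i s t) + 2^-1 * gamf c X i s t).
have Z n (W : normedModType R) (f : V -> W) : (forall s, `|s| < r' -> f s = 0) -> isO n f.
  move=> f0; exists 0, r'; split=> // s sr; by rewrite f0 // normr0 mul0r.
split; [exact: ci|exists r' => // s sr; apply: param_dom; exact: cod_s| |].
  apply: Z => s sr; rewrite paramK; last exact: cod_s.
  by rewrite -/y [y + _]addrC addrK subrr.
apply: Z => s sr; rewrite paramK; last exact: cod_s.
by rewrite -/y [y + _]addrC addrK subrr.
Qed.

Lemma dchart_TD c i k t : sol g c -> dom i (c t) -> dom k (c t) ->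
  dchart k c t = TD i k (chart i (c t)) (dchart i c t).
Proof.
by move=> S ci ck; have [cc d _ _] := S t i ci; have [_ <-] := is_derive_chart cc ci ck d.
Qed.

(** Changing the chart adds half of [D2 i k y (x s) (x s)] to the displacement, up to third order,
    and [Gam_trans] subtracts the same amount from half of [gamf]. The boundary term [b] is
    therefore the same in every chart. *)
Lemma adm_chart c (X : 'I_2 -> R -> V) t z b i k : sol g c -> adm c X t z b i -> dom k (c t) -> adm c X t z b k.
Proof.
move=> S [ci [r r0 zi] O2 O3] ck; set y := chart i (c t) in O2 O3.
have oy : overlap i k y by exact: overlap_chart.
have [r1 r10 [U1 E3]] := trans_taylor oy.
pose Y s := chart i (z s) - y; pose x s := xf c X i s t.
have Ox : isO 1 x := xf_isO c X i t.
have OY2 : isO 2 (fun s => Y s - x s) := O2.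
have OY : isO 1 Y.
  by apply: (isO_ext (f := fun s => (Y s - x s) + x s)) => [s|]; [rewrite subrK|apply: isO_add => //; exact: isO_le OY2].
have [r2 r20 Hr2] := isO_small OY r10.
have rr0 : 0 < Num.min r r2 by rewrite lt_min r0.
have near_s s : `|s| < Num.min r r2 -> dom k (z s) /\ chart k (z s) = trans i k (y + Y s).
  rewrite lt_min => /andP[s1 s2]; have zs := zi s s1.
  have yE : y + Y s = chart i (z s) by rewrite addrC subrK.
  have [_] := U1 _ (Hr2 s s2); rewrite yE chartK // => zk; split; first exact: zk.
  by rewrite trans_chart.
have ty : trans i k y = chart k (c t) by exact: trans_chart.
have OE := isO_comp E3 OY.
have [K K0 HK] := linear_bound (fun u v => TDD u v oy) (fun a u => TDZ a u oy).
have [K2 K20 HK2] := bilinear_bound (fun u u' v => D2Dl u u' v oy) (fun a u v => D2Zl a u v oy)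
   (fun u v v' => D2Dr u v v' oy) (fun a u v => D2Zr a u v oy).
have OD2 : isO 3 (fun s => D2 i k y (Y s) (Y s) - D2 i k y (x s) (x s)).
  apply: (isO_ext (f := fun s => D2 i k y (Y s - x s) (Y s) + D2 i k y (x s) (Y s - x s))) => [s|].
    have e1 : D2 i k y (Y s) (Y s) = D2 i k y (Y s - x s) (Y s) + D2 i k y (x s) (Y s) by rewrite -D2Dl // subrK.
    have e2 : D2 i k y (x s) (Y s) = D2 i k y (x s) (Y s - x s) + D2 i k y (x s) (x s) by rewrite -D2Dr // subrK.
    by rewrite e1 e2 addrA addrK.
  apply: isO_add; first exact: (isO_bilin HK2 OY2 OY).
  exact: (isO_bilin HK2 Ox OY2).
have expand s : `|s| < Num.min r r2 -> chart k (z s) - chart k (c t) =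
    (trans i k (y + Y s) - trans i k y - TD i k y (Y s) - 2^-1 *: D2 i k y (Y s) (Y s))
    + TD i k y (Y s) + 2^-1 *: D2 i k y (Y s) (Y s).
  move=> /near_s[_ ->]; rewrite ty; move: (trans _ _ _) (chart _ _) (TD _ _ _ _) (_ *: _) => p q m n.
  by apply/rowP => l; rewrite !mxE; ring.
split; first exact: ck.
- by exists (Num.min r r2) => // s /near_s[].
- apply: (isO_near rr0 (f := fun s => (trans i k (y + Y s) - trans i k y - TD i k y (Y s) - 2^-1 *: D2 i k y (Y s) (Y s))
     + TD i k y (Y s - x s) + 2^-1 *: D2 i k y (Y s) (Y s))) => [s sr|].
    rewrite expand // -(xf_TD X s ci ck) -/y -/(x s).
    have -> : TD i k y (Y s) = TD i k y (Y s - x s) + TD i k y (x s) by rewrite -TDD // subrK.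
    move: (2^-1 *: _) (TD i k y (Y s - x s)) (TD i k y (x s)) (trans i k (y + Y s)) (trans i k y) => p q m n o.
    by apply/rowP => l; rewrite !mxE; ring.
  apply: isO_add; first apply: isO_add.
  + exact: isO_le OE.
  + exact: isO_lin HK OY2.
  + apply: (isO_lin (b := fun w : V => 2^-1 *: w) (K := 2^-1)).
      by move=> w; rewrite normrZ gtr0_norm.
    exact: (isO_bilin HK2 OY OY).
- set yk := chart k (c t); set vk := dchart k c t.
  have cy : cod i y := chart_cod ci.
  have vkE : vk = TD i k y (dchart i c t) by exact: dchart_TD.
  have gT w : bf (G k yk) vk (TD i k y w) = bf (G i y) (dchart i c t) w.
    by rewrite vkE /yk -ty -gram_trans.
  have gE s : gamf c X k s t = gamf c X i s t - bf (G k yk) vk (D2 i k y (x s) (x s)).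
    by rewrite /gamf -/yk -/vk -(xf_TD X s ci ck) -/y -/(x s) {2}/yk -ty Gam_trans // bfBr gT.
  have [K3 K30 HK3] := linear_bound (fun u v => bfDr (G k yk) vk u v) (fun a u => bfZr (G k yk) a vk u).
  apply: (isO_near rr0 (f := fun s => (bf (G i y) (dchart i c t) (Y s) + 2^-1 * gamf c X i s t - b s)
     + bf (G k yk) vk (trans i k (y + Y s) - trans i k y - TD i k y (Y s) - 2^-1 *: D2 i k y (Y s) (Y s))
     + 2^-1 * bf (G k yk) vk (D2 i k y (Y s) (Y s) - D2 i k y (x s) (x s)))) => [s sr|].
    rewrite expand // gE; move: (trans _ _ _ - _ - _ - _) => p.
    rewrite !(bfDr (G k yk)) gT (bfZr (G k yk)) (bfNr (G k yk)).
    move: (bf (G k yk) vk p) (bf (G i y) _ _) (bf (G k yk) vk _) (bf (G k yk) vk _) (gamf _ _ _ _ _) (b s).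
    by clear => x1 x2 x3 x4 x5 x6; ring.
  apply: isO_add; first apply: isO_add.
  + exact: O3.
  + exact: isO_lin HK3 OE.
  + apply: (isO_lin (b := fun w : V => 2^-1 * bf (G k yk) vk w) (K := 2^-1 * K3)).
      by move=> w; rewrite normrM gtr0_norm // -mulrA ler_pM2l.
    exact: OD2.
Qed.

Lemma near_bounded (W : normedModType R) (f : R -> W) (t0 : R) : {for t0, continuous f} ->
  exists B d : R, [/\ 0 <= B, 0 < d & forall t, `|t - t0| < d -> `|f t| <= B].
Proof.
move=> /continuous_forP/(_ 1 ltr01)[d d0 H]; exists (`|f t0| + 1), d; split; [by rewrite addr_ge0|exact: d0|].
move=> t /H h; have := ler_normD (f t0) (f t - f t0); rewrite [f t0 + _]addrC subrK => h'.
by apply: le_trans h' _; rewrite lerD2l ltW.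
Qed.


(** These are the remainders left by [gram_taylor] and [DDG_bound] in the next lemma. With [x],
    [dx], [Y], [dY] of order [sg] and [Z], [dZ] of order [sg ^+ 2], all of them are cubic. *)
Lemma cubic_sum (C1 E B La C4 sg y1 y2 y3 : R) (dd Yn dYn xn dxn Zn dZn Yd : R) :
  0 <= C1 -> 0 <= E -> 0 <= B -> 0 <= La -> 0 <= C4 -> 0 <= sg -> 0 <= dd -> dd <= B ->
  0 <= Yn -> Yn <= E * sg -> 0 <= dYn -> dYn <= E * sg -> 0 <= xn -> xn <= E * sg -> 0 <= dxn -> dxn <= E * sg ->
  0 <= Zn -> Zn <= E * sg ^+ 2 -> 0 <= dZn -> dZn <= E * sg ^+ 2 ->
  [/\ C1 * Yn ^+ 3 * dd * dd <= C1 * E ^+ 3 * B ^+ 2 * sg ^+ 3,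
      C1 * Yn ^+ 2 * dd * dYn <= C1 * E ^+ 3 * B * sg ^+ 3 &
      C1 * Yn * dYn * dYn <= C1 * E ^+ 3 * sg ^+ 3] /\
  [/\ C4 * Zn * (Yn + xn) * dd * dd <= 2 * C4 * E ^+ 2 * B ^+ 2 * sg ^+ 3,
      C1 * Zn * dd * dYn <= C1 * E ^+ 2 * B * sg ^+ 3,
      C1 * xn * dd * dZn <= C1 * E ^+ 2 * B * sg ^+ 3,
      La * dZn * dYn <= La * E ^+ 2 * sg ^+ 3 &
      La * dxn * dZn <= La * E ^+ 2 * sg ^+ 3].
Proof.
move=> C10 E0 B0 La0 C40 sg0 d0 dB Y0 YE dY0 dYE x0 xE dx0 dxE Z0 ZE dZ0 dZE.
have Es : 0 <= E * sg by rewrite mulr_ge0.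
have Es2 : 0 <= E * sg ^+ 2 by rewrite mulr_ge0 // exprn_ge0.
have Y2 : Yn ^+ 2 <= (E * sg) ^+ 2 by rewrite !expr2; exact: ler_pM.
have Y3 : Yn ^+ 3 <= (E * sg) ^+ 3 by rewrite !(exprS _ 2); apply: ler_pM; rewrite ?exprn_ge0.
have YX : Yn + xn <= 2 * (E * sg) by rewrite mulr_natl mulr2n lerD.
split; split.
- rewrite (_ : C1 * E ^+ 3 * B ^+ 2 * sg ^+ 3 = C1 * (E * sg) ^+ 3 * B * B); last by ring.
  by do 2 (apply: ler_pM; rewrite ?mulr_ge0 ?exprn_ge0 //); apply: ler_wpM2l.
- rewrite (_ : C1 * E ^+ 3 * B * sg ^+ 3 = C1 * (E * sg) ^+ 2 * B * (E * sg)); last by ring.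
  by do 2 (apply: ler_pM; rewrite ?mulr_ge0 ?exprn_ge0 //); apply: ler_wpM2l.
- rewrite (_ : C1 * E ^+ 3 * sg ^+ 3 = C1 * (E * sg) * (E * sg) * (E * sg)); last by ring.
  by do 2 (apply: ler_pM; rewrite ?mulr_ge0 ?exprn_ge0 //); apply: ler_wpM2l.
- rewrite (_ : 2 * C4 * E ^+ 2 * B ^+ 2 * sg ^+ 3 = C4 * (E * sg ^+ 2) * (2 * (E * sg)) * B * B); last by ring.
  by do 3 (apply: ler_pM; rewrite ?mulr_ge0 ?addr_ge0 //); apply: ler_wpM2l.
- rewrite (_ : C1 * E ^+ 2 * B * sg ^+ 3 = C1 * (E * sg ^+ 2) * B * (E * sg)); last by ring.
  by do 2 (apply: ler_pM; rewrite ?mulr_ge0 //); apply: ler_wpM2l.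
- rewrite (_ : C1 * E ^+ 2 * B * sg ^+ 3 = C1 * (E * sg) * B * (E * sg ^+ 2)); last by ring.
  by do 2 (apply: ler_pM; rewrite ?mulr_ge0 //); apply: ler_wpM2l.
- rewrite (_ : La * E ^+ 2 * sg ^+ 3 = La * (E * sg ^+ 2) * (E * sg)); last by ring.
  by apply: ler_pM; rewrite ?mulr_ge0 //; apply: ler_wpM2l.
- rewrite (_ : La * E ^+ 2 * sg ^+ 3 = La * (E * sg) * (E * sg ^+ 2)); last by ring.
  by apply: ler_pM; rewrite ?mulr_ge0 //; apply: ler_wpM2l.
Qed.

(** The comparison curve is [u + X_s + Z], where [Z] is affine in time and moves the ends to [z1 s]
    and [z2 s]. As [Z] is of second order, it enters to this order only through the linear part of
    the energy, which [variation_reach] integrates exactly. *)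
Lemma second_order_piece c (a e : R) X t0 : fields c a e X -> 0 <= t0 <= a -> exists2 d : R, 0 < d &
  forall (t1 t2 : R) z1 b1 z2 b2 i1 i2 (Hq : V -> R -> R), 0 <= t1 -> t1 < t2 -> t2 <= a ->
  `|t1 - t0| < d -> `|t2 - t0| < d -> adm c X t1 z1 b1 i1 -> adm c X t2 z2 b2 i2 ->
  (forall s (t : R), 0 <= t <= a -> is_derive t 1 (Hq s) (qdens c X s t)) ->
  exists C r : R, [/\ 0 <= C, 0 < r & forall s, `|s| < r ->
    dist (z1 s) (z2 s) <= (t2 - t1) + (b2 s - b1 s) + 2^-1 * (Hq s t2 - Hq s t1) + C * `|s| ^+ 3].
Proof.
move=> F t0a; have [S a0 e0 _ _] := F.
set i := c t0; have ci : dom i (c t0) := dom_center _.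
set y0 := chart i (c t0); have cy : cod i y0 by exact: chart_cod.
have At0 := in_itv_ext e0 t0a.
have [r1 [C1 [r10 C10 H1]]] := gram_taylor g cy.
have [r2 [l [r20 l0 H2]]] := gram_lower g cy.
have [r3 [La [r30 La0 H3]]] := gram_upper g cy.
have [r4 [C4 [r40 C40 H4]]] := DDG_bound g cy.
have [r [r0 rr1 rr2 rr3 rr4]] := lt_min4 r10 r20 r30 r40.
pose u := chart i \o c; pose du := dchart i c.
have rh : 0 < r / 2 by rewrite divr_gt0.
have [d5 d50 n1] := sol_near S ci rh.
have n3 : \forall t \near t0, `]- e, a + e[%classic t.
  by apply: open_nbhs_nbhs; split; [exact: interval_open|].
have [d6 d60 n2] := (near_normP t0 _).1 n3.
have [Dx0 cDx0] := field_C1 0 F At0 ci; have [Dx1 cDx1] := field_C1 1 F At0 ci.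
have [B0 [d1 [B00 d10 HB0]]] := near_bounded (is_derive_continuous Dx0).
have [B1 [d2 [B10 d20 HB1]]] := near_bounded (is_derive_continuous Dx1).
have [B2 [d3 [B20 d30 HB2]]] := near_bounded cDx0.
have [B3 [d4 [B30 d40 HB3]]] := near_bounded cDx1.
have [d0 [d00 d05 d06]] := lt_min2 d50 d60; have [d7 [d70 d71 d72]] := lt_min2 d10 d20.
have [d [dp dd0 dd1 dd3 dd4]] := lt_min4 d00 d70 d30 d40; have dd2 := lt_trans dd1 d72; have {}dd1 := lt_trans dd1 d71.
exists d; first exact: dp.
move=> t1 t2 z1 b1 z2 b2 i1 i2 Hq t1p t12 t2a td1 td2 A1 A2 DHq.
have tin t : t1 <= t <= t2 -> `|t - t0| < d.
  move=> /andP[h1 h2]; move: td1 td2; rewrite !ltr_norml => /andP[h3 _] /andP[_ h6]; apply/andP; split.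
    by apply: lt_le_trans h3 _; rewrite lerD2r.
  by apply: le_lt_trans h6; rewrite lerD2r.
have ta t : t1 <= t <= t2 -> 0 <= t <= a.
  by move=> /andP[h1 h2]; rewrite (le_trans t1p h1) (le_trans h2 t2a).
have fact t : `|t - t0| < d -> [/\ dom i (c t), `|u t - y0| < r / 2 & `]- e, a + e[%classic t].
  by move=> /lt_trans/(_ dd0) h; have [k1 k2] := n1 t (lt_trans h d05); split; [| |exact: n2 (lt_trans h d06)].
have tt11 : t1 <= t1 <= t2 by rewrite lexx ltW.
have tt22 : t1 <= t2 <= t2 by rewrite lexx andbT ltW.
have [ct1 _ _] := fact _ (tin _ tt11); have [ct2 _ _] := fact _ (tin _ tt22).
have [_ [ra ra0 za] [D1 [rb [D10 rb0 OD1]]] [E1 [rc [E10 rc0 OE1]]]] := adm_chart S A1 ct1.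
have [_ [ra' ra'0 za'] [D2 [rb' [D20 rb'0 OD2]]] [E2 [rc' [E20 rc'0 OE2]]]] := adm_chart S A2 ct2.
pose L := t2 - t1; have L0 : 0 < L by rewrite subr_gt0.
have [B EB] : exists B : R, B = 1 + l^-1 by exists (1 + l^-1).
have Bp : 0 <= B by rewrite EB addr_ge0 // invr_ge0 ltW.
have Li : 0 < L^-1 by rewrite invr_gt0.
(* One constant bounds the field, its derivative, the curve variation [Y] and its derivative
   relative to [|s|], and [Z] with its slope relative to [|s| ^+ 2]. *)
have [E [EE0 EE1 EE2 EE3]] : exists E : R, [/\ 0 < E, B0 + B1 + (D1 + D2) <= E, B2 + B3 + L^-1 * (D1 + D2) <= E & D1 + D2 <= E /\ L^-1 * (D1 + D2) <= E].
  have D12 : 0 <= D1 + D2 by rewrite addr_ge0.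
  have LD : 0 <= L^-1 * (D1 + D2) by rewrite mulr_ge0 // ltW.
  exists (1 + (B0 + B1) + (B2 + B3) + (D1 + D2) + L^-1 * (D1 + D2)); move: B00 B10 B20 B30 D12 LD; clear.
  by move: (L^-1 * _) => w; split; [| | |split]; lra.
pose K := C1 * E ^+ 3 * B ^+ 2 + 2 * (C1 * E ^+ 3 * B) + C1 * E ^+ 3 + C4 * E ^+ 2 * B ^+ 2
   + 4 * (C1 * E ^+ 2 * B) + 2 * (La * E ^+ 2).
have K0 : 0 <= K.
  by rewrite /K !addr_ge0 // ?mulr_ge0 // ?mulr_ge0 // ?exprn_ge0 ?mulr_ge0 ?exprn_ge0 // ltW.
pose C := E1 + E2 + 2^-1 * K * L.
pose rs := Num.min (Num.min (Num.min ra ra') (Num.min rb rb')) (Num.min (Num.min rc rc') (Num.min 1 (r / 2 / E))).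
exists C, rs; split.
- by rewrite /C !addr_ge0 // !mulr_ge0 // ltW.
- by rewrite /rs !lt_min ra0 ra'0 rb0 rb'0 rc0 rc'0 ltr01 divr_gt0.
move=> s; rewrite /rs !lt_min => /andP[/andP[/andP[sa sa'] /andP[sb sb']] /andP[/andP[sc sc'] /andP[s1 sr]]].
have {}OD1 := OD1 s sb; have {}OD2 := OD2 s sb'; have {}OE1 := OE1 s sc; have {}OE2 := OE2 s sc'.
have zs1 := za s sa; have zs2 := za' s sa'.
have sg2 : `|s| ^+ 2 <= `|s| by rewrite expr2 ler_piMr // ltW.
pose v0 := chart i (z1 s) - chart i (c t1) - xf c X i s t1.
pose v1 := chart i (z2 s) - chart i (c t2) - xf c X i s t2.
rewrite -/v0 in OD1; rewrite -/v1 in OD2.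
pose dZ := L^-1 *: (v1 - v0); pose Z (t : R) := (v0 - t1 *: dZ) + t *: dZ.
have DZ (t : R) : is_derive t 1 Z dZ by exact: is_derive_affine.
have ZE t : Z t = v0 + (t - t1) *: dZ by apply/rowP => q; rewrite !mxE; ring.
have Z1 : Z t1 = v0 by rewrite ZE subrr scale0r addr0.
have Z2 : Z t2 = v1 by rewrite ZE /dZ -/L scalerA divff ?gt_eqF // scale1r addrC subrK.
have dZn : `|dZ| <= L^-1 * (D1 + D2) * `|s| ^+ 2.
  rewrite normrZ gtr0_norm // -mulrA ler_pM2l // mulrDl [leRHS]addrC; apply: le_trans (ler_normB _ _) _.
  exact: lerD.
have ZN t : t1 <= t <= t2 -> `|Z t| <= (D1 + D2) * `|s| ^+ 2.
  move=> /andP[h1 h2]; pose q := (t - t1) / L.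
  have q0 : 0 <= q by rewrite divr_ge0 ?subr_ge0 // ltW.
  have q1 : q <= 1 by rewrite ler_pdivrMr // mul1r lerD2r.
  have -> : Z t = (1 - q) *: v0 + q *: v1.
    by rewrite ZE /dZ scalerA -/q scalerBr scalerBl scale1r addrA addrAC.
  have nq1 : `|1 - q| = 1 - q by rewrite ger0_norm // subr_ge0.
  apply: le_trans (ler_normD _ _) _; rewrite (normrZ (1 - q)) (normrZ q) [leRHS]mulrDl nq1 (_ : `|q| = q); last exact: ger0_norm.
  apply: lerD; [apply: le_trans OD1|apply: le_trans OD2]; rewrite ler_piMl //.
  by rewrite lerBlDr lerDl.
clearbody Z dZ.
pose x (t : R) := xf c X i s t; pose dx (t : R) := dxf c X i s t.
pose Y (t : R) := x t + Z t; pose dY (t : R) := dx t + dZ.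
have [EE4 EE5] := EE3.
have sn := normr_ge0 s.
have bnd t : t1 <= t <= t2 -> [/\ `|x t| <= E * `|s|, `|dx t| <= E * `|s|, `|Y t| <= E * `|s| & `|dY t| <= E * `|s|].
  move=> tt; have td := tin t tt; have s2n : 0 <= `|s| ^+ 2 by rewrite exprn_ge0.
  have k1 : `|x t| <= (B0 + B1) * `|s|.
    apply: le_trans (xf_le c X i s t) _; rewrite ler_wpM2r // lerD //.
      by apply: HB0; exact: lt_trans td dd1.
    by apply: HB1; exact: lt_trans td dd2.
  have k2 : `|dx t| <= (B2 + B3) * `|s|.
    apply: le_trans (ler_normD _ _) _; rewrite !normrZ mulrDl; apply: lerD; rewrite mulrC.
      by apply: ler_pM; rewrite ?coord_le_norm //; apply: HB2; exact: lt_trans td dd3.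
    by apply: ler_pM; rewrite ?coord_le_norm //; apply: HB3; exact: lt_trans td dd4.
  have k3 : `|Z t| <= (D1 + D2) * `|s|.
    by apply: le_trans (ZN t tt) _; rewrite ler_wpM2l // addr_ge0.
  have k4 : `|dZ| <= L^-1 * (D1 + D2) * `|s|.
    by apply: le_trans dZn _; rewrite ler_wpM2l // mulr_ge0 ?addr_ge0 // ltW.
  have D12 : 0 <= D1 + D2 by rewrite addr_ge0.
  have LD : 0 <= L^-1 * (D1 + D2) by rewrite mulr_ge0 // ltW.
  split.
  - by apply: le_trans k1 _; rewrite ler_wpM2r // (le_trans _ EE1) // lerDl.
  - by apply: le_trans k2 _; rewrite ler_wpM2r // (le_trans _ EE2) // lerDl.
  - apply: le_trans (ler_normD _ _) _; apply: le_trans (lerD k1 k3) _.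
    by rewrite -mulrDl ler_wpM2r.
  - apply: le_trans (ler_normD _ _) _; apply: le_trans (lerD k2 k4) _.
    by rewrite -mulrDl ler_wpM2r.
have Esr : E * `|s| < r / 2 by rewrite mulrC -ltr_pdivlMr.
have DY t : `|t - t0| < d -> is_derive t 1 Y (dY t) /\ {for t, continuous dY}.
  move=> td; have [ct _ At] := fact t td; have [k1 k2] := xf_derive s F At ct.
  by split; [exact: is_deriveD k1 (DZ t)|apply: cvgD; [exact: k2|exact: cvg_cst]].
(* By [gamf_derive], half of [gamf] plus half of the primitive of [qdens] is a primitive of half the
   quadratic energy density [Qd]. The last term contributes the length and absorbs the cubic
   remainders, whose total constant is [K]. *)
pose H (t : R) := 2^-1 * gamf c X i s t + 2^-1 * Hq s t + (1 + 2^-1 * K * `|s| ^+ 3) * t.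
pose Qd t := bf (G i (u t)) (dx t) (dx t) + 2 * bf (DG i (u t) (x t)) (du t) (dx t) + 2^-1 * bf (DDG i (u t) (x t)) (du t) (du t).
have pE t (v : V) : dom i (c t) -> u t + (x t + (v - chart i (c t) - x t)) = v.
  by move=> _; rewrite /u /= [x t + _]addrC subrK addrC subrK.
have := @variation_reach R M g c i t0 t1 t2 r d Y dY H (fun t => 2^-1 * Qd t + (1 + 2^-1 * K * `|s| ^+ 3)) S.
have e1 : u t1 + Y t1 = chart i (z1 s) by rewrite /Y Z1 /v0 pE.
have e2 : u t2 + Y t2 = chart i (z2 s) by rewrite /Y Z2 /v1 pE.
rewrite /= -/(u t1) -/(u t2) e1 e2 !chartK // => VR; apply: le_trans (VR _ _ DY (ltW t12) _) _; first last.
- have y1 : Y t1 = chart i (z1 s) - chart i (c t1) by rewrite /Y Z1 /v0 addrC subrK.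
  have y2 : Y t2 = chart i (z2 s) - chart i (c t2) by rewrite /Y Z2 /v1 addrC subrK.
  have f1 := le_trans (ler_norm _) OE2; rewrite -normrN in OE1; have f2 := le_trans (ler_norm _) OE1.
  rewrite /H y1 y2 /C mulrDl; move: f1 f2; rewrite -/(u t1) -/(u t2) -/(du t1) -/(du t2) /L.
  move: (bf _ _ _) (bf _ _ _) (gamf _ _ _ _ _) (gamf _ _ _ _ _) (Hq _ _) (Hq _ _) (b1 s) (b2 s).
  by clearbody K; move: (`|s| ^+ 3) => m2; clear -E1; move=> *; lra.
- move=> t tt; have td := tin t tt; have [ct ut Ait] := fact t td.
  have [_ k1 k2 un] := S t i ct; have [k3 _] := DY t td; have [_ _ YE _] := bnd t tt.
  have cu' : cod i (u t) by exact: chart_cod.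
  have ub : `|u t + Y t - y0| < r.
    by have := ler_normD (u t - y0) (Y t); rewrite addrAC; move: ut YE Esr; clear; lra.
  rewrite -/(u t) -/(du t); split; [exact: td|exact: le_lt_trans YE Esr| |].
    have g1 := gamf_derive s F (ta t tt) ct; have g2 := DHq s t (ta t tt).
    apply: (is_derive_subst (is_deriveD (is_deriveD (is_deriveZ 2^-1 g1) (is_deriveZ 2^-1 g2))
      (is_deriveZ (1 + 2^-1 * K * `|s| ^+ 3) (is_derive_id t 1)))).
    rewrite /Qd -/(u t) -/(du t) -/(x t) -/(dx t) /GRing.scale /= mulr1.
    have id (p3 k q : R) : 2^-1 * (p3 - q) + 2^-1 * q + k = 2^-1 * p3 + k by field.
    exact: id.
have ur : `|u t - y0| < r by exact: lt_trans ut (half_lt r0).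
  have dB : `|du t| <= B.
    have [_ low] := H2 _ (lt_trans ur rr2).
    by rewrite EB; apply: (unit_norm_le l0 (low _)); rewrite un.
  have TT (p q : V) := H1 (u t) (Y t) p q (lt_trans ur rr1) (lt_trans ub rr1).
  have xr : `|u t + x t - y0| < r.
    have [k5 _ _ _] := bnd t tt; have := ler_normD (u t - y0) (x t); rewrite addrAC.
    by move: ut k5 Esr; clear; lra.
  have zr : `|u t + Z t - y0| < r.
    have k5 : `|Z t| < r / 2.
      apply: le_lt_trans (ZN t tt) _; apply: le_lt_trans Esr; apply: ler_pM; rewrite ?addr_ge0 ?exprn_ge0 //.
    have := ler_normD (u t - y0) (Z t); rewrite addrAC.
    by move: ut k5; clear; lra.
  have [_ [_ _ _ _ T3]] := TT (du t) (du t).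
  have [_ [_ _ _ T2 _]] := TT (du t) (dY t).
  have [_ [_ _ T1 _ _]] := TT (dY t) (dY t).
  have [_ [Dz _ _ _ _]] := H1 (u t) (Z t) (du t) (dY t) (lt_trans ur rr1) (lt_trans zr rr1).
  have [_ [Dxx _ _ _ _]] := H1 (u t) (x t) (du t) dZ (lt_trans ur rr1) (lt_trans xr rr1).
  have [_ up] := H3 _ (lt_trans ur rr3); have G1 := up dZ (dY t); have G2 := up (dx t) dZ.
  have DD := H4 (u t) (x t) (Y t) (du t) (du t) (lt_trans ur rr4).
  have YxZ : Y t - x t = Z t by rewrite /Y addrC addKr.
  rewrite YxZ in DD; rewrite un in T3.
  have [k5 k6 k7 k8] := bnd t tt.
  have ZN' : `|Z t| <= E * `|s| ^+ 2 by apply: le_trans (ZN t tt) _; rewrite ler_wpM2r // exprn_ge0.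
  have dZN' : `|dZ| <= E * `|s| ^+ 2 by apply: le_trans dZn _; rewrite ler_wpM2r // exprn_ge0.
  have [[q1 q2 q3] [q4 q5 q6 q7 q8]] := cubic_sum 0 0 0 0 (ltW C10) (ltW EE0) Bp (ltW La0) C40 sn (normr_ge0 (du t)) dB
    (normr_ge0 (Y t)) k7 (normr_ge0 (dY t)) k8 (normr_ge0 (x t)) k5 (normr_ge0 (dx t)) k6
    (normr_ge0 (Z t)) ZN' (normr_ge0 dZ) dZN'.
  have {}T3 := le_trans (le_trans (ler_norm _) T3) q1; have {}T2 := le_trans (le_trans (ler_norm _) T2) q2.
  have {}T1 := le_trans (le_trans (ler_norm _) T1) q3; have {}DD := le_trans (le_trans (ler_norm _) DD) q4.
  have {}Dz := le_trans (le_trans (ler_norm _) Dz) q5; have {}Dxx := le_trans (le_trans (ler_norm _) Dxx) q6.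
  have {}G1 := le_trans (le_trans (ler_norm _) G1) q7; have {}G2 := le_trans (le_trans (ler_norm _) G2) q8.
  have e3 : bf (DG i (u t) (Y t)) (du t) (dY t) = bf (DG i (u t) (Z t)) (du t) (dY t)
      + (bf (DG i (u t) (x t)) (du t) (dx t) + bf (DG i (u t) (x t)) (du t) dZ).
    have -> : DG i (u t) (Y t) = DG i (u t) (Z t) + DG i (u t) (x t) by rewrite /Y DGD // addrC.
    by rewrite bfDm -(bfDr (DG i (u t) (x t))).
  have e4 : bf (G i (u t)) (dY t) (dY t) = bf (G i (u t)) dZ (dY t) + (bf (G i (u t)) (dx t) dZ + bf (G i (u t)) (dx t) (dx t)).
    by rewrite -bfDr [dZ + dx t]addrC -/(dY t) -bfDl [dZ + dx t]addrC.
  rewrite (bfDl (G i (u t + Y t)) (du t) (dY t)) !(bfDr (G i (u t + Y t)) _ (du t) (dY t)) (GmC g i (u t + Y t) (dY t) (du t)).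
  rewrite e3 in T2; rewrite e4 in T1; rewrite /Qd.
  have fin (g1 g2 g3 n1' n2' w1 w2 w3 a1 a2 a3 b1' b2' k1' k2' k3' k4 k5' k6' s3 : R) :
      g3 - (w1 + (w2 + w3)) <= k3' * s3 -> g2 - n1' - (a1 + (a2 + a3)) <= k2' * s3 ->
      g1 - 1 - n2' - 2^-1 * b1' <= k1' * s3 -> b1' - b2' <= 2 * k4 * s3 ->
      a1 <= k5' * s3 -> a3 <= k5' * s3 -> w1 <= k6' * s3 -> w2 <= k6' * s3 ->
      g1 + g2 + (g2 + g3) <= 2 * (2^-1 * n2' + n1' + (2^-1 * (w3 + 2 * a2 + 2^-1 * b2') +
        (1 + 2^-1 * (k1' + 2 * k2' + k3' + k4 + 4 * k5' + 2 * k6') * s3))) - 1 by clear; lra.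
  rewrite (_ : 2 * C4 * E ^+ 2 * B ^+ 2 = 2 * (C4 * E ^+ 2 * B ^+ 2)) in DD; last by ring.
  exact: (fin _ _ _ _ _ _ _ _ _ _ _ _ _ _ _ _ _ _ _ _ T1 T2 T3 DD Dz Dxx G1 G2).
- by move=> t /fact[].
- by move=> y yr; have [] := H2 y (lt_trans yr rr2).
Qed.

End Variation.

(** * Second variation along a whole geodesic *)

Section SecondVariation.
Context {R : realType} {M : surface R} (g : riemannian M).
Local Notation V := 'rV[R]_2.
Implicit Types (i q : M) (y w s : V) (c : R -> M) (X : 'I_2 -> R -> V) (b : V -> R).
Local Notation dist := (dist g).
Local Notation G := (Gm g).
Local Notation Gam := (Gam g).

Lemma gram_det_gt0 i y : cod i y ->
  0 < bf (G i y) (delta_mx 0 0) (delta_mx 0 0) * bf (G i y) (delta_mx 0 1) (delta_mx 0 1)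
    - bf (G i y) (delta_mx 0 0) (delta_mx 0 1) ^+ 2.
Proof.
by move=> yi; rewrite !bf_delta expr2; exact: gdet_gt0.
Qed.

Lemma cvg_Rm (T : Type) (F : set_system T) {FF : Filter F} i (y : T -> V) (y0 a b : V) :
  cod i y0 -> y @ F --> y0 -> (fun t => Rm g i (y t) a b b) @ F --> Rm g i y0 a b b.
Proof.
move=> yi cy.
have cD u v w : (fun t => DGam g i (y t) u v w) @ F --> DGam g i y0 u v w.
  have [_ /(_ u) H] := Gam_Ck g 1 i v w.
  apply: (@cvg_comp _ _ _ y (fun x => DGam g i x u v w) _ _ _ cy).
  have H' := H y0 yi; rewrite (_ : 'D_u _ = fun x => DGam g i x u v w) in H'; last first.
    by apply/funext => x; rewrite /DGam -lock.
  exact: H'.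
have cG (u : V) (v : T -> V) (v0 : V) : v @ F --> v0 -> (fun t => Gam i (y t) u (v t)) @ F --> Gam i y0 u v0.
  by move=> cv; apply: cvg_Gam => //; exact: cvg_cst.
apply: cvgD; first by apply: cvgB; exact: cD.
apply: cvgB.
  exact: (cG a _ _ (cG b (fun=> b) b (cvg_cst _))).
exact: (cG b _ _ (cG a (fun=> b) b (cvg_cst _))).
Qed.

(** The definition of the curvature changes the chart with the point. In one fixed chart
    [gauss_curvatureE] writes it as a quotient of continuous functions with positive denominator. *)
Lemma gauss_curvature_continuous c (t : R) : {for t, continuous c} ->
  {for t, continuous (fun t => gauss_curvature g (c t))}.
Proof.
move=> cc; set i := c t; have ci : dom i (c t) := dom_center _.
pose e0 : V := delta_mx 0 0; pose e1 : V := delta_mx 0 1.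
pose f (r : R) := bf (G i (chart i (c r))) (Rm g i (chart i (c r)) e0 e1 e1) e0 /
  (bf (G i (chart i (c r))) e0 e0 * bf (G i (chart i (c r))) e1 e1 - bf (G i (chart i (c r))) e0 e1 ^+ 2).
have E : \forall r \near t, f r = gauss_curvature g (c r).
  apply: filterS (near_dom cc ci) => r cr; rewrite /f gauss_curvatureE //.
  by rewrite mulfK // gt_eqF //; exact: gram_det_gt0 (chart_cod cr).
apply: (near_eq_continuous_for E).
have cy : (fun r => chart i (c r)) @ t --> chart i (c t).
  by apply: continuous_comp; [exact: cc|exact: chart_continuous].
have yi : cod i (chart i (c t)) := chart_cod ci.
have cG (u v : V) : (fun r => bf (G i (chart i (c r))) u v) @ t --> bf (G i (chart i (c t))) u v.
  by apply: cvg_bf; [exact: cvg_Gm|exact: cvg_cst|exact: cvg_cst].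
have cR : (fun r => bf (G i (chart i (c r))) (Rm g i (chart i (c r)) e0 e1 e1) e0) @ t
    --> bf (G i (chart i (c t))) (Rm g i (chart i (c t)) e0 e1 e1) e0.
  by apply: cvg_bf; [exact: cvg_Gm|exact: cvg_Rm|exact: cvg_cst].
apply: (cvgM cR); apply: cvgV; first by rewrite gt_eqF //; exact: gram_det_gt0.
apply: cvgB; first exact: cvgM.
by under eq_fun do rewrite expr2; rewrite expr2; exact: cvgM.
Qed.

Lemma qdens_continuous c (a e : R) X s (t : R) : fields g c a e X -> 0 <= t <= a ->
  {for t, continuous (qdens g c X s)}.
Proof.
move=> F ta; have [S a0 e0 _ _] := F; set i := c t; have ci : dom i (c t) := dom_center _.
have [cc d dd _] := S t i ci.
have At := in_itv_ext e0 ta.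
pose n (r : R) := dxf c X i s r + Gam i (chart i (c r)) (dchart i c r) (xf c X i s r).
pose f (r : R) := bf (G i (chart i (c r))) (n r) (n r)
  - gauss_curvature g (c r) * bf (G i (chart i (c r))) (xf c X i s r) (xf c X i s r).
have nA : \forall r \near t, `]- e, a + e[%classic r.
  by apply: open_nbhs_nbhs; split; [exact: interval_open|].
have E : \forall r \near t, f r = qdens g c X s r.
  near=> r; rewrite (@qdens_chart R M g c a e X i s r F) //; near: r; first exact: nA.
  exact: near_dom cc ci.
apply: (near_eq_continuous_for E).
have cy : (fun r => chart i (c r)) @ t --> chart i (c t).
  by apply: continuous_comp; [exact: cc|exact: chart_continuous].
have yi : cod i (chart i (c t)) := chart_cod ci.
have [k1 k2] := xf_derive s F At ci.
have cx : xf c X i s @ t --> xf c X i s t by exact: (is_derive_continuous k1).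
have cd : dchart i c @ t --> dchart i c t by exact: (is_derive_continuous dd).
have cn : n @ t --> n t by apply: cvgD; [exact: k2|exact: cvg_Gam].
apply: cvgB; first by apply: cvg_bf; [exact: cvg_Gm|exact: cn|exact: cn].
apply: cvgM; first exact: gauss_curvature_continuous.
by apply: cvg_bf; [exact: cvg_Gm|exact: cx|exact: cx].
Unshelve. all: by end_near. Qed.

Lemma row2_quadratic (q : V -> R) (B : V -> V -> R) :
  (forall s s' w, B (s + s') w = B s w + B s' w) -> (forall r s w, B (r *: s) w = r * B s w) ->
  (forall s s' w, B w (s + s') = B w s + B w s') -> (forall r s w, B w (r *: s) = r * B w s) ->
  (forall s, q s = B s s) -> forall s, q s = s 0 0 ^+ 2 * q (delta_mx 0 0) + s 0 1 ^+ 2 * q (delta_mx 0 1)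
   + s 0 0 * s 0 1 * (q (delta_mx 0 0 + delta_mx 0 1) - q (delta_mx 0 0) - q (delta_mx 0 1)).
Proof.
move=> Dl Zl Dr Zr E s; rewrite !E {1 2}(row2_delta s) !(Dl, Dr, Zl, Zr).
move: (B _ _) (B _ _) (B _ _) (B _ _) => x1 x2 x3 x4.
by ring.
Qed.

Lemma xfD c X i s s' t : xf c X i (s + s') t = xf c X i s t + xf c X i s' t.
Proof. by rewrite /xf !mxE !scalerDl addrACA. Qed.
Lemma xfZ c X i (r : R) s t : xf c X i (r *: s) t = r *: xf c X i s t.
Proof. by rewrite /xf !mxE scalerDr !scalerA. Qed.
Lemma dxfD c X i s s' t : dxf c X i (s + s') t = dxf c X i s t + dxf c X i s' t.
Proof. by rewrite /dxf; move: ('D_1 _ t) ('D_1 _ t) => u v; rewrite !mxE !scalerDl addrACA. Qed.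
Lemma dxfZ c X i (r : R) s t : dxf c X i (r *: s) t = r *: dxf c X i s t.
Proof. by rewrite /dxf; move: ('D_1 _ t) ('D_1 _ t) => u v; rewrite !mxE scalerDr !scalerA. Qed.

(** Polarisation: the value at [s] of the quadratic form determined by [q] at the two basis vectors
    and at their sum. The equation [q s = quad q s] says that [q] is a quadratic form. *)
Definition quad (q : V -> R) s : R := s 0 0 ^+ 2 * q (delta_mx 0 0) + s 0 1 ^+ 2 * q (delta_mx 0 1)
   + s 0 0 * s 0 1 * (q (delta_mx 0 0 + delta_mx 0 1) - q (delta_mx 0 0) - q (delta_mx 0 1)).

Lemma qdens_quadratic c (a e : R) X s (t : R) : fields g c a e X -> 0 <= t <= a ->
  qdens g c X s t = quad (fun s => qdens g c X s t) s.
Proof.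
move=> F ta; have [S a0 e0 _ _] := F; set i := c t; have ci : dom i (c t) := dom_center _.
have At := in_itv_ext e0 ta; set y := chart i (c t).
pose n s := dxf c X i s t + Gam i y (dchart i c t) (xf c X i s t).
have nD s1 s2 : n (s1 + s2) = n s1 + n s2 by rewrite /n dxfD xfD GamDr addrACA.
have nZ (r : R) s1 : n (r *: s1) = r *: n s1 by rewrite /n dxfZ xfZ GamZr -scalerDr.
pose B s1 s2 := bf (G i y) (n s1) (n s2) - gauss_curvature g (c t) * bf (G i y) (xf c X i s1 t) (xf c X i s2 t).
apply: (@row2_quadratic (fun s => qdens g c X s t) B).
- by move=> s1 s2 w; rewrite /B nD xfD !bfDl mulrDr opprD addrACA.
- by move=> r s1 w; rewrite /B nZ xfZ !bfZl mulrBr mulrCA.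
- by move=> s1 s2 w; rewrite /B nD xfD !bfDr mulrDr opprD addrACA.
- by move=> r s1 w; rewrite /B nZ xfZ !bfZr mulrBr mulrCA.
- by move=> s1; rewrite (qdens_chart s1 F At ci).
Qed.

Lemma equal_increments (f h df : R -> R) (a : R) : 0 <= a ->
  (forall t : R, 0 <= t <= a -> is_derive t 1 f (df t)) -> (forall t : R, 0 <= t <= a -> is_derive t 1 h (df t)) ->
  f a - f 0 = h a - h 0.
Proof.
move=> a0 Df Dh.
have key (f1 h1 : R -> R) : (forall t : R, 0 <= t <= a -> is_derive t 1 f1 (df t)) ->
    (forall t : R, 0 <= t <= a -> is_derive t 1 h1 (df t)) -> f1 0 - h1 0 <= f1 a - h1 a.
  move=> D1 D2; apply: (@nondecreasing_derive R (fun t => f1 t - h1 t) (fun t => df t - df t) 0 a a0).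
    by move=> t ta; exact: is_deriveB (D1 t ta) (D2 t ta).
  by move=> t _; rewrite subrr.
by have := key _ _ Df Dh; have := key _ _ Dh Df; clear; lra.
Qed.

(** The primitives are chosen separately for each [s], so the quadratic dependence on [s] is
    asserted of their increments, where the constants of integration cancel. *)
Lemma qdens_primitive c (a e : R) X : fields g c a e X -> exists Hq : V -> R -> R,
  (forall s (t : R), 0 <= t <= a -> is_derive t 1 (Hq s) (qdens g c X s t)) /\
  (forall s, \int[lebesgue_measure]_(t in `[0, a]) qdens g c X s t = Hq s a - Hq s 0) /\
  forall s, Hq s a - Hq s 0 = quad (fun s => Hq s a - Hq s 0) s.
Proof.
move=> F; have [S a0 e0 _ _] := F.
have ex s := primitive a0 (fun t ta => qdens_continuous (s := s) F ta).
have [Hq H] := choice ex; exists Hq.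
have H1 s : forall t : R, 0 <= t <= a -> is_derive t 1 (Hq s) (qdens g c X s t) by exact: (H s).1.
split; [exact: H1|split; first by move=> s; exact: (H s).2].
move=> s.
pose h (t : R) := quad (fun s => Hq s t) s.
have Dh (t : R) : 0 <= t <= a -> is_derive t 1 h (qdens g c X s t).
  move=> ta; rewrite (qdens_quadratic s F ta).
  have d0 := H1 (delta_mx 0 0) t ta; have d1 := H1 (delta_mx 0 1) t ta; have d2 := H1 (delta_mx 0 0 + delta_mx 0 1) t ta.
  apply: (is_derive_subst (is_deriveD (is_deriveD (is_deriveZ (s 0 0 ^+ 2) d0) (is_deriveZ (s 0 1 ^+ 2) d1))
     (is_deriveZ (s 0 0 * s 0 1) (is_deriveB (is_deriveB d2 d0) d1)))).
  by [].
rewrite (equal_increments (ltW a0) (H1 s) Dh) /h /quad.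
by move: (Hq _ _) (Hq _ _) (Hq _ _) (Hq _ _) (Hq _ _) (Hq _ _) (s 0 0) (s 0 1); clear => x1 x2 x3 x4 x5 x6 p q; ring.
Qed.

(** Consecutive pieces are joined at an arbitrary admissible displacement of the intermediate point,
    whose boundary term telescopes. The assertion [P] is empty at time 0, since [second_order_piece]
    works on intervals of positive length. *)
Lemma second_order_chain c (a e : R) X z0 b0 i0 (Hq : V -> R -> R) : fields g c a e X -> adm g c X 0 z0 b0 i0 ->
  (forall s (t : R), 0 <= t <= a -> is_derive t 1 (Hq s) (qdens g c X s t)) ->
  forall za ba ia, adm g c X a za ba ia ->
  exists C r : R, [/\ 0 <= C, 0 < r & forall s, `|s| < r ->
    dist (z0 s) (za s) <= a + (ba s - b0 s) + 2^-1 * (Hq s a - Hq s 0) + C * `|s| ^+ 3].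
Proof.
move=> F A0 DH; have [S a0 e0 _ _] := F.
pose est t z b := exists C r : R, [/\ 0 <= C, 0 < r & forall s, `|s| < r ->
    dist (z0 s) (z s) <= t + (b s - b0 s) + 2^-1 * (Hq s t - Hq s 0) + C * `|s| ^+ 3].
pose P t := 0 < t -> forall z b i, adm g c X t z b i -> est t z b.
suff H : forall t, 0 <= t <= a -> P t.
  by move=> za ba ia Aa; apply: (H a _ a0 za ba ia Aa); rewrite lexx ltW.
have step (t : R) (t0a : 0 <= t <= a) : exists2 d : R, 0 < d & forall t1 t2 : R, 0 <= t1 -> t1 < t2 -> t2 <= a ->
   `|t1 - t| < d -> `|t2 - t| < d -> P t1 -> P t2.
  have [d d0 Hd] := second_order_piece F t0a.
  exists d; first exact: d0.
  move=> {}t1 {}t2 t1p t12 t2a d1 d2 P1 t2p z b i A2.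
  have [t1E|t1n] := eqVneq t1 0.
    rewrite t1E in t1p t12 d1; have [C [r [C0 r0 HC]]] := Hd 0 t2 z0 b0 z b i0 i Hq t1p t12 t2a d1 d2 A0 A2 DH.
    exists C, r; split; [exact: C0|exact: r0|move=> s sr].
    by have := HC s sr; rewrite subr0.
  have t1g : 0 < t1 by rewrite lt_neqAle eq_sym t1n.
  have [z1 [b1 A1]] := adm_exists g c X t1.
  have [C [r [C0 r0 HC]]] := P1 t1g _ _ _ A1.
  have [C' [r' [C'0 r'0 HC']]] := Hd t1 t2 z1 b1 z b _ i Hq t1p t12 t2a d1 d2 A1 A2 DH.
  exists (C + C'), (Num.min r r'); split; [by rewrite addr_ge0|by rewrite lt_min r0|].
  move=> s; rewrite lt_min => /andP[sr sr'].
  apply: le_trans (dist_triangle _ _ (z1 s) _) _; have := HC s sr; have := HC' s sr'.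
  rewrite mulrDl; move: (dist _ _) (dist _ _) (C * _) (C' * _) (Hq _ _) (Hq _ _) (Hq _ _) (b s) (b1 s) (b0 s).
  by clear => *; lra.
apply: (real_induction (ltW a0)); first by rewrite /P ltxx.
  move=> t /andP[t0 ta] Pt; have [|d d0 Hd] := step t; first by rewrite t0 ltW.
  exists (d / 2); first by rewrite divr_gt0.
  move=> s /andP[ts sd] sa; have [<-//|ne] := eqVneq t s.
  apply: (Hd t s) => //; first by rewrite lt_neqAle ne.
    by rewrite subrr normr0.
  by rewrite ger0_norm ?subr_ge0 //; move: sd d0; clear; lra.
move=> t /andP[t0 ta] Ps; have [|d d0 Hd] := step t; first by rewrite ta ltW.
have [s [s0 st sd]] := left_close t0 d0.
apply: (Hd s t) => //; [by rewrite ltr0_norm ?subr_lt0 ?opprB|by rewrite subrr normr0|].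
by apply: Ps; rewrite s0.
Qed.

End SecondVariation.

(** * Displacements along the boundary *)

Section Boundary.
Context {R : realType} {M : surface R} (g : riemannian M).
Local Notation V := 'rV[R]_2.
Implicit Types (i k p : M) (y v w s : V) (c P : R -> M) (X : 'I_2 -> R -> V).
Local Notation G := (Gm g).
Local Notation DG := (DG g).
Local Notation Gam := (Gam g).

Lemma derive_pow_real (U : set R) (f : R -> R) (h : R) : open U -> Ck 3 U f -> forall t, U t ->
  [/\ 'D_h f t = h * 'D_1 f t, 'D_h ('D_h f) t = h ^+ 2 * 'D_1 ('D_1 f) t &
    'D_h ('D_h ('D_h f)) t = h ^+ 3 * 'D_1 ('D_1 ('D_1 f)) t].
Proof.
move=> oU [D1 /(_ 1) [D2 /(_ 1) [D3 _]]].
have Z (b c : R -> R) (k : R) : (forall t, U t -> differentiable b t) -> (forall t, U t -> c t = k * b t) ->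
    forall t, U t -> 'D_h c t = k * h * 'D_1 b t.
  move=> db cE t Ut; rewrite (derive_eq_on (g := k *: b) h oU Ut cE).
  by rewrite (deriveZ _ (diff_derivable (db t Ut))) (derivable1_real h (db t Ut)) /GRing.scale /= mulrA.
have E1 t : U t -> 'D_h f t = h * 'D_1 f t by move=> Ut; rewrite (derivable1_real h (D1 t Ut)).
have E2 t : U t -> 'D_h ('D_h f) t = h ^+ 2 * 'D_1 ('D_1 f) t by rewrite expr2; exact: Z D2 E1 t.
by move=> t Ut; split; [exact: E1|exact: E2|rewrite exprSr; exact: Z D3 E2 t Ut].
Qed.

Lemma curve_taylor P (x : R) i : curve_smooth setT P -> dom i (P x) ->
  exists C r : R, [/\ 0 <= C, 0 < r & forall h : R, `|h| < r -> dom i (P (x + h)) /\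
    `|chart i (P (x + h)) - chart i (P x) - h *: dchart i P x - (2^-1 * h ^+ 2) *: 'D_1 (dchart i P) x| <= C * `|h| ^+ 3].
Proof.
move=> S Pi; have [cP Ck3] := S 3%N; pose U := [set: R] `&` P @^-1` dom i.
have oU : open U by rewrite /U setTI; apply: open_comp (@dom_open _ M i) => t _; exact: cP.
have Ux : U x by split.
pose f (j : 'I_2) t : R := chart i (P t) 0 j; have Cf j : Ck 3 U (f j) by exact: Ck_coord (Ck3 i).
have B j : exists C r : R, [/\ 0 <= C, 0 < r & forall h : R, `|h| < r ->
    U (x + h) /\ `|f j (x + h) - f j x - 'D_h (f j) x - 2^-1 * 'D_h ('D_h (f j)) x| <= C * `|h| ^+ 3].
  have [d1 /(_ 1) [_ /(_ 1) [_ /(_ 1) D4]]] := Cf j; have [K [r1 [K0 r10 HK]]] := near_bounded (D4 x Ux).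
  have [r2 r20 HU] := open_normP oU Ux; have [r [r0 rr1 rr2]] := lt_min2 r10 r20.
  exists K, r; split=> // h hr.
  have near_x t : 0 <= t <= 1 -> `|x + t *: h - x| < r.
    move=> /andP[t0 t1]; rewrite addrAC subrr add0r normrM ger0_norm //; apply: le_lt_trans hr.
    by rewrite ler_piMl.
  split; first by apply: HU; rewrite addrAC subrr add0r; exact: lt_trans hr rr2.
  apply: taylor3 => t /near_x tr; have Ut := HU _ (lt_trans tr rr2).
    by have [e1 /(_ h) [e2 /(_ h) [e3 _]]] := Cf j; split; [exact: e1|exact: e2|exact: e3].
  have [_ _ ->] := derive_pow_real h oU (Cf j) Ut.
  by rewrite normrM normrX mulrC ler_wpM2r ?exprn_ge0 // HK // (lt_trans tr).
have [C0 [r0 [C00 r00 H0]]] := B 0; have [C1 [r1 [C10 r10 H1]]] := B 1; have [r [rp rr0 rr1]] := lt_min2 r00 r10.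
exists (C0 + C1), r; split; [by rewrite addr_ge0|exact: rp|move=> h hr].
have [[_ Ui] T0] := H0 h (lt_trans hr rr0); have [_ T1] := H1 h (lt_trans hr rr1); split; first exact: Ui.
have [D1 /(_ 1) [D2 _]] := Ck3 i.
have E1 t j : U t -> 'D_1 (f j) t = dchart i P t 0 j.
  by move=> Ut; have [_ ->] := is_derive_coord 0 j (is_derive_dir (1 : R) (D1 t Ut)).
have E2 j : 'D_1 ('D_1 (f j)) x = 'D_1 (dchart i P) x 0 j.
  rewrite (derive_eq_on (g := fun t => dchart i P t 0 j) 1 oU Ux (fun t Ut => E1 t j Ut)).
  by have [_ ->] := is_derive_coord 0 j (is_derive_dir (1 : R) (D2 x Ux)).
have E j : (chart i (P (x + h)) - chart i (P x) - h *: dchart i P x - (2^-1 * h ^+ 2) *: 'D_1 (dchart i P) x) 0 j =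
    f j (x + h) - f j x - 'D_h (f j) x - 2^-1 * 'D_h ('D_h (f j)) x.
  have [-> -> _] := derive_pow_real h oU (Cf j) Ux; rewrite E2 E1 //.
  by rewrite !mxE -mulrA.
have h3 : 0 <= `|h| ^+ 3 by rewrite exprn_ge0.
by apply: norm_row2_le; rewrite E; [apply: le_trans T0 _|apply: le_trans T1 _]; rewrite ler_wpM2r // ?lerDl ?lerDr.
Qed.

Lemma cmp_self p v : cmp p p v = v.
Proof. by rewrite cmp_TD TD_self //; exact: chart_cod (dom_center p). Qed.

Lemma perp_line i y u v w : cod i y -> v != 0 -> w != 0 -> bf (G i y) u w = 0 -> bf (G i y) v w = 0 ->
  u = (bf (G i y) u v / bf (G i y) v v) *: v.
Proof.
move=> yi v0 w0 uw vw; set k := _ / _.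
have pv := Gm_gt0 g yi v0; have pw := Gm_gt0 g yi w0.
apply/eqP; rewrite -subr_eq0; set z := u - _.
have zw : bf (G i y) z w = 0 by rewrite /z bfBl bfZl uw vw mulr0 subr0.
have zv : bf (G i y) z v = 0 by rewrite /z bfBl bfZl /k divfK ?gt_eqF // subrr.
apply/negPn/negP => /(Gm_gt0 g yi); apply/negP; rewrite -leNgt.
have sym : G i y 1 0 = G i y 0 1.
  by have /(congr1 (fun A : 'M[R]_2 => A 0 1)) := Gm_sym g i y; rewrite mxE.
(* the Gram determinant of three vectors of the plane vanishes *)
have : bf (G i y) z z * (bf (G i y) v v * bf (G i y) w w) = bf (G i y) z z * bf (G i y) v w ^+ 2
    + bf (G i y) v v * bf (G i y) z w ^+ 2 + bf (G i y) w w * bf (G i y) z v ^+ 2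
    - 2 * bf (G i y) z v * bf (G i y) v w * bf (G i y) z w by rewrite !bfE sym; ring.
rewrite zw zv vw !expr0n /= !mulr0 !addr0 subr0 => /eqP; rewrite mulf_eq0 => /orP[/eqP->//|].
by rewrite gt_eqF // mulr_gt0.
Qed.

(** Differentiating [<N, P'> = 0] trades the covariant derivative of [N] for the covariant
    acceleration of the boundary curve. *)
Lemma second_form_chart (U : set M) (N : M -> V) P (x r : R) : open U -> vfield_smooth U N -> U (P x) ->
  curve_smooth setT P -> (forall t, inner g (P t) (N (P t)) (velocity P t) = 0) ->
  let i := P x in let y := chart i (P x) in let v := dchart i P x in
  second_form g N (P x) (r *: v) = - (r ^+ 2 * bf (G i y) (N (P x)) ('D_1 (dchart i P) x + Gam i y v v)).
Proof.
move=> oU NU Ux S orth i y v.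
have ii : dom i (P x) := dom_center _; have yi : cod i y := chart_cod ii.
pose n (w : V) := cmp i (param i w) (N (param i w)).
have ny : n y = N (P x) by rewrite /n /y chartK // -/i cmp_self.
have dn : differentiable n y.
  have -> : n = (fun w => comp i (param i w) (N (param i w))) by apply/funext => w; rewrite cmpE.
  by have [+ _] := NU i 1%N; apply; split; [exact: yi|rewrite /y chartK].
have [cP Ck2] := S 2%N; have [D1 /(_ 1) [D2 _]] := Ck2 i.
have A0 : (setT `&` P @^-1` dom i) x by split.
have I1 (t : R) : dom i (P t) -> is_derive t 1 (chart i \o P) (dchart i P t).
  by move=> ti; apply: is_derive_dir; apply: D1; split.
have I2 : is_derive x 1 (dchart i P) ('D_1 (dchart i P) x) by apply: is_derive_dir; exact: D2.
have dm : is_derive x 1 (fun t => n (chart i (P t))) ('D_v n y) by exact: (is_derive_comp (I1 x ii) dn).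
have dG : is_derive x 1 (fun t => G i (chart i (P t))) (DG i y v).
  by rewrite -DGE; apply: (is_derive_comp (I1 x ii)); exact: Gm_differentiable.
have D := is_derive_bf dG dm I2.
have Z : is_derive x 1 (fun t => bf (G i (chart i (P t))) (n (chart i (P t))) (dchart i P t)) 0.
  apply: (near_eq_is_derive _ (is_derive_cst (0 : R) x 1)).
  apply: filterS (near_dom (cP x Logic.I) ii) => t ti; rewrite -(orth t) (inner_chart g _ _ ti).
  by rewrite (cmp_velocity (cP t Logic.I) ti (I1 t ti)) /n chartK.
have E : bf (DG i y v) (n y) v + bf (G i y) ('D_v n y) v + bf (G i y) (n y) ('D_1 (dchart i P) x) = 0.
  by have [_ <-] := D; have [_ ->] := Z.
rewrite (metric_compat g v (n y) v yi) ny in E.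
have nE : 'D_(r *: v) n y = r *: 'D_v n y by exact: deriveZr.
rewrite /second_form /cov (inner_chart g _ _ ii) -/i !cmp_self -/y.
rewrite (_ : (fun w => comp i (param i w) (N (param i w))) = n); last by apply/funext => w; rewrite cmpE.
rewrite nE GamE GamZl -scalerDr bfZl bfZr bfDl bfDr; move: E.
rewrite -/i.
have id (p q m k : R) : q + k + p + m = 0 -> r * (r * (p + q)) = - (r ^+ 2 * (m + k)).
  by move=> h; have -> : p = - (q + k + m); [move: h; clear; lra|ring].
exact: id.
Qed.

(** Where [c] meets the boundary orthogonally, a field normal to [c] is tangent to the boundary, so
    the end can be displaced along [P] itself by a parameter linear in [s]. The acceleration of [P]
    then produces the second fundamental form. The sign [eps] is [-1] at the start and [1] at the
    end of the geodesic. *)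
Lemma adm_boundary c (a e eps t : R) X (U : set M) (N : M -> V) P (x : R) :
  fields g c a e X -> 0 <= t <= a -> open U -> vfield_smooth U N -> U (P x) ->
  curve_smooth setT P -> (forall t, inner g (P t) (N (P t)) (velocity P t) = 0) ->
  velocity P x != 0 -> P x = c t -> velocity c t = eps *: N (c t) -> 
  exists al : V, adm g c X t (fun s => P (x + (s 0 0 * al 0 0 + s 0 1 * al 0 1)))
    (fun s => - (2^-1 * eps * second_form g N (c t) (comb X s t))) (P x) /\
  exists k : R, forall s, second_form g N (c t) (comb X s t) = k * (s 0 0 * al 0 0 + s 0 1 * al 0 1) ^+ 2.
Proof.
move=> F ta oU NU Ux S orth v0 Pc vel; have [Sc a0 e0 _ _] := F.
set i := P x; have ii : dom i (P x) := dom_center _; have ci : dom i (c t) by rewrite -Pc.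
have [cc cd _ un] := Sc t i ci.
set y := chart i (c t); have yE : y = chart i (P x) by rewrite /y -Pc.
have yi : cod i y := chart_cod ci.
set v := dchart i P x; have vE : v = velocity P x by rewrite /velocity derive1E.
have v0' : v != 0 by rewrite vE.
pose cv := dchart i c t.
have cvE : cv = eps *: N (c t).
  by rewrite -vel /cv -(cmp_velocity cc ci cd) /i Pc cmp_self.
have cv0 : cv != 0.
  by apply/eqP => e1; move: un; rewrite -/cv e1 bf0l => /eqP; rewrite eq_sym oner_eq0.
have vcv : bf (G i y) v cv = 0.
  have := orth x; rewrite (inner_chart g _ _ ii) !cmp_self -yE -vE => h.
  by rewrite cvE bfZr (GmC g i y v) -Pc h mulr0.
pose al := row2 (bf (G i y) (cmp i (c t) (X 0 t)) v / bf (G i y) v v) (bf (G i y) (cmp i (c t) (X 1 t)) v / bf (G i y) v v).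
pose del s := s 0 0 * al 0 0 + s 0 1 * al 0 1.
have xfE s : xf c X i s t = del s *: v.
  have h (j : 'I_2) : bf (G i y) (cmp i (c t) (X j t)) cv = 0.
    have [_ _ _ _ H] := F; rewrite -(H j t ta) (inner_chart g _ _ ci) (cmp_velocity cc ci cd) //.
  rewrite /xf (perp_line yi v0' cv0 (h 0) vcv) (perp_line yi v0' cv0 (h 1) vcv) !scalerA -scalerDl.
  by rewrite /del /al row2_0 row2_1.
have Odel : isO 1 del.
  exists (`|al 0 0| + `|al 0 1|), 1; split; [by rewrite addr_ge0|exact: ltr01|].
  move=> s _; rewrite expr1; apply: le_trans (ler_normD _ _) _; rewrite !normrM mulrDl.
  by apply: lerD; rewrite mulrC ler_wpM2l // coord_le_norm.
have [C [r [C0 r0 HT]]] := curve_taylor S ii.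
pose w := 'D_1 (dchart i P) x.
pose rem (s : V) := chart i (P (x + del s)) - chart i (P x) - del s *: v - (2^-1 * del s ^+ 2) *: w.
have [r1 r10 Hr1] := isO_small Odel r0.
have Orem : isO 3 rem.
  have [D [rd [D0 rd0 HD]]] := Odel.
  exists (C * D ^+ 3), (Num.min r1 rd); split; [by rewrite mulr_ge0 // exprn_ge0|by rewrite lt_min r10|].
  move=> s; rewrite lt_min => /andP[s1 s2]; have [_ h] := HT _ (Hr1 s s1).
  apply: le_trans h _; rewrite -mulrA -exprMn ler_wpM2l //.
  by apply: lerXn2r; rewrite ?nnegrE ?mulr_ge0 //; have := HD s s2; rewrite expr1.
have Osq : isO 2 (fun s => (2^-1 * del s ^+ 2) *: w).
  have b1 (p q : R) : `|(2^-1 * (p * q)) *: w| <= `|w| * `|p| * `|q|.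
    rewrite normrZ !normrM (gtr0_norm (x := 2^-1)) ?invr_gt0 //.
    rewrite -[leRHS]mulrA [leRHS]mulrC -mulrA; apply: ler_piMl; first by rewrite !mulr_ge0.
    by rewrite invf_le1 ?ltr0n ?ler1n.
  exact: (isO_bilin b1 Odel Odel).
have sfE s : second_form g N (c t) (comb X s t) =
    - (del s ^+ 2 * bf (G i y) (N (c t)) (w + Gam i y v v)).
  rewrite -(cmp_self (c t) (comb X s t)) -{2}Pc -/i (xf_comb X s ci) xfE -Pc.
  by rewrite (second_form_chart (del s) oU NU Ux S orth) -/i -yE.
exists al; split; last first.
  by exists (- bf (G i y) (N (c t)) (w + Gam i y v v)) => s; rewrite sfE mulNr mulrC.
split.
- exact: ci.
- by exists r1 => // s /Hr1 /HT[].
- apply: (isO_ext (f := fun s => (2^-1 * del s ^+ 2) *: w + rem s)) => [s|].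
    rewrite xfE -/y yE /rem -/(del s); move: (chart _ _) (chart _ _) (del s *: v) (_ *: w) => m n o q.
    by apply/rowP => l; rewrite !mxE; ring.
  by apply: isO_add; [exact: Osq|exact: isO_le Orem].
- have [K K0 HK] := linear_bound (fun u1 u2 => bfDr (G i y) cv u1 u2) (fun (r2 : R) u => bfZr (G i y) r2 cv u).
  apply: (isO_ext (f := fun s => bf (G i y) cv (rem s))) => [s|]; last exact: isO_lin HK Orem.
  rewrite sfE.
  rewrite -[s 0 0 * al 0 0 + s 0 1 * al 0 1]/(del s) /gamf xfE -/y -/cv GamZl (GamZr g i y).
  have Nc u : bf (G i y) cv u = eps * bf (G i y) (N (c t)) u by rewrite cvE bfZl.
  have -> : chart i (P (x + del s)) - y = rem s + del s *: v + (2^-1 * del s ^+ 2) *: w.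
    rewrite /rem -yE; move: (chart _ _) (del s *: v) (_ *: w) => m o q.
    by apply/rowP => l; rewrite !mxE; ring.
  move: (rem s) (del s) => rr d.
  rewrite !(bfDr (G i y)) !(bfZr (G i y)) (GmC g i y cv v) vcv !Nc.
  move: (bf (G i y) (N (c t)) rr) (bf (G i y) (N (c t)) w) (bf (G i y) (N (c t)) (Gam i y v v)).
  by clear => m n o; field.
Qed.

End Boundary.

(** * Index two and strict local maxima *)

Section IndexTwo.
Context {R : realType} {M : surface R} (g : riemannian M).
Local Notation V := 'rV[R]_2.
Implicit Types (s : V) (c P : R -> M) (X : 'I_2 -> R -> V).
Local Notation dist := (dist g).

Lemma delta_neq0 (j : 'I_2) : (delta_mx 0 j : V) != 0.
Proof. by apply/eqP => /rowP/(_ j)/eqP; rewrite !mxE !eqxx oner_eq0. Qed.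

Lemma quad_negative (q : V -> R) : (forall s, q s = quad q s) -> (forall s, s != 0 -> q s < 0) ->
  exists2 k : R, 0 < k & forall s, q s <= - (k * `|s| ^+ 2).
Proof.
move=> Q N.
pose A := q (delta_mx 0 0); pose D := q (delta_mx 0 1); pose B := q (delta_mx 0 0 + delta_mx 0 1) - A - D.
have E s : q s = s 0 0 ^+ 2 * A + s 0 1 ^+ 2 * D + s 0 0 * s 0 1 * B by rewrite Q.
have A0 : A < 0 by exact: N (delta_neq0 0).
have D0 : D < 0 by exact: N (delta_neq0 1).
have det : 0 < 4 * (A * D) - B ^+ 2.
  have w0 : row2 B (- (2 * A)) != 0.
    apply/eqP => /rowP/(_ 1); rewrite row2_1 mxE; move: A0; clear; lra.
  have := N _ w0; rewrite E row2_0 row2_1 => h.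
  by rewrite -(nmulr_rlt0 _ A0); move: h; clear; lra.
clearbody A B D.
(* The determinant of the form over minus its trace: the product of two negative eigenvalues divided
   by the sum of their absolute values, which is less than either absolute value. *)
pose k := (4 * (A * D) - B ^+ 2) / (- (4 * (A + D))).
have k0 : 0 < k by rewrite divr_gt0 //; move: A0 D0; clear; lra.
have kE : k * (- (4 * (A + D))) = 4 * (A * D) - B ^+ 2.
  by rewrite /k divfK // gt_eqF //; move: A0 D0; clear; lra.
clearbody k.
have Ak : A + k < 0.
  rewrite -(nmulr_lgt0 (x := 4 * (A + D))); last by move: A0 D0; clear; lra.
  have := mulr_gt0 (x := - A) (y := - A); have := sqr_ge0 B; move: A0 kE; clear; rewrite !expr2.
  by move=> h1 h2 h3 h4; have := h4 _ _; rewrite oppr_gt0 h1 => /(_ isT isT); nra.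
exists k; first exact: k0.
move=> s; apply: (@le_trans _ _ (- (k * (s 0 0 ^+ 2 + s 0 1 ^+ 2)))).
  rewrite E -subr_le0 -(nmulr_rge0 _ Ak).
  rewrite [X in 0 <= X](_ : _ = ((A + k) * s 0 0 + 2^-1 * B * s 0 1) ^+ 2 + k ^+ 2 * s 0 1 ^+ 2
     + 4^-1 * ((4 * (A * D) - B ^+ 2) - k * (- (4 * (A + D)))) * s 0 1 ^+ 2); last by field.
  rewrite kE subrr mulr0 mul0r addr0; apply: addr_ge0; first exact: sqr_ge0.
  by rewrite mulr_ge0 ?sqr_ge0.
rewrite lerN2 ler_pM2l //.
have h (x : R) : `|x| ^+ 2 = x ^+ 2 by rewrite -normrX ger0_norm // sqr_ge0.
rewrite norm_row2; have [l|l] := leP `|s 0 0| `|s 0 1|; rewrite h.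
  by rewrite lerDr sqr_ge0.
by rewrite lerDl sqr_ge0.
Qed.

(** In the difference of the boundary terms at the two ends the opposite signs [eps] make both
    second fundamental forms appear with the sign they have in [Qform]. Both are multiples of
    squares of linear forms in [s], so that [Qform] is quadratic. *)
Lemma second_variation c (a e : R) X (U : set M) (N : M -> V) P (x1 x2 : R) :
  fields g c a e X -> open U -> vfield_smooth U N -> (forall x, U (P x)) ->
  curve_smooth setT P -> (forall t, inner g (P t) (N (P t)) (velocity P t) = 0) ->
  (forall x, velocity P x != 0) -> P x1 = c 0 -> P x2 = c a ->
  velocity c 0 = - N (c 0) -> velocity c a = N (c a) ->
  exists al be : V, (forall s, Qform g N a c (comb X s) = quad (fun s => Qform g N a c (comb X s)) s) /\
  exists C r : R, [/\ 0 <= C, 0 < r & forall s, `|s| < r ->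
    dist (P (x1 + (s 0 0 * al 0 0 + s 0 1 * al 0 1))) (P (x2 + (s 0 0 * be 0 0 + s 0 1 * be 0 1)))
     <= a + 2^-1 * Qform g N a c (comb X s) + C * `|s| ^+ 3].
Proof.
move=> F oU NU Ux S orth v0 p1 p2 n0 na; have [Sc a0 e0 _ _] := F.
have [||al [A1 [k1 K1]]] := adm_boundary (eps := -1) F _ oU NU (Ux x1) S orth (v0 x1) p1.
- by rewrite lexx ltW.
- by rewrite scaleN1r.
have [||al' [A2 [k2 K2]]] := adm_boundary (eps := 1) F _ oU NU (Ux x2) S orth (v0 x2) p2.
- by rewrite lexx andbT ltW.
- by rewrite scale1r.
have [Hq [DH [IH QH]]] := qdens_primitive F.
have QE s : Qform g N a c (comb X s) = (Hq s a - Hq s 0) - second_form g N (c 0) (comb X s 0) - second_form g N (c a) (comb X s a).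
  by rewrite -IH.
exists al, al'; split.
  move=> s; rewrite /quad !QE !K1 !K2 QH /quad !mxE /=.
  move: (Hq _ _ - Hq _ _) (Hq _ _ - Hq _ _) (Hq _ _ - Hq _ _) => u1 u2 u3.
  by move: (s 0 0) (s 0 1) (al 0 0) (al 0 1) (al' 0 0) (al' 0 1); clear => *; ring.
have [C [r [C0 r0 H]]] := second_order_chain F A1 DH A2.
exists C, r; split; [exact: C0|exact: r0|move=> s sr].
have := H s sr; rewrite QE.
move: (dist _ _) (C * _) (second_form _ _ _ _) (second_form _ _ _ _) (Hq _ _) (Hq _ _).
by clear => *; lra.
Qed.

(** The displacements of the two ends depend linearly on [s]. A non-zero [s] displacing neither end
    would give their distance a value below [a]; so the linear map is invertible, and every small
    displacement of the ends arises from a non-zero [s], for which the form is negative. *)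
Lemma index_two_descent c (a : R) (U : set M) (N : M -> V) P (x1 x2 : R) :
  sol g c -> 0 < a -> index_ge g N a c 2 -> open U -> vfield_smooth U N -> (forall x, U (P x)) ->
  curve_smooth setT P -> (forall t, inner g (P t) (N (P t)) (velocity P t) = 0) ->
  (forall x, velocity P x != 0) -> P x1 = c 0 -> P x2 = c a ->
  velocity c 0 = - N (c 0) -> velocity c a = N (c a) -> dist (P x1) (P x2) = a ->
  exists2 r : R, 0 < r & forall h1 h2 : R, `|h1| < r -> `|h2| < r -> (h1 != 0) || (h2 != 0) ->
    dist (P (x1 + h1)) (P (x2 + h2)) < a.
Proof.
move=> Sc a0 [X [NX Neg]] oU NU Ux S orth v0 p1 p2 n0 na dE.
have [e F] : exists e : R, fields g c a e X.
  have [[e0 e00 S0] _] := NX 0; have [[e1 e10 S1] _] := NX 1.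
  have sub (e' : R) : Num.min e0 e1 <= e' -> `]- Num.min e0 e1, a + Num.min e0 e1[ `<=` `]- e', a + e'[.
    by move=> le t; rewrite /= !in_itv /= => /andP[t1 t2]; apply/andP; split; move: le t1 t2; clear; lra.
  have fs (j : 'I_2) (e' : R) : Num.min e0 e1 <= e' -> field_along_smooth `]- e', a + e'[ c (X j) ->
      field_along_smooth `]- Num.min e0 e1, a + Num.min e0 e1[ c (X j).
    by move=> le H i k; apply: Ck_sub (H i k) => t [t1 t2]; split=> //; exact: sub le t t1.
  exists (Num.min e0 e1); split; [exact: Sc|exact: a0|by rewrite lt_min e00| |by move=> j; have [_] := NX j].
  move=> j; have [->|->] := ord2P j.
  - by apply: (fs _ e0); rewrite ?ge_min ?lexx.
  - by apply: (fs _ e1); rewrite ?ge_min ?lexx ?orbT.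
have [al [be [Q [C [r [C0 r0 H]]]]]] := second_variation F oU NU Ux S orth v0 p1 p2 n0 na.
have [k k0 Hk] := quad_negative Q (fun s => Neg s).
(* Below this radius the cubic error is smaller than half of [k |s|^2], the gain from the negative
   form. *)
pose r1 := Num.min r (k / (2 * (C + 1))).
have r10 : 0 < r1 by rewrite lt_min r0 divr_gt0 // mulr_gt0 // ltr_wpDl.
have low s : `|s| < r1 -> s != 0 ->
   dist (P (x1 + (s 0 0 * al 0 0 + s 0 1 * al 0 1))) (P (x2 + (s 0 0 * be 0 0 + s 0 1 * be 0 1))) < a.
  rewrite lt_min => /andP[sr sk] sn; apply: le_lt_trans (H s sr) _.
  have := Hk s; move: (Qform _ _ _ _ _) => q hq.
  have s0 : 0 < `|s| by rewrite normr_gt0.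
  have C1 : 0 < C + 1 by rewrite ltr_wpDl.
  rewrite ltr_pdivlMr ?mulr_gt0 // in sk.
  have h : `|s| * (2 * C) <= `|s| * (2 * (C + 1)) by rewrite !ler_pM2l // lerDl.
  have := le_lt_trans h sk => {}h.
  have := exprn_gt0 2 s0 => s2; have : `|s| ^+ 2 * (`|s| * (2 * C)) < `|s| ^+ 2 * k by rewrite ltr_pM2l.
  rewrite (exprSr _ 2); move: (`|s| ^+ 2) hq => m; clear; lra.
pose dt := al 0 0 * be 0 1 - al 0 1 * be 0 0.
have dt0 : dt != 0.
  apply/eqP => e0.
  have [s [s0 sa sb]] : exists s, [/\ s != 0, s 0 0 * al 0 0 + s 0 1 * al 0 1 = 0 & s 0 0 * be 0 0 + s 0 1 * be 0 1 = 0].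
    have nz (u : V) : u != 0 -> row2 (- u 0 1) (u 0 0) != 0.
      move=> u0; apply: contra u0 => /eqP/rowP E.
      have := E 1; rewrite row2_1 mxE => E1; have := E 0; rewrite row2_0 mxE => /eqP; rewrite oppr_eq0 => /eqP E0.
      by apply/eqP; apply: row2P; rewrite ?E1 ?E0 mxE.
    have [al0|al0] := eqVneq al 0; last first.
      exists (row2 (- al 0 1) (al 0 0)); split; rewrite ?row2_0 ?row2_1; [exact: nz|ring|].
      by rewrite -e0 /dt; ring.
    have [be0|be0] := eqVneq be 0; last first.
      exists (row2 (- be 0 1) (be 0 0)); split; rewrite ?row2_0 ?row2_1; [exact: nz| |ring].
      by rewrite al0 !mxE !mulr0 addr0.
    exists (delta_mx 0 0); rewrite al0 be0 !mxE !mulr0 addr0; split=> //.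
    exact: delta_neq0.
  have sn : 0 < `|s| by rewrite normr_gt0.
  pose l := r1 / (2 * `|s|).
  have l0 : 0 < l by rewrite divr_gt0 // mulr_gt0.
  have ls : `|l *: s| < r1.
    rewrite normrZ gtr0_norm // (_ : l * `|s| = r1 / 2); first by move: r10; clear; lra.
    by rewrite /l invfM mulrA -mulrA mulVf ?gt_eqF // mulr1.
  have ls0 : l *: s != 0 by rewrite scaler_eq0 negb_or gt_eqF.
  have := low _ ls ls0; rewrite !mxE -!mulrA -!mulrDr sa sb !mulr0 !addr0 dE ltxx //.
(* Cramer's rule bounds [|s|] by [L] times the larger of [|h1|] and [|h2|]. *)
pose L := (`|al 0 0| + `|al 0 1| + `|be 0 0| + `|be 0 1|) / `|dt| + 1.
have ndt : 0 < `|dt| by rewrite normr_gt0.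
have L0 : 0 < L by rewrite ltr_wpDl // divr_ge0 // !addr_ge0.
exists (r1 / L); first by rewrite divr_gt0.
move=> h1 h2 b1 b2 hn.
pose s := row2 ((h1 * be 0 1 - h2 * al 0 1) / dt) ((al 0 0 * h2 - be 0 0 * h1) / dt).
have sa : s 0 0 * al 0 0 + s 0 1 * al 0 1 = h1.
  by rewrite row2_0 row2_1; move: dt0; rewrite /dt => dn0; field.
have sb : s 0 0 * be 0 0 + s 0 1 * be 0 1 = h2.
  by rewrite row2_0 row2_1; move: dt0; rewrite /dt => dn0; field.
have s0 : s != 0.
  apply/eqP => e0; move: sa sb hn; rewrite e0 !mxE !mul0r addr0 => <- <-; by rewrite eqxx.
have sr : `|s| < r1.
  pose m := Num.max `|h1| `|h2|.
  have mr : m < r1 / L by rewrite gt_max b1.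
  have hm1 : `|h1| <= m by rewrite le_max lexx.
  have hm2 : `|h2| <= m by rewrite le_max lexx orbT.
  have m0 : 0 <= m by apply: le_trans hm1.
  have bd (p q : R) : `|p| + `|q| <= `|al 0 0| + `|al 0 1| + `|be 0 0| + `|be 0 1| -> forall x, `|x| <= `|h1| * `|p| + `|h2| * `|q| -> `|x / dt| <= m * L.
    move=> pq x hx; rewrite normrM normfV ler_pdivrMr // /L mulrDr mulr1 mulrDl mulrA divfK ?gt_eqF //.
    apply: le_trans hx _; apply: le_trans (lerD (ler_wpM2r (normr_ge0 p) hm1) (ler_wpM2r (normr_ge0 q) hm2)) _.
    by rewrite -mulrDr; apply: ler_wpDr; [rewrite mulr_ge0|rewrite ler_wpM2l].
  apply: (@le_lt_trans _ _ (m * L)); last by rewrite -ltr_pdivlMr.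
  have := normr_ge0 (al 0 0); have := normr_ge0 (al 0 1); have := normr_ge0 (be 0 0); have := normr_ge0 (be 0 1) => n1 n2 n3 n4.
  apply: norm_row2_le; rewrite ?row2_0 ?row2_1.
    apply: (bd (be 0 1) (al 0 1)); first by move: n1 n2 n3 n4; clear; lra.
    by rewrite -!normrM; exact: ler_normB.
  apply: (bd (be 0 0) (al 0 0)); first by move: n1 n2 n3 n4; clear; lra.
  by apply: le_trans (ler_normB _ _) _; rewrite !normrM; clear; lra.
by have := low s sr s0; rewrite sa sb.
Qed.

End IndexTwo.

(** * The embedded disc near a point *)

Section Disc.
Context {R : realType}.
Local Notation V := 'rV[R]_2.
Implicit Types (x y u v w : V).

Lemma unit_disc_norm x : unit_disc x -> `|x| <= 1.
Proof.
rewrite /unit_disc /= => h; have h0 := sqr_ge0 (x 0 0); have h1 := sqr_ge0 (x 0 1).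
have b (r : R) : r ^+ 2 <= 1 -> `|r| <= 1 by move=> hr; rewrite -(@ler_pXn2r _ 2) ?nnegrE // expr1n -normrX ger0_norm ?sqr_ge0.
by apply: norm_row2_le; apply: b; move: h h0 h1; clear; lra.
Qed.

Lemma continuous_sqnorm : continuous (fun x : V => x 0 0 ^+ 2 + x 0 1 ^+ 2 : R).
Proof.
move=> x; have h (j : 'I_2) : (fun y : V => y 0 j : R) @ x --> (x 0 j : R).
  exact: (@cvg_coord R V (nbhs x) _ 1 2 id x 0 j cvg_id).
have c (j : 'I_2) : (fun y : V => y 0 j ^+ 2 : R) @ x --> x 0 j ^+ 2.
  rewrite (_ : (fun y : V => y 0 j ^+ 2 : R) = fun y : V => y 0 j * y 0 j); first exact: (cvgM (h j) (h j)).
  by apply/funext => y; rewrite expr2.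
exact: (cvgD (c 0) (c 1)).
Qed.

Lemma closed_unit_disc : closed (@unit_disc R).
Proof.
have -> : @unit_disc R = (fun x : V => x 0 0 ^+ 2 + x 0 1 ^+ 2 : R) @^-1` [set r | r <= 1] by [].
by apply: closed_comp; [move=> x _; exact: continuous_sqnorm|exact: closed_le].
Qed.

Lemma compact_unit_disc : compact (@unit_disc R).
Proof.
apply: (subclosed_compact closed_unit_disc (@compact_norm_ball R 0 1 ltr01)).
by move=> x /unit_disc_norm h; rewrite /= subr0.
Qed.

Lemma unitmx_inj (A : 'M[R]_2) : (forall u, u *m A = 0 -> u = 0) -> A \in unitmx.
Proof.
move=> H; rewrite -row_free_unit -kermx_eq0; apply/eqP/row_matrixP => i; rewrite row0.
by apply: H; rewrite -row_mul mulmx_ker row0.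
Qed.

Context {M : surface R}.
Implicit Types (i p : M).

(** The conditions of [smooth_disc] with the embedding as a parameter, so that the same one is
    shared by all lemmas below. *)
Definition disc_chart (W : set V) (F : V -> M) (Omega : set M) := [/\ open W /\ unit_disc `<=` W,
        (forall x, W x -> {for x, continuous F}) /\
        (forall i : M, smooth_on (W `&` F @^-1` dom i) (chart i \o F)),
        forall x v, unit_disc x -> 'D_v (chart (F x) \o F) x = 0 -> v = 0,
        forall x y, unit_disc x -> unit_disc y -> F x = F y -> x = y
      & Omega = F @` unit_disc].

Lemma disc_chart_open W F Omega i : disc_chart W F Omega -> open (W `&` F @^-1` dom i).
Proof.
move=> [[oW _] [cF _] _ _ _]; rewrite openE => x [Wx Fx]; rewrite /interior.
apply: filterI; first exact: open_nbhs_nbhs.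
by apply: (cF x Wx); exact: nbhs_dom.
Qed.

(** A local inverse [Z] of [F] with derivative [B] at the image of [x0]. The composition of [F] with
    [B] in coordinates is close to the identity, whence existence of preimages; the estimate of [Z]
    is strict differentiability of [F] read backwards. *)
Lemma disc_chart_local W F Omega x0 : disc_chart W F Omega -> unit_disc x0 ->
  let i := F x0 in let y0 := chart i i in
  exists (Z : M -> V) (B : V -> V), [/\
    (forall u v, B (u + v) = B u + B v) /\ (forall (a : R) u, B (a *: u) = a *: B u),
    (forall u, 'D_(B u) (chart i \o F) x0 = u) /\ (forall u, B ('D_u (chart i \o F) x0) = u),
    \forall p \near i, [/\ dom i p, F (Z p) = p & (Omega p <-> unit_disc (Z p))] &
    forall e : R, 0 < e -> exists2 d : R, 0 < d & forall p, dom i p -> `|chart i p - y0| < d ->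
      `|Z p - x0 - B (chart i p - y0)| <= e * `|chart i p - y0|].
Proof.
move=> DF x0d i y0; have [[oW dW] [cF sF] inj injF OE] := DF.
pose f := chart i \o F; pose U := W `&` F @^-1` dom i.
have oU : open U by exact: disc_chart_open DF.
have Ux : U x0 by split; [exact: dW|exact: dom_center].
have C1 : Ck 1 U f by exact: sF.
have df : differentiable f x0 := Ck_differentiable C1 Ux.
have [a aE] : exists a : 'I_2 -> V, forall k, 'D_(delta_mx 0 k : V) f x0 = a k by exists (fun k => 'D_(delta_mx 0 k : V) f x0).
pose J : 'M[R]_2 := \matrix_(k, l) a k 0 l.
have JE u : u *m J = 'D_u f x0.
  rewrite (derive_row2 _ df) !aE; apply/rowP => l; by rewrite !mxE sum_ord2 !mxE.
have Ju : J \in unitmx by apply: unitmx_inj => u; rewrite JE; exact: inj.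
pose B u := u *m invmx J.
have BD u v : B (u + v) = B u + B v by rewrite /B mulmxDl.
have BZ (k : R) u : B (k *: u) = k *: B u by rewrite /B scalemxAl.
have BB u v : B (u - v) = B u - B v by rewrite /B mulmxBl.
have BA u : B ('D_u f x0) = u by rewrite /B -JE mulmxK.
have AB u : 'D_(B u) f x0 = u by rewrite -JE /B mulmxKV.
have [K K0 HK] := linear_bound BD BZ.
have K1 : 0 < K + 1 by rewrite ltr_wpDl.
have strict (e : R) : 0 < e -> exists2 r : R, 0 < r & forall y z, `|y - x0| < r -> `|z - x0| < r ->
    `|B (f y) - B (f z) - (y - z)| <= e * `|y - z|.
  move=> e0; have e1 : 0 < e / (K + 1) by rewrite divr_gt0.
  have [r r0 H] := strictly_differentiable oU Ux C1 e1; exists r; first exact: r0.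
  move=> y z yr zr; rewrite -BB -[X in _ - X](BA (y - z)) -BB; apply: le_trans (HK _) _.
  apply: le_trans (ler_wpM2l K0 (H y z yr zr)) _.
  rewrite mulrA ler_wpM2r // mulrC -mulrA ler_piMr ?(ltW e0) //.
  by rewrite ler_pdivrMl // mulr1 lerDl.
have [r1 r10 H1] := strict 2^-1 ltac:(by rewrite invr_gt0).
have [r2 r20 H2] := open_normP oU Ux.
pose r := Num.min r1 r2 / 2; have r0 : 0 < r by rewrite divr_gt0 // lt_min r10.
have rlt y : `|y - x0| <= r -> `|y - x0| < r1 /\ U y.
  move=> yr; have : `|y - x0| < Num.min r1 r2.
    apply: le_lt_trans yr _; have : 0 < Num.min r1 r2 by rewrite lt_min r10.
    by rewrite /r; clear; lra.
  by rewrite lt_min => /andP[h1 h2]; split; [exact: h1|exact: H2].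
have half y z : `|y - x0| <= r -> `|z - x0| <= r -> `|B (f y) - B (f z) - (y - z)| <= 2^-1 * `|y - z|.
  by move=> /rlt[y1 _] /rlt[z1 _]; exact: H1.
have lip y z : `|y - x0| <= r -> `|z - x0| <= r -> `|y - z| <= 2 * `|B (f y) - B (f z)|.
  move=> yr zr; have := half y z yr zr; rewrite -normrN opprB.
  have := ler_normD (y - z - (B (f y) - B (f z))) (B (f y) - B (f z)); rewrite subrK.
  by clear; lra.
have fx0 : f x0 = y0 by [].
pose rho := r / 8 / (K + 1); have rho0 : 0 < rho by rewrite divr_gt0 // divr_gt0.
have ex p : exists z, dom i p -> `|chart i p - y0| <= rho -> `|z - x0| <= r /\ F z = p.
  have [[pi pr]|np] := pselect (dom i p /\ `|chart i p - y0| <= rho); last by exists 0 => pi pr; case: np.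
  have small : `|B (chart i p) - B (f x0)| <= r / 8.
    rewrite -BB fx0; apply: le_trans (HK _) _; apply: (@le_trans _ _ ((K + 1) * rho)).
      by apply: ler_pM => //; rewrite lerDl.
    by rewrite /rho mulrC divfK // gt_eqF.
  have [z zr zE] := near_identity_surjective (h := fun y => B (f y)) r0 half small.
  exists z => _ _; split; first exact: zr.
  have [_ [_ Fz]] := rlt z zr.
  have : f z = chart i p by rewrite -(AB (f z)) -(AB (chart i p)) zE.
  by rewrite /f /= => h; rewrite -(chartK Fz) h chartK.
have [Z HZ] := choice ex.
exists Z, B; split; [by split|by split| |].
- have cy : (chart i) @ i --> y0 by exact: (chart_continuous (dom_center i)).
  have n1 : \forall p \near i, `|chart i p - y0| <= rho.
    by apply: filterS (near_cont cy rho0) => p /ltW.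
  have n2 : \forall p \near i, dom i p by exact: nbhs_dom (dom_center i).
  (* Injectivity of [F] holds on the disc. The points of the disc away from [x0] have a compact
     image that misses [F x0]; near [F x0] only the preimage found by [Z] can lie in the disc. *)
  pose D : set V := unit_disc `&` [set w | r <= `|w - x0|].
  have cD : compact D.
    apply: (subclosed_compact _ compact_unit_disc) => [|w []//].
    apply: closedI; first exact: closed_unit_disc.
    apply: (@closed_comp _ _ (fun w : V => `|w - x0|) [set s | r <= s]); last exact: closed_ge.
    move=> w _; have cw : {for w, continuous (fun w : V => w - x0)} by exact: (cvgB cvg_id (cvg_cst x0)).
    exact: (cvg_norm cw).
  have cFD : compact (F @` D).
    apply: continuous_compact cD; apply: within_continuous_in => w [/dW Ww _]; exact: cF.
  have n3 : \forall p \near i, ~ (F @` D) p.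
    have o : open (~` (F @` D)) by apply: closed_openC; apply: compact_closed => //; exact: surface_hausdorff.
    apply: open_nbhs_nbhs; split; first exact: o.
    move=> [w [wd wr] wE]; have e := injF _ _ wd x0d wE.
    by move: wr; rewrite e /= subrr normr0 leNgt r0.
  apply: filterS (filterI n1 (filterI n2 n3)) => p [pr [pi pD]].
  have [zr zE] := HZ p pi pr; split; [exact: pi|exact: zE|rewrite OE; split=> [[w wd wE]|zd]; last by exists (Z p)].
  suff -> : Z p = w by [].
  have wr : `|w - x0| <= r.
    by rewrite leNgt; apply/negP => /ltW h; apply: pD; exists w.
  apply/eqP; rewrite -subr_eq0 -normr_le0; apply: le_trans (lip _ _ zr wr) _.
  by rewrite /f /= zE wE subrr normr0 mulr0.
- move=> e e0; pose e' := e / (2 * (K + 1)).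
  have e'0 : 0 < e' by rewrite divr_gt0 // mulr_gt0.
  have [r3 r30 H3] := strict e' e'0.
  exists (Num.min rho (r3 / (2 * (K + 1)))); first by rewrite lt_min rho0 divr_gt0 // mulr_gt0.
  move=> p pi; rewrite lt_min => /andP[/ltW p1 p2]; have [zr zE] := HZ p pi p1.
  have x0r : `|x0 - x0| <= r by rewrite subrr normr0 ltW.
  have l1 : `|Z p - x0| <= 2 * (K + 1) * `|chart i p - y0|.
    apply: le_trans (lip _ _ zr x0r) _; rewrite -BB fx0 /f /= zE -mulrA ler_pM2l //.
    by apply: le_trans (HK _) _; rewrite ler_wpM2r // lerDl.
  have l2 : `|Z p - x0| < r3.
    by apply: le_lt_trans l1 _; rewrite mulrC -ltr_pdivlMr // mulr_gt0.
  have := H3 (Z p) x0 l2; rewrite subrr normr0 => /(_ r30); rewrite -BB fx0 /f /= zE -normrN opprB => h.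
  apply: le_trans h _; apply: le_trans (ler_wpM2l (ltW e'0) l1) _.
  by rewrite mulrA /e' divfK // gt_eqF // mulr_gt0.
Qed.


Definition turn x : V := row2 (- x 0 1) (x 0 0).

Lemma dotDr u v w : dot u (v + w) = dot u v + dot u w.
Proof. by rewrite /dot !mxE; ring. Qed.

Lemma dotZr (a : R) u v : dot u (a *: v) = a * dot u v.
Proof. by rewrite /dot !mxE; ring. Qed.

Lemma dot_eq0_turn x w : dot x x = 1 -> dot x w = 0 -> w = dot (turn x) w *: turn x.
Proof.
rewrite /dot => x1 xw; apply: row2P; rewrite mxE /turn !row2_0 !row2_1.
  have -> : (- x 0 1 * w 0 0 + x 0 0 * w 0 1) * - x 0 1 =
    w 0 0 * (x 0 0 * x 0 0 + x 0 1 * x 0 1) - (x 0 0 * w 0 0 + x 0 1 * w 0 1) * x 0 0 by ring.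
  by rewrite x1 xw mul0r subr0 mulr1.
have -> : (- x 0 1 * w 0 0 + x 0 0 * w 0 1) * x 0 0 =
  w 0 1 * (x 0 0 * x 0 0 + x 0 1 * x 0 1) - (x 0 0 * w 0 0 + x 0 1 * w 0 1) * x 0 1 by ring.
by rewrite x1 xw mul0r subr0 mulr1.
Qed.

Lemma unit_discE x : unit_disc x <-> dot x x <= 1.
Proof. by rewrite /unit_disc /dot /= !expr2. Qed.

Lemma disc_chart_interior W F Omega x0 : disc_chart W F Omega -> dot x0 x0 < 1 -> Omega° (F x0).
Proof.
move=> DF x1; have x0d : unit_disc x0 by apply/unit_discE; exact: ltW.
have [Z [B [[BD BZ] _ nr HZ]]] := disc_chart_local DF x0d.
have [K K0 HK] := linear_bound BD BZ.
have [d d0 Hd] := HZ 1 ltr01.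
have cq := @continuous_sqnorm x0.
have nq : nbhs (x0 0 0 ^+ 2 + x0 0 1 ^+ 2) [set r | r <= 1].
  apply/(near_normP (x0 0 0 ^+ 2 + x0 0 1 ^+ 2) (fun r => r <= 1)); exists (1 - dot x0 x0); first by rewrite subr_gt0.
  move=> r; rewrite ltr_norml => /andP[_]; rewrite /dot !expr2; clear; lra.
have [e e0 He] := (near_normP x0 _).1 (cq _ nq).
have cy : (chart (F x0)) @ F x0 --> chart (F x0) (F x0) by exact: (chart_continuous (dom_center _)).
have m0 : 0 < Num.min d (e / (K + 2)) by rewrite lt_min d0 divr_gt0 // ltr_wpDl.
have n1 : \forall p \near F x0, `|chart (F x0) p - chart (F x0) (F x0)| < Num.min d (e / (K + 2)).
  exact: near_cont cy m0.
apply: filterS (filterI n1 nr) => p [pr [pi _ OE]]; apply/OE.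
move: pr; rewrite lt_min => /andP[p1 p2]; have h := Hd p pi p1.
apply: (He (Z p)); have K2 : 0 < K + 2 by rewrite ltr_wpDl.
rewrite ltr_pdivlMr // in p2; apply: le_lt_trans p2.
move: h (HK (chart (F x0) p - chart (F x0) (F x0))); set a := chart (F x0) p - _ => h hK.
have := ler_normD (Z p - x0 - B a) (B a); rewrite subrK; have := normr_ge0 a; move: h hK; rewrite mul1r; clear.
by move: `|a| => n; lra.
Qed.

(** The form [l u = dot x0 (B u)] is half the derivative of the squared norm of [Z] along [u], so
    its sign tells whether a curve with velocity [u] leaves the disc or enters its interior. *)
Lemma disc_chart_side W F Omega x0 : disc_chart W F Omega -> dot x0 x0 = 1 ->
  let f := chart (F x0) \o F in exists l : V -> R, [/\
    (forall u v, l (u + v) = l u + l v) /\ (forall (a : R) u, l (a *: u) = a * l u),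
    forall u, l u = 0 -> exists k : R, u = k *: 'D_(turn x0) f x0,
    l ('D_(turn x0) f x0) = 0 /\ l ('D_x0 f x0) = 1,
    forall (c : R -> M) (t0 : R) u, {for t0, continuous c} -> c t0 = F x0 -> is_derive t0 1 (chart (F x0) \o c) u ->
      0 < l u -> exists2 d : R, 0 < d & forall s : R, 0 < s < d -> ~ Omega (c (t0 + s)) &
    forall (c : R -> M) (t0 : R) u, {for t0, continuous c} -> c t0 = F x0 -> is_derive t0 1 (chart (F x0) \o c) u ->
      l u < 0 -> exists2 d : R, 0 < d & forall s : R, 0 < s < d -> Omega° (c (t0 + s))].
Proof.
move=> DF x1 f; have x0d : unit_disc x0 by apply/unit_discE; rewrite x1.
have [Z [B [[BD BZ] [AB BA] nr HZ]]] := disc_chart_local DF x0d.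
have [K K0 HK] := linear_bound BD BZ.
have BN u : B (- u) = - B u by rewrite -scaleN1r BZ scaleN1r.
set i := F x0 in AB BA nr HZ *; set y0 := chart i i in HZ.
have key (c : R -> M) (t0 : R) u : {for t0, continuous c} -> c t0 = i -> is_derive t0 1 (chart i \o c) u ->
    dot x0 (B u) != 0 -> exists2 d : R, 0 < d & forall s : R, 0 < s < d -> exists z, [/\ F z = c (t0 + s),
      Omega (c (t0 + s)) <-> unit_disc z & `|dot z z - 1 - 2 * s * dot x0 (B u)| <= s * `|dot x0 (B u)|].
  move=> cc c0 du; set m := dot x0 (B u) => m0; have nm : 0 < `|m| by rewrite normr_gt0.
  (* Per unit of time, [eta] bounds the deviation of the preimage [z] from [x0 + s *: B u]. The
     factor 16 keeps its effect on [dot z z] within half of [s * |m|]; the other half is left to the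
     quadratic term. *)
  pose eta := Num.min 1 (`|m| / (16 * (`|x0| + 1))).
  have x01 : 0 < `|x0| + 1 by rewrite ltr_wpDl.
  have eta0 : 0 < eta by rewrite lt_min ltr01 divr_gt0 // mulr_gt0.
  have eta1 : eta <= 1 by rewrite ge_min lexx.
  have eta2 : 4 * `|x0| * eta <= `|m| / 2.
    have h : eta * (16 * (`|x0| + 1)) <= `|m| by rewrite -ler_pdivlMr ?mulr_gt0 // ge_min lexx orbT.
    have := mulr_ge0 (normr_ge0 x0) (ltW eta0); move: h eta0; rewrite mulrDr mulr1 mulrDr mulrCA; clear.
    lra.
  clearbody eta.
  pose e1 := eta / (2 * (K + 1)); have e10 : 0 < e1 by rewrite divr_gt0 // mulr_gt0 // ltr_wpDl.
  have u1 : 0 < `|u| + e1 by rewrite ltr_wpDl.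
  pose e2 := eta / (2 * (`|u| + e1)); have e20 : 0 < e2 by rewrite divr_gt0 // mulr_gt0.
  have [d d0 Hd] := HZ e2 e20.
  have dd : differentiable (chart i \o c) t0 by apply/derivable1_diffP; case: du.
  have [r r0 Hr] := (near_normP (0 : R) _).1 (diff_eps dd e10).
  have [r' r'0 Hr'] : exists2 r : R, 0 < r & forall t : R, `|t - t0| < r -> [/\ dom i (c t), F (Z (c t)) = c t & Omega (c t) <-> unit_disc (Z (c t))].
    have nr' : nbhs (c t0) [set p | [/\ dom i p, F (Z p) = p & Omega p <-> unit_disc (Z p)]] by rewrite c0; exact: nr.
    apply/(near_normP t0 (fun t => [/\ dom i (c t), F (Z (c t)) = c t & Omega (c t) <-> unit_disc (Z (c t))])).
    exact: (cc _ nr').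
  pose b := `|B u| + 1; have b0 : 0 < b by rewrite ltr_wpDl.
  pose D := Num.min (Num.min r r') (Num.min (d / (`|u| + e1)) (`|m| / (4 * b ^+ 2))).
  exists D; first by rewrite /D !lt_min r0 r'0 !divr_gt0 // mulr_gt0 // exprn_gt0.
  move=> s /andP[s0]; rewrite /D !lt_min => /andP[/andP[sr sr'] /andP[sd sm]].
  have hs : `|t0 + s - t0| < r' by rewrite addrAC subrr add0r gtr0_norm.
  have [si Zs Os] := Hr' _ hs.
  exists (Z (c (t0 + s))); split; [exact: Zs|exact: Os|].
  have hr : `|s - 0| < r by rewrite subr0 gtr0_norm.
  have := Hr s hr; rewrite (derivable1_real _ dd) (_ : 'D_1 (chart i \o c) t0 = u); last by case: du.
  rewrite [s + t0]addrC /= c0 -/y0 (gtr0_norm s0) => h1.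
  set a := chart i (c (t0 + s)) - y0 in h1.
  have h2 : `|a| <= (`|u| + e1) * s.
    have := ler_normD (a - s *: u) (s *: u); rewrite subrK normrZ (gtr0_norm s0) mulrDl => h.
    by apply: le_trans h _; rewrite addrC (mulrC s) lerD2l.
  have ad : `|a| < d by apply: le_lt_trans h2 _; rewrite mulrC -ltr_pdivlMr.
  have h3 := Hd _ si ad; rewrite -/a in h3.
  pose z := Z (c (t0 + s)); rewrite -/z in h3 *.
  have h4 : `|z - x0 - s *: B u| <= eta * s.
    have e : z - x0 - s *: B u = (z - x0 - B a) + B (a - s *: u).
      by rewrite BD BN BZ addrA subrK.
    rewrite e; apply: le_trans (ler_normD _ _) _.
    have k1 : `|B (a - s *: u)| <= eta / 2 * s.
      apply: le_trans (HK _) _; apply: le_trans (ler_wpM2l K0 h1) _; rewrite mulrA ler_wpM2r ?(ltW s0) //.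
      rewrite (_ : eta / 2 = (K + 1) * e1); first by rewrite ler_wpM2r ?lerDl // ltW.
      by have Kn : K + 1 != 0 by [rewrite gt_eqF // ltr_wpDl]; rewrite /e1; field.
    have k2 : e2 * `|a| <= eta / 2 * s.
      apply: le_trans (ler_wpM2l (ltW e20) h2) _; rewrite mulrA ler_wpM2r ?(ltW s0) // /e2 invfM mulrA mulfVK ?gt_eqF //.
    by apply: le_trans (lerD (le_trans h3 k2) k1) _; rewrite -mulrDl -splitr.
  pose q := z - x0 - s *: B u; rewrite -/q in h4.
  have zE : z = x0 + (s *: B u + q) by rewrite /q [s *: _ + _]addrC subrK addrC subrK.
  have w1 : `|s *: B u + q| <= b * s.
    apply: le_trans (ler_normD _ _) _; rewrite normrZ (gtr0_norm s0) /b mulrDl mul1r mulrC lerD2l.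
    by apply: le_trans h4 _; rewrite ler_piMl // ltW.
  have -> : dot z z - 1 - 2 * s * m = 2 * dot x0 q + dot (s *: B u + q) (s *: B u + q).
    have id (v p : V) : dot (x0 + (s *: v + p)) (x0 + (s *: v + p)) - 1 - 2 * s * dot x0 v =
        2 * dot x0 p + dot (s *: v + p) (s *: v + p) by move: x1; rewrite /dot !mxE => h; rewrite -[X in _ - X - _]h; ring.
    by rewrite zE; exact: id.
  apply: le_trans (ler_normD _ _) _; rewrite normrM (gtr0_norm (x := 2)) //.
  have l1 : 2 * `|dot x0 q| <= `|m| / 2 * s.
    have hh := dot_norm_le x0 q; have : 2 * `|x0| * `|q| <= 2 * `|x0| * (eta * s) by rewrite ler_wpM2l // mulr_ge0.
    have : 4 * `|x0| * eta * s <= `|m| / 2 * s by rewrite ler_wpM2r // ltW.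
    rewrite (_ : 4 * `|x0| * eta * s = 2 * (2 * `|x0| * (eta * s))); last by ring.
    by move: hh; move: (2 * `|x0| * (eta * s)) (2 * `|x0| * `|q|) `|dot x0 q|; clear => k1 k2 k3; lra.
  have l2 : `|dot (s *: B u + q) (s *: B u + q)| <= `|m| / 2 * s.
    apply: le_trans (dot_norm_le _ _) _; rewrite -mulrA -expr2.
    have : `|s *: B u + q| ^+ 2 <= (b * s) ^+ 2 by apply: lerXn2r; rewrite ?nnegrE ?normr_ge0 // mulr_ge0 // ltW.
    rewrite ltr_pdivlMr ?mulr_gt0 ?exprn_gt0 // in sm.
    have : s * (s * (4 * b ^+ 2)) <= s * `|m| by rewrite ler_pM2l // ltW.
    rewrite (_ : s * (s * (4 * b ^+ 2)) = 4 * (b * s) ^+ 2); last by ring.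
    by move: ((b * s) ^+ 2) (`|s *: B u + q| ^+ 2) => k1 k2; clear; lra.
  by move: (lerD l1 l2); rewrite -mulrDl -splitr [s * _]mulrC.
exists (fun u => dot x0 (B u)); split.
- by split=> *; rewrite ?BD ?BZ ?dotDr ?dotZr.
- move=> u h; exists (dot (turn x0) (B u)); transitivity ('D_(B u) f x0); first by rewrite /f AB.
  rewrite {1}(dot_eq0_turn x1 h).
  have Fx : (W `&` F @^-1` dom i) x0 by split; [have [[_ dW] _ _ _ _] := DF; exact: dW|exact: dom_center].
  have df : differentiable f x0.
    have [_ [_ sF] _ _ _] := DF; exact: (Ck_differentiable (sF i 1%N) Fx).
  exact: deriveZr.
- by rewrite !BA x1; split=> //; rewrite /dot /turn row2_0 row2_1; ring.
- move=> c t0 u cc c0 du lu; have [d d0 H] := key c t0 u cc c0 du (lt0r_neq0 lu).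
  exists d => // s sd; have [z [zE OE h]] := H s sd; have [s0 _] := andP sd.
  move=> /OE/unit_discE zd; move: h; rewrite (gtr0_norm lu) => h; have := le_trans (ler_norm _) h.
  have := mulr_gt0 s0 lu; rewrite -normrN in h; have := le_trans (ler_norm _) h; move: zd; rewrite -mulrA; clear.
  by move: (s * _) => w; lra.
- move=> c t0 u cc c0 du lu; have [d d0 H] := key c t0 u cc c0 du (ltr0_neq0 lu).
  exists d => // s sd; have [z [zE OE h]] := H s sd; have [s0 _] := andP sd.
  rewrite -zE; apply: (disc_chart_interior DF); move: h; rewrite (ltr0_norm lu) => h; have := le_trans (ler_norm _) h.
  have : s * dot x0 (B u) < 0 by rewrite pmulr_rlt0.
  by rewrite -mulrA mulrN; clear; move: (s * _) => w; lra.
Qed.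

(** A curve that starts with the image of the radial direction [x0], where [l] is 1, leaves [Omega]
    at once, so [F x0] is not an interior point. *)
Lemma disc_chart_bd W F Omega x0 : disc_chart W F Omega -> dot x0 x0 = 1 -> bd Omega (F x0).
Proof.
move=> DF x1; have [_ _ _ _ OE] := DF; split.
  by rewrite OE; exists x0 => //; apply/unit_discE; rewrite x1.
have [l [[lD lZ] _ [_ l1] out _]] := disc_chart_side DF x1 => int.
set i := F x0 in int out l1; set u := 'D_x0 _ x0 in l1.
have ii : dom i i := dom_center i; have yi : cod i (chart i i) := chart_cod ii.
pose c (t : R) := param i (chart i i + t *: u).
have c0 : c 0 = i by rewrite /c scale0r addr0 chartK.
have aff (t : R) : is_derive t 1 (fun t : R => chart i i + t *: u) u by exact: is_derive_affine.
have cc : {for 0, continuous c}.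
  apply: (@continuous_comp _ _ _ (fun t : R => chart i i + t *: u) (param i)); first exact: is_derive_continuous (aff 0).
  by rewrite scale0r addr0; exact: param_continuous.
have du : is_derive (0 : R) 1 (chart i \o c) u.
  apply: near_eq_is_derive (aff 0).
  have nU : nbhs (chart i i + (0 : R) *: u) (cod i) by rewrite scale0r addr0; exact: nbhs_cod.
  have nn : \forall t \near (0 : R), cod i (chart i i + t *: u) := is_derive_continuous (aff 0) nU.
  by apply: filterS nn => t ct; rewrite /= /c paramK.
have [|d d0 H] := out c 0 u cc c0 du; first by rewrite l1 ltr01.
have [r r0 Hr] : exists2 r : R, 0 < r & forall t : R, `|t - 0| < r -> Omega (c t).
  have int' : nbhs (c 0) Omega by rewrite c0; exact: int.
  exact: ((near_normP (0 : R) (fun t => Omega (c t))).1 (cc _ int')).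
have [s [s0 sd sr]] := lt_min2 d0 r0.
apply: (H s); first by rewrite s0.
by rewrite add0r; apply: Hr; rewrite subr0 gtr0_norm.
Qed.

End Disc.

(** * The boundary curve and the outward normal *)

Section Circle.
Context {R : realType}.
Local Notation V := 'rV[R]_2.

Lemma cos_sin_Ck k : Ck k [set: R] (@cos R) /\ Ck k [set: R] (@sin R).
Proof.
have dc (x : R) : differentiable (@cos R) x by apply/derivable1_diffP; case: (is_derive_cos x).
have ds (x : R) : differentiable (@sin R) x by apply/derivable1_diffP; case: (is_derive_sin x).
have DC (v : R) : 'D_v (@cos R) = fun x => (- v) * sin x.
  apply/funext => x; rewrite (derivable1_real v (dc x)); have [_ ->] := is_derive_cos x.
  by rewrite /GRing.scale /= mulrN mulNr.
have DS (v : R) : 'D_v (@sin R) = fun x => v * cos x.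
  by apply/funext => x; rewrite (derivable1_real v (ds x)); have [_ ->] := is_derive_sin x.
elim: k => [|k [Cc Cs]]; first by split=> x _; [exact: continuous_cos|exact: continuous_sin].
split; split; [by move=> x _|move=> v|by move=> x _|move=> v].
  by rewrite DC; exact: Ck_mul openT (Ck_cst k setT (- v)) Cs.
by rewrite DS; exact: Ck_mul openT (Ck_cst k setT v) Cc.
Qed.

Lemma Ck_shift (U' : normedModType R) k (U : set R) (f : R -> U') (t : R) : open U -> Ck k U f ->
  Ck k [set s | U (t + s)] (fun s => f (t + s)).
Proof.
move=> oU; have ct : continuous (fun s : R => t + s) by move=> s; exact: cvgD (cvg_cst t) cvg_id.
have oS : open [set s | U (t + s)] by apply: open_comp => [s _|]; [exact: ct|exact: oU].
have dt (s v : R) : is_derive s v (fun s : R => t + s) v.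
  by apply: (is_derive_subst (is_deriveD (is_derive_cst t s v) (is_derive_id s v))); rewrite add0r.
elim: k f => [|k IH] f.
  by move=> H s Us; apply: (@continuous_comp _ _ _ (fun s : R => t + s) f); [exact: ct|exact: H].
move=> [df Df]; split=> [s Us|v].
  apply: (@differentiable_comp _ _ _ _ (fun s : R => t + s) f); last exact: df.
  by apply/derivable1_diffP; case: (dt s 1).
apply: (Ck_ext oS _ (IH _ (Df v))) => s Us.
by have [_ <-] := is_derive_comp (dt s v) (df _ Us).
Qed.

Definition circ (t : R) : V := row2 (cos t) (sin t).

Lemma circ_Ck k : Ck k [set: R] circ.
Proof.
apply: Ck_mx openT _ => i j; rewrite (ord1 i); have [Cc Cs] := cos_sin_Ck k.
have [->|->] := ord2P j.
- by rewrite (_ : (fun x => _) = @cos R) //; apply/funext => x; rewrite row2_0.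
- by rewrite (_ : (fun x => _) = @sin R) //; apply/funext => x; rewrite row2_1.
Qed.

Lemma is_derive_circ (t : R) : is_derive t 1 circ (turn (circ t)).
Proof.
apply: is_derive_mx => i j; rewrite (ord1 i).
have [->|->] := ord2P j.
- rewrite (_ : (fun x => _) = @cos R); last by apply/funext => x; rewrite row2_0.
  by rewrite /turn row2_0 row2_1; exact: is_derive_cos.
- rewrite (_ : (fun x => _) = @sin R); last by apply/funext => x; rewrite row2_1.
  by rewrite /turn row2_1 row2_0; exact: is_derive_sin.
Qed.

Lemma dot_circ t : dot (circ t) (circ t) = 1.
Proof. by rewrite /dot row2_0 row2_1 -!expr2 cos2Dsin2. Qed.

Lemma circ_periodic t : circ (t + pi *+ 2) = circ t.
Proof. by rewrite /circ cosD2pi sinD2pi. Qed.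

(** Equality of the two points means [cos (t - s) = 1], while the sine of half the difference is
    positive. *)
Lemma circ_inj (s t : R) : s < t -> t < s + pi *+ 2 -> circ s <> circ t.
Proof.
move=> st ts E; pose d := (t - s) / 2.
have : 0 < sin d.
  apply: sin_gt0_pi; apply/andP; split; first by rewrite divr_gt0 // subr_gt0.
  by rewrite /d ltr_pdivrMr // mulr_natr ltrBlDl.
have : cos (d + d) = 1.
  rewrite /d -splitr cosB; have := dot_circ t; rewrite /dot -{2 4}E.
  by rewrite !row2_0 !row2_1.
rewrite cosD; have := cos2Dsin2 d; rewrite -!expr2 => h1 h2 h3.
by have : 0 < sin d ^+ 2 by [rewrite exprn_gt0]; move: h1 h2; clear; lra.
Qed.

Lemma turn_neq0 (t : R) : turn (circ t) != 0.
Proof.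
apply/eqP => /rowP e; have := dot_circ t; have := e 0; have := e 1; rewrite /turn row2_0 row2_1 /dot !mxE.
by move=> -> /eqP; rewrite oppr_eq0 => /eqP ->; rewrite !mul0r addr0 => /eqP; rewrite eq_sym oner_eq0.
Qed.

Context {M : surface R}.
Variable (W : set V) (F : V -> M) (Omega : set M).
Hypothesis DF : disc_chart W F Omega.
Local Notation P := (F \o circ).

Lemma circ_disc t : unit_disc (circ t).
Proof. by apply/unit_discE; rewrite dot_circ. Qed.

Lemma bd_curve_smooth : curve_smooth [set: R] P.
Proof.
have [[oW dW] [cF sF] _ _ _] := DF.
have cc (t : R) : {for t, continuous circ} by exact: (Ck_continuous (circ_Ck 0) Logic.I).
have cP (t : R) : {for t, continuous P} by apply: continuous_comp; [exact: cc|apply: cF; apply: dW; exact: circ_disc].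
move=> k; split=> [t _|i]; first exact: cP.
have oi := disc_chart_open (i := i) DF.
apply: (@Ck_comp R R 1 2 k _ (W `&` F @^-1` dom i) circ (chart i \o F)).
- apply: openI; first exact: openT.
  by apply: open_comp => [t _|]; [exact: cP|exact: dom_open].
- exact: oi.
- by move=> t [_ ti]; split; [apply: dW; exact: circ_disc|exact: ti].
- exact: Ck_sub (circ_Ck k).
- exact: sF.
Qed.

Lemma bd_curve_bd t : bd Omega (P t).
Proof. by apply: (disc_chart_bd DF); exact: dot_circ. Qed.

Lemma bd_curve_derive i t : dom i (P t) ->
  is_derive t 1 (chart i \o P) ('D_(turn (circ t)) (chart i \o F) (circ t)).
Proof.
move=> ti; have [[oW dW] [cF sF] _ _ _] := DF.
have df : differentiable (chart i \o F) (circ t).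
  by apply: (Ck_differentiable (sF i 1%N)); split; [apply: dW; exact: circ_disc|exact: ti].
exact: is_derive_comp (is_derive_circ t) df.
Qed.

Lemma bd_curve_velocityE t : velocity P t = 'D_(turn (circ t)) (chart (P t) \o F) (circ t).
Proof. by rewrite /velocity derive1E; have [_ ->] := bd_curve_derive (dom_center (P t)). Qed.

Lemma bd_curve_velocity t : velocity P t != 0.
Proof.
rewrite bd_curve_velocityE; have [_ _ H _ _] := DF.
by apply/eqP => /(H _ _ (circ_disc t)) /eqP; apply/negP; exact: turn_neq0.
Qed.

Lemma bd_curve_inj (s t : R) : s < t -> t < s + pi *+ 2 -> P s <> P t.
Proof.
move=> st ts e; have [_ _ _ H _] := DF.
exact: (circ_inj st ts) (H _ _ (circ_disc s) (circ_disc t) e).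
Qed.

Variable g : riemannian M.
Variable N : M -> V.
Hypothesis ON : outward_unit_normal g Omega N.
Local Notation G := (Gm g).

Lemma bd_curve_tangent t : bd_tangent Omega (P t) (velocity P t).
Proof.
exists 1, (fun s => P (t + s)); split; [exact: ltr01| |by move=> s _; exact: bd_curve_bd|by rewrite addr0|].
  move=> k; have [cP cS] := bd_curve_smooth k; split=> [s _|i].
    have cs : {for s, continuous (fun s : R => t + s)} by exact: cvgD (cvg_cst t) cvg_id.
    exact: (continuous_comp cs (cP (t + s) Logic.I)).
  have oU : open ([set: R] `&` P @^-1` dom i).
    apply: openI; first exact: openT.
    by apply: open_comp => [s _|]; [exact: (bd_curve_smooth 0%N).1|exact: dom_open].
  by apply: Ck_sub (Ck_shift t oU (cS i)) => s [_ h]; split.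
have ii : dom (P t) (P (t + 0)) by rewrite addr0; exact: dom_center.
have tau : is_derive (0 : R) 1 (fun s : R => t + s) 1.
  by apply: (is_derive_subst (is_deriveD (is_derive_cst t (0 : R) 1) (is_derive_id (0 : R) 1))); rewrite add0r.
have := is_derive_time tau (bd_curve_derive ii); rewrite scale1r => D.
by rewrite bd_curve_velocityE /velocity derive1E addr0; rewrite addr0 in D; have [_ <-] := D.
Qed.

Lemma bd_curve_normal t : inner g (P t) (N (P t)) (velocity P t) = 0.
Proof. by have [_ /(_ _ (bd_curve_bd t)) [_ H _]] := ON; exact: H (bd_curve_tangent t). Qed.

Lemma normal_unit t : inner g (P t) (N (P t)) (N (P t)) = 1.
Proof.
have [_ /(_ _ (bd_curve_bd t)) [H _ _]] := ON; move: H; rewrite /norm => h.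
have := @ltr01 R; rewrite -h sqrtr_gt0 => h0; rewrite -[LHS]sqr_sqrtr ?ltW // h expr1n //.
Qed.

Lemma inner_self p u v : inner g p u v = bf (G p (chart p p)) u v.
Proof. by rewrite (inner_chart g _ _ (dom_center p)) !cmp_self. Qed.

Lemma innerC p u v : inner g p u v = inner g p v u.
Proof. by rewrite !inner_self GmC. Qed.

Lemma normal_decomp t (u : V) : exists k : R,
  u = inner g (P t) u (N (P t)) *: N (P t) + k *: velocity P t.
Proof.
set i := P t; have yi : cod i (chart i i) := chart_cod (dom_center i).
set n := N i; set v := velocity P t.
have n1 : bf (G i (chart i i)) n n = 1 by rewrite -inner_self; exact: normal_unit.
have nv : bf (G i (chart i i)) v n = 0 by rewrite -inner_self innerC; exact: bd_curve_normal.
have n0 : n != 0 by apply/eqP => e; move: n1; rewrite e bf0l => /eqP; rewrite eq_sym oner_eq0.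
have wn : bf (G i (chart i i)) (u - inner g i u n *: n) n = 0.
  by rewrite bfBl bfZl n1 mulr1 inner_self subrr.
have := perp_line yi (bd_curve_velocity t) n0 wn nv; set k := _ / _ => E.
by exists k; rewrite -E addrC subrK.
Qed.

(** By [normal_decomp] every tangent vector in the sense of [bd_tangent], being orthogonal to [N],
    is a multiple of the velocity of [P]. *)
Lemma bd_orthogonal_curve t (u : V) : inner g (P t) u (velocity P t) = 0 -> bd_orthogonal g Omega (P t) u.
Proof.
move=> h w wt; have [k ->] := normal_decomp t w.
have [_ /(_ _ (bd_curve_bd t)) [_ H _]] := ON.
by rewrite (innerC (P t) w) (H w wt) scale0r add0r inner_self bfZr -inner_self h mulr0.
Qed.

(** The form [l] of [disc_chart_side] is a positive multiple of the product with [N]: both vanish on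
    the velocity of [P], and [l] is positive on [N] because points in the direction of [N] lie
    outside [Omega]. *)
Lemma boundary_side t (c : R -> M) (t0 : R) (u : V) : {for t0, continuous c} -> c t0 = P t ->
  is_derive t0 1 (chart (P t) \o c) u ->
  (0 < inner g (P t) u (N (P t)) -> exists2 d : R, 0 < d & forall s : R, 0 < s < d -> ~ Omega (c (t0 + s))) /\
  (inner g (P t) u (N (P t)) < 0 -> exists2 d : R, 0 < d & forall s : R, 0 < s < d -> Omega° (c (t0 + s))).
Proof.
move=> cc c0 du; have [l [[lD lZ] l0 [lt _] out inn]] := disc_chart_side DF (dot_circ t).
rewrite -bd_curve_velocityE in lt.
set i := P t in c0 du *; set n := N i.
have ii : dom i i := dom_center i; have yi : cod i (chart i i) := chart_cod ii.
have ln : 0 < l n.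
  rewrite lt_neqAle; apply/andP; split.
    rewrite eq_sym; apply/eqP => /l0[k]; rewrite -bd_curve_velocityE => nk.
    have := normal_unit t; rewrite -/i -/n {2}nk inner_self bfZr -inner_self bd_curve_normal mulr0.
    by move/eqP; rewrite eq_sym oner_eq0.
  rewrite leNgt; apply/negP => ln.
  pose b (s : R) := param i (chart i i + s *: n).
  have aff (s : R) : is_derive s 1 (fun s : R => chart i i + s *: n) n by exact: is_derive_affine.
  have b0 : b 0 = i by rewrite /b scale0r addr0 chartK.
  have cb : {for 0, continuous b}.
    apply: (@continuous_comp _ _ _ (fun s : R => chart i i + s *: n) (param i)); first exact: is_derive_continuous (aff 0).
    by rewrite scale0r addr0; exact: param_continuous.
  have db : is_derive (0 : R) 1 (chart i \o b) n.
    apply: near_eq_is_derive (aff 0).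
    have nU : nbhs (chart i i + (0 : R) *: n) (cod i).
      by rewrite scale0r addr0; apply: open_nbhs_nbhs; split; [exact: cod_open|exact: yi].
    have nn : \forall s \near (0 : R), cod i (chart i i + s *: n) := is_derive_continuous (aff 0) nU.
    by apply: filterS nn => s cs; rewrite /= /b paramK.
  have [d d0 H] := inn b 0 n cb b0 db ln.
  have [_ /(_ _ (bd_curve_bd t)) [_ _ nO]] := ON.
  have : \forall s \near (0 : R)^'+, False; last by move=> /filter_ex[].
  have nd : \forall s \near (0 : R)^'+, 0 < s < d by near=> s; apply/andP; split.
  apply: filterS (filterI nd nO) => s [sd no]; apply: no.
  by have := H s sd; rewrite add0r => /interior_subset.
have [k uk] := normal_decomp t u; rewrite -/i -/n in uk *.
have lu : l u = inner g i u n * l n by rewrite {1}uk lD !lZ lt mulr0 addr0.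
split=> h.
  by apply: (out c t0 u cc c0 du); rewrite lu mulr_gt0.
by apply: (inn c t0 u cc c0 du); rewrite lu nmulr_rlt0.
Unshelve. all: by end_near. Qed.

End Circle.

(** * Convexity and proper geodesics *)

Section Proper.
Context {R : realType} {M : surface R} (g : riemannian M).
Local Notation V := 'rV[R]_2.
Implicit Types (c b : R -> M) (i p : M).
Local Notation G := (Gm g).

(** The predicate [sol] records the equation only; smoothness is recovered by identifying [c] with
    the geodesic that completeness provides for the same initial data. *)
Lemma sol_geodesic c : complete g -> sol g c -> geodesic_on g [set: R] c.
Proof.
move=> cpl S; have [cc _ _ un] := S 0 _ (dom_center (c 0)).
have [b [Gb b0 v0]] := complete_sol cpl (dom_center (c 0)) un.
suff <- : b = c by [].
apply/funext; apply: (sol_unique (geodesic_sol Gb) S b0).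
by exists (c 0); split; [exact: dom_center|exact: v0].
Qed.

Lemma sol_velocity c t : sol g c -> velocity c t = dchart (c t) c t.
Proof. by move=> S; rewrite /velocity derive1E. Qed.

Lemma geodesic_on_geodesic a c : geodesic_on g [set: R] c -> 0 < a -> geodesic g a c.
Proof.
move=> [S E] a0; split; first exact: a0.
exists 1; first exact: ltr01.
split; last by move=> t _; exact: E.
move=> k; have [cc cs] := S k; split=> [t _|i]; first exact: cc.
by apply: Ck_sub (cs i) => t [_ h]; split.
Qed.

Lemma convex_between Omega c (s t r : R) : complete g -> totally_convex g Omega -> sol g c ->
  Omega (c s) -> Omega (c t) -> s < r < t -> Omega (c r).
Proof.
move=> cpl TC S Os Ot /andP[sr rt]; have st : s < t := lt_trans sr rt.
have e2 : (1 : R) ^+ 2 = 1 by rewrite expr1n.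
have [Sb _] := sol_affine s e2 S.
have Gb := geodesic_on_geodesic (sol_geodesic cpl Sb) (a := t - s).
have := TC (t - s) _ (Gb _); rewrite subr_gt0 => /(_ st).
have eb (x : R) : s + 1 * (x - s) = x by rewrite mul1r addrC subrK.
rewrite mulr0 addr0 eb => /(_ Os Ot (r - s)); rewrite eb; apply.
by rewrite subr_ge0 (ltW sr) lerD2r ltW.
Qed.

(* A geodesic through [c t] perturbed within the normalised field of the
   chart velocity stays in [Omega] by convexity, so [c t] is interior. *)
Lemma interior_between Omega c (s t r : R) : complete g -> totally_convex g Omega -> sol g c ->
  Omega° (c s) -> Omega° (c t) -> s < r < t -> Omega° (c r).
Proof.
move=> cpl TC S Is It srt.
have e2 : (1 : R) ^+ 2 = 1 by rewrite expr1n.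
pose b (x : R) := c (r + 1 * x).
have [Sb _] := sol_affine r e2 S; rewrite -/b in Sb.
have b0 : b 0 = c r by rewrite /b mulr0 addr0.
have eb (x : R) : b (x - r) = c x by rewrite /b mul1r addrC subrK.
set i := b 0; have ii : dom i (b 0) := dom_center _.
pose w0 := dchart i b 0.
have [cb _ _ un] := Sb 0 i ii.
have w0n : w0 != 0 by apply/eqP => e; move: un; rewrite -/w0 e bf0l => /eqP; rewrite eq_sym oner_eq0.
pose h p := (Num.sqrt (bf (G i (chart i p)) w0 w0))^-1 *: w0.
have ex p : exists c' : R -> M, sol g c' /\ (dom i p -> c' 0 = p /\ dchart i c' 0 = h p).
  have [pi|np] := pselect (dom i p); last by exists b; split=> // pi; case: np.
  have pos : 0 < bf (G i (chart i p)) w0 w0 by exact: Gm_gt0 (chart_cod pi) w0n.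
  have u1 : bf (G i (chart i p)) (h p) (h p) = 1.
    rewrite /h bfZl bfZr mulrA -expr2 exprVn sqr_sqrtr ?ltW // mulVf // gt_eqF //.
  have [c' [Gc c0 v0]] := complete_sol cpl pi u1.
  by exists c'; split; [exact: geodesic_sol|].
have [cn H] := choice ex.
have FF : ProperFilter (nbhs i) by exact: nbhs_pfilter.
have nd : \forall p \near i, dom i p by exact: nbhs_dom ii.
have cv : conv (nbhs i) cn b 0.
  split.
    apply: (cvg_trans (G := nbhs i)) => //; apply: near_eq_cvg; apply: filterS nd => p pi.
    by have [_ /(_ pi)[]] := H p.
  exists i; split; first exact: ii.
  have cG : (fun p => bf (G i (chart i p)) w0 w0) @ i --> bf (G i (chart i i)) w0 w0.
    by apply: cvg_bf; [apply: cvg_Gm; [exact: chart_cod|exact: chart_continuous]|exact: cvg_cst|exact: cvg_cst].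
  have ch : h @ i --> h i.
    apply: cvgZ; last exact: cvg_cst.
    apply: cvgV.
      by rewrite gt_eqF // sqrtr_gt0; apply: Gm_gt0 w0n; exact: chart_cod.
    apply: (@continuous_cvg _ _ _ (nbhs i) _ (fun p => bf (G i (chart i p)) w0 w0) Num.sqrt); last exact: cG.
    exact: sqrt_continuous.
  have hi : h i = w0 by rewrite /h un sqrtr1 invr1 scale1r.
  rewrite hi in ch; apply: cvg_trans ch; apply: near_eq_cvg; apply: filterS nd => p pi.
  by have [_ /(_ pi)[_ ->]] := H p.
have cvt := conv_backward FF (fun p => (H p).1) Sb cv.
have at_ (x : R) : Omega° (c x) -> \forall p \near i, Omega (cn p (x - r)).
  move=> Ix; have [cx _] := cvt (x - r).
  have nU : nbhs (b (x - r)) Omega by rewrite eb; exact: Ix.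
  exact: (cx _ nU).
rewrite -b0; apply: filterS (filterI nd (filterI (at_ s Is) (at_ t It))) => p [pi [ps pt]].
have [Sp /(_ pi)[p0 _]] := H p; rewrite -p0.
have [sr rt] := andP srt; apply: (convex_between cpl TC Sp ps pt).
by rewrite subr_lt0 subr_gt0 sr.
Qed.

Variables (W : set V) (F : V -> M) (Omega : set M) (N : M -> V).
Hypothesis DF : disc_chart W F Omega.
Hypothesis ON : outward_unit_normal g Omega N.
Local Notation P := (F \o circ).

Lemma reverse_sol c (t : R) : sol g c -> let b := fun s : R => c (t + -1 * s) in
  [/\ sol g b, b 0 = c t & velocity b 0 = - velocity c t].
Proof.
move=> S b; have e2 : (-1 : R) ^+ 2 = 1 by rewrite sqrrN expr1n.
have [Sb _] := sol_affine t e2 S; have tt : t + -1 * 0 = t by rewrite mulr0 addr0.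
have b0 : b 0 = c t by rewrite /b tt.
split; [exact: Sb|exact: b0|rewrite (sol_velocity (c := b) 0 Sb) (sol_velocity t S) b0].
by rewrite (dchart_affine (s := t) e2 S tt (dom_center _)) scaleN1r.
Qed.

Lemma enters_interior c (t0 t : R) : sol g c -> c t0 = P t -> inner g (P t) (velocity c t0) (N (P t)) < 0 ->
  exists2 d : R, 0 < d & forall s : R, 0 < s < d -> Omega° (c (t0 + s)).
Proof.
move=> S ct v0; have [cc dd _ _] := S t0 _ (dom_center (c t0)).
rewrite ct in dd; have [_ H] := boundary_side DF ON cc ct dd; apply: H.
by move: v0; rewrite (sol_velocity t0 S) ct.
Qed.

Lemma leaves_exterior c (t0 t : R) : sol g c -> c t0 = P t -> 0 < inner g (P t) (velocity c t0) (N (P t)) ->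
  exists2 d : R, 0 < d & forall s : R, 0 < s < d -> ~ Omega (c (t0 + s)).
Proof.
move=> S ct v0; have [cc dd _ _] := S t0 _ (dom_center (c t0)).
rewrite ct in dd; have [H _] := boundary_side DF ON cc ct dd; apply: H.
by move: v0; rewrite (sol_velocity t0 S) ct.
Qed.

Lemma start_inward c (a t : R) : sol g c -> 0 < a -> (forall s : R, 0 <= s <= a -> Omega (c s)) -> c 0 = P t ->
  inner g (P t) (velocity c 0) (N (P t)) <= 0.
Proof.
move=> S a0 H c0; rewrite leNgt; apply/negP => /(leaves_exterior S c0)[d d0 D].
have [s [s0 sd sa]] := lt_min2 d0 a0.
apply: (D s); first by rewrite s0.
by rewrite add0r; apply: H; rewrite !ltW.
Qed.

Lemma inner_opp p (u v : V) : inner g p (- u) v = - inner g p u v.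
Proof. by rewrite !inner_self bfNl. Qed.

Lemma end_outward c (a t : R) : sol g c -> 0 < a -> (forall s : R, 0 <= s <= a -> Omega (c s)) -> c a = P t ->
  0 <= inner g (P t) (velocity c a) (N (P t)).
Proof.
move=> S a0 H ca; have [Sb b0 vb] := reverse_sol a S.
have := start_inward (a := a) (t := t) Sb a0; rewrite b0 => h.
have := h _ ca; rewrite vb inner_opp oppr_le0; apply => s /andP[s0 sa]; apply: H.
by apply/andP; split; [rewrite mulN1r subr_ge0|rewrite mulN1r gerBl].
Qed.

(** Transversality puts the geodesic in the interior just after its start and just before its end,
    and [interior_between] covers the times in between. *)
Lemma proper_geodesic c (a t1 t2 : R) : complete g -> totally_convex g Omega -> sol g c ->
  c 0 = P t1 -> c a = P t2 -> inner g (P t1) (velocity c 0) (N (P t1)) < 0 ->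
  0 < inner g (P t2) (velocity c a) (N (P t2)) -> proper Omega a c.
Proof.
move=> cpl TC S c0 ca v0 va t /andP[tp ta] [_]; apply.
have [d d0 D] := enters_interior S c0 v0.
have [Sb b0 vb] := reverse_sol a S.
have [||d' d'0 D'] := enters_interior (t0 := 0) (t := t2) Sb; [by rewrite b0|by rewrite vb inner_opp oppr_lt0|].
have at0 : 0 < a - t by rewrite subr_gt0.
have [s [sp sd st]] := lt_min2 d0 tp; have [s' [s'p sd' sa']] := lt_min2 d'0 at0.
apply: (interior_between (s := s) (t := a - s') cpl TC S).
- by have := D s; rewrite sp sd add0r; apply.
- by have := D' s'; rewrite s'p sd' add0r mulN1r; apply.
- by apply/andP; split; [exact: st|rewrite ltrBrDl -ltrBrDr].
Qed.

Lemma normal_velocity c (t0 t : R) : sol g c -> c t0 = P t -> inner g (P t) (velocity c t0) (velocity P t) = 0 ->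
  exists2 e : R, velocity c t0 = e *: N (c t0) & e = inner g (P t) (velocity c t0) (N (P t)) /\ e ^+ 2 = 1.
Proof.
move=> S ct orth; have [k E] := normal_decomp DF ON t (velocity c t0).
set e := inner g (P t) (velocity c t0) (N (P t)) in E *.
have vv : inner g (P t) (velocity P t) (velocity P t) != 0.
  rewrite inner_self gt_eqF //; apply: Gm_gt0; first exact: chart_cod (dom_center _).
  exact: (bd_curve_velocity DF).
have k0 : k = 0.
  move: orth; rewrite E inner_self bfDl !bfZl -!inner_self (bd_curve_normal DF ON) mulr0 add0r => /eqP.
  by rewrite mulf_eq0 (negbTE vv) orbF => /eqP.
have {}E : velocity c t0 = e *: N (c t0) by rewrite E k0 scale0r addr0 ct.
exists e; [exact: E|split=> //].
have [_ _ _ un] := S t0 _ (dom_center (c t0)).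
move: un; rewrite -(sol_velocity t0 S) E bfZl bfZr mulrA -expr2 -inner_self ct.
by rewrite (normal_unit DF ON) mulr1.
Qed.

End Proper.

(** * Limits of minimisers and the first-order bound *)

Section Minimisers.
Context {R : realType} {M : surface R} (g : riemannian M).
Local Notation V := 'rV[R]_2.
Implicit Types (c P : R -> M) (i p q : M).
Local Notation G := (Gm g).
Local Notation dist := (dist g).

Lemma fmap_ultra (I J : Type) (U : set_system I) (f : I -> J) : UltraFilter U -> UltraFilter (f @ U).
Proof.
move=> UU; have PU : ProperFilter U by case: UU.
split; first exact: fmap_proper_filter.
move=> H PH sub; apply/seteqP; split=> [A HA|A]; last exact: sub.
have [//|nA] := in_ultra_setVsetC (f @^-1` A) UU.
have : H (~` A) by exact: sub.
by move=> /(filterI HA); rewrite setICr => /filter_ex[].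
Qed.

(** The initial velocities are unit vectors, hence lie in a compact coordinate ball, and converge
    along the ultrafilter. Completeness gives the geodesic with the limit velocity. *)
Lemma limit_start (I : Type) (U : set_system I) (cs : I -> R -> M) p : UltraFilter U -> complete g ->
  (forall t, sol g (cs t)) -> (fun t => cs t 0) @ U --> p ->
  exists c, [/\ sol g c, c 0 = p & conv U cs c 0].
Proof.
move=> UU cpl S cp; have PU : ProperFilter U by [case: UU]; set i := p; have ii : dom i p := dom_center p.
have cy : cod i (chart i p) := chart_cod ii.
have [r [l [r0 l0 H]]] := gram_lower g cy.
have ch : (fun t => chart i (cs t 0)) @ U --> chart i p.
  exact: (@cvg_comp _ _ _ (fun t => cs t 0) (chart i) _ _ _ cp (chart_continuous ii)).
have nd : \forall t \near U, dom i (cs t 0).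
  exact: cp (nbhs_dom ii).
have nr : \forall t \near U, `|chart i (cs t 0) - chart i p| < r by exact: (cvg_normP _ _).1 ch r r0.
pose w t := dchart i (cs t) 0.
have wB : \forall t \near U, `|w t - 0| <= 1 + l^-1.
  apply: filterS (filterI nd nr) => t [ti tr]; have [_ _ _ un] := S t 0 i ti.
  by rewrite subr0; have [_ low] := H _ tr; apply: (unit_norm_le l0 (low _)); rewrite un.
have l1 : 0 < 1 + l^-1 by rewrite addr_gt0 // invr_gt0.
have UF : UltraFilter (w @ U) by exact: fmap_ultra.
have := @compact_norm_ball R 0 _ l1; rewrite compact_ultra => /(_ (w @ U) UF wB) [w0 [_ cw]].
have un0 : bf (G i (chart i p)) w0 w0 = 1.
  have c1 : (fun t => bf (G i (chart i (cs t 0))) (w t) (w t)) @ U --> bf (G i (chart i p)) w0 w0.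
    by apply: cvg_bf; [exact: cvg_Gm|exact: cw|exact: cw].
  have c2 : (fun t => bf (G i (chart i (cs t 0))) (w t) (w t)) @ U --> (1 : R).
    have E : \forall t \near U, (1 : R) = bf (G i (chart i (cs t 0))) (w t) (w t).
    by apply: filterS nd => t ti; have [_ _ _ ->] := S t 0 i ti.
  exact: (cvg_trans (near_eq_cvg E) (cvg_cst (1 : R))).
  exact: (cvg_unique _ c1 c2).
have [c [Gc c0 v0]] := complete_sol cpl ii un0.
exists c; split; [exact: geodesic_sol|exact: c0|split; first by rewrite c0].
by exists i; rewrite c0 v0; split; [exact: ii|exact: cw].
Qed.

(** At the fixed time [t] the positions converge by continuous dependence, and the shift from [t] to
    [ts] costs at most its size since the speed is 1. *)
Lemma limit_time (I : Type) (U : set_system I) (UU : ProperFilter U) (cs : I -> R -> M) c (ts : I -> R) (t : R) :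
  (forall t, sol g (cs t)) -> sol g c -> conv U cs c 0 -> ts @ U --> t -> (fun k => cs k (ts k)) @ U --> c t.
Proof.
move=> S Sc cv ct; have [h _] := conv_backward UU S Sc cv t.
move=> B nB; have [e e0 He] := near_distP g nB.
have eh : 0 < e / 2 by rewrite divr_gt0.
have n1 : \forall k \near U, dist (c t) (cs k t) < e / 2 by exact: (h _ (near_dist g (c t) eh)).
have n2 : \forall k \near U, `|ts k - t| < e / 2.
  by move/cvgrPdist_lt: ct => /(_ _ eh); apply: filterS => k; rewrite distrC.
apply: filterS (filterI n1 n2) => k [k1 k2]; apply: He; apply: le_lt_trans (dist_triangle g _ (cs k t) _) _.
have k3 : dist (cs k t) (cs k (ts k)) <= `|ts k - t|.
  have [tt|tt] := leP t (ts k).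
    by rewrite ger0_norm ?subr_ge0 //; exact: sol_dist.
  by rewrite ltr0_norm ?subr_lt0 // opprB dist_sym; apply: sol_dist => //; exact: ltW.
by move: k1 k2 k3; move: (dist _ _) (dist _ _); clear => *; lra.
Qed.

Lemma limit_point (I : Type) (U : set_system I) (UU : ProperFilter U) (f : I -> M) p q :
  f @ U --> p -> f @ U --> q -> p = q.
Proof. by move=> fp fq; apply: (cvg_unique (@surface_hausdorff _ M) fp fq). Qed.

Variable P : R -> M.
Hypothesis SP : curve_smooth [set: R] P.

Definition bdist (y : R * R) : R := dist (P y.1) (P y.2).

Definition minim (y : R * R) c := [/\ sol g c, c 0 = P y.1 & c (bdist y) = P y.2].

Definition bgrad (y : R * R) c : V := row2 (- inner g (P y.1) (velocity c 0) (velocity P y.1))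
  (inner g (P y.2) (velocity c (bdist y)) (velocity P y.2)).

Lemma P_continuous : continuous P.
Proof. by move=> x; exact: (SP 0%N).1 x Logic.I. Qed.

Lemma bdist_continuous : continuous bdist.
Proof.
move=> x; apply/cvgrPdist_lt => e e0.
have eh : 0 < e / 2 by rewrite divr_gt0.
have c1 : (fun y : R * R => P y.1) @ x --> P x.1.
  by apply: (@continuous_comp _ _ _ (fun y : R * R => y.1) P); [exact: cvg_fst|exact: P_continuous].
have c2 : (fun y : R * R => P y.2) @ x --> P x.2.
  by apply: (@continuous_comp _ _ _ (fun y : R * R => y.2) P); [exact: cvg_snd|exact: P_continuous].
have n1 : \forall y \near x, dist (P x.1) (P y.1) < e / 2 by exact: (c1 _ (near_dist g (P x.1) eh)).
have n2 : \forall y \near x, dist (P x.2) (P y.2) < e / 2 by exact: (c2 _ (near_dist g (P x.2) eh)).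
apply: filterS (filterI n1 n2) => y [y1 y2].
by apply: le_lt_trans (dist_diff g _ _ _ _) _; rewrite (splitr e) ltrD.
Qed.

Lemma P_derive i (x : R) : dom i (P x) -> is_derive x 1 (chart i \o P) (dchart i P x) /\
  {for x, continuous (dchart i P)}.
Proof.
move=> xi; have [_ /(_ i) [D1 /(_ 1) c1]] := SP 1%N; have A0 : (setT `&` P @^-1` dom i) x by split.
by split; [apply: is_derive_dir; exact: D1|exact: c1].
Qed.

Lemma inner_velocities i c (t x : R) : sol g c -> c t = P x -> dom i (P x) ->
  inner g (P x) (velocity c t) (velocity P x) = bf (G i (chart i (P x))) (dchart i c t) (dchart i P x).
Proof.
move=> S ct xi; rewrite (inner_chart g _ _ xi) (cmp_velocity (P_continuous (x := x)) xi (P_derive xi).1).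
have ti : dom i (c t) by rewrite ct.
by have [cc dd _ _] := S t i ti; rewrite -{2}ct (cmp_velocity cc ti dd).
Qed.

Lemma limit_pairing (I : Type) (U : set_system I) (cs : I -> R -> M) c (xs : I -> R) (x : R) : ProperFilter U ->
  (forall t, sol g (cs t)) -> sol g c -> conv U cs c 0 -> (forall t, cs t 0 = P (xs t)) -> c 0 = P x -> xs @ U --> x ->
  (fun t => inner g (P (xs t)) (velocity (cs t) 0) (velocity P (xs t))) @ U --> inner g (P x) (velocity c 0) (velocity P x).
Proof.
move=> PU S Sc cv c0s c0 cx; set i := P x; have ii : dom i (P x) := dom_center _.
have cP : (fun t => P (xs t)) @ U --> P x by exact: (cvg_comp _ _ cx (P_continuous (x := x))).
rewrite (inner_velocities Sc c0 ii).
have C : (fun t => bf (G i (chart i (P (xs t)))) (dchart i (cs t) 0) (dchart i P (xs t))) @ U -->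
    bf (G i (chart i (P x))) (dchart i c 0) (dchart i P x).
  apply: cvg_bf; last exact: (cvg_comp _ _ cx (P_derive ii).2).
    by apply: cvg_Gm; [exact: chart_cod|exact: (cvg_comp _ _ cP (chart_continuous ii))].
  by apply: (conv_chart PU S Sc cv); rewrite c0.
have nd : \forall t \near U, dom i (P (xs t)) by exact: cP (nbhs_dom ii).
apply: cvg_trans C; apply: near_eq_cvg; apply: filterS nd => t ti.
by rewrite (inner_velocities (S t) (c0s t) ti).
Qed.

Lemma minimiser_limit (I : Type) (U : set_system I) (ys : I -> R * R) (cs : I -> R -> M) (x : R * R) :
  UltraFilter U -> complete g -> (forall t, minim (ys t) (cs t)) -> ys @ U --> x ->
  exists c, minim x c /\ (fun t => bgrad (ys t) (cs t)) @ U --> bgrad x c.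
Proof.
move=> UU cpl mi cy.
have S t : sol g (cs t) by have [] := mi t.
have cy1 : (fun t => (ys t).1) @ U --> x.1 by exact: (cvg_comp _ _ cy cvg_fst).
have cy2 : (fun t => (ys t).2) @ U --> x.2 by exact: (cvg_comp _ _ cy cvg_snd).
have cP1 : (fun t => P (ys t).1) @ U --> P x.1 by exact: (cvg_comp _ _ cy1 (P_continuous (x := x.1))).
have cP2 : (fun t => P (ys t).2) @ U --> P x.2 by exact: (cvg_comp _ _ cy2 (P_continuous (x := x.2))).
have ca : (fun t => bdist (ys t)) @ U --> bdist x by exact: (cvg_comp _ _ cy (bdist_continuous (x := x))).
have s0 : (fun t => cs t 0) @ U --> P x.1.
  by rewrite (_ : (fun t => cs t 0) = fun t => P (ys t).1) //; apply/funext => t; have [_ -> _] := mi t.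
have [c [Sc c0 cv]] := limit_start UU cpl S s0.
have PU : ProperFilter U by case: UU.
have e1 := limit_time PU S Sc cv ca.
have cE : c (bdist x) = P x.2.
  apply: (limit_point PU e1).
  by rewrite (_ : (fun t => _) = fun t => P (ys t).2) //; apply/funext => t; have [_ _ ->] := mi t.
(* Reversal turns end velocities into initial ones, to which [limit_pairing] applies. The limit [b]
   of the reversed geodesics is [c] reversed, by uniqueness of limits. *)
pose bs t (s : R) := cs t (bdist (ys t) + -1 * s).
have rs t := reverse_sol (bdist (ys t)) (S t).
have Sb t : sol g (bs t) by have [] := rs t.
have b0E t : bs t 0 = P (ys t).2 by have [_ h _] := rs t; have [_ _ <-] := mi t; exact: h.
have sb0 : (fun t => bs t 0) @ U --> P x.2.
  by rewrite (_ : (fun t => bs t 0) = fun t => P (ys t).2) //; apply/funext => t.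
have [b [Sb' b0 cvb]] := limit_start UU cpl Sb sb0.
have bc : b = fun s => c (bdist x + -1 * s).
  apply/funext => s; apply: (limit_point PU); first exact: (limit_time PU Sb Sb' cvb (cvg_cst s)).
  apply: (limit_time PU S Sc cv).
  by apply: cvgD; [exact: ca|exact: cvg_cst].
have [_ _ rb] := reverse_sol (bdist x) Sc; rewrite -bc in rb.
exists c; split; first by split.
have c0s t : cs t 0 = P (ys t).1 by have [] := mi t.
have L1 := limit_pairing PU S Sc cv c0s c0 cy1; have L2 := limit_pairing PU Sb Sb' cvb b0E b0 cy2.
apply: cvg_mx => k l; rewrite (ord1 k); have [->|->] := ord2P l.
  have E t : bgrad (ys t) (cs t) 0 0 = - inner g (P (ys t).1) (velocity (cs t) 0) (velocity P (ys t).1).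
    by rewrite row2_0.
  by rewrite (funext E) row2_0; exact: cvgN L1.
have E t : bgrad (ys t) (cs t) 0 1 = - inner g (P (ys t).2) (velocity (bs t) 0) (velocity P (ys t).2).
  by have [_ _ h] := rs t; rewrite row2_1 [velocity (bs t) 0]h inner_opp opprK.
have r : bgrad x c 0 1 = - inner g (P x.2) (velocity b 0) (velocity P x.2) by rewrite row2_1 rb inner_opp opprK.
by rewrite (funext E) r; exact: cvgN L2.
Qed.

Lemma norm_split (a q : V) : `|a| <= `|a - q| + `|q|.
Proof. by have := ler_normD (a - q) q; rewrite subrK. Qed.

(** The first variation is evaluated along the boundary curve; the second-order Taylor term of [P]
    goes into the constant [C]. *)
Lemma half_variation c (t0 x : R) : sol g c -> c t0 = P x -> exists2 L0 : R, 0 < L0 & forall L, 0 < L <= L0 ->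
  exists r C : R, [/\ 0 < r, 0 < C & forall h : R, `|h| < r ->
    dist (P (x + h)) (c (t0 + L)) <= L - h * inner g (P x) (velocity c t0) (velocity P x) + C * h ^+ 2].
Proof.
move=> S ct; set i := P x; have ii : dom i (P x) := dom_center _; have ti : dom i (c t0) by rewrite ct.
have [L0 L00 H] := first_variation S ti; exists L0; first exact: L00.
move=> L /H[r [C [r0 C0 HL]]].
have [C' [r' [C'0 r'0 HT]]] := curve_taylor SP ii.
set v := dchart i P x in HT; set w := 'D_1 (dchart i P) x in HT.
pose K := `|w| + C'; have K0 : 0 <= K by rewrite addr_ge0.
have [D D0 HD] := linear_bound (fun u1 u2 => bfDr (G i (chart i (c t0))) (dchart i c t0) u1 u2)
  (fun (a : R) u => bfZr (G i (chart i (c t0))) a (dchart i c t0) u).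
pose B := `|v| + K; have B0 : 0 <= B by rewrite addr_ge0.
have B1 : 0 < B + 1 by rewrite ltr_wpDl.
exists (Num.min (Num.min r' 1) (r / (B + 1))), (D * K + C * B ^+ 2 + 1); split.
- by rewrite !lt_min r'0 ltr01 divr_gt0.
- by rewrite ltr_wpDl // addr_ge0 // mulr_ge0 ?exprn_ge0 // ltW.
move=> h; rewrite !lt_min => /andP[/andP[h1 h2] h3]; have [hi ht] := HT h h1.
have hh : `|h| ^+ 2 = h ^+ 2 by rewrite -normrX ger0_norm // sqr_ge0.
have h0 := normr_ge0 h.
set e := chart i (P (x + h)) - chart i (P x).
have rem : `|e - h *: v| <= K * h ^+ 2.
  move: ht; rewrite -/e; set q := (2^-1 * h ^+ 2) *: w => ht.
  apply: le_trans (norm_split _ q) _; rewrite /q normrZ normrM (gtr0_norm (x := 2^-1)) ?invr_gt0 // normrX hh /K mulrDl addrC.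
  apply: lerD.
    by rewrite mulrC; apply: ler_wpM2l => //; rewrite ler_piMl ?sqr_ge0 // invf_le1 ?ltr0n ?ler1n.
  by apply: le_trans ht _; apply: ler_wpM2l => //; rewrite (exprSr _ 2) hh ler_piMr ?sqr_ge0 // ltW.
have eB : `|e| <= B * `|h|.
  apply: le_trans (norm_split _ (h *: v)) _; rewrite normrZ.
  rewrite (_ : B * `|h| = K * `|h| + `|h| * `|v|); last by rewrite /B; ring.
  rewrite lerD2r; apply: le_trans rem _.
  by apply: ler_wpM2l => //; rewrite -hh expr2 ler_piMl // ltW.
have er : `|e| < r.
  apply: le_lt_trans eB _; apply: (@le_lt_trans _ _ ((B + 1) * `|h|)); first by rewrite ler_wpM2r // lerDl.
  by rewrite mulrC -ltr_pdivlMr.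
have [ce de] := HL e er.
have pE : param i (chart i (c t0) + e) = P (x + h) by rewrite ct /e addrC subrK chartK.
rewrite pE in de; apply: le_trans de _.
have k1 : bf (G i (chart i (c t0))) (dchart i c t0) e = bf (G i (chart i (c t0))) (dchart i c t0) (e - h *: v) +
    h * inner g (P x) (velocity c t0) (velocity P x).
  by rewrite (inner_velocities S ct ii) -ct -bfZr -bfDr subrK.
have k2 := HD (e - h *: v).
have k3 : D * `|e - h *: v| <= D * K * h ^+ 2 by rewrite -mulrA ler_wpM2l.
have k4 : C * `|e| ^+ 2 <= C * B ^+ 2 * h ^+ 2.
  by rewrite -mulrA ler_pM2l // -hh -exprMn lerXn2r ?nnegrE ?mulr_ge0.
have k6 : - bf (G i (chart i (c t0))) (dchart i c t0) (e - h *: v) <= D * K * h ^+ 2.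
  by apply: le_trans k3; apply: le_trans k2; rewrite -normrN; exact: ler_norm.
rewrite k1 !mulrDl mul1r; move: k4 k6 (sqr_ge0 h).
move: (bf _ _ _) (C * `|e| ^+ 2) (C * B ^+ 2 * h ^+ 2) (D * K * h ^+ 2) (h * inner _ _ _ _) (h ^+ 2).
by clear -SP; move=> *; lra.
Qed.

(** Only a piece of length [L < a / 3] is modified near each end, and the middle of the geodesic is
    kept; the triangle inequality adds the three parts. *)
Lemma bdist_variation (x : R * R) c : 0 < bdist x -> minim x c -> exists r C : R, [/\ 0 < r, 0 < C &
  forall h1 h2 : R, `|h1| < r -> `|h2| < r ->
    bdist (x.1 + h1, x.2 + h2) <= bdist x + (bgrad x c 0 0 * h1 + bgrad x c 0 1 * h2) + C * (h1 ^+ 2 + h2 ^+ 2)].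
Proof.
move=> a0 [S c0 ca]; set a := bdist x in a0 ca *.
have [L1 L10 H1] := half_variation S c0.
have [Sb b0 rb] := reverse_sol a S.
pose b (s : R) := c (a + -1 * s).
have b0' : b 0 = P x.2 by rewrite -ca -b0.
have [L2 L20 H2] := half_variation Sb b0'.
have [|L [L0 LL1 LL2 LL3]] := lt_min3 L10 L20 (_ : 0 < a / 3); first by rewrite divr_gt0.
have [|r1 [C1 [r10 C10 HH1]]] := H1 L; first by rewrite L0 ltW.
have [|r2 [C2 [r20 C20 HH2]]] := H2 L; first by rewrite L0 ltW.
exists (Num.min r1 r2), (C1 + C2); split; [by rewrite lt_min r10|by rewrite addr_gt0|].
move=> h1 h2; rewrite !lt_min => /andP[h11 _] /andP[_ h22].
have k1 := HH1 h1 h11; have k2 := HH2 h2 h22.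
rewrite add0r in k1; rewrite add0r mulN1r in k2.
have k3 : dist (c L) (c (a - L)) <= a - L - L.
  by apply: sol_dist; [exact: S|rewrite lerBrDl; move: LL3 a0; clear -SP; lra].
have vb : inner g (P x.2) (velocity b 0) (velocity P x.2) = - bgrad x c 0 1.
  by rewrite row2_1 rb inner_opp.
rewrite vb mulrN opprK in k2.
have g0 : bgrad x c 0 0 = - inner g (P x.1) (velocity c 0) (velocity P x.1) by rewrite row2_0.
rewrite g0 /bdist /= -/a.
have t1 := dist_triangle g (P (x.1 + h1)) (c L) (P (x.2 + h2)).
have t2 := dist_triangle g (c L) (c (a - L)) (P (x.2 + h2)).
rewrite (dist_sym g (c (a - L))) in t2.
move: k1 k2 k3 t1 t2 (sqr_ge0 h1) (sqr_ge0 h2) (mulr_ge0 (ltW C10) (sqr_ge0 h2)) (mulr_ge0 (ltW C20) (sqr_ge0 h1)).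
move: (dist _ _) (dist _ _) (dist _ _) (dist _ _) (dist _ _) (bgrad _ _ _ _) (inner _ _ _ _) => d1 d2 d3 d4 d5 u1 u2.
by clear -SP; move=> *; lra.
Qed.

End Minimisers.

(** * An alternative for sets of plane vectors *)

Section Planar.
Context {R : realType}.
Local Notation V := 'rV[R]_2.
Implicit Types (u v : V).

Lemma dotC u v : dot u v = dot v u.
Proof. by rewrite /dot; ring. Qed.

Lemma dot_gt0 u : u != 0 -> 0 < dot u u.
Proof.
move=> u0; rewrite /dot -!expr2 lt_neqAle addr_ge0 ?sqr_ge0 // andbT eq_sym.
apply: contra u0; rewrite paddr_eq0 ?sqr_ge0 // !sqrf_eq0 => /andP[/eqP a /eqP b].
by apply/eqP; apply: row2P; rewrite ?a ?b mxE.
Qed.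

Lemma dot_orth G v : dot G v = 0 -> dot v v *: G = dot (turn v) G *: turn v.
Proof.
rewrite /dot => h; apply: row2P; rewrite !mxE /turn ?row2_0 ?row2_1 /=.
  rewrite (_ : _ * G 0 0 = (- v 0 1 * G 0 0 + v 0 0 * G 0 1) * - v 0 1 + v 0 0 * (G 0 0 * v 0 0 + G 0 1 * v 0 1)); last by ring.
  by rewrite h mulr0 addr0.
rewrite (_ : _ * G 0 1 = (- v 0 1 * G 0 0 + v 0 0 * G 0 1) * v 0 0 + v 0 1 * (G 0 0 * v 0 0 + G 0 1 * v 0 1)); last by ring.
by rewrite h mulr0 addr0.
Qed.

Lemma cvg_dot (I : Type) (U : set_system I) {FU : Filter U} (f : I -> V) (f0 v : V) : f @ U --> f0 ->
  (fun t => dot (f t) v) @ U --> dot f0 v.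
Proof.
move=> cf.
have c (j : 'I_2) : (fun t => f t 0 j * v 0 j) @ U --> f0 0 j * v 0 j.
  by apply: cvgM; [exact: cvg_coord|exact: cvg_cst].
exact: (cvgD (c 0) (c 1)).
Qed.

(** The first hypothesis is compactness in terms of ultrafilters. If an open half-plane misses [S],
    then [S] lies in the opposite closed one, and its elements on the boundary line all point the
    same way, none being zero and no two opposite. A slight tilt of the line then puts all of [S]
    strictly on one side. *)
Lemma planar_alternative (S : set V) :
  (forall (I : Type) (U : set_system I) (f : I -> V), UltraFilter U -> (forall t, S (f t)) ->
     exists G, S G /\ f @ U --> G) ->
  ~ S 0 -> (forall G1 G2 (k : R), S G1 -> S G2 -> 0 < k -> G1 <> - (k *: G2)) ->
  (exists v, forall G, S G -> dot G v < 0) \/ (forall v, v != 0 -> exists2 G, S G & dot G v < 0).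
Proof.
move=> clo S0 anti; have [r|nr] := pselect (forall v, v != 0 -> exists2 G, S G & dot G v < 0); first by right.
have [[G0 SG0]|em] := pselect (exists G, S G); last by left; exists 0 => G SG; case: em; exists G.
left.
have [v [v0 vS]] : exists v, v != 0 /\ forall G, S G -> 0 <= dot G v.
  apply: contrapT => h; apply: nr => v v0; apply: contrapT => h'; apply: h; exists v; split=> // G SG.
  by rewrite leNgt; apply/negP => ?; apply: h'; exists G.
pose n := turn v; have vv := dot_gt0 v0.
have nz G : S G -> dot G v = 0 -> dot n G != 0.
  move=> SG h; apply/eqP => e; have := dot_orth h; rewrite e scale0r => /eqP; rewrite scaler_eq0 gt_eqF //= => /eqP E.
  by apply: S0; rewrite -E.
(* The sign [ep], 1 or -1, is that of the common direction of the elements of [S] on the line; two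
   elements in different directions would be opposite up to a positive factor. *)
have [ep Hep] : exists ep : R, forall G, S G -> dot G v = 0 -> 0 < ep * dot n G.
  have [[G1 [S1 v1 p1]]|none] := pselect (exists G, [/\ S G, dot G v = 0 & 0 < dot n G]).
    exists 1 => G SG Gv; rewrite mul1r ltNge; apply/negP => Gn.
    have Gn' : dot n G < 0 by rewrite lt_neqAle nz.
    have k0 : 0 < dot n G1 / - dot n G by rewrite divr_gt0 // oppr_gt0.
    apply: (anti G1 G _ S1 SG k0).
    apply: (scalerI (a := dot v v)); first by rewrite gt_eqF.
    rewrite dot_orth // scalerN scalerA mulrC -scalerA dot_orth // scalerA -scaleNr.
    congr (_ *: _); rewrite -/n; have b0 : dot n G != 0 by exact: nz.
    by move: (dot n G1) (dot n G) b0; clear => p q q0; field.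
  exists (-1) => G SG Gv; rewrite mulN1r oppr_gt0 lt_neqAle nz //= leNgt; apply/negP => p.
  by apply: none; exists G.
suff [dl Hd] : exists dl : R, forall G, S G -> 0 < dot G v + dl * (ep * dot n G).
  exists (- (v + (dl * ep) *: n)) => G SG; rewrite -(oppr_gt0 (dot G _)).
  rewrite (_ : - dot G _ = dot G v + dl * (ep * dot n G)); first exact: Hd.
  by rewrite (dotC n G) /dot !mxE; ring.
apply: contrapT => none.
have ex (dl : R) : exists G, S G /\ dot G v + dl * (ep * dot n G) <= 0.
  apply: contrapT => h; apply: none; exists dl => G SG; rewrite ltNge; apply/negP => h'.
  by apply: h; exists G.
(* Compactness makes the tilt uniform: if every [dl] failed, the counterexamples for [dl] tending to
   0 from the right would converge to an element of [S] on the line, where [ep * dot n G] is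
   positive; near it they cannot be counterexamples. *)
have [f Hf] := choice ex.
have [U [UU sub]] := ultraFilterLemma (at_right_proper_filter (0 : R)).
have PU : ProperFilter U by case: UU.
have [G [SG cG]] := clo _ U f UU (fun t => (Hf t).1).
have cid : (fun t : R => t) @ U --> (0 : R).
  by move=> B nB; apply: sub; exact: (filterS (fun (t : R) (h : B t) _ => h) nB).
have c1 := cvg_dot (v := v) cG; have c2 := cvg_dot (v := n) cG.
have c3 : (fun t => dot (f t) v + t * (ep * dot (f t) n)) @ U --> dot G v + 0 * (ep * dot G n).
  by apply: cvgD; [exact: c1|apply: cvgM; [exact: cid|apply: cvgM; [exact: cvg_cst|exact: c2]]].
rewrite mul0r addr0 in c3.
have Gv : dot G v = 0.
  apply/le_anti; rewrite vS // andbT leNgt; apply/negP => p.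
  have : \forall t \near U, `|dot G v - (dot (f t) v + t * (ep * dot (f t) n))| < dot G v.
    by move/cvgrPdist_lt: c3; apply.
  move=> /filter_ex[t]; have [_ h] := Hf t; rewrite dotC in h.
  rewrite (dotC (f t) n) ltr_norml => /andP[_]; rewrite (dotC v) in h; move: h; clear; lra.
have pos : 0 < ep * dot G n by rewrite dotC Hep.
have c4 : (fun t => ep * dot (f t) n) @ U --> ep * dot G n by apply: cvgM; [exact: cvg_cst|exact: c2].
have n1 : \forall t \near U, 0 < ep * dot (f t) n.
  have : \forall t \near U, `|ep * dot G n - ep * dot (f t) n| < ep * dot G n.
    by move/cvgrPdist_lt: c4; apply.
  by apply: filterS => t; rewrite ltr_norml => /andP[_]; clear; lra.
have n2 : \forall t \near U, 0 < t by apply: sub; exact: nbhs_right_gt.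
have [t [t1 t2]] := filter_ex (filterI n1 n2).
have [St h] := Hf t; have := vS _ St; rewrite dotC in t1; have := mulr_gt0 t2 t1.
by move: h; clear; lra.
Qed.

End Planar.

(** * Passing below a level *)

Section Pass.
Context {R : realType}.
Local Notation P := (R * R)%type.
Implicit Types (d : P -> R) (x y u v : P).

(** Descent is known only to the right of each point, as [d] may have no derivative; continuity
    takes care of limit times. *)
Lemma right_decreasing (f : R -> R) (s : R) : 0 <= s -> continuous f ->
  (forall t : R, 0 <= t < s -> exists2 e : R, 0 < e & forall h : R, 0 < h < e -> f (t + h) < f t) ->
  forall t, 0 <= t <= s -> f t <= f 0.
Proof.
move=> s0 cf H; apply: (real_induction s0); first exact: lexx.
  move=> t ts ft; have [e e0 He] := H t ts; exists (e / 2); first by rewrite divr_gt0.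
  move=> h /andP[]; rewrite le_eqVlt => /orP[/eqP <- //|th] he hs.
  apply: le_trans ft; apply: ltW; have := He (h - t); rewrite [t + _]addrC subrK; apply.
  by rewrite subr_gt0 th /= ltrBlDl; apply: le_lt_trans he _; rewrite ltrD2l half_lt.
move=> t /andP[t0 ts] ft; rewrite leNgt; apply/negP => h.
have n1 : \forall u \near t, f 0 < f u by exact: (cf t _ (lt_nbhsr h)).
have [e e0 He] := (near_normP t _).1 n1.
have [u [u0 ut te]] := left_close t0 e0.
have : f 0 < f u by apply: He; rewrite ltr0_norm ?subr_lt0 // opprB.
by rewrite ltNge ft // u0.
Qed.

Lemma near_strip (T : R) x : x.1 < x.2 < x.1 + T -> \forall y \near x, strip T y.
Proof.
move=> /andP[x1 x2].
have c1 : {for x, continuous (fun y : P => y.2 - y.1)} by apply: cvgB; [exact: cvg_snd|exact: cvg_fst].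
have n1 : \forall y \near x, 0 < y.2 - y.1 by apply: (c1 _ (lt_nbhsr _)); rewrite subr_gt0.
have n2 : \forall y \near x, y.2 - y.1 < T by apply: (c1 _ (lt_nbhsl _)); rewrite ltrBlDl.
apply: filterS (filterI n1 n2) => y [y1 y2]; rewrite /strip /=; apply/andP; split.
  by rewrite -subr_ge0 ltW.
by rewrite -lerBlDl ltW.
Qed.

(** Two points below [W] near [x] are pushed along [v], which does not raise [d], until they are
    near [x + s *: v]. There [d] is below some [m < W] on a whole ball, and a segment joins them. *)
Lemma pass_descent d (T W : R) x v : continuous d -> x.1 < x.2 < x.1 + T -> d x = W ->
  (\forall y \near x, exists2 e : R, 0 < e & forall s : R, 0 < s < e -> d (y + s *: v) < d y) ->
  pass_free d T W x.
Proof.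
move=> dc sx dx desc.
have [r r0 Hr] := (near_normP x _).1 (filterI (near_strip sx) desc).
have [_ [e e0 He]] : strip T x /\ exists2 e : R, 0 < e & forall s : R, 0 < s < e -> d (x + s *: v) < d x.
  by apply: Hr; rewrite subrr normr0.
have v1 : 0 < `|v| + 1 by rewrite ltr_wpDl.
have rv : 0 < r / 2 / (`|v| + 1) by rewrite !divr_gt0.
have [s [s0 se sr]] := lt_min2 e0 rv; rewrite ltr_pdivlMr // in sr.
have mv (t : R) y : 0 <= t <= s -> `|y - x| < r / 2 -> `|y + t *: v - x| < r.
  move=> /andP[t0 ts] yr; rewrite addrAC; apply: le_lt_trans (ler_normD _ _) _.
  rewrite normrZ (ger0_norm t0) (splitr r) ltrD //; apply: le_lt_trans sr.
  by apply: ler_pM => //; rewrite lerDl.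
have dxs : d (x + s *: v) < W by rewrite -dx; apply: He; rewrite s0.
split.
  move=> B nB; have [r' r'0 HB] := (near_normP x _).1 nB.
  have [|t [t0 ts tr]] := lt_min2 s0 (_ : 0 < r' / (`|v| + 1)); first by rewrite divr_gt0.
  rewrite ltr_pdivlMr // in tr.
  exists (x + t *: v); split; first split.
  - have [] := Hr (x + t *: v); last by [].
    by apply: mv; [rewrite !ltW|rewrite subrr normr0 divr_gt0].
  - by rewrite -dx; apply: He; rewrite t0 (lt_trans ts).
  - apply: HB; rewrite addrAC subrr add0r normrZ gtr0_norm //.
    by apply: le_lt_trans tr; rewrite ler_pM2l // lerDl.
pose m := (W + d (x + s *: v)) / 2.
have mW : m < W by rewrite /m; move: dxs; clear; lra.
have dm : d (x + s *: v) < m by rewrite /m; move: dxs; clear; lra.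
have nm : \forall u \near x + s *: v, d u < m by exact: (dc _ _ (lt_nbhsl dm)).
have [r2 r20 H2] := (near_normP _ _).1 nm.
exists [set y | `|y - x| < Num.min (r / 2) r2].
  by apply: (@near_ball _ _ x); rewrite subrr normr0 lt_min r20 divr_gt0.
move=> y z yU zU sy sz dy dz.
have noninc p : `|p - x| < Num.min (r / 2) r2 -> forall t : R, 0 <= t <= s -> d (p + t *: v) <= d p.
  rewrite lt_min => /andP[pr _].
  have cf : continuous (fun t : R => d (p + t *: v)).
    by move=> t; apply: (@continuous_comp _ _ _ (fun t : R => p + t *: v) d); [exact: line_continuous|exact: dc].
  have := right_decreasing (ltW s0) cf; rewrite scale0r addr0; apply => t /andP[t0 ts].
  have [|_ [e' e'0 He']] := Hr (p + t *: v); first by apply: mv => //; rewrite t0 ltW.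
  by exists e' => // h /He'; rewrite -addrA -scalerDl.
have seg_in p u : `|p - x| < Num.min (r / 2) r2 -> segment p (p + s *: v) u -> strip T u /\ d u <= d p.
  move=> pU [t] /=; rewrite in_itv /= => /andP[t0 t1] <-.
  have ts : 0 <= t * s <= s by rewrite mulr_ge0 ?(ltW s0) //= ler_piMl // ltW.
  have -> : p + t *: (p + s *: v - p) = p + (t * s) *: v by rewrite [p + s *: v]addrC addrK scalerA.
  split; last exact: noninc.
  by have [] := Hr (p + (t * s) *: v); [apply: mv => //; move: pU; rewrite lt_min => /andP[]|].
have mid u : segment (y + s *: v) (z + s *: v) u -> strip T u /\ d u < m.
  move=> hu; have shift p : `|p - x| < Num.min (r / 2) r2 -> `|p + s *: v - (x + s *: v)| < Num.min (r / 2) r2.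
    by rewrite opprD addrACA subrr addr0.
  have := ball_segment (shift _ yU) (shift _ zU) hu; rewrite lt_min => /andP[u1 u2].
  split; last exact: H2.
  have [] := Hr u; last by [].
  rewrite -(subrK (s *: v) u); apply: mv; first by rewrite lexx ltW.
  by rewrite -addrA -opprD [s *: v + x]addrC.
exists (Num.max (Num.max (d y) (d z)) m),
  (segment y (y + s *: v) `|` (segment (y + s *: v) (z + s *: v) `|` segment z (z + s *: v))); split.
- by rewrite !gt_max dy dz.
- apply: (connectedU2 (z := y + s *: v)).
  + exact: segment_connected.
  + by apply: (connectedU2 (z := z + s *: v)); [exact: segment_connected|exact: segment_connected|exact: segment_r|exact: segment_r].
  + exact: segment_r.
  + by left; exact: segment_l.
- by split; [left; exact: segment_l|right; right; exact: segment_l].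
- move=> u [/seg_in|[/mid|/seg_in]].
  + by move=> /(_ yU)[h1 h2]; split=> //; rewrite !le_max h2.
  + by move=> [h1 h2]; split=> //; rewrite le_max (ltW h2) orbT.
  + by move=> /(_ zU)[h1 h2]; split=> //; rewrite !le_max h2 orbT.
Qed.

Definition pdot u v : R := u.1 * v.1 + u.2 * v.2.

Lemma pdot_gt0 u : u != 0 -> 0 < pdot u u.
Proof.
move=> u0; rewrite /pdot -!expr2 lt_neqAle addr_ge0 ?sqr_ge0 // andbT eq_sym.
apply: contra u0; rewrite paddr_eq0 ?sqr_ge0 // !sqrf_eq0; case: u => a b /= /andP[/eqP -> /eqP ->].
by [].
Qed.

Lemma segment_avoid x e q : pdot e q = 0 -> e != 0 -> q != 0 -> ~ segment (x + e) (x + q) x.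
Proof.
move=> eq0 e0 q0 [t _ h].
have [h1 h2] : (1 - t) * e.1 + t * q.1 = 0 /\ (1 - t) * e.2 + t * q.2 = 0.
  have h1 : x.1 + e.1 + t * (x.1 + q.1 - (x.1 + e.1)) = x.1 := congr1 fst h.
  have h2 : x.2 + e.2 + t * (x.2 + q.2 - (x.2 + e.2)) = x.2 := congr1 snd h.
  by split; [move: h1|move: h2]; clear; lra.
have k1 : (1 - t) * pdot e e = 0.
  have : ((1 - t) * e.1 + t * q.1) * e.1 + ((1 - t) * e.2 + t * q.2) * e.2 = 0 by rewrite h1 h2 !mul0r addr0.
  rewrite (_ : _ + _ = (1 - t) * pdot e e + t * pdot e q); last by rewrite /pdot; ring.
  by rewrite eq0 mulr0 addr0.
have k2 : t * pdot q q = 0.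
  have : ((1 - t) * e.1 + t * q.1) * q.1 + ((1 - t) * e.2 + t * q.2) * q.2 = 0 by rewrite h1 h2 !mul0r addr0.
  rewrite (_ : _ + _ = t * pdot q q + (1 - t) * pdot e q); last by rewrite /pdot; ring.
  by rewrite eq0 mulr0 addr0.
move/eqP: k1; move/eqP: k2; rewrite !mulf_eq0 !(gt_eqF (pdot_gt0 _)) // !orbF => /eqP ->.
by rewrite subr0 oner_eq0.
Qed.

(** A punctured disc is connected: two of its points are joined by their segment or, if that runs
    through [x], by a detour. The joining set is compact and avoids [x], so the maximum of [d] on it
    is below [W]. *)
Lemma pass_punctured d (T W : R) x : continuous d -> x.1 < x.2 < x.1 + T -> d x = W ->
  (\forall y \near x, y != x -> d y < W) -> pass_free d T W x.
Proof.
move=> dc sx dx pun.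
have [r r0 Hr] := (near_normP x _).1 (filterI (near_strip sx) pun).
split.
  move=> B nB; have [r' r'0 HB] := (near_normP x _).1 nB.
  have [t [t0 tr tr']] := lt_min2 r0 r'0; pose y : P := (x.1 + t, x.2).
  have yx (s : R) : t < s -> `|y - x| < s.
    have -> : `|y - x| = Num.max `|x.1 + t - x.1| `|x.2 - x.2| by [].
    by move=> ts; rewrite addrAC subrr add0r subrr normr0 gtr0_norm // gt_max ts (lt_trans t0 ts).
  have [st h] := Hr y (yx _ tr).
  exists y; split; [split; [exact: st|apply: h]|exact: HB _ (yx _ tr')].
  by apply/eqP => /(congr1 fst) /= /eqP; rewrite -subr_eq0 addrAC subrr add0r gt_eqF.
exists [set y | `|y - x| < r]; first by apply: (@near_ball _ _ x); rewrite subrr normr0.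
move=> y z yU zU sy sz dy dz.
have neq u : d u < W -> u - x != 0 by rewrite subr_eq0; apply: contraTneq => ->; rewrite dx ltxx.
have join (C : set P) : connected C -> C y -> C z -> compact C -> (forall u, C u -> `|u - x| < r) -> ~ C x ->
    exists w C, [/\ w < W, connected C, C y /\ C z & C `<=` sublevel d T w].
  move=> Cc Cy Cz CK CU nx.
  have [||u /[!inE] Cu mx] := @compact_EVT_max P R d C _ CK; first by exists y.
    by apply: within_continuous_in => u _; exact: dc.
  exists (d u), C; split=> //.
    by have [_] := Hr u (CU u Cu); apply; apply/eqP => e; apply: nx; rewrite -e.
  by move=> u' Cu'; split; [have [] := Hr u' (CU u' Cu')|apply: mx; rewrite inE].
have [xs|nxs] := pselect (segment y z x); last first.
  apply: (join (segment y z)) => //; [exact: segment_connected|exact: segment_l|exact: segment_r|exact: compact_segment|].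
  by move=> u; exact: ball_segment.
pose e := y - x; pose f := z - x.
have e0 : e != 0 := neq _ dy; have f0 : f != 0 := neq _ dz.
(* The detour goes through the point [x + q] on the perpendicular to the segment at [x], at distance
   [r / 2] from [x]. *)
pose ep : P := (- e.2, e.1).
have ep0 : ep != 0.
  have := pdot_gt0 e0; rewrite (_ : pdot e e = pdot ep ep); last by rewrite /pdot /=; ring.
  by apply: contraTneq => ->; rewrite /pdot /= !mulr0 addr0 ltxx.
have n0 : 0 < `|ep| by rewrite normr_gt0.
have [k k0 kE] : exists2 k : R, 0 < k & k * `|ep| = r / 2.
  by exists (r / 2 / `|ep|); [rewrite !divr_gt0|rewrite divfK // gt_eqF].
pose q := k *: ep.
have q0 : q != 0 by rewrite scaler_eq0 negb_or ep0 andbT gt_eqF.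
have eq0 : pdot e q = 0.
  by rewrite /pdot (_ : q.1 = k * - e.2) // (_ : q.2 = k * e.1) //; ring.
have fq0 : pdot f q = 0.
  case: xs => t /= _ h.
  have [h1 h2] : (1 - t) * e.1 + t * f.1 = 0 /\ (1 - t) * e.2 + t * f.2 = 0.
    have h1 : y.1 + t * (z.1 - y.1) = x.1 := congr1 fst h.
    have h2 : y.2 + t * (z.2 - y.2) = x.2 := congr1 snd h.
    rewrite (_ : e.1 = y.1 - x.1) // (_ : f.1 = z.1 - x.1) // (_ : e.2 = y.2 - x.2) // (_ : f.2 = z.2 - x.2) //.
    by split; [move: h1|move: h2]; clear; lra.
  have : ((1 - t) * e.1 + t * f.1) * q.1 + ((1 - t) * e.2 + t * f.2) * q.2 = 0 by rewrite h1 h2 !mul0r addr0.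
  rewrite (_ : _ + _ = t * pdot f q + (1 - t) * pdot e q); last by rewrite /pdot; ring.
  rewrite eq0 mulr0 addr0 => /eqP; rewrite mulf_eq0 => /orP[/eqP t0|/eqP //].
  move: h1 h2; rewrite t0 !subr0 !mul1r !mul0r !addr0 => h1 h2.
  by exfalso; move/eqP: e0; apply; case: (e) h1 h2 => a b /= -> ->.
have xq : `|x + q - x| < r.
  by rewrite addrAC subrr add0r /q normrZ gtr0_norm // kE half_lt.
have ye : y = x + e by rewrite /e addrC subrK.
have zf : z = x + f by rewrite /f addrC subrK.
apply: (join (segment y (x + q) `|` segment z (x + q))).
- by apply: (connectedU2 (z := x + q)); [exact: segment_connected|exact: segment_connected|exact: segment_r|exact: segment_r].
- by left; exact: segment_l.
- by right; exact: segment_l.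
- by apply: compactU; exact: compact_segment.
- by move=> u [|]; exact: ball_segment.
- by move=> []; [rewrite ye; exact: segment_avoid|rewrite zf; exact: segment_avoid].
Qed.

End Pass.

(** * Gradients and the local behaviour of the boundary distance *)

Section Descent.
Context {R : realType} {M : surface R} (g : riemannian M).
Local Notation V := 'rV[R]_2.
Implicit Types (c P : R -> M) (u v : V) (x y : R * R).

Lemma bgrad_opposite P x c1 c2 (k : R) : bgrad g P x c1 = - (k *: bgrad g P x c2) ->
  inner g (P x.1) (velocity c1 0) (velocity P x.1) = - (k * inner g (P x.1) (velocity c2 0) (velocity P x.1)) /\
  inner g (P x.2) (velocity c1 (bdist g P x)) (velocity P x.2) =
    - (k * inner g (P x.2) (velocity c2 (bdist g P x)) (velocity P x.2)).
Proof.
have id (u1 u2 w1 w2 : R) : row2 u1 u2 = - (k *: row2 w1 w2) -> u1 = - (k * w1) /\ u2 = - (k * w2).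
  by move/rowP => h; have := h 0; have := h 1; rewrite !mxE.
by move=> /id[h1 h2]; split; [apply: oppr_inj; rewrite h1 mulrN|exact: h2].
Qed.

Lemma minim_exists P y : complete g -> 0 < bdist g P y -> exists c, minim g P y c.
Proof.
move=> cpl dy; have [|c [Gc c0 ca]] := hopf_rinow (p := P y.1) (q := P y.2) cpl.
  by move=> e; move: dy; rewrite /bdist e dist_refl ltxx.
by exists c; split; [exact: geodesic_sol|exact: c0|exact: ca].
Qed.

(** The sign condition persists at all [y] near [x]: minimisers violating it for [y] tending to [x]
    would converge, gradients included, to a minimiser at [x] that violates it too. At each such [y]
    one minimiser gives the descent, by [bdist_variation]. *)
Lemma descent_near P x v : complete g -> curve_smooth [set: R] P -> 0 < bdist g P x ->
  (forall c, minim g P x c -> dot (bgrad g P x c) v < 0) ->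
  \forall y \near x, exists2 e : R, 0 < e & forall s : R, 0 < s < e ->
    bdist g P (y + s *: (v 0 0, v 0 1)) < bdist g P y.
Proof.
move=> cpl SP dx H; pose Q y := forall c, minim g P y c -> dot (bgrad g P y c) v < 0.
have nQ : \forall y \near x, Q y.
  apply: contrapT => nn.
  have cl : closure [set y | ~ Q y] x.
    move=> B nB; apply: contrapT => no; apply: nn; apply: filterS nB => y By.
    by apply: contrapT => h; apply: no; exists y.
  have [U [UU sub]] := ultraFilterLemma (within_nbhs_proper cl).
  have PU : ProperFilter U by case: UU.
  have [cx mx] := minim_exists cpl dx.
  (* A minimiser is attached to every [y] so that the family is total; the default [(x, cx)] serves
     where [Q y] holds, a set that the ultrafilter ignores. *)
  have ex y : exists p : (R * R) * (R -> M), minim g P p.1 p.2 /\ (~ Q y -> p.1 = y /\ 0 <= dot (bgrad g P p.1 p.2) v).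
    have [q|nq] := pselect (Q y); first by exists (x, cx).
    have [c [mc hc]] : exists c, minim g P y c /\ 0 <= dot (bgrad g P y c) v.
      apply: contrapT => no; apply: nq => c mc; rewrite ltNge; apply/negP => h.
      by apply: no; exists c.
    by exists (y, c).
  have [f Hf] := choice ex.
  have nU : \forall y \near U, ~ Q y by apply: sub; exact: (filterS (fun y (_ : True) (h : ~ Q y) => h) filterT).
  have cf : (fun y => (f y).1) @ U --> x.
    move=> B nB; have nB' : \forall y \near U, B y by apply: sub; exact: (filterS (fun y (h : B y) _ => h) nB).
    apply: filterS (filterI nU nB') => y [ny By]; have [_ /(_ ny)[e1 _]] := Hf y.
    by change (B (f y).1); rewrite e1.
  have [c [mc cg]] := minimiser_limit SP UU cpl (fun y => (Hf y).1) cf.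
  have hc := H c mc.
  have cd : (fun y => dot (bgrad g P (f y).1 (f y).2) v) @ U --> dot (bgrad g P x c) v by exact: cvg_dot.
  have : \forall y \near U, `|dot (bgrad g P x c) v - dot (bgrad g P (f y).1 (f y).2) v| < - dot (bgrad g P x c) v.
    by move/cvgrPdist_lt: cd; apply; rewrite oppr_gt0.
  move=> n1; have [y [y1 y2]] := filter_ex (filterI nU n1).
  have [_ /(_ y1)[_ h]] := Hf y; move: y2; rewrite ltr_norml => /andP[y2 _].
  have fin (p q : R) : - - p < p - q -> 0 <= q -> p < 0 -> False by clear; lra.
  exact: (fin _ _ y2 h hc).
have nd : \forall y \near x, 0 < bdist g P y by exact: (@bdist_continuous R M g P SP x) _ (lt_nbhsr dx).
apply: filterS (filterI nQ nd) => y [qy dy].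
have [c mc] := minim_exists cpl dy; have G0 := qy c mc.
have [r [C [r0 C0 HC]]] := bdist_variation SP dy mc.
set m := dot _ v in G0.
pose K := C * (v 0 0 ^+ 2 + v 0 1 ^+ 2).
have K0 : 0 <= K by rewrite mulr_ge0 ?(ltW C0) // addr_ge0 // sqr_ge0.
have K1 : 0 < K + 1 by rewrite ltr_wpDl.
have v1 : 0 < `|v| + 1 by rewrite ltr_wpDl.
exists (Num.min (r / (`|v| + 1)) (- m / (K + 1))).
  by rewrite lt_min !divr_gt0 // oppr_gt0.
move=> s /andP[s0]; rewrite lt_min !ltr_pdivlMr // => /andP[s1 s2].
have small (j : 'I_2) : `|s * v 0 j| < r.
  rewrite normrM (gtr0_norm s0); apply: le_lt_trans s1; rewrite ler_pM2l //.
  by apply: le_trans (coord_le_norm v j) _; rewrite lerDl.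
apply: le_lt_trans (HC (s * v 0 0) (s * v 0 1) (small 0) (small 1)) _.
have -> : bgrad g P y c 0 0 * (s * v 0 0) + bgrad g P y c 0 1 * (s * v 0 1) = s * m by rewrite /m /dot; ring.
have -> : C * ((s * v 0 0) ^+ 2 + (s * v 0 1) ^+ 2) = s * (s * K) by rewrite /K; ring.
rewrite -addrA gtrDl -mulrDr pmulr_rlt0 //.
have : s * K <= s * (K + 1) by rewrite ler_pM2l // lerDl.
by move: s2; clear; lra.
Qed.

Lemma sphere_compact : compact [set u : V | `|u| = 1].
Proof.
apply: (subclosed_compact _ (@compact_norm_ball R 0 1 ltr01)).
  by apply: (@closed_comp _ _ (fun v : V => `|v|) [set 1]) => [v _|]; [exact: norm_continuous|exact: closed_eq].
by move=> u /= uS; rewrite subr0 uS.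
Qed.

(** A minimiser whose gradient pairs negatively with a direction bounds [d] from above also in the
    neighbouring directions. Compactness of the unit sphere makes the radius the same for all
    directions. *)
Lemma punctured_near P x : complete g -> curve_smooth [set: R] P -> 0 < bdist g P x ->
  (forall v, v != 0 -> exists2 c, minim g P x c & dot (bgrad g P x c) v < 0) ->
  \forall y \near x, y != x -> bdist g P y < bdist g P x.
Proof.
move=> cpl SP dx H.
pose pr (s : R) u := bdist g P (x.1 + s * u 0 0, x.2 + s * u 0 1) < bdist g P x.
have : \forall s \near (0 : R)^'+, [set u : V | `|u| = 1] `<=` pr s.
  have /compact_near_coveringP cov := sphere_compact; apply: cov => v v1.
  have v0 : v != 0 by rewrite -normr_gt0 v1 ltr01.
  have [c mc G0] := H v v0; set Gr := bgrad g P x c in G0.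
  have [r [C [r0 C0 HC]]] := bdist_variation SP dx mc; rewrite -/Gr in HC.
  pose m := - dot Gr v / 2; have m0 : 0 < m by rewrite divr_gt0 // oppr_gt0.
  have nu : \forall u \near v, dot Gr u < - m /\ `|u| < 2.
    have c1 : (fun u : V => dot u Gr) @ v --> dot v Gr by exact: (@cvg_dot R V (nbhs v) _ id v Gr cvg_id).
    have n1 : \forall u \near v, dot u Gr < - m.
      by apply: (c1 _ (lt_nbhsl _)); rewrite dotC /m; move: (dot Gr v) G0; clear => p; lra.
    have n2 : \forall u \near v, `|u| < 2 
      by apply: (@norm_continuous R V v _ (lt_nbhsl _)); rewrite v1 ltr1n.
    apply: filterS (filterI n1 n2) => u [u1 u2]; split; [by rewrite dotC|exact: u2].
  have b0 : 0 < Num.min (r / 2) (m / (8 * C)) by rewrite lt_min; apply/andP; split; rewrite divr_gt0 // mulr_gt0.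
  have ns : \forall s \near (0 : R)^'+, 0 < s < Num.min (r / 2) (m / (8 * C)).
    by near=> s; apply/andP; split.
  exists ([set u | dot Gr u < - m /\ `|u| < 2], [set s | 0 < s < Num.min (r / 2) (m / (8 * C))]); first by split.
  move=> [u s] [/= [u1 u2] /andP[s0]]; rewrite lt_min => /andP[s1 s2].
  rewrite ltr_pdivlMr ?mulr_gt0 // in s2.
  have small (j : 'I_2) : `|s * u 0 j| < r.
    rewrite normrM (gtr0_norm s0); rewrite ltr_pdivlMr // in s1; apply: le_lt_trans s1; rewrite ler_pM2l //.
    by apply: ltW; apply: le_lt_trans (coord_le_norm u j) u2.
  rewrite /pr; apply: le_lt_trans (HC (s * u 0 0) (s * u 0 1) (small 0) (small 1)) _.
  have -> : Gr 0 0 * (s * u 0 0) + Gr 0 1 * (s * u 0 1) = s * dot Gr u by rewrite /dot; ring.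
  rewrite -addrA gtrDl.
  have sq (j : 'I_2) : (s * u 0 j) ^+ 2 <= s * s * 4.
    rewrite exprMn expr2 ler_pM2l ?mulr_gt0 // (_ : 4 = 2 ^+ 2 :> R); last by ring.
    rewrite -[u 0 j ^+ 2]ger0_norm ?sqr_ge0 // normrX lerXn2r ?nnegrE //.
    by apply: ltW; apply: le_lt_trans (coord_le_norm u j) u2.
  have q1 : C * ((s * u 0 0) ^+ 2 + (s * u 0 1) ^+ 2) <= C * (s * s * 8).
    by rewrite ler_pM2l //; have := sq 0; have := sq 1; clear; lra.
  have q2 : s * (s * (8 * C)) < s * m by rewrite ltr_pM2l.
  have q3 : s * dot Gr u < s * - m by rewrite ltr_pM2l.
  by move: q1 q2 q3; move: (s * dot Gr u) => w; clear; lra.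
move=> nr; have [r r0 Hr] : exists2 r : R, 0 < r & forall s : R, 0 < s < r -> [set u : V | `|u| = 1] `<=` pr s.
  have [r r0 h] := (near_normP (0 : R) _).1 nr; exists r => // s /andP[s0 sr].
  by apply: h => //; rewrite subr0 gtr0_norm.
apply/(near_normP x (fun y => y != x -> bdist g P y < bdist g P x)); exists r => // y yr yx.
have s0 : 0 < `|y - x| by rewrite normr_gt0 subr_eq0.
pose u := row2 ((y.1 - x.1) / `|y - x|) ((y.2 - x.2) / `|y - x|).
have u1 : `|u| = 1.
  rewrite norm_row2 row2_0 row2_1 !normrM normfV normr_id -maxr_pMl ?invr_ge0 //.
  have -> : Num.max `|y.1 - x.1| `|y.2 - x.2| = `|y - x| by [].
  by rewrite divff // gt_eqF.
have := Hr `|y - x| _ u u1; rewrite s0 yr => /(_ isT); rewrite /pr row2_0 row2_1.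
rewrite ![`|y - x| * _]mulrC !divfK ?gt_eqF // ![_ + (_ - _)]addrC !subrK.
by case: (y).
Unshelve. all: by end_near. Qed.

End Descent.

(** * The two kinds of critical pairs *)

Section Assembly.
Context {R : realType} {M : surface R} (g : riemannian M).
Local Notation V := 'rV[R]_2.
Implicit Types (c : R -> M) (x : R * R).

Lemma sol_length c (a : R) : 0 < a -> sol g c -> curve_length g 0 a c = a.
Proof.
move=> a0 S; rewrite /curve_length (_ : (fun t => norm g (c t) (velocity c t)) = fun=> 1); last first.
  by apply/funext => t; exact: sol_speed.
have [H [DH ->]] := primitive (f := fun=> 1) a0 (fun t _ => @cst_continuous _ _ (1 : R) t).
have -> := equal_increments (h := id) (ltW a0) DH (fun t _ => is_derive_id t 1).
exact: subr0.
Qed.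

(** Agreement on [[0, a]] determines position and velocity at the midpoint, hence the whole
    geodesics. By contraposition, distinct minimisers differ at a time in [[0, a]]. *)
Lemma sol_eq c1 c2 (a : R) : 0 < a -> sol g c1 -> sol g c2 -> (forall t, 0 <= t <= a -> c1 t = c2 t) -> c1 = c2.
Proof.
move=> a0 S1 S2 E; pose m := a / 2.
have e2 : (1 : R) ^+ 2 = 1 by rewrite expr1n.
have [T1 _] := sol_affine m e2 S1; have [T2 _] := sol_affine m e2 S2.
have mm : 0 <= m <= a by rewrite /m divr_ge0 ?(ltW a0) // ler_pdivrMr // ler_peMr ?ler1n // ltW.
have m0 : m + 1 * 0 = m by rewrite mulr0 addr0.
have ci : dom (c2 m) (c2 m) := dom_center _.
have dE : dchart (c2 m) c1 m = dchart (c2 m) c2 m.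
  have nt : \forall t \near m, 0 <= t <= a.
    apply/(near_normP m (fun t => 0 <= t <= a)); exists m; first by rewrite divr_gt0.
    by move=> t; rewrite ltr_norml /m => /andP[t1 t2]; apply/andP; split; move: t1 t2; clear; lra.
  by apply: near_eq_derive; apply: filterS nt => t ta /=; rewrite E.
suff H t : c1 (m + 1 * t) = c2 (m + 1 * t).
  by apply/funext => t; have := H (t - m); rewrite mul1r [m + _]addrC subrK.
move: t; apply: (sol_unique T1 T2); first by rewrite m0 E.
exists (c2 m); rewrite m0; split; first exact: ci.
have ci' : dom (c2 m) (c1 m) by rewrite E.
by rewrite (dchart_affine e2 S1 m0 ci') (dchart_affine e2 S2 m0 ci) dE.
Qed.

Variables (W : set V) (F : V -> M) (Omega : set M) (N : M -> V).
Hypothesis DF : disc_chart W F Omega.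
Hypothesis ON : outward_unit_normal g Omega N.
Hypothesis cpl : complete g.
Hypothesis TC : totally_convex g Omega.
Local Notation P := (F \o circ).

Lemma minim_geodesic x c : 0 < bdist g P x -> minim g P x c ->
  geodesic_in g Omega (bdist g P x) c /\ minimising g (bdist g P x) c.
Proof.
move=> a0 [S c0 ca]; have Gc := geodesic_on_geodesic (sol_geodesic cpl S) a0.
have bd0 : bd Omega (c 0) by rewrite c0; exact: (bd_curve_bd DF).
have bda : bd Omega (c (bdist g P x)) by rewrite ca; exact: (bd_curve_bd DF).
split; last by rewrite /minimising sol_length // c0 ca.
split; [exact: Gc| |exact: bd0|exact: bda].
by move=> t ta; apply: (TC Gc) ta; [case: bd0|case: bda].
Qed.

Lemma bd_proj_tangent (t : R) (v : V) : exists2 k : R, bd_proj g N (P t) v = k *: velocity P t &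
  inner g (P t) v (velocity P t) = k * inner g (P t) (velocity P t) (velocity P t).
Proof.
have [k E] := normal_decomp DF ON t v; exists k.
  by rewrite /bd_proj {1}E addrC addKr.
by rewrite {1}E inner_self bfDl !bfZl -!inner_self (bd_curve_normal DF ON) mulr0 add0r.
Qed.

Lemma bd_proj_opposite (t k : R) (v w : V) :
  inner g (P t) v (velocity P t) = - (k * inner g (P t) w (velocity P t)) ->
  bd_proj g N (P t) v = - (k *: bd_proj g N (P t) w).
Proof.
have [k1 -> ->] := bd_proj_tangent t v; have [k2 -> ->] := bd_proj_tangent t w.
rewrite mulrA -mulNr => h; rewrite scalerA -scaleNr; congr (_ *: _).
have pos : inner g (P t) (velocity P t) (velocity P t) != 0.
  rewrite inner_self gt_eqF //; apply: Gm_gt0; first exact: chart_cod (dom_center _).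
  exact: (bd_curve_velocity DF).
exact: (mulIf pos h).
Qed.

(** Opposite gradients mean opposite tangential components at both ends with the same factor. The
    geodesics are distinct because a non-zero vector is not a negative multiple of itself. *)
Lemma stationary_pair x c1 c2 (k : R) : 0 < bdist g P x -> minim g P x c1 -> minim g P x c2 -> 0 < k ->
  bgrad g P x c1 = - (k *: bgrad g P x c2) -> bgrad g P x c2 != 0 ->
  exists (a : R) (c1 c2 : R -> M),
     [/\ geodesic_in g Omega a c1 /\ minimising g a c1,
         geodesic_in g Omega a c2 /\ minimising g a c2,
         c1 0 = c2 0 /\ c1 a = c2 a,
         exists t : R, 0 <= t <= a /\ c1 t <> c2 t
       & simultaneously_stationary g N a c1 c2].
Proof.
move=> a0 m1 m2 k0 E G2; exists (bdist g P x), c1, c2.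
have [S1 b1 e1] := m1; have [S2 b2 e2] := m2.
split; [exact: minim_geodesic|exact: minim_geodesic|by rewrite b1 b2 e1 e2| |].
  apply: contrapT => no.
  have eq : c1 = c2.
    by apply: (sol_eq a0 S1 S2) => t ta; apply: contrapT => h; apply: no; exists t.
  move: E; rewrite eq => /eqP; rewrite -subr_eq0 opprK -{1}[bgrad _ _ _ _]scale1r -scalerDl scaler_eq0 (negbTE G2) orbF.
  by rewrite gt_eqF // addr_gt0.
exists k; split; first exact: k0.
- by rewrite b1 b2; apply: bd_proj_opposite; exact: (bgrad_opposite E).1.
- by rewrite e1 e2; apply: bd_proj_opposite; exact: (bgrad_opposite E).2.
Qed.

Lemma index_geS c (a : R) (X : R -> V) : sol g c -> 0 < a -> normal_field g a c X ->
  (forall r : R, Qform g N a c (fun t => r *: X t) = r ^+ 2 * Qform g N a c X) -> Qform g N a c X < 0 ->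
  index_ge g N a c 1.
Proof.
move=> S a0 NX hom neg; exists (fun=> X); split; first by [].
move=> s s0; have -> : (fun t => \sum_(j < 1) s 0 j *: X t) = fun t => s 0 0 *: X t.
  by apply/funext => t; rewrite big_ord1.
rewrite hom pmulr_rlt0 // lt_neqAle sqr_ge0 andbT eq_sym sqrf_eq0.
by apply: contra s0 => /eqP e; apply/eqP/rowP => j; rewrite (ord1 j) e mxE.
Qed.

Lemma free_boundary_case x c : ~ (exists (a : R) (c : R -> M), free_boundary_stable g Omega N a c) ->
  0 < bdist g P x -> minim g P x c -> bgrad g P x c = 0 ->
  ~ (\forall y \near x, y != x -> bdist g P y < bdist g P x) ->
  exists (a : R) (c : R -> M),
     [/\ free_boundary g Omega a c, proper Omega a c, minimising g a c
       & free_boundary_index g N a c 1].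
Proof.
move=> star a0 mc G0 npun; have [S c0 ca] := mc; have [GI MI] := minim_geodesic a0 mc.
set a := bdist g P x in a0 ca GI MI *; exists a, c.
have [Gc inO bd0 bda] := GI.
have o1 : inner g (P x.1) (velocity c 0) (velocity P x.1) = 0.
  by have /rowP/(_ 0) := G0; rewrite row2_0 mxE => /eqP; rewrite oppr_eq0 => /eqP.
have o2 : inner g (P x.2) (velocity c a) (velocity P x.2) = 0.
  by have /rowP/(_ 1) := G0; rewrite row2_1 mxE.
have [e1 v1 [e1E e1s]] := normal_velocity DF ON S c0 o1.
have [e2 v2 [e2E e2s]] := normal_velocity DF ON S ca o2.
have s1 := start_inward DF ON S a0 inO c0; rewrite -e1E in s1.
have s2 := end_outward DF ON S a0 inO ca; rewrite -e2E in s2.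
(* Both end velocities are [N] or [- N]; the signs follow because the geodesic stays in [Omega]. *)
have {}e1s : e1 = -1.
  by move/eqP: e1s; rewrite sqrf_eq1 => /orP[/eqP e|/eqP //]; move: s1; rewrite e ler10.
have {}e2s : e2 = 1.
  by move/eqP: e2s; rewrite sqrf_eq1 => /orP[/eqP //|/eqP e]; move: s2; rewrite e oppr_ge0 ler10.
have FB : free_boundary g Omega a c.
  split; [exact: GI|rewrite c0|rewrite ca].
    exact: (bd_orthogonal_curve DF ON o1).
  exact: (bd_orthogonal_curve DF ON o2).
have PR : proper Omega a c.
  apply: (proper_geodesic DF ON cpl TC S c0 ca).
    by rewrite -e1E e1s oppr_lt0.
  by rewrite -e2E e2s.
split; [exact: FB|exact: PR|exact: MI|].
have [[U [oU bU NU]] _] := ON.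
have UP t : U (P t) by apply: bU; exact: (bd_curve_bd DF).
have nv0 : velocity c 0 = - N (c 0) by rewrite v1 e1s scaleN1r.
have nva : velocity c a = N (c a) by rewrite v2 e2s scale1r.
have SP := bd_curve_smooth DF.
have orth := bd_curve_normal DF ON.
have vel := bd_curve_velocity DF.
split.
  have [X [NX neg]] : exists X, normal_field g a c X /\ Qform g N a c X < 0.
    apply: contrapT => no; apply: star; exists a, c; split; [exact: FB|exact: PR|].
    by move=> X NX; rewrite leNgt; apply/negP => h; apply: no; exists X.
  apply: (index_geS S a0 NX _ neg) => r.
  have [[e e0 fs] fn] := NX.
  (* The field is taken twice in order to read off from [second_variation] that [Qform] is
     homogeneous of degree two in it. *)
  have Fi : fields g c a e (fun _ : 'I_2 => X) by split.
  have [al [be [Q _]]] := second_variation Fi oU NU UP SP orth vel (esym c0) (esym ca) nv0 nva.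
  have cE s : comb (fun _ : 'I_2 => X) s = fun t => (s 0 0 + s 0 1) *: X t.
    apply/funext => t; by rewrite /comb sum_ord2 -scalerDl.
  have := Q (row2 r 0); rewrite /quad !cE row2_0 row2_1 !mxE /= !addr0 add0r expr0n /= !mul0r !mulr0 !mul0r !addr0 => ->.
  by rewrite (_ : (fun t => 1 *: X t) = X) //; apply/funext => t; rewrite scale1r.
move=> i2; apply: npun.
have [r r0 Hr] := index_two_descent S a0 i2 oU NU UP SP orth vel (esym c0) (esym ca) nv0 nva (erefl a).
apply/(near_normP x (fun y => y != x -> bdist g P y < a)); exists r => // y yr yx.
have : Num.max `|y.1 - x.1| `|y.2 - x.2| < r by exact: yr.
rewrite gt_max => /andP[y1 y2].
have := Hr (y.1 - x.1) (y.2 - x.2) y1 y2; rewrite ![_ + (_ - _)]addrC !subrK; apply.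
move: yx; apply: contraNT; rewrite negb_or !negbK !subr_eq0 => /andP[/eqP h1 /eqP h2].
by apply/eqP; move: h1 h2; case: (x) (y) => a1 a2 [b1' b2'] /= -> ->.
Qed.

End Assembly.

Theorem corollary1p5 (R : realType) (M : surface R) (g : riemannian M)
    (Omega : set M) (N : M -> 'rV[R]_2)
    (Mcomplete : complete g)
    (Omega_disc : smooth_disc Omega)
    (Omega_convex : totally_convex g Omega)
    (N_normal : outward_unit_normal g Omega N)
    (star : ~ exists (a : R) (c : R -> M), free_boundary_stable g Omega N a c) :
  (exists (a : R) (c : R -> M),
     [/\ free_boundary g Omega a c, proper Omega a c, minimising g a c
       & free_boundary_index g N a c 1])
  \/
  (exists (a : R) (c1 c2 : R -> M),
     [/\ geodesic_in g Omega a c1 /\ minimising g a c1,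
         geodesic_in g Omega a c2 /\ minimising g a c2,
         c1 0 = c2 0 /\ c1 a = c2 a,
         exists t : R, 0 <= t <= a /\ c1 t <> c2 t
       & simultaneously_stationary g N a c1 c2]).
Proof.
have [W [F DF]] := Omega_disc; have {}DF : disc_chart W F Omega by exact: DF.
pose P := F \o circ; pose T : R := pi *+ 2; pose d := bdist g P.
have SP : curve_smooth [set: R] P := bd_curve_smooth DF.
have T0 : 0 < T by rewrite /T mulr2n addr_gt0 // pi_gt0.
have per t : P (t + T) = P t by rewrite /P /= circ_periodic.
have cd : continuous d := @bdist_continuous R M g P SP.
have edge1 t : d (t, t) = 0 by rewrite /d /bdist dist_refl.
have edge2 t : d (t, t + T) = 0 by rewrite /d /bdist /= per dist_refl.
have dpos x : x.1 < x.2 < x.1 + T -> 0 < d x.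
  move=> /andP[x1 x2]; rewrite /d /bdist lt_neqAle dist_ge0 andbT eq_sym; apply/eqP => /dist_eq0.
  exact: (bd_curve_inj DF x1 x2).
have dper t s : d (t + T, s + T) = d (t, s) by rewrite /d /bdist /= !per.
have [x [sx dx dl npf]] := level_point T0 cd edge1 edge2 dpos dper.
have xs : x.1 < x.2 < x.1 + T.
  move: sx; rewrite /strip /= !le_eqVlt => /andP[/orP[/eqP e|x1] h2].
    by move: dx; rewrite (surjective_pairing x) -e edge1 ltxx.
  case/orP: h2 => [/eqP e|x2]; last by rewrite x1.
  by move: dx; rewrite (surjective_pairing x) e edge2 ltxx.
have npun : ~ (\forall y \near x, y != x -> d y < d x).
  by move=> h; apply: npf; rewrite -dl; exact: pass_punctured.
have [[c mc c0]|no0] := pselect (exists2 c, minim g P x c & bgrad g P x c = 0).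
  by left; exact: (free_boundary_case DF N_normal Mcomplete Omega_convex star dx mc c0 npun).
have [[c1 [c2 [k [m1 m2 k0 E]]]]|noanti] := pselect (exists c1 c2 (k : R),
    [/\ minim g P x c1, minim g P x c2, 0 < k & bgrad g P x c1 = - (k *: bgrad g P x c2)]).
  right; apply: (stationary_pair DF N_normal Mcomplete Omega_convex dx m1 m2 k0 E).
  by apply/eqP => e; apply: no0; exists c2.
exfalso.
have [|||[v Hv]|Hv] := @planar_alternative R [set G | exists2 c, minim g P x c & G = bgrad g P x c].
(* The minimisers all have the ends given by [x], so [minimiser_limit] is applied to a constant
   family of end points. *)
- move=> I U f UU Hf; have [cs Hcs] := choice (fun t => let: ex_intro2 c h1 h2 := Hf t in ex_intro (fun c => minim g P x c /\ f t = bgrad g P x c) c (conj h1 h2)).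
  have PU : ProperFilter U by case: UU.
  have [c [mc cg]] := minimiser_limit (ys := fun=> x) SP UU Mcomplete (fun t => (Hcs t).1) (cvg_cst x).
  exists (bgrad g P x c); split; first by exists c.
  by rewrite (_ : f = fun t => bgrad g P x (cs t)) //; apply/funext => t; have [] := Hcs t.
- by move=> [c mc e]; apply: no0; exists c.
- by move=> G1 G2 k [c1 m1 ->] [c2 m2 ->] k0 E; apply: noanti; exists c1, c2, k.
- apply: npf; rewrite -dl; apply: (pass_descent (v := (v 0 0, v 0 1)) cd xs) => //.
  by apply: (descent_near Mcomplete SP dx) => c mc; apply: Hv; exists c.
- apply: npun; apply: (punctured_near Mcomplete SP dx) => v v0.
  by have [G [c mc ->] h] := Hv v v0; exists c.
Qed.
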